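(* There exists an absolute constant $c>0$ such that the following holds for every $n\ge 1$. Let $\Omega,\Omega'$ be two bounded convex domains in $\mathbb{R}^n$ having piecewise smooth boundaries, with $\Omega\subseteq\Omega'$, and set $v:=\operatorname{vol}\Omega/\operatorname{vol}\Omega'\in[0,1]$. Then for all natural numbers $k\geq 2$, $$\lambda^N_k(\Omega')\leq \frac{1}{c}\,(n\log k)^2\,\lambda^N_k(\Omega)$$ and $$\lambda^N_k(\Omega')\geq c\,\min\Big\{\frac{(\log(1-2^{-n}v))^2}{n^8(\log k)^6},\ \frac{1}{n^6(\log k)^4}\Big\}\,\lambda^N_k(\Omega).$$
   Context: For a bounded domain $\Omega\subset\mathbb{R}^n$ with piecewise smooth boundary, $0=\lambda_0^N(\Omega)<\lambda_1^N(\Omega)\leq\lambda_2^N(\Omega)\leq\cdots\leq\lambda_k^N(\Omega)\leq\cdots$ denote the Neumann eigenvalues of the (positive) Laplacian on $\Omega$, listed in increasing order, counted with multiplicity, and indexed from $0$. $\operatorname{vol}$ is Lebesgue measure on $\mathbb{R}^n$ and $\log$ is the natural logarithm. ''Absolute constant'' means a constant independent of everything (of $n$, $k$, $\Omega$, $\Omega'$). *)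

(* Defs.v *)
From HB Require Import structures.
From mathcomp Require Import all_boot all_order all_algebra.
From mathcomp Require Import all_classical all_reals all_analysis.
Set Implicit Arguments.
Unset Strict Implicit.
Unset Printing Implicit Defensive.
Import Order.TTheory GRing.Theory Num.Theory.
Import numFieldNormedType.Exports.
Local Open Scope classical_set_scope.
Local Open Scope ring_scope.

(** * Lebesgue measure on R^n *)

Definition box (R : realType) (n : nat) (c : 'rV[R]_n * 'rV[R]_n) :
    set 'rV[R]_n :=
  [set x | forall i, c.1 ord0 i <= x ord0 i <= c.2 ord0 i].

Definition box_volume (R : realType) (n : nat) (c : 'rV[R]_n * 'rV[R]_n) : R :=
  \prod_(i < n) Num.max 0 (c.2 ord0 i - c.1 ord0 i).

(* Infimum of the total volume of countable covers by boxes.  [None] stands for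
   a missing box, so that finite and empty covers are allowed (in dimension 0
   there is no box of volume 0). *)
Definition lebesgue_outer (R : realType) (n : nat) (A : set 'rV[R]_n) : \bar R :=
  ereal_inf [set (\sum_(k <oo) (oapp (@box_volume R n) 0 (B k))%:E)%E
    | B in [set B : nat -> option ('rV[R]_n * 'rV[R]_n) |
            A `<=` \bigcup_k oapp (@box R n) set0 (B k)]].

Section lebesgue_outer_measure.
Context (R : realType) (n : nat).
Local Open Scope ereal_scope.
Local Notation mu := (@lebesgue_outer R n).
Local Notation ovol := (fun o => (oapp (@box_volume R n) 0%R o)%:E).

Let ovol_ge0 o : 0 <= ovol o.
Proof.
case: o => [c|] //=; rewrite lee_fin; apply: prodr_ge0 => i _.
by rewrite le_max lexx.
Qed.

Let lebesgue_outer_ge0 A : 0 <= mu A.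
Proof.
by apply: le_ereal_inf_tmp => x [B _ <-{x}]; apply: nneseries_ge0 => k _ _.
Qed.

Let le_lebesgue_outer : {homo mu : A B / A `<=` B >-> A <= B}.
Proof.
move=> A B AB; apply/ereal_inf_le_tmp => x [C BC <-{x}].
by exists C => //; exact: subset_trans BC.
Qed.

Let lebesgue_outer0 : mu set0 = 0.
Proof.
apply/eqP; rewrite eq_le lebesgue_outer_ge0 andbT.
apply: ereal_inf_lbound; exists (fun=> None) => //=.
by rewrite eseries0.
Qed.

Let lebesgue_outer_sigma_subadditive : sigma_subadditive mu.
Proof.
move=> A; have [[i ioo]|] := pselect (exists i, mu (A i) = +oo).
  rewrite (eseries_pinfty _ _ ioo) ?leey// => k _.
  by rewrite -ltNye (lt_le_trans _ (lebesgue_outer_ge0 _)).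
rewrite -forallNE => Aoo.
suff add2e (e : {posnum R}) :
    mu (\bigcup_n A n) <= \sum_(i <oo) mu (A i) + e%:num%:E.
  by apply/lee_addgt0Pr => _/posnumP[].
rewrite (le_trans _ (epsilon_trick _ _ _))//.
pose P k (B : nat -> option ('rV[R]_n * 'rV[R]_n)) :=
  A k `<=` \bigcup_j oapp (@box R n) set0 (B j) /\
  \sum_(j <oo) ovol (B j) <= mu (A k) + (e%:num / (2 ^ k.+1)%:R)%:E.
have [G PG] : {G & forall k, P k (G k)}.
  apply: (@choice _ _ P) => k; rewrite /P /lebesgue_outer.
  set S := (X in ereal_inf X); move infS : (ereal_inf S) => iS.
  case: iS infS => [r Sr|Soo|Soo].
  - have en1 : (0 < e%:num / (2 ^ k.+1)%:R)%R by [].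
    have /(lb_ereal_inf_adherent en1) : ereal_inf S \is a fin_num by rewrite Sr.
    move=> [x [B AnB muBx] xS].
    by exists B; split => //; rewrite muBx -Sr; exact/ltW.
  - by have := Aoo k; rewrite /lebesgue_outer Soo.
  - suff : lbound S 0 by move/le_ereal_inf_tmp; rewrite Soo.
    by move=> /= _ [B AnB <-]; exact: nneseries_ge0.
pose vG := fun p : nat * nat => ovol (G p.1 p.2).
have vG_ge0 x : 0 <= vG x by exact: ovol_ge0.
apply: (@le_trans _ _ (\esum_(i in setT) vG i)).
  apply: ereal_inf_lbound => /=.
  have /card_esym/ppcard_eqP[f] := card_nat2.
  exists (fun k => G (f k).1 (f k).2).
    move=> t [i _ /(PG i).1 [j _ Bijt]]; exists (f^-1%FUN (i, j)) => //=.
    by rewrite invK ?inE.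
  rewrite -(esum_pred_image vG _ xpredT) ?[fun=> _]set_true//.
  by rewrite image_eq.
rewrite (_ : esum _ _ = \sum_(i <oo) \sum_(j <oo) vG (i, j)); last first.
  pose J : nat -> set (nat * nat) := fun i => [set (i, j) | j in setT].
  rewrite (_ : setT = \bigcup_k J k); last first.
    by rewrite predeqE => -[a b]; split => // _; exists a => //; exists b.
  rewrite esum_bigcupT /=; last 2 first.
    - apply/trivIsetP => i j _ _ ij.
      rewrite predeqE => -[k m] /=; split => //= -[] [_] _ [<-{k} _].
      by move=> [m' _] [] /esym/eqP; rewrite (negbTE ij).
    - by move=> k; exact: vG_ge0.
  rewrite -(image_id [set: nat]) -fun_true esum_pred_image//; last first.
    by move=> k _; exact: esum_ge0.
  apply: eq_eseriesr => /= j _.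
  rewrite -(esum_pred_image vG (pair j) predT)//=; last first.
    by move=> ? ? _ _; exact: (@can_inj _ _ _ snd).
  by congr esum; rewrite predeqE => -[a b]; split; move=> [i _ <-]; exists i.
apply: lee_lim.
- by apply: is_cvg_nneseries => k *; apply: nneseries_ge0 => m *.
- apply: is_cvg_nneseries => k *; apply: adde_ge0 => //.
- by near=> k; apply: lee_sum => i _; exact: (PG i).2.
Unshelve. all: by end_near. Qed.

HB.instance Definition _ := isOuterMeasure.Build R 'rV[R]_n mu
  lebesgue_outer0 lebesgue_outer_ge0 le_lebesgue_outer
  lebesgue_outer_sigma_subadditive.

End lebesgue_outer_measure.

(* R^n with the sigma-algebra of Lebesgue measurable sets. *)
Notation lebesgueRn R n := (caratheodory_type (@lebesgue_outer R n)).

Definition vol (R : realType) (n : nat) : set (lebesgueRn R n) -> \bar R :=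
  @lebesgue_outer R n.

HB.instance Definition _ (R : realType) (n : nat) :=
  isMeasure.Build _ (lebesgueRn R n) R (@vol R n)
    (@caratheodory_measure0 _ _ (@lebesgue_outer R n))
    (@caratheodory_measure_ge0 _ _ (@lebesgue_outer R n))
    (@caratheodory_measure_sigma_additive _ _ (@lebesgue_outer R n)).

(** * Smooth functions and domains *)

Definition partial (R : realType) (n : nat) (i : 'I_n) (f : 'rV[R]_n -> R) :
    'rV[R]_n -> R :=
  fun x => 'D_(delta_mx ord0 i) f x.

(* C^oo on U: all iterated partial derivatives exist and are continuous. *)
Definition smooth_on (R : realType) (n : nat) (U : set 'rV[R]_n)
    (f : 'rV[R]_n -> R) :=
  forall (s : seq 'I_n) (x : 'rV[R]_n), U x ->
    {for x, continuous (foldr (@partial R n) f s)} /\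
    (forall i, derivable (foldr (@partial R n) f s) x (delta_mx ord0 i)).

(* Embedded hypersurface of class C^oo: near each of its points p it is the
   zero set of a smooth function whose gradient does not vanish at p. *)
Definition smooth_hypersurface (R : realType) (n : nat) (M : set 'rV[R]_n) :=
  forall p, M p -> exists (U : set 'rV[R]_n) (f : 'rV[R]_n -> R),
    [/\ open U, U p, smooth_on U f,
        M `&` U = [set x | U x /\ f x = 0] &
        exists i, partial i f p != 0].

(* The boundary is covered by finitely many smooth hypersurfaces.  No condition
   is imposed on the way in which the pieces meet: faces, edges, cusps and conical
   points are all allowed, so this covers the usual conventions. *)
Definition piecewise_smooth_boundary (R : realType) (n : nat)
    (Omega : set 'rV[R]_n) :=
  exists (m : nat) (M : 'I_m -> set 'rV[R]_n),
    (forall j, smooth_hypersurface (M j)) /\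
    closure Omega `\` Omega° `<=` \bigcup_j M j.

Definition bounded_domain (R : realType) (n : nat) (Omega : set 'rV[R]_n) :=
  [/\ open Omega, connected Omega, Omega !=set0 & bounded_set Omega].

(** * The Sobolev space H^1 and the Neumann eigenvalues *)

Definition square_integrable (R : realType) (n : nat) (Omega : set 'rV[R]_n)
    (u : 'rV[R]_n -> R) :=
  measurable_fun (Omega : set (lebesgueRn R n)) (u : lebesgueRn R n -> R) /\
  (\int[@vol R n]_(x in Omega) ((u x) ^+ 2)%:E < +oo)%E.

Definition test_function (R : realType) (n : nat) (Omega : set 'rV[R]_n)
    (phi : 'rV[R]_n -> R) :=
  smooth_on setT phi /\
  exists K, [/\ compact K, K `<=` Omega & forall x, ~ K x -> phi x = 0].

(* u belongs to H^1(Omega) and has distributional gradient g.  Functions are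
   total on R^n, but only their restriction to Omega matters. *)
Definition H1_gradient (R : realType) (n : nat) (Omega : set 'rV[R]_n)
    (u : 'rV[R]_n -> R) (g : 'I_n -> 'rV[R]_n -> R) :=
  square_integrable Omega u /\
  forall i, square_integrable Omega (g i) /\
    forall phi, test_function Omega phi ->
      \int[@vol R n]_(x in Omega) (u x * partial i phi x) =
      - \int[@vol R n]_(x in Omega) (g i x * phi x).

(* Weak form of  - Laplacian u = mu u  with vanishing normal derivative: the
   test functions h range over all of H^1(Omega).  The zero function is
   included, so this describes the eigenspace of mu. *)
Definition neumann_eigenfunction (R : realType) (n : nat)
    (Omega : set 'rV[R]_n) (mu : R) (u : 'rV[R]_n -> R) :=
  exists2 gu, H1_gradient Omega u gu &
    forall h gh, H1_gradient Omega h gh ->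
      \int[@vol R n]_(x in Omega) (\sum_(i < n) gu i x * gh i x) =
      mu * \int[@vol R n]_(x in Omega) (u x * h x).

Definition ae_free (R : realType) (n : nat) (Omega : set 'rV[R]_n) (m : nat)
    (u : 'I_m -> 'rV[R]_n -> R) :=
  forall a : 'I_m -> R,
    {ae @vol R n, forall x, Omega x -> \sum_(j < m) a j * u j x = 0} ->
    forall j, a j = 0.

(* The eigenspace of mu, as a subspace of L^2(Omega), has dimension >= m. *)
Definition neumann_multiplicity_ge (R : realType) (n : nat)
    (Omega : set 'rV[R]_n) (mu : R) (m : nat) :=
  exists u : 'I_m -> 'rV[R]_n -> R,
    (forall j, neumann_eigenfunction Omega mu (u j)) /\ ae_free Omega u.

(* lam lists the Neumann eigenvalues in increasing order, from index 0, each
   one being repeated according to its multiplicity: for every real mu, the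
   number of k with lam k = mu is the dimension of the eigenspace of mu. *)
Definition neumann_eigenvalues (R : realType) (n : nat) (Omega : set 'rV[R]_n)
    (lam : nat -> R) :=
  {homo lam : i j / (i <= j)%N >-> i <= j} /\
  forall mu m,
    (exists2 f : 'I_m -> nat, injective f & forall j, lam (f j) = mu) <->
    neumann_multiplicity_ge Omega mu m.

(* Main.v *)
(* Choose r so that a convex domain O contains k + 1 points at mutual distances at
   least r, but no k + 1 points at mutual distances at least 2 r.  Then lambda_k(O)
   equals r^-2 up to absolute constants and a factor n^2.  For the upper bound,
   min-max is applied to the tents (1 - |x - x_i|^2 / rho^2)_+^2 with rho = r / 2,
   whose supports are disjoint; convexity bounds their Rayleigh quotients by
   O(n^2 / r^2).  For the lower bound, a maximal 2r-separated set has at most k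
   points, its Voronoi cells are convex of diameter at most 4 r, and a convex set
   of diameter d satisfies a Poincare inequality with constant O(d^2), independent
   of n, by Brunn-Minkowski.  The same cell decomposition at small scales gives the
   compactness needed for the eigenvalues in the min-max principle to exist.

   Packing numbers are monotone under inclusion, which gives the first estimate.
   For the second one, some point z of Omega satisfies
   vol (Omega n (2 z - Omega)) >= 2^-(n+1) vol Omega; a volume count of disjoint
   shrunk copies of this symmetric set inside Omega' then shows that Omega contains
   the image of Omega' under the homothety of centre z and ratio 2^-n v / (16 n). *)

From HB Require Import structures.
From mathcomp Require Import finmap.
From mathcomp Require Import all_boot all_order all_algebra.
From mathcomp Require Import all_classical all_reals all_analysis.
From mathcomp Require Import measurable_realfun.
From mathcomp Require Import ring lra.
Require Import Defs.
Set Implicit Arguments.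
Unset Strict Implicit.
Unset Printing Implicit Defensive.
Import Order.TTheory GRing.Theory Num.Theory.
Import numFieldNormedType.Exports.
Local Open Scope classical_set_scope.
Local Open Scope ring_scope.

(** * Boxes, open sets and homotheties *)

Section box_length.
Context {R : realType}.

(** The eigenvalues are given by counting: the multiplicity of a real number in [lam] is the
    dimension of its eigenspace, and no variational formula comes with it. The lower bound can work
    with the eigenfunctions that the counting supplies. The upper bound has to produce some:
    successive minimization turns k + 1 trial functions into k + 1 orthonormal eigenvectors below
    the Rayleigh bound, at the price of completeness and compactness of H^1. The Poincare constant
    is free of the dimension for the following reason. A superlevel set of at most half the volume,
    moved by the fraction t towards every point of the convex set, grows by the factor 2^t by
    Brunn-Minkowski; comparison with the first-order growth of the function gives the inequality as
    t tends to 0. Weakly differentiable functions are reached by mollification inside slightly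
    contracted copies of the domain, where mollification commutes with the gradient; convexity makes
    these copies exhaust the domain. The packing estimates contain no logarithm: the powers of ln k
    are inserted at the end by ln k >= 1/2. *)

Definition in_itv01 (a b t : R) : R := (a <= t <= b)%R%:R.

Lemma in_itv01E a b : in_itv01 a b = \1_(`[a, b]%classic : set R) :> (R -> R).
Proof.
by apply/funext => t; rewrite /in_itv01 indicE mem_setE in_itv.
Qed.

Lemma in_itv01_ge0 a b t : 0 <= in_itv01 a b t. Proof. exact: ler0n. Qed.

Lemma measurable_in_itv01 (r a b : R) : measurable_fun setT
  (fun t : measurableTypeR R => (r * in_itv01 a b t)%:E).
Proof.
rewrite in_itv01E; apply/(@measurable_EFinP _ (measurableTypeR R)).
by apply: measurable_funM => //; exact: measurable_indic.
Qed.

Lemma integral_in_itv01 (r a b : R) : 0 <= r ->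
  (\int[lebesgue_measure]_t (r * in_itv01 a b t)%:E = (r * Num.max 0 (b - a))%:E)%E.
Proof.
move=> r0; rewrite in_itv01E.
under eq_integral do rewrite EFinM.
rewrite ge0_integralZl//; last first.
  apply/(@measurable_EFinP _ (measurableTypeR R)).
  exact: (@measurable_indic _ (measurableTypeR R)).
rewrite (@integral_indic _ (measurableTypeR R))//= setIT.
rewrite [X in (_ * X)%E](lebesgue_measure_itv `[a, b]) /= lte_fin EFinM.
case: ltP => ab; first by rewrite max_r ?subr_ge0 1?ltW// -EFinB.
by rewrite max_l// subr_le0.
Qed.

(** Both sides are integrated over the line. The weights [al] and [be] carry the factors contributed
    by the other coordinates. *)
Lemma length_cover N (al a b : 'I_N -> R) (be c d : R) :
  (forall k, 0 <= al k) -> 0 <= be ->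
  (forall t, be * in_itv01 c d t <= \sum_k al k * in_itv01 (a k) (b k) t) ->
  be * Num.max 0 (d - c) <= \sum_k al k * Num.max 0 (b k - a k).
Proof.
move=> al0 be0 H.
rewrite -lee_fin -integral_in_itv01// -sumEFin.
rewrite (eq_bigr (fun k => (\int[lebesgue_measure]_t
  (al k * in_itv01 (a k) (b k) t)%:E)%E)); last first.
  by move=> k _; rewrite integral_in_itv01.
rewrite -ge0_integral_sum//; last 2 first.
- by move=> k; exact: measurable_in_itv01.
- by move=> k t _; rewrite lee_fin mulr_ge0 ?in_itv01_ge0.
apply: ge0_le_integral => //.
- by move=> t _; rewrite lee_fin mulr_ge0 ?in_itv01_ge0.
- exact: measurable_in_itv01.
- by apply: emeasurable_sum => k; exact: measurable_in_itv01.
- by move=> t _; rewrite sumEFin lee_fin.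
Qed.

(* One coordinate after the other is integrated out.  The weights allow some
   of the boxes to be discarded. *)
Lemma volume_cover n N (w : 'I_N -> R) (B : 'I_N -> 'rV[R]_n * 'rV[R]_n)
    (c : 'rV[R]_n * 'rV[R]_n) :
  (forall k, 0 <= w k) ->
  box c `<=` \bigcup_(k in [set k | 1 <= w k]) box (B k) ->
  box_volume c <= \sum_k w k * box_volume (B k).
Proof.
move=> w0 cB.
(* A hybrid of two products: the coordinates below [m] contribute side lengths, the others still
   contribute indicators at [x]. The case [m = 0] is the covering hypothesis, the case [m = n] is
   the inequality of volumes. *)
pose G m (c : 'rV[R]_n * 'rV[R]_n) (x : 'rV[R]_n) (i : 'I_n) : R :=
  if (i < m)%N then Num.max 0 (c.2 ord0 i - c.1 ord0 i)
  else in_itv01 (c.1 ord0 i) (c.2 ord0 i) (x ord0 i).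
have G0 m c' x i : 0 <= G m c' x i.
  by rewrite /G; case: ifP => _; rewrite ?in_itv01_ge0// le_max lexx.
have wG0 k m c' x : 0 <= w k * \prod_i G m c' x i.
  by rewrite mulr_ge0// prodr_ge0.
suff H m x : \prod_i G m c x i <= \sum_k w k * \prod_i G m (B k) x i.
  have := H n 0.
  rewrite (eq_bigr (fun i => Num.max 0 (c.2 ord0 i - c.1 ord0 i))); last first.
    by move=> i _; rewrite /G ltn_ord.
  congr (_ <= _); apply: eq_bigr => k _; congr (_ * _); apply: eq_bigr => i _.
  by rewrite /G ltn_ord.
elim: m x => [|m IH] x.
  have [cx|/asboolPn ncx] := asboolP (box c x); last first.
    rewrite [leLHS](_ : _ = 0); first exact: sumr_ge0.
    move/asboolP/existsNP: ncx => [i /negP Hi].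
    by apply/eqP/prodf_eq0; exists i => //=; rewrite /G/= /in_itv01 (negbTE Hi).
  have [k wk Bx] := cB _ cx.
  rewrite (bigD1 k)//= -[leLHS]addr0; apply: lerD; last exact: sumr_ge0.
  rewrite !big1 ?mulr1// => i _; rewrite /G/= /in_itv01.
    by rewrite Bx.
  by rewrite cx.
have [mn|nm] := ltnP m n; last first.
  have GE c' i : G m.+1 c' x i = G m c' x i.
    by rewrite /G !(leq_trans (ltn_ord i))// (leq_trans nm).
  under eq_bigr do rewrite GE.
  by under [leRHS]eq_bigr do under eq_bigr do rewrite GE.
pose j := Ordinal mn.
pose y t : 'rV[R]_n := \row_i (if i == j then t else x ord0 i).
have GE c' : \prod_i G m.+1 c' x i =
    (\prod_(i | i != j) G m c' x i) * Num.max 0 (c'.2 ord0 j - c'.1 ord0 j).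
  rewrite (bigD1 j)//= mulrC {2}/G ltnSn; congr (_ * _).
  apply: eq_bigr => i ij; rewrite /G ltnS leq_eqVlt.
  by rewrite -[i == m :> nat]/(i == j) (negbTE ij).
have Gy c' t : \prod_i G m c' (y t) i =
    (\prod_(i | i != j) G m c' x i) * in_itv01 (c'.1 ord0 j) (c'.2 ord0 j) t.
  rewrite (bigD1 j)//= mulrC {2}/G/= ltnn mxE eqxx; congr (_ * _).
  by apply: eq_bigr => i ij; rewrite /G mxE (negbTE ij).
rewrite GE; under [leRHS]eq_bigr do rewrite GE mulrA.
apply: length_cover => [k||t]; rewrite ?mulr_ge0 ?prodr_ge0//.
by have := IH (y t); rewrite Gy; under [leRHS]eq_bigr do rewrite Gy mulrA.
Qed.

End box_length.

Lemma filter_forall_fin {T : Type} (F : set_system T) {FF : Filter F}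
    (I : finType) (P : I -> set T) :
  (forall i, F (P i)) -> F [set t | forall i, P i t].
Proof.
move=> H; suff : F [set t | forall i, i \in enum I -> P i t].
  by apply: filterS => t Pt i; apply: Pt; rewrite mem_enum.
elim: (enum I) => [|i s IH]; first by apply: filterS filterT => t _ i.
apply: filterS (filterI (H i) IH) => t [Pit Pst] j.
by rewrite inE => /predU1P[->//|]; exact: Pst.
Qed.

Section rV_topology.
Context {R : realType} {n : nat}.
Implicit Types (A : set 'rV[R]_n) (x y : 'rV[R]_n).

Lemma nbhs_boxP x A : nbhs x A <->
  exists2 e : R, 0 < e & forall y, (forall i, `|y ord0 i - x ord0 i| < e) -> A y.
Proof.
split => [/nbhs_ballP[e e0 xA]|[e e0 xA]].
  exists e => // y xy; apply: xA; split => // i j; rewrite ord1.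
  by rewrite -ball_normE/= distrC.
apply/nbhs_ballP; exists e => // y [_ xy]; apply: xA => i.
by have := xy ord0 i; rewrite -ball_normE/= distrC.
Qed.

Lemma open_box_nbhs A x : open A -> A x ->
  exists2 e : R, 0 < e & forall y, (forall i, `|y ord0 i - x ord0 i| <= e) -> A y.
Proof.
move=> oA Ax; have /nbhs_boxP[e e0 xA] : nbhs x A by exact: open_nbhs_nbhs.
exists (e / 2); rewrite ?divr_gt0// => y xy; apply: xA => i.
by rewrite (le_lt_trans (xy i))// ltr_pdivrMr// ltr_pMr// ltr1n.
Qed.

Lemma box_open (a b : 'I_n -> R) : open [set x : 'rV[R]_n | forall i, a i < x ord0 i < b i].
Proof.
rewrite openE => x xab; apply: filter_forall_fin => i.
have /= := @coord_continuous R 1 n ord0 i x.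
move=> /cvgrPdist_lt /(_ (Num.min (x ord0 i - a i) (b i - x ord0 i))).
have /andP[ax xb] := xab i.
rewrite lt_min !subr_gt0 ax xb => /(_ isT); apply: filterS => y.
rewrite lt_min !ltr_norml; lra.
Qed.

Lemma ler_coord_norm x i : `|x ord0 i| <= `|x|.
Proof.
rewrite [leRHS]mx_normrE.
exact: (@le_bigmax _ _ _ 0 (fun ij : 'I_1 * 'I_n => `|x ij.1 ij.2|) (ord0, i)).
Qed.

End rV_topology.

(** * The Lebesgue measure of a box *)

Section volume_box.
Context {R : realType} {n : nat}.
Local Notation mu := (@lebesgue_outer R n).
Local Notation boxes := ('rV[R]_n * 'rV[R]_n)%type.

Lemma box_volume_ge0 (c : boxes) : 0 <= box_volume c.
Proof. by apply: prodr_ge0 => i _; rewrite le_max lexx. Qed.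

Definition enlarge (d : R) (c : boxes) : boxes :=
  (c.1 - const_mx d, c.2 + const_mx d).

(** The limit is two-sided: positive [d] turns the boxes of a cover into open neighbourhoods,
    negative [d] pushes a box into its own interior. *)
Lemma box_volume_enlarge (c : boxes) : box_volume (enlarge d c) @[d --> (0 : R)] --> box_volume c.
Proof.
apply: cvg_big => [|i _]; first exact: mul_continuous.
rewrite [X in _ --> X](_ : _ = Num.max 0 ((c.2 ord0 i + 0) - (c.1 ord0 i - 0))); last first.
  by rewrite addr0 subr0.
under eq_fun do rewrite !mxE.
apply: (@continuous_cvg _ _ _ _ _ _ (fun x : R => Num.max 0 x)).
  by apply: (@continuous_max _ _ (cst 0) id) => //; exact: cst_continuous.
by apply: cvgB; apply: cvgD => //; try exact: cvg_cst; apply: cvgN.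
Qed.

Lemma lebesgue_outer_le_box (c : boxes) : (mu (box c) <= (box_volume c)%:E)%E.
Proof.
apply: ereal_inf_lbound; exists (fun k : nat => if k == 0%N then Some c else None).
  by move=> x cx; exists 0%N.
rewrite (nneseries_split 0 1)//; last first.
  by move=> [|k] _ //=; rewrite lee_fin box_volume_ge0.
rewrite add0n big_nat1 /= eseries0 ?adde0//.
by move=> [|k].
Qed.

(** A countable cover is enlarged to open boxes at a cost of e / 2^(k+1) for the k-th one.
    Compactness then leaves finitely many of them, to which [volume_cover] applies. *)
Lemma lebesgue_outer_box (c : boxes) : mu (box c) = (box_volume c)%:E.
Proof.
apply/eqP; rewrite eq_le lebesgue_outer_le_box /=.
apply: le_ereal_inf_tmp => _ [B cB <-].
apply/lee_addgt0Pr => e e0.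
have ovol0 o : (0 <= (oapp (@box_volume R n) 0 o)%:E)%E.
  by case: o => [b|]//=; rewrite lee_fin box_volume_ge0.
apply: le_trans (epsilon_trick xpredT (fun k => ovol0 (B k)) (ltW e0)).
pose ek k := e / (2 ^ k.+1)%:R.
have ek0 k : 0 < ek k by rewrite divr_gt0// ltr0n expn_gt0.
have /choice[d Hd] k : exists d : R, 0 < d /\
    oapp (fun b => box_volume (enlarge d b)) 0 (B k) <= oapp (@box_volume R n) 0 (B k) + ek k.
  case: (B k) => [b|] /=; last by exists 1; split => //; rewrite add0r ltW.
  have /cvgrPdist_le /(_ _ (ek0 k)) H := cvg_at_right_filter (@box_volume_enlarge b).
  have : \forall d \near 0^'+, 0 < d :> R by exact: nbhs_right_gt.
  move=> /(filterI H) /(@filter_ex _ _ (at_right_proper_filter (0 : R)))[d [Hd d0]].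
  exists d; split => //.
  by move: Hd; rewrite distrC ler_norml => /andP[_]; rewrite lerBlDl.
pose O k : set 'rV[R]_n := oapp (fun b : boxes =>
  [set x | forall i, (enlarge (d k) b).1 ord0 i < x ord0 i < (enlarge (d k) b).2 ord0 i]) set0 (B k).
have cc : compact (box c).
  by apply: (@rV_compact R n (fun i => `[c.1 ord0 i, c.2 ord0 i]%classic)) => i; exact: segment_compact.
rewrite compact_cover in cc.
have [k _||D _ cD] := cc nat setT O.
- by rewrite /O; case: (B k) => [b|] /=; [exact: box_open|exact: open0].
- move=> x /cB[k _ H]; exists k => //; move: H; rewrite /O.
  case: (B k) (Hd k) => [b|] //= [d0 _] bx i; have := bx i; rewrite !mxE; lra.
(* All indices below [N] are kept, whether selected or not, since this only increases the sum. The
   weight [w] cancels the missing boxes, which [odflt] replaces by a dummy. *)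
pose N := (\max_(k <- finmap.enum_fset D) k.+1)%N.
have ltN (k : nat) : [set` D] k -> (k < N)%N.
  by move=> kD; rewrite /N; apply: leq_bigmax_seq.
pose w (k : 'I_N) : R := (B k != None)%:R.
pose B' (k : 'I_N) := enlarge (d k) (odflt (0, 0) (B k)).
have wB (k : 'I_N) : w k * box_volume (B' k) <= oapp (@box_volume R n) 0 (B k) + ek k.
  rewrite /w /B'; case: (B k) (Hd k).2 => [b|]//=; first by rewrite mul1r.
  by rewrite mul0r.
have : box_volume c <= \sum_k w k * box_volume (B' k).
  apply: volume_cover => [k|x /cD[k kD Ox]]; first exact: ler0n.
  exists (Ordinal (ltN _ kD)); rewrite /w /B' /=; move: Ox; rewrite /O.
    by case: (B k).
  by case: (B k) => [b|]//= + i => /(_ i); rewrite !mxE; lra.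
rewrite -lee_fin => /le_trans; apply.
apply: (@le_trans _ _ (\sum_(0 <= k < N) ((oapp (@box_volume R n) 0 (B k))%:E + (ek k)%:E))%E).
  by rewrite big_mkord -sumEFin; apply: lee_sum => k _; rewrite -EFinD lee_fin wB.
apply: nneseries_lim_ge => k _ _; rewrite adde_ge0// lee_fin; exact: ltW.
Qed.

End volume_box.

(** * Measurability of half-spaces, boxes and open sets *)

Section measurability.
Context {R : realType} {n : nat}.
Local Notation mu := (@lebesgue_outer R n).
Local Notation boxes := ('rV[R]_n * 'rV[R]_n)%type.

Lemma ovol_ge0 (o : option boxes) : (0 <= (oapp (@box_volume R n) 0 o)%:E)%E.
Proof. by case: o => [b|]//=; rewrite lee_fin box_volume_ge0. Qed.

Definition cut_below (i : 'I_n) (r : R) (c : boxes) : boxes :=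
  (c.1, \row_j if j == i then Num.min (c.2 ord0 j) r else c.2 ord0 j).

Definition cut_above (i : 'I_n) (r : R) (c : boxes) : boxes :=
  (\row_j (if j == i then Num.max (c.1 ord0 j) r else c.1 ord0 j), c.2).

Lemma box_volume_cut i r c :
  box_volume (cut_below i r c) + box_volume (cut_above i r c) = box_volume c.
Proof.
rewrite /box_volume (bigD1 i)//= [X in _ + X](bigD1 i)//= [RHS](bigD1 i)//= !mxE eqxx.
under eq_bigr => j ji do rewrite mxE (negbTE ji).
under [X in _ + _ * X]eq_bigr => j ji do rewrite mxE (negbTE ji).
rewrite -mulrDl; congr (_ * _).
rewrite !maxEle !minEle; repeat case: ifPn; rewrite -?ltNge; lra.
Qed.

(** Cutting every box of a cover along the hyperplane gives covers of both sides with the same total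
    volume, which is the Caratheodory condition. *)
Lemma measurable_halfspace i r :
  measurable ([set x | x ord0 i <= r] : set (lebesgueRn R n)).
Proof.
apply: le_caratheodory_measurable => X; apply: le_ereal_inf_tmp => _ [B XB <-].
apply: (@le_trans _ _ (
    \sum_(k <oo) (oapp (@box_volume R n) 0 (omap (cut_below i r) (B k)))%:E +
    \sum_(k <oo) (oapp (@box_volume R n) 0 (omap (cut_above i r) (B k)))%:E)%E).
  apply: leeD; apply: ereal_inf_lbound; eexists => //=.
  - move=> x [/XB[k _ xk] xr]; exists k => //; case: (B k) xk => [c|]//= cx j.
    by rewrite mxE; case: eqP => [->|//]; rewrite le_min xr andbT.
  - move=> x [/XB[k _ xk] xr]; exists k => //; case: (B k) xk => [c|]//= cx j.
    rewrite mxE; case: eqP => [->|//]; rewrite ge_max.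
    by move/negP: xr; rewrite -ltNge => /ltW ->; rewrite andbT.
rewrite -nneseriesD//; try by move=> k _ _; exact: ovol_ge0.
rewrite (eq_eseriesr (g := fun k => (oapp (@box_volume R n) 0 (B k))%:E))// => k _.
by case: (B k) => [c|]/=; rewrite ?adde0// -EFinD box_volume_cut.
Qed.

Lemma measurable_coord i :
  measurable_fun setT (fun x : lebesgueRn R n => x ord0 i : R).
Proof.
move=> _; apply: (measurability _ (RGenOInfty.measurableE R)) => // /= _ [_ [r ->] <-].
rewrite [X in measurable X](_ : _ = ~` ([set x | x ord0 i <= r] : set (lebesgueRn R n))).
  by apply: measurableC; exact: measurable_halfspace.
apply/seteqP; split => [x [_]|x] /=; rewrite in_itv/= andbT ltNge; first by move/negP.
by move=> /negP H; split.
Qed.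

Lemma measurable_forall_fin d (T : measurableType d) (I : finType) (P : I -> set T) :
  (forall i, measurable (P i)) -> measurable [set x | forall i, P i x].
Proof.
move=> mP; rewrite (_ : mkset _ = \big[setI/setT]_(i <- enum I) P i).
  exact: bigsetI_measurable.
apply/seteqP; split => x; rewrite -bigcap_seq.
  by move=> Px i _.
by move=> Px i; apply: Px; rewrite /= mem_enum.
Qed.

Lemma measurable_box (c : boxes) : measurable (box c : set (lebesgueRn R n)).
Proof.
apply: measurable_forall_fin => i.
rewrite [X in measurable X](_ : _ =
  (fun x : lebesgueRn R n => x ord0 i : R) @^-1` `[c.1 ord0 i, c.2 ord0 i]%classic).
  by rewrite -[X in measurable X]setTI; exact: measurable_coord.
by apply/seteqP; split => x /=; rewrite in_itv.
Qed.

(** Boxes with rational corners are enumerated, and those that are not contained in [A] are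
    dropped. *)
Lemma open_bigcup_box (A : set 'rV[R]_n) : open A ->
  exists c : nat -> option boxes, A = \bigcup_k oapp (@box R n) set0 (c k).
Proof.
move=> oA.
pose qbox (q : 'rV[rat]_n * 'rV[rat]_n) : boxes := (map_mx ratr q.1, map_mx ratr q.2).
exists (fun k => obind (fun q => if `[< box (qbox q) `<=` A >] then Some (qbox q) else None)
  (unpickle k)).
apply/seteqP; split => [x Ax|x [k _]]; last first.
  by case: (unpickle k) => [q|]//=; case: asboolP => // H; exact: H.
have [e e0 He] := open_box_nbhs oA Ax.
have /choice[q1 Hq1] i : exists q, ratr q \in `]x ord0 i - e, x ord0 i[.
  by apply: rat_in_itvoo; rewrite ltrBlDr ltrDl.
have /choice[q2 Hq2] i : exists q, ratr q \in `]x ord0 i, x ord0 i + e[.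
  by apply: rat_in_itvoo; rewrite ltrDl.
exists (pickle (\row_i q1 i, \row_i q2 i)) => //; rewrite pickleK/=.
case: asboolP => [_ i|[]].
  by rewrite !mxE; move: (Hq1 i) (Hq2 i); rewrite !in_itv/=; lra.
move=> y Hy; apply: He => i; move: (Hy i) (Hq1 i) (Hq2 i).
rewrite !mxE !in_itv/= ler_norml; lra.
Qed.

Lemma measurable_openRn (A : set (lebesgueRn R n)) : open (A : set 'rV[R]_n) -> measurable A.
Proof.
move=> /open_bigcup_box[c ->]; apply: bigcup_measurable => k _.
by case: (c k) => [b|]/=; [exact: measurable_box|exact: measurable0].
Qed.

Lemma vol_bounded (A : set 'rV[R]_n) : bounded_set A -> (mu A < +oo)%E.
Proof.
move=> [M [Mr HM]].
apply: (@le_lt_trans _ _ (mu (box (const_mx (- (M + 1)), const_mx (M + 1))))).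
  apply: le_outer_measure => x Ax i; rewrite !mxE -ler_norml.
  by apply: le_trans (HM (M + 1) _ x Ax); rewrite ?ltrDl// ler_coord_norm.
by rewrite lebesgue_outer_box ltry.
Qed.

Lemma vol_open_gt0 (A : set 'rV[R]_n) : open A -> A !=set0 -> (0 < mu A)%E.
Proof.
move=> oA [x Ax]; have [e e0 He] := open_box_nbhs oA Ax.
apply: (@lt_le_trans _ _ (mu (box (x - const_mx e, x + const_mx e)))).
  rewrite lebesgue_outer_box lte_fin; apply: prodr_gt0 => i _.
  by rewrite !mxE lt_max; apply/orP; right; lra.
apply: le_outer_measure => y Hy; apply: He => i; have := Hy i.
by rewrite !mxE ler_norml; lra.
Qed.

End measurability.

(** * Lebesgue measure under homotheties *)

Section affine.
Context {R : realType} {n : nat}.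
Local Notation mu := (@lebesgue_outer R n).
Local Notation boxes := ('rV[R]_n * 'rV[R]_n)%type.

(** Here [c] is the image of the origin and not the fixed point: the homothety of centre z and ratio
    s has [c] equal to (1 - s) z. With [s = 1] this is a translation. *)
Definition homothety (s : R) (c x : 'rV[R]_n) : 'rV[R]_n := s *: x + c.

Lemma homothetyK s c : s != 0 -> cancel (homothety s c) (homothety s^-1 (- s^-1 *: c)).
Proof.
move=> s0 x; rewrite /homothety scalerDr scalerA mulVf// scale1r.
by rewrite scaleNr addrK.
Qed.

Lemma le_lebesgue_outer_homothety s c (A : set 'rV[R]_n) : 0 < s ->
  (mu (homothety s c @` A) <= (s ^+ n)%:E * mu A)%E.
Proof.
move=> s0; rewrite -lee_pdivrMl ?exprn_gt0//.
apply: le_ereal_inf_tmp => _ [B AB <-].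
rewrite lee_pdivrMl ?exprn_gt0// -nneseriesZl; last by move=> k _; exact: ovol_ge0.
apply: ereal_inf_lbound.
exists (fun k => omap (fun b : boxes => (homothety s c b.1, homothety s c b.2)) (B k)).
  move=> _ [x Ax <-]; have [k _ Bx] := AB _ Ax; exists k => //.
  case: (B k) Bx => [b|]//= bx i; rewrite !mxE !lerD2r.
  by have /andP[? ?] := bx i; rewrite !ler_pM2l//; apply/andP.
apply: eq_eseriesr => k _; rewrite -EFinM; congr EFin.
case: (B k) => [b|] /=; last by rewrite mulr0.
have sn : s ^+ n = \prod_(i < n) s by rewrite prodr_const card_ord.
rewrite /box_volume sn -big_split/=.
apply: eq_bigr => i _; rewrite !mxE.
by rewrite maxr_pMr ?ltW// mulr0; congr Num.max; ring.
Qed.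

Lemma lebesgue_outer_homothety s c (A : set 'rV[R]_n) : 0 < s ->
  mu (homothety s c @` A) = ((s ^+ n)%:E * mu A)%E.
Proof.
move=> s0; apply/eqP; rewrite eq_le le_lebesgue_outer_homothety//=.
rewrite -lee_pdivlMl ?exprn_gt0// -exprVn.
apply: le_trans (le_lebesgue_outer_homothety (- s^-1 *: c) _ _); last by rewrite invr_gt0.
apply: le_outer_measure => x Ax; exists (homothety s c x); first by exists x.
by rewrite homothetyK ?gt_eqF.
Qed.

Lemma homothety_preimage s c (A : set 'rV[R]_n) : s != 0 ->
  homothety s c @^-1` A = homothety s^-1 (- s^-1 *: c) @` A.
Proof.
move=> s0; apply/seteqP; split => [x Ax|_ [y Ay <-]] /=.
  by exists (homothety s c x) => //; rewrite homothetyK.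
rewrite (_ : homothety _ _ _ = y)//.
by rewrite /homothety scalerDr !scalerA mulrN mulfV// scaleN1r scale1r addrNK.
Qed.

Lemma lebesgue_outer_preimage s c (A : set 'rV[R]_n) : 0 < s ->
  mu (homothety s c @^-1` A) = ((s ^- n)%:E * mu A)%E.
Proof.
move=> s0; rewrite homothety_preimage ?gt_eqF// lebesgue_outer_homothety ?invr_gt0//.
by rewrite exprVn.
Qed.

(** The Caratheodory condition for the preimage of [A], tested on [X], is the one for [A] tested on
    the image of [X], scaled by a constant. *)
Lemma measurable_homothety s c : 0 < s ->
  measurable_fun setT (homothety s c : lebesgueRn R n -> lebesgueRn R n).
Proof.
move=> s0 _ A mA; rewrite setTI; apply: le_caratheodory_measurable => X.
have KX : homothety s c @^-1` (homothety s c @` X) = X.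
  apply/seteqP; split => [x [y Xy] /(can_inj (homothetyK c (lt0r_neq0 s0))) <-//|x Xx].
  by exists x.
set Y := homothety s c @` X.
have mAY : mu Y = (mu (Y `&` A) + mu (Y `&` ~` A))%E by exact: mA.
suff : (mu (homothety s c @^-1` (Y `&` A)) + mu (homothety s c @^-1` (Y `&` ~` A)) <=
        mu (homothety s c @^-1` Y))%E by rewrite !preimage_setI -preimage_setC KX.
by rewrite !lebesgue_outer_preimage// mAY ge0_muleDr ?outer_measure_ge0.
Qed.

End affine.

(** * The Brunn-Minkowski inequality *)

Section brunn_minkowski.
Context {R : realType} {n : nat}.
Local Notation mu := (@lebesgue_outer R n).
Local Notation boxes := ('rV[R]_n * 'rV[R]_n)%type.

Definition obox (c : boxes) : set 'rV[R]_n :=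
  [set x | forall i, c.1 ord0 i < x ord0 i < c.2 ord0 i].

(** The open box contains slightly shrunk closed boxes, whose volumes tend to the full volume. *)
Lemma obox_volume_le (c : boxes) : ((box_volume c)%:E <= mu (obox c))%E.
Proof.
apply/lee_addgt0Pr => e e0.
have /cvgrPdist_le /(_ _ e0) H : box_volume (enlarge (- d) c) @[d --> 0^'+] --> box_volume c.
  apply: (@cvg_at_right_filter _ _ _ 0).
  have N0 : - x @[x --> (0 : R)] --> (0 : R).
    by rewrite -[X in _ --> X]oppr0; apply: cvgN; exact: cvg_id.
  exact: (@cvg_comp _ _ _ (fun x : R => - x) (fun d => box_volume (enlarge d c)) _ (nbhs (0 : R)) _
    N0 (@box_volume_enlarge R n c)).
have d0 : \forall d \near 0^'+, 0 < d :> R by exact: nbhs_right_gt.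
have [d [Hd {}d0]] := @filter_ex _ _ (at_right_proper_filter (0 : R)) _ (filterI H d0).
apply: (@le_trans _ _ ((box_volume (enlarge (- d) c))%:E + e%:E)%E).
  by rewrite -EFinD lee_fin -lerBlDl; move: Hd; rewrite ler_norml => /andP[_].
rewrite leeD2r// -lebesgue_outer_box; apply: le_outer_measure => x Hx i.
by have := Hx i; rewrite !mxE; lra.
Qed.

Definition nondeg (c : boxes) := [forall i, c.1 ord0 i < c.2 ord0 i].

Definition separated_boxes (c d : boxes) :=
  [exists i, (c.2 ord0 i <= d.1 ord0 i) || (d.2 ord0 i <= c.1 ord0 i)].

Definition volumes (s : seq boxes) : R := \sum_(c <- s) box_volume c.

(** [S] contains the Minkowski combination with weights 1 - t and t of the two unions of open boxes.
    Only this inclusion is recorded, so that [S] may be cut by hyperplanes during the induction. *)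
Definition minkowski_sub (t : R) (As Bs : seq boxes) (S : set 'rV[R]_n) :=
  forall a b x y, a \in As -> b \in Bs -> obox a x -> obox b y -> S ((1 - t) *: x + t *: y).

Lemma degenerate_volume (c : boxes) : ~~ nondeg c -> box_volume c = 0.
Proof.
move=> /forallPn[i]; rewrite -leNgt => ci; rewrite /box_volume (bigD1 i)//=.
by rewrite max_l ?mul0r// subr_le0.
Qed.

Lemma nondeg_volume_gt0 (c : boxes) : nondeg c -> 0 < box_volume c.
Proof.
by move=> /forallP nc; apply: prodr_gt0 => i _; rewrite lt_max subr_gt0 nc orbT.
Qed.

Lemma powR_prod (I : Type) (s : seq I) (f : I -> R) (t : R) : (forall i, 0 <= f i) ->
  (\prod_(i <- s) f i) `^ t = \prod_(i <- s) f i `^ t.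
Proof.
move=> f0; elim: s => [|i s IH]; first by rewrite !big_nil powR1.
by rewrite !big_cons powRM// ?IH// prodr_ge0.
Qed.

Lemma powR_AMGM (a b t : R) : 0 <= a -> 0 <= b -> 0 < t < 1 ->
  a `^ (1 - t) * b `^ t <= (1 - t) * a + t * b.
Proof.
move=> a0 b0 /andP[t0 t1].
have t1' : 0 < 1 - t by rewrite subr_gt0.
have := @conjugate_powR R (a `^ (1 - t)) (b `^ t) (1 - t)^-1 t^-1.
rewrite !powR_ge0 !invr_gt0 t0 t1' !invrK subrK => /(_ isT isT isT isT erefl) /le_trans; apply.
by rewrite -!powRrM !mulfV ?gt_eqF// !powRr1// [a * _]mulrC [b * _]mulrC.
Qed.

(** The combination of two boxes is the box whose sides are the weighted arithmetic means of the
    sides. The weighted arithmetic-geometric inequality is applied to each side. *)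
Lemma minkowski_box (a b : boxes) (t : R) S : 0 < t < 1 -> nondeg a -> nondeg b ->
  minkowski_sub t [:: a] [:: b] S ->
  ((box_volume a `^ (1 - t) * box_volume b `^ t)%:E <= mu S)%E.
Proof.
move=> t01 na nb H; have /andP[t0 t1] := t01.
have /forallP na' := na; have /forallP nb' := nb.
pose c : boxes := ((1 - t) *: a.1 + t *: b.1, (1 - t) *: a.2 + t *: b.2).
apply: (@le_trans _ _ (box_volume c)%:E).
  rewrite lee_fin !powR_prod; do ?[by move=> i; rewrite le_max lexx].
  rewrite -big_split/=; apply: ler_prod => i _.
  rewrite mulr_ge0 ?powR_ge0//=; apply: le_trans (powR_AMGM _ _ t01) _; rewrite ?le_max ?lexx//.
  have da : 0 <= a.2 ord0 i - a.1 ord0 i by rewrite subr_ge0 ltW.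
  have db : 0 <= b.2 ord0 i - b.1 ord0 i by rewrite subr_ge0 ltW.
  apply/orP; right; rewrite (max_r da) (max_r db) /= !mxE; lra.
apply: le_trans (obox_volume_le c) _; apply: le_outer_measure => z Hz.
(* the box c is parametrized affinely by the unit cube, and so are a and b *)
pose u i := (z ord0 i - c.1 ord0 i) / (c.2 ord0 i - c.1 ord0 i).
have dc i : 0 < c.2 ord0 i - c.1 ord0 i.
  by rewrite subr_gt0 !mxE ltrD// ltr_pM2l// subr_gt0.
have u01 i : 0 < u i < 1.
  have /andP[z1 z2] := Hz i.
  by rewrite /u; apply/andP; split; [rewrite divr_gt0// subr_gt0|rewrite ltr_pdivrMr// mul1r ltrD2r].
pose pt (d : boxes) : 'rV[R]_n := \row_i (d.1 ord0 i + u i * (d.2 ord0 i - d.1 ord0 i)).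
have Hpt d : nondeg d -> obox d (pt d).
  move=> /forallP nd i; rewrite mxE; have /andP[u0 u1] := u01 i.
  have di : 0 < d.2 ord0 i - d.1 ord0 i by rewrite subr_gt0.
  by rewrite ltrDl mulr_gt0//= -ltrBrDl -[ltRHS]mul1r ltr_pM2r.
have -> : z = (1 - t) *: pt a + t *: pt b.
  apply/rowP => i; rewrite !mxE.
  have zE : z ord0 i = c.1 ord0 i + u i * (c.2 ord0 i - c.1 ord0 i).
    by rewrite /u divfK ?gt_eqF// addrC subrK.
  by rewrite {1}zE !mxE; ring.
by apply: (H a b); rewrite ?mem_seq1//; exact: Hpt.
Qed.

(** Degenerate pieces are removed, so that the number of boxes can decrease; this is what the
    induction runs on. *)
Definition cuts_below i r (s : seq boxes) := [seq c <- map (cut_below i r) s | nondeg c].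
Definition cuts_above i r (s : seq boxes) := [seq c <- map (cut_above i r) s | nondeg c].

Lemma volumes_filter (s : seq boxes) : volumes [seq c <- s | nondeg c] = volumes s.
Proof.
rewrite /volumes big_filter [RHS](bigID nondeg)/= [X in _ + X]big1 ?addr0//.
by move=> c; exact: degenerate_volume.
Qed.

Lemma volumes_cuts i r s : volumes (cuts_below i r s) + volumes (cuts_above i r s) = volumes s.
Proof.
rewrite !volumes_filter /volumes !big_map -big_split/=.
by apply: eq_bigr => c _; rewrite box_volume_cut.
Qed.

Lemma volumes_ge0 s : 0 <= volumes s.
Proof. by apply: sumr_ge0 => c _; exact: box_volume_ge0. Qed.

Lemma volumes_gt0 s : all nondeg s -> (0 < size s)%N -> 0 < volumes s.
Proof.
case: s => [//|c s] /= /andP[nc _] _; rewrite /volumes big_cons.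
by rewrite ltr_wpDr ?volumes_ge0// nondeg_volume_gt0.
Qed.

Lemma volumes_cuts_below_cont i s : continuous (fun r => volumes (cuts_below i r s)).
Proof.
move=> r; under eq_fun do rewrite volumes_filter /volumes big_map.
apply: cvg_big => [|c _]; first exact: add_continuous.
rewrite {2}/box_volume; under eq_fun do rewrite /box_volume.
apply: cvg_big => [|j _]; first exact: mul_continuous.
under eq_fun do rewrite !mxE; rewrite !mxE.
apply: (@continuous_cvg _ _ _ _ _ _ (fun x : R => Num.max 0 x)).
  by apply: (@continuous_max _ _ (cst 0) id) => //; exact: cst_continuous.
apply: cvgB; last exact: cvg_cst.
case: eqP => _; last exact: cvg_cst.
by apply: (@continuous_min _ _ (cst (c.2 ord0 j)) id) => //; exact: cst_continuous.
Qed.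

Lemma separated_sub (c d c' d' : boxes) :
  (forall i, c.1 ord0 i <= c'.1 ord0 i /\ c'.2 ord0 i <= c.2 ord0 i) ->
  (forall i, d.1 ord0 i <= d'.1 ord0 i /\ d'.2 ord0 i <= d.2 ord0 i) ->
  separated_boxes c d -> separated_boxes c' d'.
Proof.
move=> Hc Hd /existsP[i /orP[H|H]]; apply/existsP; exists i; apply/orP; [left|right].
  by apply: le_trans (Hc i).2 (le_trans H (Hd i).1).
by apply: le_trans (Hd i).2 (le_trans H (Hc i).1).
Qed.

Lemma cut_below_sub i r (c : boxes) j :
  c.1 ord0 j <= (cut_below i r c).1 ord0 j /\ (cut_below i r c).2 ord0 j <= c.2 ord0 j.
Proof. by rewrite lexx !mxE; case: eqP => //; rewrite ge_min lexx. Qed.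

Lemma cut_above_sub i r (c : boxes) j :
  c.1 ord0 j <= (cut_above i r c).1 ord0 j /\ (cut_above i r c).2 ord0 j <= c.2 ord0 j.
Proof. by rewrite lexx !mxE; case: eqP => //; rewrite le_max lexx. Qed.

Lemma pairwise_cuts_below i r s : pairwise separated_boxes s -> pairwise separated_boxes (cuts_below i r s).
Proof.
move=> H; apply: pairwise_filter; rewrite pairwise_map; apply: sub_pairwise H => c d.
by apply: separated_sub => j; exact: cut_below_sub.
Qed.

Lemma pairwise_cuts_above i r s : pairwise separated_boxes s -> pairwise separated_boxes (cuts_above i r s).
Proof.
move=> H; apply: pairwise_filter; rewrite pairwise_map; apply: sub_pairwise H => c d.
by apply: separated_sub => j; exact: cut_above_sub.
Qed.

Lemma size_cuts_below i r s : (size (cuts_below i r s) <= size s)%N.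
Proof. by rewrite size_filter -[leqRHS](size_map (cut_below i r)) count_size. Qed.

Lemma size_cuts_above i r s : (size (cuts_above i r s) <= size s)%N.
Proof. by rewrite size_filter -[leqRHS](size_map (cut_above i r)) count_size. Qed.

(** Points below the levels [r] and [r'] combine to a point below the combined level. Together with
    the analogue above it, this sends the lower and the upper combinations to opposite sides of one
    hyperplane, where the measures of the two parts of [S] add up. *)
Lemma minkowski_sub_below t As Bs S i r r' : 0 < t < 1 -> minkowski_sub t As Bs S ->
  minkowski_sub t (cuts_below i r As) (cuts_below i r' Bs)
    (S `&` [set x | x ord0 i <= (1 - t) * r + t * r']).
Proof.
move=> /andP[t0 t1] H a b x y.
rewrite !mem_filter => /andP[_ /mapP[a' a'A ->]] /andP[_ /mapP[b' b'B ->]] ax bY.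
have t1' : 0 < 1 - t by rewrite subr_gt0.
split; last first.
  move: (ax i) (bY i); rewrite /= !mxE eqxx !lt_min => /andP[_ /andP[_ ?]] /andP[_ /andP[_ ?]].
  by rewrite lerD// ler_pM2l// ltW.
apply: (H a' b') => // j.
- by move: (ax j); rewrite !mxE; case: eqP => // _ /andP[->]; rewrite lt_min => /andP[->].
- by move: (bY j); rewrite !mxE; case: eqP => // _ /andP[->]; rewrite lt_min => /andP[->].
Qed.

Lemma minkowski_sub_above t As Bs S i r r' : 0 < t < 1 -> minkowski_sub t As Bs S ->
  minkowski_sub t (cuts_above i r As) (cuts_above i r' Bs)
    (S `&` ~` [set x | x ord0 i <= (1 - t) * r + t * r']).
Proof.
move=> /andP[t0 t1] H a b x y.
rewrite !mem_filter => /andP[_ /mapP[a' a'A ->]] /andP[_ /mapP[b' b'B ->]] ax bY.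
have t1' : 0 < 1 - t by rewrite subr_gt0.
split; last first.
  move: (ax i) (bY i); rewrite /= !mxE eqxx !gt_max => /andP[/andP[_ ?] _] /andP[/andP[_ ?] _].
  by apply/negP; rewrite -ltNge ltrD// ltr_pM2l.
apply: (H a' b') => // j.
- by move: (ax j); rewrite !mxE; case: eqP => // _ /andP[+ ->]; rewrite gt_max => /andP[->].
- by move: (bY j); rewrite !mxE; case: eqP => // _ /andP[+ ->]; rewrite gt_max => /andP[->].
Qed.

Lemma volumes_cut_IVT i s p : 0 <= p <= 1 -> exists r, volumes (cuts_below i r s) = p * volumes s.
Proof.
move=> /andP[p0 p1].
(* A crude bound for all coordinates involved: the cut at [- U] leaves no volume below and the cut
   at [U] leaves everything below. *)
pose U := \sum_(c <- s) (`|c.1 ord0 i| + `|c.2 ord0 i|).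
have U0 : 0 <= U by apply: sumr_ge0 => c _; rewrite addr_ge0.
have HU c : c \in s -> `|c.1 ord0 i| + `|c.2 ord0 i| <= U.
  move=> cs; rewrite /U (big_rem _ cs)/= lerDl.
  by apply: sumr_ge0 => d _; rewrite addr_ge0.
have Hlo : volumes (cuts_below i (- U) s) = 0.
  rewrite volumes_filter /volumes big_map big_seq big1// => c cs.
  apply: degenerate_volume; apply/forallPn; exists i; rewrite -leNgt !mxE eqxx.
  rewrite ge_min; apply/orP; right; have := HU _ cs.
  have := ler_norm (- c.1 ord0 i); rewrite normrN; have := normr_ge0 (c.2 ord0 i); lra.
have Hhi : volumes (cuts_below i U s) = volumes s.
  rewrite volumes_filter /volumes big_map big_seq [RHS]big_seq; apply: eq_bigr => c cs.
  congr box_volume; case: c cs => a b cs; congr pair; apply/rowP => j; rewrite !mxE.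
  case: eqP => // ->; apply/min_idPl; have := HU _ cs => /=.
  have := ler_norm (b ord0 i); have := normr_ge0 (a ord0 i); lra.
have [|||r _ <-] := @IVT R (fun r => volumes (cuts_below i r s)) (- U) U (p * volumes s).
- by rewrite -subr_ge0 opprK addr_ge0.
- by apply: continuous_subspaceT; exact: volumes_cuts_below_cont.
- rewrite Hlo Hhi min_l ?volumes_ge0// max_r ?volumes_ge0// mulr_ge0 ?volumes_ge0//=.
  by rewrite ler_piMl// volumes_ge0.
by exists r.
Qed.

(** The multiplicative form of Brunn-Minkowski for unions of boxes, set up for the Hadwiger-Ohmann
    induction on the total number [N] of boxes. *)
Definition brunn_minkowski_upto N := forall (t : R) (As Bs : seq boxes) S, 0 < t < 1 ->
  (size As + size Bs <= N)%N -> (0 < size As)%N -> (0 < size Bs)%N ->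
  all nondeg As -> all nondeg Bs -> pairwise separated_boxes As -> pairwise separated_boxes Bs ->
  minkowski_sub t As Bs S ->
  ((volumes As `^ (1 - t) * volumes Bs `^ t)%:E <= mu S)%E.

(** The weighted geometric mean is homogeneous of degree one. Hence two halves cut in the common
    proportion p and 1 - p contribute exactly p and 1 - p of the bound. *)
Lemma powR_interp (p a b t : R) : 0 <= p -> 0 <= a -> 0 <= b -> 0 < t < 1 ->
  (p * a) `^ (1 - t) * (p * b) `^ t = p * (a `^ (1 - t) * b `^ t).
Proof.
move=> p0 a0 b0 /andP[t0 t1]; rewrite !powRM//.
have -> : p * (a `^ (1 - t) * b `^ t) = (p `^ (1 - t) * p `^ t) * (a `^ (1 - t) * b `^ t).
  rewrite -powRD; last by rewrite subrK oner_eq0.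
  by rewrite subrK powRr1.
ring.
Qed.

(* Both families are cut by parallel hyperplanes, in the same proportion. *)
Lemma brunn_minkowski_cut N t (As Bs : seq boxes) S (l u : boxes) i :
  brunn_minkowski_upto N -> 0 < t < 1 ->
  (size As + size Bs <= N.+1)%N -> (0 < size Bs)%N ->
  all nondeg As -> all nondeg Bs -> pairwise separated_boxes As -> pairwise separated_boxes Bs ->
  l \in As -> u \in As -> l.2 ord0 i <= u.1 ord0 i ->
  minkowski_sub t As Bs S ->
  ((volumes As `^ (1 - t) * volumes Bs `^ t)%:E <= mu S)%E.
Proof.
move=> IH t01 sz B0 nA nB sA sB lA uA lu H.
set r := l.2 ord0 i.
have loA : l \in cuts_below i r As.
  rewrite mem_filter (allP nA)//=; apply/mapP; exists l => //.
  case: (l) @r {lu lA} => a b /= ; congr pair; apply/rowP => j; rewrite mxE.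
  by case: eqP => // ->; rewrite minxx.
have hiA : u \in cuts_above i r As.
  rewrite mem_filter (allP nA)//=; apply/mapP; exists u => //.
  case: (u) lu {uA} => a b /= ar; congr pair; apply/rowP => j; rewrite mxE.
  by case: eqP => // ->; rewrite max_l.
have A0 : (0 < size As)%N by case: (As) lA.
(* The hyperplane separates [l] from [u]. The part of [u] below it is degenerate and so is the part
   of [l] above it, hence each half of [As] loses a box, while the halves of [Bs] have no more boxes
   than [Bs]. *)
have szlo : (size (cuts_below i r As) < size As)%N.
  rewrite size_filter -[ltnRHS](size_map (cut_below i r)) ltn_neqAle count_size andbT -all_count.
  apply/allPn; exists (cut_below i r u); first exact: map_f.
  by apply/forallPn; exists i; rewrite -leNgt !mxE eqxx ge_min lu orbT.
have szhi : (size (cuts_above i r As) < size As)%N.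
  rewrite size_filter -[ltnRHS](size_map (cut_above i r)) ltn_neqAle count_size andbT -all_count.
  apply/allPn; exists (cut_above i r l); first exact: map_f.
  by apply/forallPn; exists i; rewrite -leNgt !mxE eqxx le_max lexx orbT.
have VA0 := volumes_gt0 nA A0; have VB0 := volumes_gt0 nB B0.
have Vlo : 0 < volumes (cuts_below i r As).
  by apply: volumes_gt0; [exact: filter_all|case: (cuts_below _ _ _) loA].
have Vhi : 0 < volumes (cuts_above i r As).
  by apply: volumes_gt0; [exact: filter_all|case: (cuts_above _ _ _) hiA].
(* The cut of [As] dictates the proportion [p]; the level [r'] is then chosen by continuity so as to
   cut [Bs] in the same proportion. *)
pose p := volumes (cuts_below i r As) / volumes As.
have p0 : 0 < p by rewrite divr_gt0.
have pE : volumes (cuts_below i r As) = p * volumes As by rewrite /p divfK ?gt_eqF.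
have qE : volumes (cuts_above i r As) = (1 - p) * volumes As.
  by rewrite mulrBl mul1r -pE -[in RHS](volumes_cuts i r As) addrC addKr.
have q0 : 0 < 1 - p by move: Vhi; rewrite qE pmulr_lgt0.
have [|r' pB] := @volumes_cut_IVT i Bs p; first by rewrite !ltW//= -subr_gt0.
have qB : volumes (cuts_above i r' Bs) = (1 - p) * volumes Bs.
  by rewrite mulrBl mul1r -pB -[in RHS](volumes_cuts i r' Bs) addrC addKr.
have Blo0 : (0 < size (cuts_below i r' Bs))%N.
  rewrite lt0n size_eq0; apply/eqP => E; move: pB; rewrite E /volumes big_nil => /esym/eqP.
  by rewrite gt_eqF// mulr_gt0.
have Bhi0 : (0 < size (cuts_above i r' Bs))%N.
  rewrite lt0n size_eq0; apply/eqP => E; move: qB; rewrite E /volumes big_nil => /esym/eqP.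
  by rewrite gt_eqF// mulr_gt0.
have -> : mu S = (mu (S `&` [set x | (x ord0 i <= (1 - t) * r + t * r')%R]) +
             mu (S `&` ~` [set x | (x ord0 i <= (1 - t) * r + t * r')%R]))%E.
  exact: (@measurable_halfspace R n i ((1 - t) * r + t * r') S).
have V0 := ltW VA0; have W0 := ltW VB0; have p0' := ltW p0; have q0' := ltW q0.
apply: (@le_trans _ _ ((volumes (cuts_below i r As) `^ (1 - t) *
     volumes (cuts_below i r' Bs) `^ t)%:E +
   (volumes (cuts_above i r As) `^ (1 - t) * volumes (cuts_above i r' Bs) `^ t)%:E)%E).
  rewrite pE qE pB qB !powR_interp// -EFinD lee_fin.
  by rewrite -mulrDl [p + _]addrC subrK mul1r.
apply: leeD; apply: IH => //.
- by rewrite -ltnS (leq_trans _ sz)// -addSn leq_add// size_cuts_below.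
- by case: (cuts_below _ _ _) loA.
- exact: filter_all.
- exact: filter_all.
- exact: pairwise_cuts_below.
- exact: pairwise_cuts_below.
- exact: minkowski_sub_below.
- by rewrite -ltnS (leq_trans _ sz)// -addSn leq_add// size_cuts_above.
- by case: (cuts_above _ _ _) hiA.
- exact: filter_all.
- exact: filter_all.
- exact: pairwise_cuts_above.
- exact: pairwise_cuts_above.
- exact: minkowski_sub_above.
Qed.

Lemma minkowski_subC t As Bs S : minkowski_sub t As Bs S -> minkowski_sub (1 - t) Bs As S.
Proof.
move=> H b a y x bB aA yb xa; rewrite opprB addrCA subrr addr0 addrC.
exact: (H a b).
Qed.

Lemma separated_seq2 (As : seq boxes) : (1 < size As)%N -> pairwise separated_boxes As ->
  exists i l u, [/\ l \in As, u \in As & l.2 ord0 i <= u.1 ord0 i].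
Proof.
case: As => [|a [|a' s]]//= _ /andP[/andP[/existsP[i /orP[H|H]] _] _].
  by exists i, a, a'; rewrite !inE !eqxx !orbT.
by exists i, a', a; rewrite !inE !eqxx !orbT.
Qed.

Lemma brunn_minkowski_boxes N : brunn_minkowski_upto N.
Proof.
elim: N => [|N IH] t As Bs S t01 sz A0 B0 nA nB sA sB H.
  by move: sz A0; rewrite leqn0 addn_eq0 => /andP[/eqP->].
have [A1|A1] := ltnP 1 (size As).
  have [i [l [u [lA uA lu]]]] := separated_seq2 A1 sA.
  exact: (brunn_minkowski_cut IH t01 sz B0 nA nB sA sB lA uA lu H).
have [B1|B1] := ltnP 1 (size Bs).
  have [i [l [u [lA uA lu]]]] := separated_seq2 B1 sB.
  rewrite mulrC -{1}[t](subKr 1).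
  apply: (brunn_minkowski_cut IH) lA uA lu _ => //.
  - by rewrite subr_gt0 gtrBl andbC.
  - by rewrite addnC.
  - exact: minkowski_subC.
case: As A0 nA sA H {sz} A1 => [//|a [|//]] _ /andP[na _] _ H _.
case: Bs B0 nB sB H B1 => [//|b [|//]] _ /andP[nb _] _ H _.
by rewrite /volumes !big_seq1; exact: minkowski_box.
Qed.


Lemma separated_grid (h M : R) (f g : {ffun 'I_n -> nat}) : 0 < h -> f != g ->
  separated_boxes (\row_i (h * (f i)%:R - M), \row_i (h * (f i).+1%:R - M))
    (\row_i (h * (g i)%:R - M), \row_i (h * (g i).+1%:R - M)).
Proof.
move=> h0 /eqP fg; have [i fgi] : exists i, f i != g i.
  apply/existsP; rewrite -negb_forall; apply/negP => /forallP H.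
  by apply: fg; apply/ffunP => i; apply/eqP.
apply/existsP; exists i; rewrite !mxE !lerD2r !ler_pM2l// !ler_nat.
by move: fgi; rewrite neq_ltn.
Qed.

Definition grid_box (N : nat) (M : R) (f : {ffun 'I_n -> nat}) : boxes :=
  (\row_i (N.+1%:R^-1 * (f i)%:R - M), \row_i (N.+1%:R^-1 * (f i).+1%:R - M)).

Lemma nondeg_grid_box N M f : nondeg (grid_box N M f).
Proof. by apply/forallP => i; rewrite !mxE ltrD2r ltr_pM2l ?invr_gt0// ltr_nat. Qed.

(** The cells of a fine grid that lie inside [A] exhaust its volume. Cells of one grid are separated
    because their integer indices differ in some coordinate. *)
Lemma open_inner_boxes (A : set 'rV[R]_n) (e : R) : open A -> bounded_set A -> 0 < e ->
  exists s : seq boxes, [/\ all nondeg s, pairwise separated_boxes s,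
    forall c, c \in s -> obox c `<=` A & (mu A <= (volumes s)%:E + e%:E)%E].
Proof.
move=> oA bA e0; have := bA => -[M0 [M0r HM0]].
pose M := `|M0| + 1.
have M0M : M0 < M by rewrite /M (le_lt_trans (ler_norm _))// ltrDl.
have AM x i : A x -> - M <= x ord0 i <= M.
  by move=> Ax; rewrite -ler_norml (le_trans (ler_coord_norm x i))// HM0.
pose K N := (Num.truncn (2 * M * N.+1%:R)).+1.
pose cell N (f : {ffun 'I_n -> 'I_(K N)}) := grid_box N M [ffun i => val (f i)].
pose s N := [seq cell N f | f <- enum {ffun 'I_n -> 'I_(K N)} & `[< box (cell N f) `<=` A >]].
pose U N : set (lebesgueRn R n) := \bigcup_(c in [set` s N]) box c.
(* Grids of mesh 1 / (N + 1) are not nested, so [U] is not monotone in [N]. The intersections [V] of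
   its tails increase to [A], and continuity of the measure applies to them. *)
pose V N : set (lebesgueRn R n) := \bigcap_(m in [set m | (N <= m)%N]) U m.
have mU N : measurable (U N).
  by rewrite /U bigcup_seq; apply: bigsetU_measurable => c _; exact: measurable_box.
have mV N : measurable (V N) by apply: bigcap_measurableType => m _; exact: mU.
have UA N : U N `<=` A.
  move=> x [c /= /mapP[f]]; rewrite mem_filter => /andP[/asboolP H _] ->; exact: H.
have VA : \bigcup_N V N = A.
  apply/seteqP; split => [x [N _ Vx]|x Ax]; first exact: (UA N _ (Vx N (leqnn N))).
  have [d d0 Hd] := open_box_nbhs oA Ax.
  exists (Num.truncn d^-1) => // N /= dN.
  pose q i := Num.truncn ((x ord0 i + M) * N.+1%:R).
  have xM i : 0 <= (x ord0 i + M) * N.+1%:R.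
    by have /andP[? _] := AM x i Ax; rewrite mulr_ge0//; lra.
  have qK i : (q i < K N)%N.
    rewrite ltnS; apply: le_truncn; rewrite ler_pM2r//.
    by have /andP[_ ?] := AM x i Ax; lra.
  have hd : N.+1%:R^-1 <= d.
    rewrite -[leRHS]invrK lef_pV2 ?posrE ?invr_gt0//; apply/ltW.
    by rewrite (lt_le_trans (truncnS_gt _))// ler_nat ltnS.
  have Nn0 : (N.+1%:R : R) != 0 by rewrite pnatr_eq0.
  have inq i : N.+1%:R^-1 * (q i)%:R - M <= x ord0 i <= N.+1%:R^-1 * (q i).+1%:R - M.
    have /andP[q1 /ltW q2] := truncn_itv (xM i).
    apply/andP; split.
      by rewrite lerBlDr mulrC ler_pdivrMr.
    by rewrite lerBrDr mulrC ler_pdivlMr.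
  exists (cell N [ffun i => Ordinal (qK i)]); last first.
    by move=> i; rewrite !mxE !ffunE /=; exact: inq.
  apply/mapP; exists [ffun i => Ordinal (qK i)] => //.
  rewrite mem_filter mem_enum andbT; apply/asboolP => y Hy; apply: Hd => i.
  have hq : N.+1%:R^-1 * (q i).+1%:R - M = (N.+1%:R^-1 * (q i)%:R - M) + N.+1%:R^-1 :> R.
    by rewrite -(natr1 (q i)) mulrDr mulr1 addrAC.
  have := Hy i; have := inq i; rewrite !mxE !ffunE /= hq ler_norml.
  by move: (N.+1%:R^-1 * (q i)%:R - M : R) (N.+1%:R^-1 : R) hd => w h; lra.
have ndV : nondecreasing_seq V.
  move=> N N' NN'; apply/subsetPset => x Vx m /= N'm; apply: Vx => /=.
  exact: leq_trans N'm.
have := @nondecreasing_cvg_mu _ _ _ (@vol R n) V mV.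
rewrite VA => /(_ (measurable_openRn oA) ndV) cvgV.
have Afin : mu A \is a fin_num.
  by rewrite ge0_fin_numE ?outer_measure_ge0//; exact: vol_bounded.
have [N HN] : exists N, (mu A <= mu (V N) + e%:E)%E.
  apply: contrapT => /forallNP H.
  have : (vol A <= mu A - e%:E)%E.
    apply: (cvge_le _ cvgV); apply: nearW => N.
    change (mu (V N) <= mu A - e%:E)%E; rewrite leeBrDr//.
    by apply/ltW; rewrite ltNge; apply/negP; exact: H.
  suff : ~ (mu A <= mu A - e%:E)%E by [].
  by rewrite -(fineK Afin) -EFinB lee_fin; lra.
exists (s N); split.
- by apply/allP => c /mapP[f _ ->]; exact: nondeg_grid_box.
- rewrite pairwise_map; apply: pairwise_filter.
  apply: (@sub_pairwise _ (fun f g => f != g)); last by rewrite -uniq_pairwise enum_uniq.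
  move=> f g fg /=; apply: separated_grid; first by rewrite invr_gt0.
  apply: contra fg => /eqP/ffunP H; apply/eqP/ffunP => i; apply/val_inj.
  by have := H i; rewrite !ffunE.
- move=> c /mapP[f]; rewrite mem_filter => /andP[/asboolP H _] -> x Hx; apply: H => i.
  by have /andP[/ltW-> /ltW->] := Hx i.
- apply: (le_trans HN); rewrite leeD2r//.
  apply: (@le_trans _ _ (mu (U N))); first by apply: le_outer_measure => x /(_ N (leqnn N)).
  rewrite /U bigcup_seq /volumes -sumEFin.
  elim: (s N) => [|c l IH]; first by rewrite !big_nil outer_measure0.
  rewrite !big_cons; apply: le_trans (outer_measureU2 _ _ _) _.
  by apply: leeD => //; exact: lebesgue_outer_le_box.
Qed.

Theorem brunn_minkowski (A B S : set 'rV[R]_n) (t : R) : 0 < t < 1 ->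
  open A -> bounded_set A -> open B -> bounded_set B ->
  (forall x y, A x -> B y -> S ((1 - t) *: x + t *: y)) ->
  ((fine (mu A) `^ (1 - t) * fine (mu B) `^ t)%:E <= mu S)%E.
Proof.
move=> t01 oA bA oB bB H; have /andP[t0 t1] := t01.
have finmu (C : set 'rV[R]_n) : bounded_set C -> mu C \is a fin_num.
  by move=> bC; rewrite ge0_fin_numE ?outer_measure_ge0//; exact: vol_bounded.
have mu0 (C : set 'rV[R]_n) : 0 <= fine (mu C) by rewrite fine_ge0// outer_measure_ge0.
have [A0|] := ltP 0 (fine (mu A)); last first.
  move=> A0; have -> : fine (mu A) = 0 by apply/eqP; rewrite eq_le A0 mu0.
  by rewrite powR0 ?mul0r ?outer_measure_ge0// subr_eq0 gt_eqF.
have [B0|] := ltP 0 (fine (mu B)); last first.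
  move=> B0; have -> : fine (mu B) = 0 by apply/eqP; rewrite eq_le B0 mu0.
  by rewrite powR0 ?mulr0 ?outer_measure_ge0// gt_eqF.
(* Inner boxes reach any fraction [e < 1] of both volumes, and by homogeneity only the factor [e] is
   lost in the bound. *)
have key e : 0 < e < 1 ->
    ((e * (fine (mu A) `^ (1 - t) * fine (mu B) `^ t))%:E <= mu S)%E.
  move=> /andP[e0 e1].
  have approx (C : set 'rV[R]_n) : open C -> bounded_set C -> 0 < fine (mu C) ->
      exists s : seq boxes, [/\ all nondeg s, pairwise separated_boxes s,
        forall c, c \in s -> obox c `<=` C, (0 < size s)%N & e * fine (mu C) <= volumes s].
    move=> oC bC C0.
    have [|s [ns ss sC]] := @open_inner_boxes C ((1 - e) * fine (mu C)) oC bC.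
      by rewrite mulr_gt0// subr_gt0.
    rewrite -[mu C]fineK ?finmu// -EFinD lee_fin => Hs.
    have Hs' : e * fine (mu C) <= volumes s by lra.
    exists s; split => //; rewrite lt0n size_eq0; apply/eqP => s0; move: Hs'.
    by rewrite s0 /volumes big_nil leNgt mulr_gt0.
  have [As [nAs sAs AsA As0 Ale]] := approx _ oA bA A0.
  have [Bs [nBs sBs BsB Bs0 Ble]] := approx _ oB bB B0.
  have e0' := ltW e0.
  apply: (@le_trans _ _ (volumes As `^ (1 - t) * volumes Bs `^ t)%:E); last first.
    apply: (brunn_minkowski_boxes t01 (leqnn _)) => // a b x y aA bB' ax bY.
    by apply: H; [exact: AsA aA _ ax|exact: BsB bB' _ bY].
  rewrite lee_fin -powR_interp//.
  have t1' : 0 < 1 - t by rewrite subr_gt0.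
  apply: ler_pM; rewrite ?powR_ge0//.
    by apply: ge0_ler_powR; rewrite ?nnegrE ?mulr_ge0 ?volumes_ge0// ltW.
  by apply: ge0_ler_powR; rewrite ?nnegrE ?mulr_ge0 ?volumes_ge0// ltW.
set v := _ * _ in key *.
have v0 : 0 <= v by rewrite mulr_ge0 ?powR_ge0.
have mS0 : (0 <= lebesgue_outer S)%E by exact: outer_measure_ge0.
case: (lebesgue_outer S) key mS0 => [r| |]//= key _; last by rewrite leey.
rewrite lee_fin leNgt; apply/negP => rv.
have v0' : 0 < v.
  rewrite lt0r v0 andbT; apply/eqP => v0'; move: rv (key (1 / 2)); rewrite v0' mulr0 lee_fin.
  by move=> r0 /(_ _); rewrite leNgt r0 => K0; have // := K0 _; lra.
have r0 : 0 <= r.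
  have : (((1 / 2) * v)%:E <= r%:E)%E by apply: key; lra.
  by rewrite lee_fin; apply: le_trans; rewrite mulr_ge0//; lra.
have := key ((r / v + 1) / 2).
have : r / v < 1 by rewrite ltr_pdivrMr// mul1r.
have : 0 <= r / v by rewrite divr_ge0.
move=> rv0 rv1 /(_ _); rewrite lee_fin => K0; have {}K0 := K0 _.
have : (r / v + 1) / 2 * v <= r by apply: K0; lra.
have -> : (r / v + 1) / 2 * v = (r + v) / 2 by field; rewrite gt_eqF.
lra.
Qed.

End brunn_minkowski.

(** * Sigma-finiteness, change of variables and null hyperplanes *)

Section lebesgue_integration.
Context {R : realType} {n : nat}.
Local Notation mu := (@vol R n).
Local Notation Rn := (lebesgueRn R n).

Lemma vol_sigma_finite : sigma_finite setT mu.
Proof.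
exists (fun k => box (const_mx (- k%:R), const_mx k%:R)).
  apply/esym/seteqP; split => // x _; exists (Num.truncn `|x|).+1 => // i.
  rewrite !mxE -ler_norml (le_trans (ler_coord_norm x i))//.
  by apply/ltW; exact: truncnS_gt.
move=> k; split; first exact: measurable_box.
by rewrite /vol lebesgue_outer_box ltry.
Qed.

HB.instance Definition _ := @Measure_isSigmaFinite.Build _ Rn R mu vol_sigma_finite.

Lemma ge0_integral_homothety (s : R) c (A : set Rn) (f : Rn -> \bar R) : 0 < s ->
  measurable A -> measurable_fun A f -> (forall x, A x -> 0 <= f x)%E ->
  (\int[mu]_(x in homothety s c @^-1` A) f (homothety s c x) =
   (s ^- n)%:E * \int[mu]_(x in A) f x)%E.
Proof.
move=> s0 mA mf f0.
have ms := measurable_homothety c s0.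
have := ge0_integral_pushforward ms mu mA mf.
have f0' : {in A, forall y, (0 <= f y)%E} by move=> y /set_mem; exact: f0.
move=> /(_ f0') <-.
have sn0 : 0 <= s ^- n by rewrite invr_ge0 exprn_ge0// ltW.
rewrite (eq_measure_integral (mscale (NngNum sn0) mu)); last first.
  by move=> B mB BA; exact: (lebesgue_outer_preimage c B s0).
by rewrite ge0_integral_mscale//.
Qed.

(** Translates of a bounded piece of the hyperplane along its normal are pairwise disjoint, have
    equal measure and stay in a common box. Infinitely many of them fit only if the measure is 0. *)
Lemma hyperplane_null (a : 'rV[R]_n) (r : R) : a != 0 ->
  mu [set x : 'rV[R]_n | \sum_i a ord0 i * x ord0 i = r] = 0%E.
Proof.
move=> a0.
pose L (x : 'rV[R]_n) := \sum_i a ord0 i * x ord0 i.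
have LE (x : 'rV[R]_n) t : L (homothety 1 (t *: a) x) = L x + t * L a.
  rewrite /L mulr_sumr -big_split; apply: eq_bigr => i _ /=.
  by rewrite !mxE mul1r mulrDr mulrCA.
have La : 0 < L a.
  rewrite lt_neqAle eq_sym; apply/andP; split; last by apply: sumr_ge0 => i _; rewrite -expr2 sqr_ge0.
  apply: contra a0 => /eqP La0; apply/eqP/rowP => i; rewrite mxE; apply/eqP.
  rewrite -sqrf_eq0 expr2; apply/eqP.
  have H : forall i, true -> a ord0 i * a ord0 i = 0.
    by apply: psumr_eq0P La0 => j _; rewrite -expr2 sqr_ge0.
  exact: H.
have mL : measurable_fun setT (L : Rn -> R).
  rewrite /L; apply: measurable_sum => i.
  by apply: measurable_funM; [exact: measurable_cst|exact: measurable_coord].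
pose H M : set Rn := [set x | L x = r] `&` box (const_mx (- M%:R), const_mx M%:R).
have mH M : measurable (H M).
  apply: measurableI; last exact: measurable_box.
  by rewrite -[X in measurable X]setTI; apply: (mL measurableT [set r]).
have HT : [set x | L x = r] = \bigcup_M H M.
  apply/seteqP; split => [x Lx|x [M _ []]]//; exists (Num.truncn `|x|).+1 => //; split => // i.
  rewrite !mxE -ler_norml (le_trans (ler_coord_norm x i))//.
  by apply/ltW; exact: truncnS_gt.
suff H0 M : mu (H M) = 0%E.
  rewrite HT; apply/eqP; rewrite eq_le measure_ge0 andbT.
  apply: le_trans (outer_measure_sigma_subadditive (@lebesgue_outer R n) H) _.
  by rewrite eseries0// => k _ _; exact: H0.
(* Distinct displacements in the interval from 0 to 1, so that all translates stay within the
   maximum norm of [a] of the original piece. *)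
pose t (j : nat) : R := j.+1%:R^-1.
pose G j : set Rn := homothety 1 (t j *: a) @` H M.
have GE j : G j = homothety 1 (- (t j *: a)) @^-1` H M.
  rewrite homothety_preimage ?oner_eq0// invr1 /G; congr (homothety _ _ @` _).
  by rewrite scalerN scaleN1r opprK.
have mG j : measurable (G j).
  by rewrite GE -[X in measurable X]setTI; apply: measurable_homothety.
have muG j : mu (G j) = mu (H M).
  by rewrite GE /vol lebesgue_outer_preimage// expr1n invr1 mul1e.
have tG : trivIset setT G.
  apply/trivIsetP => i j _ _ ij; apply/seteqP; split => // x [[y [Ly _] yx] [z [Lz _] zx]].
  have := LE y (t i); have := LE z (t j); rewrite yx zx Ly Lz => -> /addrI /(mulIf (lt0r_neq0 La)).
  by move=> /invr_inj/eqP; rewrite eqr_nat eqSS eq_sym (negbTE ij).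
pose C := M%:R + `|a|.
have GC : \bigcup_j G j `<=` box (const_mx (- C), const_mx C).
  move=> _ [j _ [y [_ Hy] <-]] i; have := Hy i; rewrite !mxE mul1r.
  have : `|t j * a ord0 i| <= `|a|.
    rewrite normrM (le_trans _ (ler_coord_norm a i))// ler_piMl// ger0_norm ?invr_ge0//.
    by rewrite invf_le1// ler1n.
  rewrite ler_norml /C; lra.
have Cfin : (mu (\bigcup_j G j) <= (box_volume (const_mx (- C) : 'rV[R]_n, const_mx C : 'rV[R]_n))%:E)%E.
  by rewrite -lebesgue_outer_box; exact: le_outer_measure.
move: Cfin; rewrite measure_bigcup// => Cfin.
have le_N N : (N%:R%:E * mu (H M) <= (box_volume (const_mx (- C) : 'rV[R]_n, const_mx C : 'rV[R]_n))%:E)%E.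
  apply: le_trans Cfin.
  apply: le_trans (nneseries_lim_ge N _) => //.
  rewrite (eq_bigl xpredT); last by move=> i; rewrite in_setT.
  rewrite (eq_bigr (fun=> mu (H M))); last by move=> i _; exact: muG.
  elim: N => [|N IH]; first by rewrite mul0e big_geq.
  rewrite big_nat_recr//= -natr1 EFinD ge0_muleDl ?lee_fin// mul1e.
  exact: leeD.
have : mu (H M) \is a fin_num.
  rewrite ge0_fin_numE//; apply: (@le_lt_trans _ _ (mu (box (const_mx (- M%:R), const_mx M%:R)))).
    by apply: (le_outer_measure (@lebesgue_outer R n)) => x [].
  by rewrite /vol lebesgue_outer_box ltry.
move=> /fineK E; have : 0 <= fine (mu (H M)) by rewrite fine_ge0.
move: le_N; rewrite -E; set h := fine _.
set v := box_volume _ => le_N; rewrite [fine _]/= le_eqVlt => /predU1P[<-//|h0].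
have := le_N (Num.truncn (v / h)).+1; rewrite -EFinM lee_fin -ler_pdivlMr// leNgt.
by rewrite truncnS_gt.
Qed.

End lebesgue_integration.

(** * Square integrable functions *)

Section sqint.
Context {d : measure_display} {T : measurableType d} {R : realType}.
Variables (mu : {measure set T -> \bar R}) (D : set T).
Hypothesis mD : measurable D.
Implicit Types u v w : T -> R^o.

(** [square_integrable] over an arbitrary measure; for [vol] the two are convertible. *)
Definition sqint (u : T -> R) := measurable_fun D u /\
  (\int[mu]_(x in D) ((u x) ^+ 2)%:E < +oo)%E.

Definition ip (u v : T -> R) : R := \int[mu]_(x in D) (u x * v x).

Lemma sqint_integrable (u : T -> R) : sqint u -> mu.-integrable D (fun x => (u x ^+ 2)%:E).
Proof.
move=> [mu_ fu]; apply/integrableP; split.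
  by apply/measurable_EFinP; exact: measurable_funX.
by under eq_integral do rewrite gee0_abs ?lee_fin ?sqr_ge0//.
Qed.

Lemma sqint_le (u v : T -> R) (C : R) : measurable_fun D u -> sqint v -> 0 <= C ->
  (forall x, D x -> u x ^+ 2 <= C * v x ^+ 2) -> sqint u.
Proof.
move=> mu_ sv C0 H; split => //.
have : (C%:E * \int[mu]_(x in D) ((v x) ^+ 2)%:E < +oo)%E.
  by apply: lte_mul_pinfty; rewrite ?lee_fin//; exact: sv.2.
apply: le_lt_trans; rewrite -ge0_integralZl//; last 2 first.
- by apply/measurable_EFinP; apply: measurable_funX; exact: sv.1.
- by move=> x _; rewrite lee_fin sqr_ge0.
apply: ge0_le_integral => //.
- by move=> x _; rewrite lee_fin sqr_ge0.
- by apply/measurable_EFinP; exact: measurable_funX.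
- apply/measurable_EFinP; apply: measurable_funM => //.
  by apply: measurable_funX; exact: sv.1.
Qed.

Lemma integrable_sqintM (u v : T -> R) : sqint u -> sqint v ->
  mu.-integrable D (fun x => (u x * v x)%:E).
Proof.
move=> su sv; apply: (@le_integrable _ _ _ mu D mD _ (fun x => (u x ^+ 2)%:E + (v x ^+ 2)%:E)%E).
- by apply/measurable_EFinP; apply: measurable_funM; [exact: su.1|exact: sv.1].
- move=> x Dx; rewrite -EFinD !abse_EFin lee_fin normrM.
  rewrite [leRHS]ger0_norm ?addr_ge0 ?sqr_ge0// -[u x ^+ 2]real_normK ?num_real// -[v x ^+ 2]real_normK ?num_real//.
  have := normr_ge0 (u x); have := normr_ge0 (v x); nra.
- by apply: integrableD => //; exact: sqint_integrable.
Qed.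

Lemma ipC u v : ip u v = ip v u.
Proof. by apply: eq_Rintegral => x _; rewrite mulrC. Qed.

Lemma ip_lin (a : R) u v w : sqint u -> sqint v -> sqint w ->
  ip (a *: u + v) w = a * ip u w + ip v w.
Proof.
move=> su sv sw; rewrite /ip.
have iu := integrable_sqintM su sw; have iv := integrable_sqintM sv sw.
rewrite -RintegralZl// -RintegralD//; last first.
  by have := integrableZl mD a iu; apply: eq_integrable => // x _; rewrite EFinM.
by apply: eq_Rintegral => x _; rewrite -[(a *: u + v) x]/(a * u x + v x) mulrDl mulrA.
Qed.

Lemma ip_ge0 (u : T -> R) : 0 <= ip u u.
Proof. by apply: Rintegral_ge0 => x _; rewrite -expr2 sqr_ge0. Qed.

Lemma ipE (u : T -> R) : sqint u -> (ip u u)%:E = (\int[mu]_(x in D) ((u x) ^+ 2)%:E)%E.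
Proof.
move=> su; rewrite /ip /Rintegral fineK.
  by apply: eq_integral => x _; rewrite expr2.
by apply: integrable_fin_num => //; exact: integrable_sqintM.
Qed.

Lemma sqint_lin (a : R) u v : sqint u -> sqint v -> sqint (a *: u + v).
Proof.
move=> su sv; split.
  apply: measurable_funD; last exact: sv.1.
  by apply: measurable_funM => //; exact: su.1.
apply: (@le_lt_trans _ _ (\int[mu]_(x in D) ((2 * a ^+ 2)%:E * (u x ^+ 2)%:E + 2%:E * (v x ^+ 2)%:E))%E).
  apply: ge0_le_integral => //.
  - by move=> x _; rewrite lee_fin sqr_ge0.
  - apply/measurable_EFinP; apply: measurable_funX; apply: measurable_funD; last exact: sv.1.
    by apply: measurable_funM => //; exact: su.1.
  - apply: emeasurable_funD; apply/measurable_EFinP; apply: measurable_funM => //; apply: measurable_funX.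
      exact: su.1.
    exact: sv.1.
  - move=> x _; rewrite -!EFinM -EFinD lee_fin.
    rewrite -[(a *: u + v) x]/(a * u x + v x); have := sqr_ge0 (a * u x - v x); lra.
rewrite integralD//; do ?by apply: integrableZl => //; exact: sqint_integrable.
rewrite !integralZl//; try exact: sqint_integrable.
have a2 : 0 <= 2 * a ^+ 2 by have := sqr_ge0 a; lra.
apply: lte_add_pinfty; apply: lte_mul_pinfty; rewrite ?lee_fin//.
  exact: su.2.
exact: sv.2.
Qed.

Lemma sqint0 : sqint (0 : T -> R^o).
Proof.
split; first exact: measurable_cst.
by under eq_integral do rewrite /= expr0n/=; rewrite integral0.
Qed.

Lemma sqintZ (a : R) u : sqint u -> sqint (a *: u).
Proof. by move=> su; rewrite -[_ *: _]addr0; apply: sqint_lin => //; exact: sqint0. Qed.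

Lemma sqintD u v : sqint u -> sqint v -> sqint (u + v).
Proof. by move=> su sv; rewrite -[u]scale1r; exact: sqint_lin. Qed.

Lemma sqintB u v : sqint u -> sqint v -> sqint (u - v).
Proof. by move=> su sv; rewrite addrC -scaleN1r; exact: sqint_lin. Qed.

Lemma sqint_ae0 (u : T -> R) : sqint u -> ip u u = 0 -> {ae mu, forall x, D x -> u x = 0}.
Proof.
move=> su u0; have := ipE su; rewrite u0 => /esym I0.
have [//|H _] := ae_eq_integral_abs mu mD (f := fun x => (u x ^+ 2)%:E) _.
  by apply/measurable_EFinP; apply: measurable_funX; exact: su.1.
have /H : (\int[mu]_(x in D) `|(u x ^+ 2)%:E| = 0)%E.
  by under eq_integral do rewrite gee0_abs ?lee_fin ?sqr_ge0//.
apply: filterS => x + Dx => /(_ Dx) [] /eqP.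
by rewrite sqrf_eq0 => /eqP.
Qed.

Lemma ip_ae (u u' v v' : T -> R) : sqint u -> sqint v -> sqint u' -> sqint v' ->
  {ae mu, forall x, D x -> u x = u' x} -> {ae mu, forall x, D x -> v x = v' x} ->
  ip u v = ip u' v'.
Proof.
move=> su sv su' sv' uu' vv'; rewrite /ip /Rintegral; congr fine; apply: ae_eq_integral => //.
- by apply/measurable_EFinP; apply: measurable_funM; [exact: su.1|exact: sv.1].
- by apply/measurable_EFinP; apply: measurable_funM; [exact: su'.1|exact: sv'.1].
- move: uu' vv'; apply: filterS2 => x H1 H2 Dx.
  by rewrite H1// H2.
Qed.

Lemma geometric_sum_lt (N : nat) : \sum_(k < N) (2^-1 : R) ^+ k <= 2.
Proof.
have : (\sum_(k < N) (2^-1 : R) ^+ k) = 2 - 2 * 2^-1 ^+ N.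
  elim: N => [|N IH]; first by rewrite big_ord0 expr0 mulr1 subrr.
  by rewrite big_ord_recr/= IH exprS; field.
by move=> ->; rewrite lerBlDr lerDl mulr_ge0// exprn_ge0.
Qed.

(** Riesz-Fischer: a fast subsequence converges almost everywhere, and Fatou's lemma turns the
    pointwise limit [w] into a limit in L^2 of the whole sequence. *)
Lemma sqint_complete (u : nat -> T -> R^o) : (forall k, sqint (u k)) ->
  (forall e, 0 < e -> exists N, forall i j, (N <= i)%N -> (N <= j)%N ->
     ip (u i - u j) (u i - u j) <= e) ->
  exists2 w, sqint w & forall e, 0 < e -> exists N, forall i, (N <= i)%N ->
     ip (u i - w) (u i - w) <= e.
Proof.
move=> su cu.
have /choice[phi0 Hphi0] (k : nat) : exists N, forall i j, (N <= i)%N -> (N <= j)%N ->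
    ip (u i - u j) (u i - u j) <= 8^-1 ^+ k by apply: cu; rewrite exprn_gt0.
pose phi k := (\sum_(l < k.+1) phi0 l + k)%N.
have phi_ge k : (phi0 k <= phi k)%N.
  by rewrite /phi big_ord_recr/= -addnA addnCA leq_addr.
have phiS k : (phi k <= phi k.+1)%N.
  by rewrite /phi [X in (_ <= X + _)%N]big_ord_recr/= leq_add// leq_addr.
have phi_id k : (k <= phi k)%N by rewrite /phi leq_addl.
have dk k : ip (u (phi k.+1) - u (phi k)) (u (phi k.+1) - u (phi k)) <= 8^-1 ^+ k.
  by apply: Hphi0; rewrite ?phi_ge// (leq_trans (phi_ge k)).
(* The squared increments integrate to at most 8^-k. Weighted by 4^k they still have a convergent
   sum of integrals, and where the sum S of the series is finite the k-th increment is at most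
   sqrt(S) 2^-k. *)
pose F k x : \bar R := (4 ^+ k * (u (phi k.+1) x - u (phi k) x) ^+ 2)%:E.
have F0 k x : (0 <= F k x)%E by rewrite lee_fin; apply: mulr_ge0; [exact: exprn_ge0|exact: sqr_ge0].
have sd k := sqintB (su (phi k.+1)) (su (phi k)).
have mF k : measurable_fun D (F k).
  apply/measurable_EFinP; apply: measurable_funM => //; apply: measurable_funX.
  exact: (sd k).1.
have iF k : (\int[mu]_(x in D) F k x <= (2^-1 ^+ k)%:E)%E.
  under eq_integral do rewrite /F EFinM.
  rewrite ge0_integralZl//; last 2 first.
  - by apply/measurable_EFinP; apply: measurable_funX; exact: (sd k).1.
  - by move=> x _; rewrite lee_fin sqr_ge0.
  rewrite -(ipE (sd k)) -EFinM lee_fin (le_trans (ler_wpM2l _ (dk k))) ?exprn_ge0//.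
  by rewrite -exprMn (_ : 4 * 8^-1 = 2^-1 :> R)//; field.
pose S x := (\sum_(k <oo) F k x)%E.
have mS : measurable_fun D S.
  by apply: ge0_emeasurable_sum => // k _.
have S0 x : (0 <= S x)%E by apply: nneseries_ge0.
have iS : (\int[mu]_(x in D) S x < +oo)%E.
  rewrite integral_nneseries//.
  apply: (@le_lt_trans _ _ 2%:E); last exact: ltry.
  apply: lime_le; first by apply: is_cvg_nneseries => k _ _; exact: integral_ge0.
  apply: nearW => N; rewrite big_mkord.
  apply: (@le_trans _ _ (\sum_(k < N) (2^-1 ^+ k)%:E)%E); first exact: lee_sum.
  by rewrite sumEFin lee_fin geometric_sum_lt.
pose G := D `&` [set x | S x < +oo]%E.
have mG : measurable G by exact: emeasurable_fun_infty_o.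
have aeG : {ae mu, forall x, D x -> G x}.
  have : {ae mu, forall x, D x -> S x \is a fin_num}.
    by apply: integrable_ae => //; apply/integrableP; split => //; under eq_integral do rewrite gee0_abs//.
  apply: filterS => x + Dx => /(_ Dx); rewrite ge0_fin_numE// => Sx; split => //.
(* The functions are set to 0 off [G], so that they converge at every point of [D] and the limit is
   measurable. *)
pose v k x : R := u (phi k) x * \1_G x.
have mv k : measurable_fun D (v k).
  by apply: measurable_funM; [exact: (su (phi k)).1|exact: measurable_indic].
have aev k : {ae mu, forall x, D x -> v k x = u (phi k) x}.
  by apply: filterS aeG => x H Dx; rewrite /v indicE mem_set ?mulr1//; exact: H.
have cv x : D x -> cvgn (v^~ x).
  move=> Dx; rewrite /v indicE; case: (boolP (x \in G)) => [/set_mem[_ /= Sx]|_]; last first.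
    by under eq_fun do rewrite mulr0; exact: is_cvg_cst.
  under eq_fun do rewrite mulr1.
  have Sfin : S x \is a fin_num by rewrite ge0_fin_numE.
  pose s := Num.sqrt (fine (S x)).
  have Hk k : `|u (phi k.+1) x - u (phi k) x| <= s * 2^-1 ^+ k.
    have H : (F k x <= S x)%E.
      apply: le_trans (nneseries_lim_ge k.+1 _) => //.
      by rewrite big_nat_recr//= leeDr// sume_ge0.
    have {}H : 4 ^+ k * (u (phi k.+1) x - u (phi k) x) ^+ 2 <= fine (S x).
      by rewrite -lee_fin fineK.
    have hk : (2^-1 ^+ k) ^+ 2 * 4 ^+ k = 1 :> R.
      by rewrite -exprM mulnC exprM -exprMn (_ : 2^-1 ^+ 2 * 4 = 1) ?expr1n//; field.
    rewrite -ler_sqr ?nnegrE ?mulr_ge0 ?sqrtr_ge0 ?exprn_ge0//.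
    rewrite real_normK ?num_real// exprMn sqr_sqrtr ?fine_ge0//.
    have aux (a b h p : R) : h * p = 1 -> 0 <= h -> p * a <= b -> a <= b * h.
      by move=> E h0 ?; rewrite -[a]mul1r -E -mulrA [b * _]mulrC; exact: ler_wpM2l.
    by apply: aux hk _ H; rewrite !exprn_ge0.
  have -> : (fun k => u (phi k) x) = (fun k => u (phi 0%N) x + series (fun k => u (phi k.+1) x - u (phi k) x) k).
    apply/funext => k; rewrite /series/= telescope_sumr//= addrC subrK//.
  apply: is_cvgD; first exact: is_cvg_cst.
  apply: normed_cvg; apply: (@series_le_cvg _ _ (fun k => s * 2^-1 ^+ k)) => //=.
  - by move=> k; rewrite mulr_ge0 ?sqrtr_ge0// exprn_ge0.
  - by apply: is_cvg_geometric_series; rewrite ger0_norm// invf_lt1// ltr1n.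
pose w x : R := limn (v^~ x).
have vw x : D x -> v k x @[k --> \oo] --> w x by move=> Dx; exact: cv.
have mw : measurable_fun D w by apply: (measurable_fun_cvg mv) => x Dx; exact: vw.
have key i e : 0 < e -> (exists N, forall k, (N <= k)%N -> ip (u i - u (phi k)) (u i - u (phi k)) <= e) ->
    (\int[mu]_(x in D) ((u i x - w x) ^+ 2)%:E <= e%:E)%E.
  move=> e0 [N HN].
  pose f k x := ((u i x - v k x) ^+ 2)%:E.
  have mf k : measurable_fun D (f k).
    by apply/measurable_EFinP; apply: measurable_funX; apply: measurable_funB => //; exact: (su i).1.
  have f0 k x : D x -> (0 <= f k x)%E by rewrite lee_fin sqr_ge0.
  rewrite [leLHS](_ : _ = (\int[mu]_(x in D) limn_einf (f^~ x))%E); last first.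
    apply: eq_integral => x /[!inE] Dx; apply/esym.
    have : f k x @[k --> \oo] --> ((u i x - w x) ^+ 2)%:E.
      apply/cvg_EFin; first exact: nearW.
      rewrite expr2 (_ : fine \o _ = (fun k => (u i x - v k x : R) * (u i x - v k x : R))); last first.
        by apply/funext => k /=; rewrite expr2.
      by apply: cvgM; apply: cvgB (vw x Dx); exact: cvg_cst.
    by move=> /cvg_limn_einf_sup[].
  apply: (le_trans (fatou mu mD mf f0)).
  rewrite limn_einf_lim.
  apply: lime_le; first exact: is_cvg_einfs.
  apply: nearW => k; apply: (@le_trans _ _ (\int[mu]_(x in D) f (maxn N k) x)%E).
    by apply: ereal_inf_lbound; exists (maxn N k) => //=; exact: leq_maxr.
  rewrite [leLHS](_ : _ = \int[mu]_(x in D) (((u i - u (phi (maxn N k))) x) ^+ 2)%:E)%E.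
    by rewrite -ipE ?lee_fin; [apply: HN; exact: leq_maxl|exact: sqintB].
  apply: ae_eq_integral => //.
  - by apply/measurable_EFinP; apply: measurable_funX; exact: (sqintB _ _).1.
  - by apply: filterS (aev (maxn N k)) => x H Dx; rewrite /f H.
have sw i : sqint (u i - w) -> sqint w.
  by move=> H; have := sqintB (su i) H; rewrite subKr.
have suw e : 0 < e -> exists N, forall i, (N <= i)%N ->
    (\int[mu]_(x in D) ((u i x - w x) ^+ 2)%:E <= e%:E)%E.
  move=> e0; have [N HN] := cu e e0; exists N => i Ni; apply: key => //.
  by exists N => k Nk; apply: HN => //; exact: leq_trans (phi_id k).
have sqw : sqint w.
  have [N HN] := suw 1 ltr01; apply: (sw N); split.
    by apply: measurable_funB => //; exact: (su N).1.
  by apply: (le_lt_trans (HN N (leqnn N))); exact: ltry.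
exists w => // e e0; have [N HN] := suw e e0; exists N => i Ni.
by rewrite -lee_fin ipE; [exact: HN|exact: sqintB].
Qed.

End sqint.

(** * Minimization of quadratic forms *)

Lemma ler_frac_succ {R : realFieldType} (x e : R) : 0 <= x -> 0 <= e -> e / (x + 1) * x <= e.
Proof.
move=> x0 e0; rewrite -mulrA ler_piMr// mulrC ler_pdivrMr ?ltr_wpDl//.
by rewrite mul1r lerDl.
Qed.

Section quadratic_form.
Context {R : realType} {V : lmodType R} (P : V -> Prop) (q : V -> V -> R).
Hypothesis P0 : P 0.
Hypothesis P_lin : forall c u v, P u -> P v -> P (c *: u + v).
Hypothesis qC : forall u v, P u -> P v -> q u v = q v u.
Hypothesis q_lin : forall c u v w, P u -> P v -> P w -> q (c *: u + v) w = c * q u w + q v w.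
Hypothesis q_ge0 : forall u, P u -> 0 <= q u u.

Lemma subspaceB u v : P u -> P v -> P (u - v).
Proof. by move=> Pu Pv; rewrite addrC -scaleN1r; exact: P_lin. Qed.

Lemma subspace_sum I (r : seq I) (c : I -> R) (f : I -> V) : (forall i, P (f i)) ->
  P (\sum_(i <- r) c i *: f i).
Proof.
move=> Pf; elim: r => [|i r IH]; first by rewrite big_nil.
by rewrite big_cons; exact: P_lin.
Qed.

Lemma form0 w : P w -> q 0 w = 0.
Proof.
move=> Pw; have := q_lin 1 P0 P0 Pw; rewrite scaler0 add0r mul1r => E.
by have := addrK (q 0 w) (q 0 w); rewrite -E subrr.
Qed.

Lemma form_sum I (r : seq I) (c : I -> R) (f : I -> V) w : (forall i, P (f i)) -> P w ->
  q (\sum_(i <- r) c i *: f i) w = \sum_(i <- r) c i * q (f i) w.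
Proof.
move=> Pf Pw; elim: r => [|i r IH]; first by rewrite !big_nil form0.
by rewrite !big_cons q_lin ?IH//; exact: subspace_sum.
Qed.

Lemma form_linr c u v w : P u -> P v -> P w -> q w (c *: u + v) = c * q w u + q w v.
Proof.
by move=> Pu Pv Pw; rewrite qC ?q_lin ?(qC Pu Pw) ?(qC Pv Pw)//; exact: P_lin.
Qed.

Lemma form_sqrD c u v : P u -> P v ->
  q (c *: v + u) (c *: v + u) = c ^+ 2 * q v v + 2 * c * q u v + q u u.
Proof.
move=> Pu Pv; have Pw : P (c *: v + u) by exact: P_lin.
rewrite q_lin// !form_linr// (qC Pv Pu); ring.
Qed.

Lemma formZ c v : P v -> q (c *: v) (c *: v) = c ^+ 2 * q v v.
Proof.
by move=> Pv; rewrite -[c *: v]addr0 form_sqrD// (form0 Pv) (form0 P0) mulr0 !addr0.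
Qed.

Lemma form_parallelogram u v : P u -> P v ->
  q (u - v) (u - v) + q (u + v) (u + v) = 2 * q u u + 2 * q v v.
Proof.
move=> Pu Pv; rewrite [u - v]addrC [u + v]addrC -scaleN1r -[in v + u](scale1r v).
rewrite !form_sqrD//; ring.
Qed.

(** Nonnegativity at u + v / t and at u - v / t. This replaces Cauchy-Schwarz: the free parameter
    [t] spares square roots and the case of a vanishing form. *)
Lemma form_AMGM t u v : 0 < t -> P u -> P v -> `|2 * q u v| <= t * q u u + t^-1 * q v v.
Proof.
move=> t0 Pu Pv; have Ps := q_ge0 (P_lin t^-1 Pv Pu); have Pd := q_ge0 (P_lin (- t^-1) Pv Pu).
rewrite !form_sqrD// in Ps Pd.
have E (x : R) : t * (t^-1 ^+ 2 * q v v + x * t^-1 * q u v + q u u) =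
    t^-1 * q v v + x * q u v + t * q u u by field; rewrite gt_eqF.
have := mulr_ge0 (ltW t0) Ps; rewrite E => H1.
have := mulr_ge0 (ltW t0) Pd; rewrite sqrrN mulrN -mulNr E => H2.
by rewrite ler_norml; apply/andP; split; lra.
Qed.

Lemma form_continuous u e : P u -> 0 < e -> exists2 d, 0 < d &
  forall z, P z -> q z z <= d -> `|q (u + z) (u + z) - q u u| <= e.
Proof.
move=> Pu e0; have q0 := q_ge0 Pu.
pose t := e / (2 * (q u u + 1)).
have t0 : 0 < t by rewrite divr_gt0 ?mulr_gt0// ltr_wpDl.
have s0 : 0 < 1 + t^-1 by rewrite addr_gt0 ?invr_gt0.
exists (e / (2 * (1 + t^-1))); first by rewrite divr_gt0 ?mulr_gt0.
move=> z Pz zd; have -> : u + z = 1 *: z + u by rewrite scale1r addrC.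
rewrite form_sqrD// expr1n mul1r mulr1 addrK.
have A := form_AMGM t0 Pu Pz.
have tq : t * q u u <= e / 2.
  have -> : t * q u u = (e / 2) / (q u u + 1) * q u u by rewrite /t invfM mulrA.
  by apply: ler_frac_succ => //; rewrite divr_ge0// ltW.
have qz : (1 + t^-1) * q z z <= e / 2.
  by move: zd; rewrite invfM mulrA ler_pdivlMr// mulrC.
rewrite (le_trans (ler_normD _ _))// (ger0_norm (q_ge0 Pz)).
lra.
Qed.

(** A nonnegative form that vanishes on the diagonal at [u] has [u] in its kernel. For the form a -
    mu b this is the Euler equation of a minimizer. *)
Lemma form_orth_of_min u v : P u -> P v -> q u u = 0 -> q u v = 0.
Proof.
move=> Pu Pv u0; apply/eqP; rewrite -normr_le0; apply/ler_addgt0Pr => e e0; rewrite add0r.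
have qv := q_ge0 Pv.
have t0 : 0 < (q v v + 1) / e by rewrite divr_gt0// ltr_wpDl.
have := form_AMGM t0 Pu Pv; rewrite u0 mulr0 add0r normrM ger0_norm// invf_div.
have : e / (q v v + 1) * q v v <= e.
  by apply: ler_frac_succ => //; exact: ltW.
have := normr_ge0 (q u v); lra.
Qed.

End quadratic_form.

(** The limit is the supremum of the reals that are eventually below the sequence. Along one
    ultrafilter all bounded functionals converge simultaneously, without extraction of
    subsequences. *)
Lemma ultra_bounded_cvg {R : realType} (U : set_system nat) (x : nat -> R) (M : R) :
  UltraFilter U -> (forall i, `|x i| <= M) ->
  exists L, forall e, 0 < e -> U [set i | `|x i - L| <= e].
Proof.
move=> UU xM; pose A := [set r : R | U [set i | r <= x i]].
have A0 : A (- M) by apply: filterS filterT => i _ /=; have := xM i; rewrite ler_norml => /andP[].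
have Aub r : A r -> r <= M.
  move=> /filter_ex[i /= ri]; apply: le_trans ri _; apply: le_trans (ler_norm _) (xM i).
have supA : has_sup A by split; [exists (- M)|exists M => r; exact: Aub].
exists (sup A) => e e0.
have [r Ar re] := sup_adherent e0 supA.
have nA : U (~` [set i | sup A + e <= x i]).
  have [H|//] := in_ultra_setVsetC [set i | sup A + e <= x i] UU.
  have : sup A + e <= sup A by apply: sup_upper_bound.
  by rewrite gerDl leNgt e0.
apply: filterS (filterI Ar nA) => i [/= ri /negP]; rewrite -ltNge => xe.
by rewrite ler_norml; apply/andP; split; lra.
Qed.

Section minimization.
Context {R : realType} {V : lmodType R} (P : V -> Prop) (a b : V -> V -> R).
Hypothesis P0 : P 0.
Hypothesis P_lin : forall c u v, P u -> P v -> P (c *: u + v).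
Hypothesis aC : forall u v, P u -> P v -> a u v = a v u.
Hypothesis bC : forall u v, P u -> P v -> b u v = b v u.
Hypothesis a_lin : forall c u v w, P u -> P v -> P w -> a (c *: u + v) w = c * a u w + a v w.
Hypothesis b_lin : forall c u v w, P u -> P v -> P w -> b (c *: u + v) w = c * b u w + b v w.
Hypothesis a_ge0 : forall u, P u -> 0 <= a u u.
Hypothesis b_ge0 : forall u, P u -> 0 <= b u u.
(** Quantitative form of the Rellich theorem: up to a small multiple of [a], the form [b] is
    controlled by finitely many functionals, each bounded for [b]. *)
Hypothesis compact_embedding : forall e, 0 < e -> exists (N : nat) (l : 'I_N -> V -> R),
  [/\ forall j u v, P u -> P v -> l j (u - v) = l j u - l j v,
      forall j u, P u -> (l j u) ^+ 2 <= b u u &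
      forall u, P u -> b u u <= e * a u u + \sum_j (l j u) ^+ 2].
Hypothesis complete : forall w : nat -> V, (forall k, P (w k)) ->
  (forall e, 0 < e -> exists N, forall i j, (N <= i)%N -> (N <= j)%N ->
     a (w i - w j) (w i - w j) + b (w i - w j) (w i - w j) <= e) ->
  exists2 u, P u & forall e, 0 < e -> exists N, forall i, (N <= i)%N ->
    a (w i - u) (w i - u) + b (w i - u) (w i - u) <= e.

Definition eigenvector (mu : R) (u : V) := P u /\ forall h, P h -> a u h = mu * b u h.

Definition orthogonal_to (e : nat -> V) m u := forall j, (j < m)%N -> b u (e j) = 0.

(* A minimizing sequence is Cauchy along an ultrafilter: in b by the compactness
   of the embedding, then in a by the parallelogram law. *)
Lemma minimizing_cauchy (S : V -> Prop) (mu : R) (w : nat -> V) :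
  (forall c u v, S u -> S v -> S (c *: u + v)) -> (forall u, S u -> P u) ->
  (forall u, S u -> mu * b u u <= a u u) -> 0 <= mu ->
  (forall k, S (w k)) -> (forall k, b (w k) (w k) = 1) ->
  (forall k, a (w k) (w k) <= mu + k.+1%:R^-1) ->
  exists2 phi : nat -> nat, forall e, 0 < e -> exists N, forall i j, (N <= i)%N -> (N <= j)%N ->
     a (w (phi i) - w (phi j)) (w (phi i) - w (phi j)) +
     b (w (phi i) - w (phi j)) (w (phi i) - w (phi j)) <= e
   & forall i, (i <= phi i)%N.
Proof.
move=> S_lin SP Smu mu0 Sw bw aw.
have [U [UU oU]] := ultraFilterLemma (@eventually_filter).
have Pw k : P (w k) by exact: SP.
have aw1 k : a (w k) (w k) <= mu + 1.
  by rewrite (le_trans (aw k))// lerD2l invf_le1// ler1n.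
pose small e (E : set nat) := forall i j, E i -> E j ->
  a (w i - w j) (w i - w j) + b (w i - w j) (w i - w j) <= e.
have key e : 0 < e -> exists2 E, U E & small e E.
  move=> e0.
  (* The target for [b] of a difference, chosen with (mu + 1) d = e / 4. It is split evenly: [a] of
     a difference is at most 4 (mu + 1), whence the division by 8 (mu + 1) below, and the choice of
     [eta] makes the functionals contribute at most d / 2. *)
  pose d := e / (4 * (mu + 1)).
  have mu1 : 0 < mu + 1 by rewrite ltr_wpDl.
  have d0 : 0 < d by rewrite divr_gt0// mulr_gt0.
  have [N [l [lB lb lab]]] := compact_embedding (divr_gt0 d0 (mulr_gt0 (ltr0n R 8) mu1)).
  have bl j i : `|l j (w i)| <= 1.
    have H := lb j (w i) (Pw i); rewrite bw in H.
    by rewrite -ler_sqr ?nnegrE// real_normK ?num_real// expr1n.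
  have /choice[L HL] j := ultra_bounded_cvg UU (bl j).
  pose eta := Num.sqrt (d / (8 * N.+1%:R)).
  have eta0 : 0 < eta by rewrite sqrtr_gt0 divr_gt0// mulr_gt0.
  have eta2 : eta ^+ 2 = d / (8 * N.+1%:R) by rewrite sqr_sqrtr// ltW// divr_gt0// mulr_gt0.
  have UE1 : U [set i | forall j, `|l j (w i) - L j| <= eta].
    by apply: (@filter_forall_fin _ U) => j; exact: HL.
  pose K := Num.truncn (8 / e).
  have UE2 : U [set i | (K <= i)%N] by apply: oU; exists K.
  exists ([set i | forall j, `|l j (w i) - L j| <= eta] `&` [set i | (K <= i)%N]); first exact: filterI.
  move=> i j [/= Hi Ki] [/= Hj Kj].
  have Pd : P (w i - w j) by exact: (subspaceB P_lin).
  have Sd : S (w i + w j) by rewrite -[w i]scale1r; exact: S_lin.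
  have ap := form_parallelogram P_lin aC a_lin (Pw i) (Pw j).
  have bp := form_parallelogram P_lin bC b_lin (Pw i) (Pw j).
  have aij : a (w i - w j) (w i - w j) <= 4 * (mu + 1).
    have := a_ge0 (SP _ Sd); have := aw1 i; have := aw1 j; lra.
  have lij k : (l k (w i - w j)) ^+ 2 <= 4 * eta ^+ 2.
    rewrite lB// -[leLHS]real_normK ?num_real// (_ : 4 * eta ^+ 2 = (2 * eta) ^+ 2); last by ring.
    have e2 : 0 <= 2 * eta by rewrite mulr_ge0// ltW.
    rewrite ler_sqr ?nnegrE//.
    have := Hi k; have := Hj k; rewrite !ler_norml; lra.
  have bij : b (w i - w j) (w i - w j) <= d.
    apply: le_trans (lab _ Pd) _.
    apply: (@le_trans _ _ (d / 2 + d / 2)); last by lra.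
    apply: lerD.
      rewrite mulrAC ler_pdivrMr ?mulr_gt0//.
      have -> : d / 2 * (8 * (mu + 1)) = d * (4 * (mu + 1)) by field.
      by rewrite ler_pM2l.
    apply: (@le_trans _ _ (\sum_(k < N) 4 * eta ^+ 2)); first exact: ler_sum.
    rewrite sumr_const card_ord -[_ *+ N]mulr_natr eta2.
    have -> : 4 * (d / (8 * N.+1%:R)) * N%:R = (d / 2) * (N%:R / N.+1%:R).
      have N0 : (N.+1%:R : R) != 0 by rewrite pnatr_eq0.
      by move: (N.+1%:R : R) N0 => p p0; field.
    apply: ler_piMr; first by rewrite divr_ge0// ltW.
    by rewrite ler_pdivrMr// mul1r ler_nat.
  have Ke m : (K <= m)%N -> m.+1%:R^-1 <= e / 8.
    move=> Km; rewrite -[e / 8]invrK lef_pV2 ?posrE ?invr_gt0 ?divr_gt0// invf_div.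
    by apply/ltW/(lt_le_trans (truncnS_gt _)); rewrite ler_nat ltnS.
  (* By the two parallelogram laws, [a] of the difference is at most 2 / (i + 1) + 2 / (j + 1) plus
     mu times [b] of the difference, because the sum of the two vectors stays in [S]. *)
  have H := Smu _ Sd.
  have mb : (mu + 1) * b (w i - w j) (w i - w j) <= e / 4.
    apply: le_trans (ler_wpM2l (ltW mu1) bij) _.
    by rewrite /d; have -> : (mu + 1) * (e / (4 * (mu + 1))) = e / 4 by field; rewrite gt_eqF.
  have := aw i; have := aw j; have := Ke _ Ki; have := Ke _ Kj.
  rewrite !bw in bp.
  have E : b (w i + w j) (w i + w j) = 4 - b (w i - w j) (w i - w j) by lra.
  rewrite E mulrBr in H; rewrite mulrDl mul1r in mb.
  move: (i.+1%:R^-1 : R) (j.+1%:R^-1 : R) => ri rj.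
  move: (mu * b _ _) H mb => mub H mb; clear -H mb ap e0.
  lra.
have /choice[E HE] k : exists E, U E /\ small k.+1%:R^-1 E.
  by have [|E UE sE] := key k.+1%:R^-1; [rewrite invr_gt0|exists E].
have UF m : U [set i | forall k : 'I_m.+1, E k i].
  by apply: (@filter_forall_fin _ U) => k; exact: (HE k).1.
have /choice[phi Hphi] m : exists i, (forall k : 'I_m.+1, E k i) /\ (m <= i)%N.
  have UG : U [set i | (m <= i)%N] by apply: oU; exists m.
  by have [i [Hi mi]] := filter_ex (filterI (UF m) UG); exists i.
exists phi; last by move=> i; exact: (Hphi i).2.
move=> e e0; exists (Num.truncn e^-1) => i j Ni Nj.
set N := Num.truncn e^-1 in Ni Nj *.
apply: (@le_trans _ _ N.+1%:R^-1).
  apply: (HE N).2; first by have := (Hphi i).1 (Ordinal (leq_ltn_trans Ni (ltnSn i))).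
  by have := (Hphi j).1 (Ordinal (leq_ltn_trans Nj (ltnSn j))).
by rewrite -[leRHS]invrK lef_pV2 ?posrE ?invr_gt0//; exact/ltW/truncnS_gt.
Qed.

(** The form [a] is minimized on the unit sphere of [b] inside the complement of the eigenvectors
    already found. The vector [w0] is a competitor, which bounds the new eigenvalue by [Lam]. *)
Lemma next_eigenvector (e : nat -> V) (nu : nat -> R) (m : nat) (Lam : R) (w0 : V) :
  (forall j, (j < m)%N -> eigenvector (nu j) (e j)) ->
  (forall i j, (i < m)%N -> (j < m)%N -> b (e i) (e j) = (i == j)%:R) ->
  P w0 -> orthogonal_to e m w0 -> 0 < b w0 w0 -> a w0 w0 <= Lam * b w0 w0 ->
  exists u mu, [/\ eigenvector mu u, orthogonal_to e m u, b u u = 1 & mu <= Lam].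
Proof.
move=> eig orth Pw0 ow0 bw0 aw0.
have Pe j : (j < m)%N -> P (e j) by move=> /eig[].
pose S u := P u /\ orthogonal_to e m u.
have S_lin c u v : S u -> S v -> S (c *: u + v).
  move=> [Pu ou] [Pv ov]; split; first exact: P_lin.
  by move=> j jm; rewrite b_lin ?ou ?ov ?mulr0 ?addr0//; exact: Pe.
have SP u : S u -> P u by case.
pose A := [set r | exists2 h, S h /\ b h h = 1 & a h h = r].
have unitize h : S h -> 0 < b h h -> exists2 c, c ^+ 2 * b h h = 1 & S (c *: h) /\ b (c *: h) (c *: h) = 1.
  move=> Sh bh; exists (Num.sqrt (b h h))^-1.
    by rewrite exprVn sqr_sqrtr ?ltW// mulVf// gt_eqF.
  split; last by rewrite (formZ P0 P_lin bC b_lin)//; [rewrite exprVn sqr_sqrtr ?ltW// mulVf// gt_eqF|exact: SP].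
  rewrite -[_ *: h]addr0; apply: S_lin => //; split => // j jm.
  exact: (form0 P0 b_lin (Pe _ jm)).
have A0 : A !=set0.
  have [c _ [Sc bc]] := unitize _ (conj Pw0 ow0) bw0.
  by exists (a (c *: w0) (c *: w0)); exists (c *: w0).
have Alb : lbound A 0 by move=> _ [h [[Ph _] _] <-]; exact: a_ge0.
have infA : has_inf A by split => //; exists 0.
pose mu := inf A.
have mu0 : 0 <= mu by exact: lb_le_inf.
have Smu u : S u -> mu * b u u <= a u u.
  move=> Su; have := b_ge0 (SP _ Su); rewrite le_eqVlt => /predU1P[<-|bu].
    by rewrite mulr0; exact: a_ge0 (SP _ Su).
  have [c c2 [Sc bc]] := unitize _ Su bu.
  have : mu <= a (c *: u) (c *: u) by apply: ge_inf; [exists 0|exists (c *: u)].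
  rewrite (formZ P0 P_lin aC a_lin)//; last exact: SP.
  by move=> /(ler_wpM2r (ltW bu)); rewrite mulrAC c2 mul1r.
have /choice[w Hw] k : exists h, [/\ S h, b h h = 1 & a h h <= mu + k.+1%:R^-1].
  have k0 : 0 < (k.+1%:R^-1 : R) by rewrite invr_gt0.
  by have [_ [h [Sh bh] <-] /ltW ah] := inf_adherent k0 infA; exists h.
have Sw k : S (w k) by case: (Hw k).
have bw k : b (w k) (w k) = 1 by case: (Hw k).
have aw k : a (w k) (w k) <= mu + k.+1%:R^-1 by case: (Hw k).
have [phi cphi phi_ge] := minimizing_cauchy S_lin SP Smu mu0 Sw bw aw.
have Pw k : P (w (phi k)) by exact: SP.
have [u Pu Hu] := complete Pw cphi.
have Pz k : P (w (phi k) - u) by exact: (subspaceB P_lin).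
have wE k : u + (w (phi k) - u) = w (phi k) by rewrite addrC subrK.
have near_u d : 0 < d -> exists2 k, a (w (phi k)) (w (phi k)) <= mu + d &
    a (w (phi k) - u) (w (phi k) - u) <= d /\ b (w (phi k) - u) (w (phi k) - u) <= d.
  move=> d0; have [N HN] := Hu d d0.
  pose k := maxn N (Num.truncn d^-1); exists k.
    apply: le_trans (aw _) _; rewrite lerD2l -[leRHS]invrK lef_pV2 ?posrE ?invr_gt0//.
    apply/ltW/(lt_le_trans (truncnS_gt _)); rewrite ler_nat ltnS.
    by apply: leq_trans (phi_ge k); exact: leq_maxr.
  have := HN k (leq_maxl _ _); have := a_ge0 (Pz k); have := b_ge0 (Pz k).
  by move=> *; split; lra.
have bu1 : b u u = 1.
  have H e0 : 0 < e0 -> `|b u u - 1| <= e0.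
    move=> e00; have [d d0 Hd] := form_continuous P_lin bC b_lin b_ge0 Pu e00.
    have [k _ [_ bk]] := near_u d d0.
    by have := Hd _ (Pz k) bk; rewrite wE bw distrC.
  apply/eqP; rewrite -subr_eq0 -normr_le0; apply/ler_addgt0Pr => e0 /H.
  by rewrite add0r.
have au : a u u <= mu.
  apply/ler_addgt0Pr => e0 e00; have e02 : 0 < e0 / 2 by rewrite divr_gt0.
  have [d d0 Hd] := form_continuous P_lin aC a_lin a_ge0 Pu e02.
  have [|k ak [azk _]] := near_u (Num.min d (e0 / 2)); first by rewrite lt_min d0.
  have := Hd _ (Pz k) (le_trans azk _); rewrite wE ge_min lexx => /(_ isT).
  have : mu + Num.min d (e0 / 2) <= mu + e0 / 2 by rewrite lerD2l ge_min lexx orbT.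
  rewrite ler_norml => ? /andP[? ?]; lra.
have ou : orthogonal_to e m u.
  move=> j jm; apply/eqP; rewrite -normr_le0; apply/ler_addgt0Pr => d d0; rewrite add0r.
  have [k _ [_ bk]] := near_u (d ^+ 2) (exprn_gt0 2 d0).
  have := form_AMGM P_lin bC b_lin b_ge0 (t := d^-1) _ (Pz k) (Pe _ jm).
  rewrite invr_gt0 invrK => /(_ d0); rewrite orth// eqxx mulr1.
  have -> : b (w (phi k) - u) (e j) = - b u (e j).
    have := b_lin 1 Pu (Pz k) (Pe _ jm); rewrite scale1r wE mul1r (Sw (phi k)).2// => H.
    by apply/eqP; rewrite -addr_eq0 addrC; apply/eqP.
  have : d^-1 * b (w (phi k) - u) (w (phi k) - u) <= d.
    by rewrite ler_pdivrMl// -expr2.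
  rewrite mulrN normrN normrM ger0_norm//; have := normr_ge0 (b u (e j)); lra.
have Su : S u by [].
have auE : a u u = mu by apply/eqP; rewrite eq_le au -[leLHS]mulr1 -bu1 Smu.
pose Q u v := a u v - mu * b u v.
have QS h : S h -> a u h = mu * b u h.
  move=> Sh; apply/eqP; rewrite -subr_eq0; apply/eqP.
  apply: (@form_orth_of_min _ _ S Q) => //.
  - by move=> x y /SP Px /SP Py; rewrite /Q aC// bC.
  - by move=> c x y z /SP Px /SP Py /SP Pz'; rewrite /Q a_lin// b_lin//; ring.
  - by move=> x /Smu; rewrite /Q subr_ge0.
  - by rewrite /Q auE bu1 mulr1 subrr.
exists u, mu; split => //; last by rewrite -(ler_pM2r bw0) (le_trans (Smu _ (conj Pw0 ow0))).
split => // h Ph.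
(* The Euler equation holds against the orthogonal complement only. An arbitrary [h] is reduced to
   it by removing its projection, which is orthogonal to [u] for [b], and for [a] as well since the
   [e j] are eigenvectors. *)
pose pr : V := \sum_(j < m) b h (e j) *: e j.
have Pej (j : 'I_m) : P (e j) by exact: Pe.
have Ppr : P pr by exact: subspace_sum.
have a0 : a u pr = 0.
  rewrite aC// (form_sum P0 P_lin a_lin)// big1// => j _.
  by rewrite (eig _ (ltn_ord j)).2// (bC (Pej j) Pu) ou// mulr0 mulr0.
have b0 : b u pr = 0.
  rewrite bC// (form_sum P0 P_lin b_lin)// big1// => j _.
  by rewrite (bC (Pej j) Pu) ou// mulr0.
have Sh : S (h - pr).
  split; first exact: (subspaceB P_lin).
  move=> j jm; rewrite addrC -scaleN1r b_lin//; last exact: Pe.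
  rewrite (form_sum P0 P_lin b_lin)//; last exact: Pe.
  rewrite (bigD1 (Ordinal jm))//= orth// eqxx mulr1 big1 ?addr0 ?mulN1r ?addNr//.
  by move=> i ij; rewrite orth// -[i == j :> nat]/(i == Ordinal jm) (negbTE ij) mulr0.
have := QS _ Sh; rewrite addrC -scaleN1r (form_linr P_lin aC a_lin)// (form_linr P_lin bC b_lin)//.
by rewrite a0 b0 !mulr0 !add0r.
Qed.

Lemma kernel_vector (k m : nat) (M : 'I_k.+1 -> nat -> R) : (m <= k)%N ->
  exists2 c : 'I_k.+1 -> R, (exists i, c i != 0) &
    forall j, (j < m)%N -> \sum_i c i * M i j = 0.
Proof.
move=> mk; pose A : 'M[R]_(k.+1, m) := \matrix_(i, j) M i j.
have : kermx A != 0.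
  rewrite -mxrank_eq0 mxrank_ker subn_eq0 -ltnNge (leq_ltn_trans (rank_leq_col A))//.
move=> /rowV0Pn[v /sub_kermxP vA v0]; exists (v ord0).
  apply/existsP; apply: contraNT v0; rewrite negb_exists => /forallP H.
  by apply/eqP/rowP => i; rewrite mxE; apply/eqP; move: (H i); rewrite negbK.
move=> j jm; have /rowP/(_ (Ordinal jm)) := vA; rewrite !mxE => E.
by rewrite -[RHS]E; apply: eq_bigr => i _; rewrite mxE.
Qed.

(** The half of the min-max principle that gives existence. With m eigenvectors found and m <= k,
    the k + 1 trial vectors have a nontrivial combination orthogonal to all of them; it is nonzero
    for [b] and obeys the Rayleigh bound, so the next minimization applies. *)
Theorem minmax_eigenvectors (k : nat) (f : 'I_k.+1 -> V) (Lam : R) :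
  (forall i, P (f i)) ->
  (forall c : 'I_k.+1 -> R, a (\sum_i c i *: f i) (\sum_i c i *: f i) <=
     Lam * b (\sum_i c i *: f i) (\sum_i c i *: f i)) ->
  (forall c : 'I_k.+1 -> R, b (\sum_i c i *: f i) (\sum_i c i *: f i) = 0 -> forall i, c i = 0) ->
  exists (e : nat -> V) (nu : nat -> R),
    [/\ forall j, (j <= k)%N -> eigenvector (nu j) (e j),
        forall j, (j <= k)%N -> nu j <= Lam &
        forall i j, (i <= k)%N -> (j <= k)%N -> b (e i) (e j) = (i == j)%:R].
Proof.
move=> Pf af bf.
suff H m : (m <= k.+1)%N -> exists (e : nat -> V) (nu : nat -> R),
    [/\ forall j, (j < m)%N -> eigenvector (nu j) (e j),
        forall j, (j < m)%N -> nu j <= Lam &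
        forall i j, (i < m)%N -> (j < m)%N -> b (e i) (e j) = (i == j)%:R].
  exact: (H k.+1).
elim: m => [_|m IH mk]; first by exists (fun=> 0), (fun=> 0).
have [e [nu [eig nuL orth]]] := IH (ltnW mk).
have Pe j : (j < m)%N -> P (e j) by move=> /eig[].
have [c [i0 ci0] cM] := kernel_vector (fun i j => b (f i) (e j)) mk.
pose w := \sum_i c i *: f i.
have Pw : P w by exact: subspace_sum.
have ow : orthogonal_to e m w.
  by move=> j jm; rewrite (form_sum P0 P_lin b_lin) ?cM//; exact: Pe.
have bw : 0 < b w w.
  rewrite lt0r b_ge0// andbT; apply/eqP => /bf H.
  by move: ci0; rewrite H eqxx.
have [u [mu [eu ou bu muL]]] := next_eigenvector eig orth Pw ow bw (af c).
exists (fun j => if j == m then u else e j), (fun j => if j == m then mu else nu j).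
have lt_m j : (j < m.+1)%N -> j != m -> (j < m)%N by rewrite ltnS ltn_neqAle => -> ->.
split => [j jm|j jm|i j im jm].
- by case: eqVneq => [//|jm']; apply: eig; exact: lt_m.
- by case: eqVneq => [//|jm']; apply: nuL; exact: lt_m.
- case: (eqVneq i m) => [ie|im']; case: (eqVneq j m) => [je|jm'].
  + by rewrite ie je bu eqxx.
  + by rewrite ie eq_sym (negbTE jm') ou//; exact: lt_m.
  + by rewrite je (negbTE im') (bC (Pe _ (lt_m _ im im')) eu.1) ou//; exact: lt_m.
  + by apply: orth; exact: lt_m.
Qed.

End minimization.

(** * The Poincare inequality for smooth functions *)

Section staircase.
Context {R : realType}.

(** The number of levels dl, 2 dl, ..., N dl lying strictly below [y], times [dl]: a Riemann sum of
    the layer-cake formula, which falls short of [y] by at most [dl] when 0 <= y <= (N + 1) dl. *)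
Definition stair (N : nat) (dl y : R) : R := \sum_(j < N) dl * (j.+1%:R * dl < y)%R%:R.

Lemma stairS N dl y : stair N.+1 dl y = stair N dl y + dl * (N.+1%:R * dl < y)%R%:R.
Proof. by rewrite /stair big_ord_recr. Qed.

Lemma stair_le_steps N dl y : 0 <= dl -> stair N dl y <= N%:R * dl.
Proof.
move=> d0; elim: N => [|N IH]; first by rewrite /stair big_ord0 mul0r.
rewrite stairS -natr1 mulrDl mul1r lerD//.
by case: (_ < _); rewrite ?mulr1 ?mulr0.
Qed.

Lemma stair_le N dl y : 0 <= dl -> 0 <= y -> stair N dl y <= y.
Proof.
move=> d0 y0; elim: N => [|N IH]; first by rewrite /stair big_ord0.
rewrite stairS; case: ltP => [lt|_]; last by rewrite mulr0 addr0.
rewrite mulr1 (le_trans _ (ltW lt))// -natr1 mulrDl mul1r lerD2r.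
exact: stair_le_steps.
Qed.

Lemma stair_ge N dl y : 0 <= dl -> y <= N.+1%:R * dl -> y <= dl + stair N dl y.
Proof.
move=> d0; elim: N y => [|N IH] y; first by rewrite mul1r /stair big_ord0 addr0.
move=> yN; rewrite stairS; case: ltP => [lt|le]; last first.
  by rewrite mulr0 addr0; exact: IH.
suff -> : stair N dl y = N%:R * dl.
  by move: yN; rewrite /= mulr1 -(natr1 N.+1) -(natr1 N); lra.
rewrite /stair (eq_bigr (fun=> dl)) ?sumr_const ?card_ord ?mulr_natl// => j _.
rewrite (_ : _ < _) ?mulr1//; apply: le_lt_trans lt; apply: ler_wpM2r => //.
by rewrite ler_nat ltnS ltnW.
Qed.

End staircase.

(** * Comparison of integrals through superlevel sets *)

Section layer_cake.
Context {d : measure_display} {T : measurableType d} {R : realType}.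
Variables (mu : {measure set T -> \bar R}) (K : set T).
Hypotheses (mK : measurable K) (Kfin : (mu K < +oo)%E).

Lemma measurable_level (f : T -> R) s : measurable_fun K f -> measurable (K `&` [set x | s < f x]).
Proof.
move=> mf; rewrite (_ : [set x | s < f x] = f @^-1` `]s, +oo[%classic); last first.
  by apply/seteqP; split => x; rewrite /= in_itv/= andbT.
exact: mf.
Qed.

Lemma integral_stair (f : T -> R) N dl : measurable_fun K f -> 0 <= dl ->
  (\int[mu]_(x in K) (stair N dl (f x))%:E =
   \sum_(j < N) dl%:E * mu (K `&` [set x | (j.+1%:R * dl < f x)%R]))%E.
Proof.
move=> mf d0.
have E j x : K x -> ((dl * (j.+1%:R * dl < f x)%R%:R)%:E =
    (dl * \1_(K `&` [set x | j.+1%:R * dl < f x]) x)%:E)%E.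
  by move=> Kx; rewrite indicE in_setI mem_set//= mem_setE.
have mI j : measurable_fun K (fun x => (dl * \1_(K `&` [set x | j.+1%:R * dl < f x]) x)%:E).
  apply/measurable_EFinP; apply: measurable_funM => //; apply: measurable_indic.
  exact: measurable_level.
rewrite (eq_integral (fun x => \sum_(j < N) (dl * \1_(K `&` [set x | j.+1%:R * dl < f x]) x)%:E)%E); last first.
  move=> x /[!inE] Kx; rewrite /stair -sumEFin; apply: eq_bigr => j _; exact: E.
rewrite ge0_integral_sum//; last first.
  by move=> j x _; rewrite lee_fin mulr_ge0.
apply: eq_bigr => j _; under eq_integral do rewrite EFinM.
rewrite ge0_integralZl//; last first.
  by apply/measurable_EFinP; apply: measurable_indic; exact: measurable_level.
by rewrite integral_indic//; [rewrite setIAC setIid|exact: measurable_level].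
Qed.

(** The staircases of [a] and [b] are compared level by level. Their error is uniformly small
    because [a] is bounded and [K] has finite measure. *)
Lemma le_integral_layer_cake (a b : T -> R) (B lam : R) :
  measurable_fun K a -> measurable_fun K b ->
  (forall x, K x -> 0 <= a x <= B) -> (forall x, K x -> 0 <= b x) -> 0 <= lam ->
  (forall s, 0 <= s -> (lam%:E * mu (K `&` [set x | (s < a x)%R]) <= mu (K `&` [set x | (s < b x)%R]))%E) ->
  (lam%:E * \int[mu]_(x in K) (a x)%:E <= \int[mu]_(x in K) (b x)%:E)%E.
Proof.
move=> ma mb a0B b0 lam0 H.
have [[x0 Kx0]|K0] := pselect (exists x, K x); last first.
  rewrite (_ : K = set0) ?integral_set0 ?mule0//.
  by apply/seteqP; split => // x Kx; apply: K0; exists x.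
have B0 : 0 <= B by have /andP[/le_trans] := a0B _ Kx0; exact.
apply/lee_addgt0Pr => e e0.
have Kfn : mu K \is a fin_num by rewrite ge0_fin_numE.
set k := fine (mu K).
have k0 : 0 <= k by rewrite fine_ge0.
(* Enough levels between 0 and [B] for the total error lam B k / (N + 1) to be at most [e]. *)
pose N := Num.truncn (lam * B * k / e).
pose dl := B / N.+1%:R.
have d0 : 0 <= dl by rewrite divr_ge0.
have small : lam * (dl * k) <= e.
  have -> : lam * (dl * k) = (lam * B * k) / N.+1%:R by rewrite /dl; ring.
  rewrite ler_pdivrMr// [e * _]mulrC -ler_pdivrMr//; exact/ltW/truncnS_gt.
have mstair (f : T -> R) : measurable_fun K f -> measurable_fun K (fun x => (stair N dl (f x))%:E).
  move=> mf; apply/measurable_EFinP; rewrite /stair; apply: measurable_sum => j.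
  apply: measurable_funM; first exact: measurable_cst.
  have : measurable_fun K (\1_(K `&` [set x | j.+1%:R * dl < f x]) : T -> R).
    by apply: measurable_indic; exact: measurable_level.
  by apply: eq_measurable_fun => x /set_mem Kx; rewrite indicE in_setI mem_set//= mem_setE.
have s0 y : 0 <= stair N dl y by apply: sumr_ge0 => j _; rewrite mulr_ge0.
apply: (@le_trans _ _ (lam%:E * \int[mu]_(x in K) (dl%:E + (stair N dl (a x))%:E))%E).
  apply: lee_wpmul2l; rewrite ?lee_fin//; apply: ge0_le_integral => //.
  - by move=> x /a0B /andP[? _]; rewrite lee_fin.
  - exact/measurable_EFinP.
  - by apply: emeasurable_funD; [exact: measurable_cst|exact: mstair].
  - move=> x Kx; rewrite -EFinD lee_fin; apply: stair_ge => //.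
    by rewrite /dl mulrC divfK//; have /andP[] := a0B _ Kx.
rewrite ge0_integralD//; last 2 first.
- by move=> x _; rewrite lee_fin.
- exact: mstair.
rewrite integral_cst// -(fineK Kfn) -/k ge0_muleDr ?lee_fin ?mulr_ge0//; last first.
  by apply: integral_ge0 => x _; rewrite lee_fin.
rewrite addeC; apply: leeD; last by rewrite -!EFinM lee_fin.
rewrite integral_stair// ge0_sume_distrr; last by move=> j _; rewrite mule_ge0 ?lee_fin.
apply: (@le_trans _ _ (\int[mu]_(x in K) (stair N dl (b x))%:E)%E).
  rewrite integral_stair//; apply: lee_sum => j _; rewrite muleCA.
  by apply: lee_wpmul2l; rewrite ?lee_fin//; apply: H; rewrite mulr_ge0.
apply: ge0_le_integral => //.
- by move=> x _; rewrite lee_fin.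
- exact: mstair.
- exact/measurable_EFinP.
- by move=> x Kx; rewrite lee_fin stair_le// b0.
Qed.

Lemma integrable_bounded (f : T -> R) (B : R) : measurable_fun K f ->
  (forall x, K x -> `|f x| <= B) -> mu.-integrable K (EFin \o f).
Proof.
move=> mf fB; apply: measurable_bounded_integrable => //.
exists B; split; first exact: num_real.
by move=> y By x Kx; apply: (le_trans (fB _ Kx)); exact: ltW.
Qed.

End layer_cake.

(** * The Euclidean norm *)

Section euclidean.
Context {R : realType} {n : nat}.
Implicit Types x y z : 'rV[R]_n.

Definition dot x y : R := \sum_i x ord0 i * y ord0 i.
(** The norm [|x|] of a row vector is the maximum of its coordinates; separation, diameters and
    gradients refer to the Euclidean norm, and the two are compared below. *)
Definition enorm x : R := Num.sqrt (dot x x).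

Lemma dot_ge0 x : 0 <= dot x x.
Proof. by apply: sumr_ge0 => i _; rewrite -expr2 sqr_ge0. Qed.

Lemma enorm_ge0 x : 0 <= enorm x. Proof. exact: sqrtr_ge0. Qed.

Lemma sqr_enorm x : enorm x ^+ 2 = dot x x.
Proof. by rewrite sqr_sqrtr// dot_ge0. Qed.

Lemma dotC x y : dot x y = dot y x.
Proof. by apply: eq_bigr => i _; rewrite mulrC. Qed.

Lemma dot_linl c x y z : dot (c *: x + y) z = c * dot x z + dot y z.
Proof.
rewrite /dot mulr_sumr -big_split; apply: eq_bigr => i _ /=.
by rewrite !mxE mulrDl mulrA.
Qed.

Lemma enormZ c x : enorm (c *: x) = `|c| * enorm x.
Proof.
rewrite /enorm -sqrtr_sqr -sqrtrM ?sqr_ge0//; congr Num.sqrt.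
by rewrite /dot mulr_sumr; apply: eq_bigr => i _; rewrite !mxE; ring.
Qed.

Lemma enorm0_eq x : enorm x = 0 -> x = 0.
Proof.
move=> x0; have : dot x x = 0 by rewrite -sqr_enorm x0 expr0n.
move=> /psumr_eq0P H; apply/rowP => i; rewrite mxE; apply/eqP; rewrite -sqrf_eq0 expr2.
by apply/eqP/H => // j _; rewrite -expr2 sqr_ge0.
Qed.

Lemma dot0l x : dot 0 x = 0.
Proof. by rewrite /dot big1// => i _; rewrite mxE mul0r. Qed.

Lemma dot_sqr c e x y : dot (c *: x + e *: y) (c *: x + e *: y) =
  c ^+ 2 * dot x x + 2 * c * e * dot x y + e ^+ 2 * dot y y.
Proof.
rewrite /dot !mulr_sumr -!big_split; apply: eq_bigr => i _ /=.
by rewrite !mxE; ring.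
Qed.

Lemma dot_le_enorm x y : dot x y <= enorm x * enorm y.
Proof.
have [x0|x0] := eqVneq (enorm x) 0.
  by rewrite (enorm0_eq x0) dot0l mulr_ge0 ?enorm_ge0.
have [y0|y0] := eqVneq (enorm y) 0.
  by rewrite dotC (enorm0_eq y0) dot0l mulr_ge0 ?enorm_ge0.
have := dot_ge0 (enorm y *: x + (- enorm x) *: y).
rewrite dot_sqr -!sqr_enorm sqrrN.
have xy : 0 < enorm x * enorm y by rewrite mulr_gt0 ?lt0r ?x0 ?y0 ?enorm_ge0.
have -> : enorm y ^+ 2 * enorm x ^+ 2 + 2 * enorm y * - enorm x * dot x y +
  enorm x ^+ 2 * enorm y ^+ 2 = 2 * (enorm x * enorm y) * (enorm x * enorm y - dot x y) by ring.
by rewrite pmulr_rge0 ?subr_ge0// mulr_gt0.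
Qed.

Lemma enormD x y : enorm (x + y) <= enorm x + enorm y.
Proof.
rewrite -ler_sqr ?nnegrE ?addr_ge0 ?enorm_ge0//.
rewrite sqr_enorm -[x]scale1r -[y in X in X <= _]scale1r dot_sqr -!sqr_enorm scale1r.
have := dot_le_enorm x y; lra.
Qed.

Lemma enormN x : enorm (- x) = enorm x.
Proof. by rewrite -scaleN1r enormZ normrN1 mul1r. Qed.

Lemma enorm_distC x y : enorm (x - y) = enorm (y - x).
Proof. by rewrite -enormN opprB. Qed.

Lemma enorm0 : enorm 0 = 0.
Proof. by rewrite /enorm dot0l sqrtr0. Qed.

Lemma ler_coord_enorm x i : `|x ord0 i| <= enorm x.
Proof.
rewrite -ler_sqr ?nnegrE ?enorm_ge0// real_normK ?num_real// sqr_enorm /dot (bigD1 i)//= -expr2 lerDl.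
by apply: sumr_ge0 => j _; rewrite -expr2 sqr_ge0.
Qed.

Lemma enorm_le_norm x : enorm x <= n%:R * `|x|.
Proof.
rewrite -ler_sqr ?nnegrE ?mulr_ge0 ?enorm_ge0// sqr_enorm.
apply: (@le_trans _ _ (\sum_(i < n) `|x| ^+ 2)).
  apply: ler_sum => i _; rewrite -expr2 -real_normK ?num_real// ler_sqr ?nnegrE//.
  exact: ler_coord_norm.
rewrite sumr_const card_ord -[_ *+ n]mulr_natl exprMn ler_wpM2r ?sqr_ge0//.
by rewrite -natrX ler_nat; case: (n) => // m; rewrite expnS expn1 leq_pmulr.
Qed.

Lemma norm_le_enorm x : `|x| <= enorm x.
Proof.
rewrite [leLHS]mx_normrE; apply/bigmax_leP; split; first exact: enorm_ge0.
by move=> [i j] _ /=; rewrite ord1 ler_coord_enorm.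
Qed.

End euclidean.

Definition convexRn {R : realType} {n} (A : set 'rV[R]_n) :=
  forall x y t, 0 < t < 1 -> A x -> A y -> A ((1 - t) *: x + t *: y).

(** 2^t = exp (t ln 2) >= 1 + t ln 2, together with ln 2 >= 1/2. *)
Lemma two_powR_ge {R : realType} (t : R) : 0 <= t -> 1 + t / 2 <= 2 `^ t.
Proof.
move=> t0; rewrite /powR (_ : 2 == 0 = false) ?pnatr_eq0//.
apply: le_trans (expR_ge1Dx _); rewrite lerD2l; apply: ler_wpM2l => //.
have := @le_ln1Dx R (- 2^-1); rewrite (_ : 1 + - 2^-1 = 2^-1); last by field.
by rewrite lnV ?posrE//; lra.
Qed.

(** * From Brunn-Minkowski to the Poincare inequality *)

Section smooth_poincare.
Context {R : realType} {n : nat}.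
Local Notation mu := (@vol R n).
Local Notation Rn := (lebesgueRn R n).
Variables (K : set 'rV[R]_n) (d : R).
Hypotheses (oK : open K) (cK : convexRn K) (bK : bounded_set K) (d0 : 0 < d).
Hypothesis diamK : forall x y, K x -> K y -> enorm (x - y) <= d.

Let mK : measurable (K : set Rn). Proof. exact: measurable_openRn. Qed.
Let Kfin : (mu K < +oo)%E. Proof. exact: vol_bounded. Qed.

(** As the volume of [K] is at least twice that of [A], Brunn-Minkowski bounds the volume of [S]
    below by |A|^(1-t) (2 |A|)^t = 2^t |A|. *)
Lemma level_growth (A S : set 'rV[R]_n) (t : R) : 0 < t < 1 -> open A -> A `<=` K ->
  2 * fine (mu A) <= fine (mu K) ->
  (forall x y, A x -> K y -> S ((1 - t) *: x + t *: y)) ->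
  ((1 + t / 2)%:E * mu A <= mu S)%E.
Proof.
move=> t01 oA AK half H; have /andP[t0 t1] := t01.
have bA : bounded_set A.
  by case: bK => M [Mr HM]; exists M; split => // y My x Ax; apply: HM => //; exact: AK.
have Afin : mu A \is a fin_num by rewrite ge0_fin_numE//; exact: vol_bounded.
apply: le_trans (brunn_minkowski t01 oA bA oK bK H).
rewrite -[X in (_ * X <= _)%E](fineK Afin) -EFinM lee_fin.
set va := fine (mu A) in half *; set vk := fine (mu K) in half *.
have va0 : 0 <= va by exact: fine_ge0.
have [->|va1] := eqVneq va 0; first by rewrite mulr0 mulr_ge0 ?powR_ge0.
have vap : 0 < va by rewrite lt0r va1.
apply: (@le_trans _ _ (va `^ (1 - t) * (2 * va) `^ t)).
  rewrite powRM// mulrCA -powRD; last by rewrite subrK oner_eq0.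
  by rewrite subrK powRr1// ler_pM2r// two_powR_ge// ltW.
apply: ler_wpM2l; first exact: powR_ge0.
by apply: ge0_ler_powR; rewrite ?nnegrE// ?ltW//; [rewrite mulr_gt0|rewrite (lt_le_trans _ half)// mulr_gt0].
Qed.

(** [H] stands for the length of the gradient. The point z = (1 - t) x + t y is within [t * d] of
    [x], so p > s at [x] forces P > s at [z], where P is [p] plus its first-order increase. By
    [level_growth] the superlevel sets of P are larger by the factor 1 + t / 2, hence so is the
    integral of P^2 compared with that of p^2. Expanding P^2, dividing by [t] and letting [t] tend
    to 0 gives the claim. *)
Lemma poincare_onesided (p H : 'rV[R]_n -> R) (B M : R) : 0 <= M ->
  measurable_fun (K : set Rn) (p : Rn -> R) -> measurable_fun (K : set Rn) (H : Rn -> R) ->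
  (forall x, K x -> 0 <= p x <= B) -> (forall x, K x -> 0 <= H x <= B) ->
  (forall s, 0 <= s -> open (K `&` [set x | s < p x])) ->
  2 * fine (mu (K `&` [set x | 0 < p x])) <= fine (mu K) ->
  (forall t x z, 0 < t < 1 -> t * d <= 1 -> K x -> K z -> enorm (x - z) <= t * d ->
    p x <= p z + t * d * (H z + M * (t * d))) ->
  \int[mu]_(x in K) (p x ^+ 2) <= 40 * d ^+ 2 * \int[mu]_(x in K) (H x ^+ 2).
Proof.
move=> M0 mp mH pB HB op half lip.
have [K0|/eqP/set0P[x0 Kx0]] := pselect (K = set0).
  by rewrite K0 !Rintegral_set0 mulr0.
have B0 : 0 <= B by have /andP[/le_trans] := pB _ Kx0; exact.
have sqB (f : 'rV[R]_n -> R) : (forall x, K x -> 0 <= f x <= B) ->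
    forall x, K x -> 0 <= f x ^+ 2 <= B ^+ 2.
  move=> fB x Kx; have /andP[f0 f1] := fB _ Kx.
  by rewrite sqr_ge0/= ler_sqr ?nnegrE.
have isq (f : 'rV[R]_n -> R) C : measurable_fun (K : set Rn) (f : Rn -> R) -> (forall x, K x -> 0 <= f x <= C) ->
    mu.-integrable K (fun x => (f x)%:E).
  move=> mf fC; apply: (@integrable_bounded _ _ _ _ _ mK Kfin _ C) => // x Kx.
  by have /andP[f0 f1] := fC _ Kx; rewrite ger0_norm.
have mp2 : measurable_fun (K : set Rn) (fun x : Rn => p x ^+ 2) by exact: measurable_funX.
have mH2 : measurable_fun (K : set Rn) (fun x : Rn => H x ^+ 2) by exact: measurable_funX.
have ip2 := isq _ _ mp2 (sqB _ pB); have iH2 := isq _ _ mH2 (sqB _ HB).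
set I := Rintegral mu K (fun x => p x ^+ 2); set J := Rintegral mu K (fun x => H x ^+ 2).
set k := fine (mu K).
have key t : 0 < t < 1 -> t * d <= 1 -> I <= 40 * d ^+ 2 * J + 40 * d ^+ 4 * M ^+ 2 * k * t ^+ 2.
  move=> t01 td; have /andP[t0 t1] := t01.
  have td0 : 0 < t * d by rewrite mulr_gt0.
  pose P z := p z + t * d * (H z + M * (t * d)).
  have P0 z : K z -> 0 <= P z.
    move=> Kz; have /andP[p0 _] := pB _ Kz; have /andP[h0 _] := HB _ Kz.
    by rewrite addr_ge0// mulr_ge0 ?(ltW td0)// addr_ge0// mulr_ge0// ltW.
  have mP : measurable_fun (K : set Rn) (P : Rn -> R).
    exact: (measurable_funD mp (measurable_funM (measurable_cst _) (measurable_funD mH (measurable_cst _)))).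
  have mP2 : measurable_fun (K : set Rn) (fun x : Rn => P x ^+ 2) by exact: measurable_funX.
  have lc : ((1 + t / 2)%:E * \int[mu]_(x in K) (p x ^+ 2)%:E <= \int[mu]_(x in K) (P x ^+ 2)%:E)%E.
    apply: (@le_integral_layer_cake _ _ _ _ _ mK Kfin _ _ (B ^+ 2)) => //.
    - exact: sqB.
    - by move=> x _; exact: sqr_ge0.
    - by rewrite addr_ge0// divr_ge0// ltW.
    move=> s s0.
    have lev (f : 'rV[R]_n -> R) : (forall x, K x -> 0 <= f x) ->
        K `&` [set x | s < f x ^+ 2] = K `&` [set x | Num.sqrt s < f x].
      move=> f0; apply/seteqP; split => x [Kx /= sf]; split => //=.
        by rewrite -ltr_sqr ?nnegrE ?sqrtr_ge0 ?f0// sqr_sqrtr.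
      by rewrite -(sqr_sqrtr s0) ltr_sqr ?nnegrE ?sqrtr_ge0 ?f0.
    rewrite !lev//; last by move=> x /pB /andP[].
    have ss0 := sqrtr_ge0 s.
    apply: level_growth => //.
    - exact: op.
    - apply: le_trans half; rewrite ler_pM2l//; apply: fine_le.
      + rewrite ge0_fin_numE//; apply: le_lt_trans Kfin.
        by apply: (le_outer_measure (@lebesgue_outer R n)) => x [].
      + rewrite ge0_fin_numE//; apply: le_lt_trans Kfin.
        by apply: (le_outer_measure (@lebesgue_outer R n)) => x [].
      + apply: (le_outer_measure (@lebesgue_outer R n)) => x [Kx /= sx]; split => //=.
        exact: le_lt_trans sx.
    - move=> x y [Kx /= sx] Ky; have Kz := cK t01 Kx Ky; split => //=.
      apply: lt_le_trans sx _; apply: lip => //.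
      have -> : x - ((1 - t) *: x + t *: y) = t *: (x - y).
        by rewrite scalerBl scale1r scalerBr opprD opprB addrA [x + _]addrC subrK.
      by rewrite enormZ ger0_norm ?(ltW t0)//; apply: ler_wpM2l (diamK Kx Ky); exact: ltW.
  (* Young's inequality with weight t / 4 uses up half of the gain t / 2. The other term has the
     factor (t + 4) t d^2, at most 5 t d^2, and squaring [H] plus its error doubles it. Division by
     the remaining t / 4 yields the constant 40. *)
  pose C0 := 10 * t * d ^+ 2.
  have iR : mu.-integrable K (fun x => ((1 + t / 4) * p x ^+ 2 + (C0 * H x ^+ 2 + C0 * (M ^+ 2 * t ^+ 2 * d ^+ 2)))%:E).
    have cst_int r : mu.-integrable K (fun=> r%:E).
      by apply: (@integrable_bounded _ _ _ _ _ mK Kfin (fun=> r) `|r|).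
    under eq_fun do rewrite !EFinD; apply: integrableD => //.
      by under eq_fun do rewrite EFinM; apply: integrableZl.
    apply: integrableD => //.
    by under eq_fun do rewrite EFinM; apply: integrableZl.
  have ub : (\int[mu]_(x in K) (P x ^+ 2)%:E <=
      \int[mu]_(x in K) ((1 + t / 4) * p x ^+ 2 + (C0 * H x ^+ 2 + C0 * (M ^+ 2 * t ^+ 2 * d ^+ 2)))%:E)%E.
    have ge0 x : K x -> (0 <= (P x ^+ 2)%:E)%E by move=> _; rewrite lee_fin sqr_ge0.
    have mP2' := (measurable_EFinP (K : set Rn) (fun x : Rn => P x ^+ 2)).2 mP2.
    apply: ge0_le_integral; [exact: mK|exact: ge0|exact: mP2'|exact: (measurable_int mu iR)|].
    move=> x Kx; rewrite lee_fin /P.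
    have := sqr_ge0 (t / 4 * p x - t * d * (H x + M * (t * d))).
    have := sqr_ge0 (H x - M * (t * d)).
    move: (p x) (H x) => a b h1 h2.
    have E1 : (a + t * d * (b + M * (t * d))) ^+ 2 <=
       (1 + t / 4) * a ^+ 2 + (1 + 4 / t) * (t * d * (b + M * (t * d))) ^+ 2.
      rewrite -subr_ge0.
      have -> : (1 + t / 4) * a ^+ 2 + (1 + 4 / t) * (t * d * (b + M * (t * d))) ^+ 2 -
        (a + t * d * (b + M * (t * d))) ^+ 2 = 4 / t * (t / 4 * a - t * d * (b + M * (t * d))) ^+ 2.
        by field; rewrite gt_eqF.
      by rewrite mulr_ge0// divr_ge0// ltW.
    apply: (le_trans E1); rewrite lerD2l.
    have -> : (1 + 4 / t) * (t * d * (b + M * (t * d))) ^+ 2 =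
        (t + 4) * t * d ^+ 2 * (b + M * (t * d)) ^+ 2 by field; rewrite gt_eqF.
    have E2 : (b + M * (t * d)) ^+ 2 <= 2 * (b ^+ 2 + M ^+ 2 * t ^+ 2 * d ^+ 2).
      rewrite -subr_ge0; apply: le_trans h1 _; rewrite le_eqVlt; apply/orP; left; apply/eqP; ring.
    rewrite -mulrDr /C0.
    have -> : 10 * t * d ^+ 2 * (b ^+ 2 + M ^+ 2 * t ^+ 2 * d ^+ 2) =
        5 * (t * d ^+ 2) * (2 * (b ^+ 2 + M ^+ 2 * t ^+ 2 * d ^+ 2)) by ring.
    apply: ler_pM.
    - by apply: mulr_ge0 (sqr_ge0 _); apply: mulr_ge0 (ltW t0); rewrite addr_ge0// ltW.
    - exact: sqr_ge0.
    - by rewrite -mulrA; apply: ler_wpM2r; [apply: mulr_ge0 (sqr_ge0 _); exact: ltW|lra].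
    - exact: E2.
  have fin_int f : mu.-integrable K (fun x => (f x)%:E) ->
      (\int[mu]_(x in K) (f x)%:E)%E = (\int[mu]_(x in K) f x)%:E.
    by move=> fi; rewrite /Rintegral fineK//; exact: integrable_fin_num.
  have iZ c f : mu.-integrable K (fun x => (f x)%:E) -> mu.-integrable K (fun x => (c * f x)%:E).
    by move=> fi; under eq_fun do rewrite EFinM; exact: integrableZl.
  have cst_int r : mu.-integrable K (fun=> r%:E).
    by apply: (@integrable_bounded _ _ _ _ _ mK Kfin (fun=> r) `|r|).
  have iCH : mu.-integrable K (fun x => (C0 * H x ^+ 2 + C0 * (M ^+ 2 * t ^+ 2 * d ^+ 2))%:E).
    by under eq_fun do rewrite EFinD; apply: integrableD => //; exact: iZ.
  have := le_trans lc ub; rewrite (fin_int _ ip2) (fin_int _ iR) -EFinM lee_fin.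
  rewrite (RintegralD mK (iZ _ _ ip2) iCH) (RintegralD mK (iZ _ _ iH2) (cst_int _)).
  rewrite (RintegralZl _ mK ip2) (RintegralZl _ mK iH2) (Rintegral_cst _ mK) -/I -/J -/k.
  rewrite /C0 => Hfin.
  have : t / 4 * I <= t / 4 * (40 * d ^+ 2 * J + 40 * d ^+ 4 * M ^+ 2 * k * t ^+ 2).
    have -> : t / 4 * (40 * d ^+ 2 * J + 40 * d ^+ 4 * M ^+ 2 * k * t ^+ 2) =
      10 * t * d ^+ 2 * J + 10 * t * d ^+ 2 * (M ^+ 2 * t ^+ 2 * d ^+ 2) * k by field.
    move: Hfin; rewrite !mulrDl !mul1r; lra.
  by rewrite ler_pM2l// divr_gt0.
have k0 : 0 <= k by exact: fine_ge0.
apply/ler_addgt0Pr => e e0.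
set C := 40 * d ^+ 4 * M ^+ 2 * k in key.
have C0 : 0 <= C by apply: mulr_ge0 k0; apply: mulr_ge0 (sqr_ge0 _); apply: mulr_ge0 (exprn_ge0 _ (ltW d0)).
pose t := Num.min (1 / 2) (Num.min (1 / d) (e / (C + 1))).
have t0 : 0 < t by rewrite !lt_min !divr_gt0// ltr_wpDl.
have t1 : t <= 1 / 2 by rewrite ge_min lexx.
have td : t * d <= 1 by rewrite -ler_pdivlMr// !ge_min lexx orbT.
have tC : C * t <= e.
  apply: (@le_trans _ _ (C * (e / (C + 1)))).
    by apply: ler_wpM2l => //; rewrite !ge_min lexx !orbT.
  by rewrite mulrC mulrAC -mulrA ler_piMr ?(ltW e0)// ler_pdivrMr ?ltr_wpDl// mul1r lerDl.
have t11 : t < 1 by lra.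
apply: le_trans (key t _ td) _; first by rewrite t0.
rewrite lerD2l; apply: le_trans tC; apply: ler_wpM2l => //.
by rewrite expr2 ler_piMl ?ltW.
Qed.

(* The infimum of the levels above which v takes at most half of the volume. *)
Lemma median_exists (v : 'rV[R]_n -> R) (B : R) : K !=set0 ->
  measurable_fun (K : set Rn) (v : Rn -> R) -> (forall x, K x -> `|v x| <= B) ->
  exists m, 2 * fine (mu (K `&` [set x | m < v x])) <= fine (mu K) /\
            2 * fine (mu (K `&` [set x | v x < m])) <= fine (mu K).
Proof.
move=> K0 mv vB.
have vk0 : 0 < fine (mu K).
  by rewrite fine_gt0// Kfin andbT; exact: vol_open_gt0.
have sub_fin (A : set Rn) : A `<=` K -> mu A \is a fin_num.
  move=> AK; rewrite ge0_fin_numE//; apply: le_lt_trans Kfin.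
  exact: (le_outer_measure (@lebesgue_outer R n)).
have sub_le (A A' : set Rn) : A `<=` A' -> A' `<=` K -> fine (mu A) <= fine (mu A').
  move=> AA' A'K; apply: fine_le; rewrite ?sub_fin//; first exact: subset_trans A'K.
  exact: (le_outer_measure (@lebesgue_outer R n)).
pose up s : set Rn := K `&` [set x | s < v x].
have upK s : up s `<=` K by move=> x [].
have mup s : measurable (up s) by exact: measurable_level.
pose A := [set s | 2 * fine (mu (up s)) <= fine (mu K)].
have AB : A B.
  rewrite /A /= (_ : up B = set0) ?measure0 ?mulr0 ?ltW//.
  apply/seteqP; split => // x [Kx /=]; rewrite ltNge => /negP; apply.
  exact: le_trans (ler_norm _) (vB _ Kx).
have Alb s : A s -> - B - 1 <= s.
  move=> As; rewrite leNgt; apply/negP => sB; move: As; rewrite /A /= (_ : up s = K).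
    by move=> ?; lra.
  apply/seteqP; split => [x []//|x Kx]; split => //=.
  have := vB _ Kx; rewrite ler_norml => /andP[? _]; lra.
have infA : has_inf A by split; [exists B|exists (- B - 1) => s; exact: Alb].
have half_lim (F : nat -> set Rn) : (forall k, measurable (F k)) -> (forall k, F k `<=` K) ->
    nondecreasing_seq F -> (forall k, 2 * fine (mu (F k)) <= fine (mu K)) ->
    2 * fine (mu (\bigcup_k F k)) <= fine (mu K).
  move=> mF FK ndF hF.
  have UK : \bigcup_k F k `<=` K by move=> x [k _]; exact: FK.
  have mU : measurable (\bigcup_k F k) by exact: bigcup_measurable.
  have cv := nondecreasing_cvg_mu (mu := mu) mF mU ndF.
  have : (mu (\bigcup_k F k) <= (fine (mu K) / 2)%:E)%E.
    apply: (cvge_le _ cv); apply: nearW => k /=.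
    by rewrite -(fineK (sub_fin _ (FK k))) lee_fin ler_pdivlMr// mulrC.
  by rewrite -(fineK (sub_fin _ UK)) lee_fin ler_pdivlMr// mulrC.
exists (inf A); split.
- rewrite (_ : K `&` _ = \bigcup_k up (inf A + k.+1%:R^-1)); last first.
    apply/seteqP; split => [x [Kx /= vx]|x [k _ [Kx /= vx]]]; last first.
      by split => //=; apply: lt_trans vx; rewrite ltrDl invr_gt0.
    exists (Num.truncn (v x - inf A)^-1) => //; split => //=.
    rewrite -ltrBrDl -[ltRHS]invrK ltf_pV2 ?posrE ?invr_gt0 ?subr_gt0//.
    exact: truncnS_gt.
  apply: half_lim => //.
  + move=> k l kl; apply/subsetPset => x [Kx /= vx]; split => //=; apply: le_lt_trans vx.
    by rewrite lerD2l lef_pV2 ?posrE// ler_nat ltnS.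
  + move=> k; have k0 : 0 < (k.+1%:R^-1 : R) by rewrite invr_gt0.
    have [s As /ltW sk] := inf_adherent k0 infA.
    apply: le_trans As; rewrite ler_pM2l//; apply: sub_le => // x [Kx /= vx]; split => //=.
    exact: le_lt_trans vx.
- pose lo s : set Rn := K `&` [set x | v x < s].
  have mlo s : measurable (lo s).
    rewrite /lo (_ : [set x | v x < s] = [set x | - s < - v x]).
      apply: (measurable_level mK); exact: measurableT_comp.
    by apply/seteqP; split => x /=; rewrite ltrN2.
  rewrite (_ : K `&` _ = \bigcup_k lo (inf A - k.+1%:R^-1)); last first.
    apply/seteqP; split => [x [Kx /= vx]|x [k _ [Kx /= vx]]]; last first.
      by split => //=; apply: lt_trans vx _; rewrite ltrBlDr ltrDl invr_gt0.
    exists (Num.truncn (inf A - v x)^-1) => //; split => //=.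
    rewrite ltrBrDr -ltrBrDl -[ltRHS]invrK ltf_pV2 ?posrE ?invr_gt0 ?subr_gt0//.
    exact: truncnS_gt.
  apply: half_lim => //; [by move=> k x []| |].
  + move=> k l kl; apply/subsetPset => x [Kx /= vx]; split => //=; apply: lt_le_trans vx _.
    by rewrite lerD2l lerN2 lef_pV2 ?posrE// ler_nat ltnS.
  (* Below the infimum more than half of the volume lies above [s], hence less than half lies below
     [s]. *)
  + move=> k; set s := inf A - _.
    have nAs : ~ A s.
      move=> As; have : inf A <= s by apply: ge_inf => //; exists (- B - 1) => r; exact: Alb.
      by rewrite /s lerBrDr gerDl leNgt invr_gt0 ltr0n.
    move/negP: nAs; rewrite -ltNge => nAs.
    have : (mu (lo s) + mu (up s) <= mu K)%E.
      rewrite -measureU//; last first.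
        by apply/seteqP; split => // x [[_ /= h1] [_ /= h2]]; have := lt_trans h1 h2; rewrite ltxx.
      by apply: (le_outer_measure (@lebesgue_outer R n)) => x [[]|[]].
    have loK : lo s `<=` K by move=> x [].
    rewrite -[X in (X + _ <= _)%E](fineK (sub_fin _ loK)) -(fineK (sub_fin _ (upK s))).
    rewrite -[X in (_ <= X)%E](fineK (sub_fin K (@subset_refl _ K))) -EFinD lee_fin.
    by move: (fine (mu (lo s))) (fine (mu (up s))) (fine (mu K)) nAs => x y z; lra.
Qed.

(** With [m] a median, the positive parts of v - m and of m - v are supported, up to the boundary of
    their levels, on at most half of the volume, and [poincare_onesided] applies to each. The
    constant doubles because both estimates integrate the gradient over all of [K]. *)
Theorem poincare_smooth (v : 'rV[R]_n -> R) (G : 'I_n -> 'rV[R]_n -> R) (B L M : R) : 0 <= M ->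
  (forall x, K x -> `|v x| <= B) -> (forall i x, K x -> `|G i x| <= B) ->
  (forall i, measurable_fun (K : set Rn) (G i : Rn -> R)) ->
  (forall x y, K x -> K y -> `|v x - v y| <= L * `|x - y|) ->
  (forall x z, K x -> K z -> enorm (x - z) <= 1 ->
    `|v x - v z - \sum_i G i z * (x ord0 i - z ord0 i)| <= M * enorm (x - z) ^+ 2) ->
  exists m, \int[mu]_(x in K) ((v x - m) ^+ 2) <=
    80 * d ^+ 2 * \int[mu]_(x in K) (\sum_i G i x ^+ 2).
Proof.
move=> M0 vB GB mG vL vT.
have [K0|/eqP/set0P K0] := pselect (K = set0).
  by exists 0; rewrite K0 !Rintegral_set0 mulr0.
have ov (w : 'rV[R]_n -> R) : (forall x y, K x -> K y -> `|w x - w y| <= `|L| * `|x - y|) ->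
    forall s, open (K `&` [set x | s < w x]).
  move=> wL s; rewrite openE => x [Kx /= sx].
  have [e e0 He] := open_box_nbhs oK Kx.
  apply/nbhs_ballP; exists (Num.min e ((w x - s) / (`|L| + 1))) => /=.
    by rewrite lt_min e0 divr_gt0 ?subr_gt0// ltr_wpDl.
  move=> y; rewrite -ball_normE /= lt_min => /andP[ye yw].
  have Ky : K y.
    by apply: He => i; rewrite -[y ord0 i - x ord0 i]opprB normrN; have := ler_coord_norm (x - y) i; rewrite !mxE => /le_trans; apply; exact: ltW.
  split => //=; have := wL _ _ Kx Ky; rewrite ler_norml => /andP[_].
  have : `|x - y| * (`|L| + 1) < w x - s by rewrite -ltr_pdivlMr ?ltr_wpDl.
  rewrite mulrDr mulr1 mulrC; have := normr_ge0 (x - y).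
  have aux (a b c f g : R) : 0 <= b -> a + b < c - f -> c - g <= a -> f < g by lra.
  exact: aux.
have mw (w : 'rV[R]_n -> R) : (forall s, open (K `&` [set x | s < w x])) ->
    measurable_fun (K : set Rn) (w : Rn -> R).
  move=> wo _; apply: (measurability _ (RGenOInfty.measurableE R)) => // /= _ [_ [r ->] <-].
  rewrite (_ : w @^-1` _ = [set x | r < w x]); last by apply/seteqP; split => x; rewrite /= in_itv/= andbT.
  by apply: measurable_openRn; exact: wo.
have mv : measurable_fun (K : set Rn) (v : Rn -> R).
  apply: mw; apply: ov => x y Kx Ky.
  by apply: le_trans (vL _ _ Kx Ky) _; rewrite ler_wpM2r// ler_norm.
have [m [hm1 hm2]] := median_exists K0 mv vB.
exists m.
pose H x : R := Num.sqrt (\sum_i G i x ^+ 2).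
have G20 x : 0 <= \sum_i G i x ^+ 2 by apply: sumr_ge0 => i _; exact: sqr_ge0.
have HE x : H x ^+ 2 = \sum_i G i x ^+ 2 by rewrite sqr_sqrtr.
have mG2 : measurable_fun (K : set Rn) (fun x : Rn => \sum_i G i x ^+ 2).
  by apply: measurable_sum => i; apply: measurable_funX; exact: mG.
have mH : measurable_fun (K : set Rn) (H : Rn -> R).
  exact: (measurableT_comp (continuous_measurable_fun (@sqrt_continuous R)) mG2).
have B0 : 0 <= B by have [x0 Kx0] := K0; exact: le_trans (vB _ Kx0).
set B' := B + `|m| + Num.sqrt (n%:R * B ^+ 2).
have HB x : K x -> 0 <= H x <= B'.
  move=> Kx; rewrite sqrtr_ge0/= -[leLHS]add0r lerD ?addr_ge0// ler_wsqrtr//.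
  apply: (@le_trans _ _ (\sum_(i < n) B ^+ 2)).
    apply: ler_sum => i _; rewrite -real_normK ?num_real// ler_sqr ?nnegrE//; exact: GB.
  by rewrite sumr_const card_ord -[_ *+ n]mulr_natl.
have side (w : 'rV[R]_n -> R) (s : R) : `|s| = `|m| -> (forall x, K x -> `|w x| <= B) ->
    (forall s, open (K `&` [set x | s < w x])) ->
    (forall x z, K x -> K z -> enorm (x - z) <= 1 ->
      w x - w z <= H z * enorm (x - z) + M * enorm (x - z) ^+ 2) ->
    2 * fine (mu (K `&` [set x | s < w x])) <= fine (mu K) ->
    \int[mu]_(x in K) (Num.max 0 (w x - s) ^+ 2) <= 40 * d ^+ 2 * \int[mu]_(x in K) (H x ^+ 2).
  move=> sm wB wo wT hs.
  have mpw : measurable_fun (K : set Rn) ((fun x => Num.max 0 (w x - s)) : Rn -> R).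
    exact: (measurable_maxr (measurable_cst _) (measurable_funB (mw _ wo) (measurable_cst _))).
  have lvl s' : 0 <= s' -> K `&` [set x | s' < Num.max 0 (w x - s)] = K `&` [set x | s + s' < w x].
    move=> s'0; apply/seteqP; split => x [Kx /= h]; split => //=.
      by move: h; rewrite lt_max ltNge s'0/= ltrBrDl.
    by rewrite lt_max; apply/orP; right; rewrite ltrBrDl.
  apply: (poincare_onesided (B := B') M0 mpw mH _ HB).
  - move=> x Kx; rewrite le_max lexx/= ge_max; apply/andP; split.
      by rewrite !addr_ge0// sqrtr_ge0.
    rewrite -[leLHS]addr0 lerD ?sqrtr_ge0// lerD//; first exact: le_trans (ler_norm _) (wB _ Kx).
    by rewrite -sm -normrN ler_norm.
  - by move=> s' s'0; rewrite lvl.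
  - by rewrite lvl// addr0.
  - move=> t x z /andP[t0 t1] td Kx Kz xz.
    have xz0 := enorm_ge0 (x - z); have td0 : 0 < t * d by rewrite mulr_gt0.
    have Hz0 : 0 <= H z by exact: sqrtr_ge0.
    have := wT _ _ Kx Kz (le_trans xz td).
    have : H z * enorm (x - z) + M * enorm (x - z) ^+ 2 <= t * d * (H z + M * (t * d)).
      rewrite mulrDr; apply: lerD; first by rewrite mulrC ler_wpM2r.
      by rewrite [leRHS]mulrCA; apply: ler_wpM2l => //; rewrite -[leRHS]expr2; rewrite ler_sqr ?nnegrE// (ltW td0).
    have : 0 <= t * d * (H z + M * (t * d)) by rewrite mulr_ge0 ?(ltW td0)// addr_ge0// mulr_ge0// ltW.
    move: (t * d * _) (H z * _ + _) => P Q P0 QP wxz.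
    rewrite ge_max; apply/andP; split.
      by rewrite addr_ge0// le_max lexx.
    apply: (@le_trans _ _ (w z - s + P)); first by move: (w x) (w z) wxz => a b *; lra.
    by rewrite lerD2r le_max lexx orbT.
have dotE (x z : 'rV[R]_n) : \sum_i G i z * (x ord0 i - z ord0 i) = dot (\row_i G i z : 'rV[R]_n) (x - z).
  by apply: eq_bigr => i _; rewrite !mxE.
have enG z : enorm (\row_i G i z : 'rV[R]_n) = H z.
  by congr Num.sqrt; apply: eq_bigr => i _; rewrite !mxE expr2.
have dotH (x z : 'rV[R]_n) : `|\sum_i G i z * (x ord0 i - z ord0 i)| <= H z * enorm (x - z).
  rewrite dotE -enG ler_norml dot_le_enorm andbT lerNl -enormN.
  apply: le_trans (dot_le_enorm _ _); rewrite le_eqVlt; apply/orP; left; apply/eqP.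
  by rewrite /dot -sumrN; apply: eq_bigr => i _; rewrite !mxE mulNr.
have vLa (w : 'rV[R]_n -> R) : (forall x y, K x -> K y -> `|w x - w y| <= L * `|x - y|) ->
    (forall x y, K x -> K y -> `|w x - w y| <= `|L| * `|x - y|).
  by move=> wL x y Kx Ky; apply: le_trans (wL _ _ Kx Ky) _; rewrite ler_wpM2r// ler_norm.
have mvL x y : K x -> K y -> `|- v x - - v y| <= L * `|x - y|.
  by move=> Kx Ky; rewrite -opprD normrN; exact: vL.
have hm2' : 2 * fine (mu (K `&` [set x | - m < - v x])) <= fine (mu K).
  rewrite (_ : [set x | - m < - v x] = [set x | v x < m])//.
  by apply/seteqP; split => x /=; rewrite ltrN2.
have s1 := side v m erefl vB (ov _ (vLa _ vL)) _ hm1.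
have s2 := side (fun x => - v x) (- m) (normrN _) _ (ov _ (vLa _ mvL)) _ hm2'.
have aux (a b c e f : R) : `|a - b - c| <= e -> `|c| <= f -> a - b <= f + e /\ - a - - b <= f + e.
  rewrite !ler_norml => /andP[? ?] /andP[? ?]; lra.
have {}s1 := s1 (fun x z Kx Kz xz => (aux _ _ _ _ _ (vT x z Kx Kz xz) (dotH x z)).1).
have {}s2 := s2 _ (fun x z Kx Kz xz => (aux _ _ _ _ _ (vT x z Kx Kz xz) (dotH x z)).2).
have {}s2 : \int[mu]_(x in K) (Num.max 0 (- v x - - m) ^+ 2) <= 40 * d ^+ 2 * \int[mu]_(x in K) (H x ^+ 2).
  by apply: s2 => x Kx; rewrite normrN; exact: vB.
have mm (w : 'rV[R]_n -> R) s : (forall s, open (K `&` [set x | s < w x])) -> (forall x, K x -> `|w x| <= B) ->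
    mu.-integrable K (fun x => (Num.max 0 (w x - s) ^+ 2)%:E).
  move=> wo wB.
  apply: (@integrable_bounded _ _ _ _ _ mK Kfin _ ((B + `|s|) ^+ 2)).
    apply: measurable_funX.
    exact: (measurable_maxr (measurable_cst _) (measurable_funB (mw _ wo) (measurable_cst _))).
  move=> x Kx; rewrite ger0_norm ?sqr_ge0// ler_sqr ?nnegrE ?addr_ge0 ?le_max ?lexx//.
  rewrite ge_max addr_ge0//= lerD//; first exact: le_trans (ler_norm _) (wB _ Kx).
  by rewrite -normrN ler_norm.
have -> : \int[mu]_(x in K) ((v x - m) ^+ 2) =
  \int[mu]_(x in K) (Num.max 0 (v x - m) ^+ 2 + Num.max 0 (- v x - - m) ^+ 2).
  apply: eq_Rintegral => x _; have -> : - v x - - m = - (v x - m) by ring.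
  move: (v x - m) => y; have [y0|y0] := leP 0 y.
    by have /max_idPl -> : - y <= 0; rewrite ?oppr_le0// expr0n addr0.
  by have /max_idPr -> : 0 <= - y; rewrite ?oppr_ge0 ?(ltW y0)// expr0n add0r sqrrN.
rewrite RintegralD//; last 2 first.
- exact: (mm _ _ (ov _ (vLa _ vL)) vB).
- by apply: (mm _ _ (ov _ (vLa _ mvL))) => x Kx; rewrite normrN; exact: vB.
apply: le_trans (lerD s1 s2) _; rewrite -mulrDl.
have -> : \int[mu]_(x in K) (H x ^+ 2) = \int[mu]_(x in K) (\sum_i G i x ^+ 2).
  by apply: eq_Rintegral => x _; exact: HE.
rewrite le_eqVlt; apply/orP; left; apply/eqP; ring.
Qed.

End smooth_poincare.

(** * Bump functions and mollification *)

(** A quadratic remainder identifies the derivative. In this form points where two formulas are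
    glued are treated like any others. *)
Lemma is_derive_quadratic {R : realType} {V : normedModType R} (f : V -> R) (x v : V) (l C d : R) :
  0 < d -> (forall t, `|t| < d -> `|f (t *: v + x) - f x - t * l| <= C * t ^+ 2) ->
  is_derive x v f l.
Proof.
move=> d0 H.
have cv : (fun h => h^-1 *: ((f \o shift x) (h *: v) - f x)) @ 0^' --> l.
  apply/cvgrPdist_le => e e0.
  have d1 : 0 < e / (`|C| + 1) by rewrite divr_gt0// ltr_wpDl.
  near=> t.
  have t0 : t != 0 by near: t; exact: nbhs_dnbhs_neq.
  have td : `|t| < d by near: t; apply: dnbhs0_lt.
  have tC : `|t| * `|C| <= e.
    apply: (@le_trans _ _ (`|t| * (`|C| + 1))); first by rewrite ler_wpM2l// lerDl.
    by rewrite -ler_pdivlMr ?ltr_wpDl//; near: t; exact: dnbhs0_le.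
  have -> : l - t^-1 *: ((f \o shift x) (t *: v) - f x) = - (t^-1 * (f (t *: v + x) - f x - t * l)).
    by rewrite /= /GRing.scale/=; field.
  rewrite normrN normrM normfV ler_pdivrMl ?normr_gt0//.
  apply: (le_trans (H _ td)); apply: (le_trans (ler_norm _)).
  by rewrite normrM normrX expr2 mulrCA ler_wpM2l// mulrC.
by apply: DeriveDef; [apply/cvg_ex; exists l|exact: cvg_lim].
Unshelve. all: by end_near. Qed.

Section flat_function.
Context {R : realType}.

(** q^-m exp (- 1 / q), extended by 0. The family over [m] is closed under differentiation: the
    derivative is - m psi_(m+1) + psi_(m+2). Smoothness of the flat function exp (- 1 / q) thus
    needs a first derivative only. *)
Definition psi (m : nat) (q : R) : R := if 0 < q then q^-1 ^+ m * expR (- q^-1) else 0.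

Lemma psi_ge0 m q : 0 <= psi m q.
Proof.
by rewrite /psi; case: ifP => // q0; rewrite mulr_ge0 ?expR_ge0// exprn_ge0// invr_ge0 ltW.
Qed.

Lemma psi_gt0 m q : 0 < q -> 0 < psi m q.
Proof. by move=> q0; rewrite /psi q0 mulr_gt0 ?expR_gt0// exprn_gt0// invr_gt0. Qed.

Lemma psi_eq0 m q : q <= 0 -> psi m q = 0.
Proof. by rewrite /psi leNgt => /negbTE ->. Qed.

Lemma psi_le m q : psi m q <= m`!%:R.
Proof.
rewrite /psi; case: ifP => [q0|_]; last exact: ler0n.
have s0 : 0 <= q^-1 by rewrite invr_ge0 ltW.
rewrite expRN ler_pdivrMr ?expR_gt0//; case: m => [|m].
  by rewrite fact0 mul1r; apply: le_trans (expR_ge1Dx _); rewrite lerDl.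
apply: le_trans (ler_wpM2l (ler0n _ _) (expR_ge1Dxn m s0)).
by rewrite mulrDr mulrCA divff ?pnatr_eq0 -?lt0n ?fact_gt0// mulr1 mulr1 lerDr ler0n.
Qed.

Lemma psiD m k q : 0 < q -> psi m q = q ^+ k * psi (m + k) q.
Proof.
move=> q0; rewrite /psi q0 exprD [X in _ = _ * (X * _)]mulrC !mulrA [X in X * _ * _]mulrC.
by rewrite -exprMn mulVf ?gt_eqF// expr1n mul1r.
Qed.

Definition dpsi m q := - m%:R * psi m.+1 q + psi m.+2 q.

Lemma is_derive_psi m q : is_derive q (1 : R) (psi m) (dpsi m q).
Proof.
have [q0|q0] := ltP 0 q; last first.
  rewrite /dpsi !psi_eq0// mulr0 addr0.
  apply: (@is_derive_quadratic _ _ _ _ _ _ (m + 2)`!%:R 1) => // t _.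
  rewrite [psi m q]psi_eq0// mulr0 !subr0 ger0_norm ?psi_ge0//.
  have -> : t *: (1 : R^o) + q = t + q by rewrite /GRing.scale/= mulr1.
  have [tq|tq] := ltP 0 (t + q); last by rewrite psi_eq0// mulr_ge0 ?sqr_ge0 ?ler0n.
  (* With q <= 0 < t + q one has t + q <= t, and psi_m = (t + q)^2 psi_(m+2) is at most (m + 2)!
     t^2, so the derivative at [q] is 0. *)
  rewrite (psiD _ 2 tq) mulrC ler_pM ?psi_ge0 ?sqr_ge0 ?psi_le//.
  by rewrite ler_sqr ?nnegrE; lra.
have q1 : q != 0 by rewrite gt_eqF.
have dV : is_derive q (1 : R) (fun q : R => q^-1) (- q ^- 2).
  have := @is_deriveV _ id q 1 1 q1 (is_derive_id _ _).
  by rewrite /GRing.scale/= mulr1.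
have dq : is_derive q (1 : R) (fun q : R => q^-1 ^+ m * expR (- q^-1)) (dpsi m q).
  have d1 : is_derive q (1 : R) (fun q : R => expR (- q^-1)) (expR (- q^-1) * q ^- 2).
    have := @is_derive1_comp _ expR (fun q => - q^-1) q _ _ (is_derive_expR _) (is_deriveN dV).
    by rewrite opprK mulrC.
  have d2 := is_deriveX m dV.
  have -> : (fun q : R => q^-1 ^+ m * expR (- q^-1)) =
      (((fun q : R => q^-1) : R -> R^o) ^+ m) * ((fun q : R => expR (- q^-1)) : R -> R^o).
    by apply/funext => y; rewrite mulrfctE exprfctE.
  apply: (is_derive_eq (is_deriveM d2 d1)); rewrite exprfctE.
  rewrite /GRing.scale/= /dpsi /psi q0.
  case: m {d2} => [|m] /=.
    by rewrite expr0 !mul0r mulr0 addr0 oppr0 mul0r add0r mul1r mulrC exprVn.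
  rewrite -exprVn !exprS; move: (q^-1) (expR _) => s E; ring.
apply: near_eq_is_derive dq.
near=> y; rewrite /psi ifT//; near: y; exact: lt_nbhsr.
Unshelve. all: by end_near. Qed.

Lemma psi_continuous m : continuous (psi m).
Proof.
move=> x; apply: differentiable_continuous; apply/derivable1_diffP.
by have [] := is_derive_psi m x.
Qed.

Lemma psi_taylor m : exists2 C, 0 <= C & forall a b, `|psi m b - psi m a - dpsi m a * (b - a)| <= C * (b - a) ^+ 2 /\
  `|dpsi m a| <= C.
Proof.
have dle m' a : `|dpsi m' a| <= m'%:R * m'.+1`!%:R + m'.+2`!%:R.
  apply: le_trans (ler_normD _ _) _; rewrite mulNr normrN normrM.
  rewrite (ger0_norm (psi_ge0 _ _)) (ger0_norm (psi_ge0 _ _)) ger0_norm ?ler0n//.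
  by rewrite lerD ?psi_le// ler_wpM2l ?psi_le ?ler0n.
have mvt (f df : R -> R) : (forall x : R, is_derive x (1 : R) f (df x)) -> continuous f ->
    forall a b, exists2 c, `|c - a| <= `|b - a| & f b - f a = df c * (b - a).
  move=> fd fc a b; have [ab|ba] := leP a b.
    have [c] := MVT_segment ab (fun x _ => fd x) (continuous_subspaceT fc).
    rewrite in_itv/= => /andP[ac cb] E; exists c => //.
    by rewrite !ger0_norm ?subr_ge0// lerD2r.
  have [c] := MVT_segment (ltW ba) (fun x _ => fd x) (continuous_subspaceT fc).
  rewrite in_itv/= => /andP[bc ca] E; exists c; last by rewrite -opprB E; ring.
  by rewrite distrC [leRHS]distrC !ger0_norm ?subr_ge0// ?lerD2l ?lerN2// ltW.
pose K m' : R := m'%:R * m'.+1`!%:R + m'.+2`!%:R.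
have K0 m' : 0 <= K m' by rewrite addr_ge0// mulr_ge0.
have dlip a b : `|dpsi m b - dpsi m a| <= (m%:R * K m.+1 + K m.+2) * `|b - a|.
  have [c1 _ E1] := mvt _ _ (is_derive_psi m.+1) (@psi_continuous _) a b.
  have [c2 _ E2] := mvt _ _ (is_derive_psi m.+2) (@psi_continuous _) a b.
  have -> : dpsi m b - dpsi m a = - m%:R * (psi m.+1 b - psi m.+1 a) + (psi m.+2 b - psi m.+2 a).
    rewrite /dpsi; ring.
  rewrite E1 E2 mulrA -mulrDl normrM ler_wpM2r//.
  apply: le_trans (ler_normD _ _) _; rewrite normrM normrN (ger0_norm (ler0n _ m)).
  by rewrite lerD ?dle// ler_wpM2l ?dle.
exists (m%:R * K m.+1 + K m.+2 + K m); first by rewrite !addr_ge0// mulr_ge0.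
move=> a b; split; last by apply: le_trans (dle _ _) _; rewrite lerDr addr_ge0// mulr_ge0.
have [c cab ->] := mvt _ _ (is_derive_psi m) (@psi_continuous _) a b.
rewrite -mulrBl normrM -real_normK ?num_real// expr2 mulrA ler_wpM2r//.
apply: le_trans (dlip _ _) _; rewrite [leRHS]mulrDl.
apply: (@le_trans _ _ ((m%:R * K m.+1 + K m.+2) * `|b - a|)).
  by apply: ler_wpM2l => //; rewrite addr_ge0// mulr_ge0.
by rewrite lerDl mulr_ge0.
Qed.

End flat_function.

(** * Bumps as test functions *)

Section bump.
Context {R : realType} {n : nat}.
Implicit Types x y z w h : 'rV[R]_n.

Definition bump (m : nat) (e : R) w : R := psi m (1 - dot w w / e ^+ 2).

(** The gradient of the bump at [w] is this scalar times [w]. *)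
Definition bump_slope (m : nat) (e : R) w : R := dpsi m (1 - dot w w / e ^+ 2) * (- 2 / e ^+ 2).

Lemma bump_taylor m e r : 0 < e -> 0 <= r -> exists2 M, 0 <= M & forall w h, enorm w <= r -> enorm h <= r ->
  `|bump m e (w + h) - bump m e w - bump_slope m e w * dot w h| <= M * enorm h ^+ 2.
Proof.
move=> e0 r0; have [C C0 HC] := @psi_taylor R m.
have e20 : 0 < e ^+ 2 by rewrite exprn_gt0.
exists (C * (9 * r ^+ 2 / e ^+ 2 ^+ 2 + (e ^+ 2)^-1)).
  by rewrite mulr_ge0// addr_ge0 ?invr_ge0 ?(ltW e20)// divr_ge0 ?sqr_ge0// mulr_ge0 ?sqr_ge0.
move=> w h wr hr; set a := 1 - dot w w / e ^+ 2; set b := 1 - dot (w + h) (w + h) / e ^+ 2.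
have h0 := enorm_ge0 h; have w0 := enorm_ge0 w.
have ab : b - a = - (2 * dot w h + enorm h ^+ 2) / e ^+ 2.
  have := dot_sqr 1 1 w h; rewrite !scale1r /a /b sqr_enorm => ->.
  by field; rewrite gt_eqF.
have wh : `|dot w h| <= r * enorm h.
  rewrite ler_norml; apply/andP; split; last by apply: le_trans (dot_le_enorm _ _) _; rewrite ler_wpM2r.
  rewrite lerNl; have -> : - dot w h = dot (- w) h.
    by rewrite /dot -sumrN; apply: eq_bigr => i _; rewrite !mxE mulNr.
  by apply: le_trans (dot_le_enorm _ _) _; rewrite enormN ler_wpM2r.
have ab2 : (b - a) ^+ 2 <= 9 * r ^+ 2 / e ^+ 2 ^+ 2 * enorm h ^+ 2.
  have -> : 9 * r ^+ 2 / e ^+ 2 ^+ 2 * enorm h ^+ 2 = (3 * r * enorm h / e ^+ 2) ^+ 2 by rewrite !exprMn exprVn; ring.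
  have p0 : 0 <= 3 * r * enorm h / e ^+ 2 by rewrite divr_ge0 ?(ltW e20)// mulr_ge0// mulr_ge0.
  rewrite -real_normK ?num_real// ler_sqr ?nnegrE// ab normrM normrN (gtr0_norm (x := (e ^+ 2)^-1)) ?invr_gt0//.
  rewrite ler_wpM2r ?invr_ge0 ?(ltW e20)//; apply: le_trans (ler_normD _ _) _.
  rewrite normrM (gtr0_norm (x := 2))// (ger0_norm (sqr_ge0 _)).
  have : enorm h ^+ 2 <= r * enorm h by rewrite expr2 ler_wpM2r.
  by move: wh; lra.
have [E1 E2] := HC a b.
rewrite /bump -/a -/b /bump_slope -/a.
have -> : psi m b - psi m a - dpsi m a * (- 2 / e ^+ 2) * dot w h =
  (psi m b - psi m a - dpsi m a * (b - a)) - dpsi m a * (enorm h ^+ 2 / e ^+ 2).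
  by rewrite ab; field; rewrite gt_eqF.
apply: le_trans (ler_normB _ _) _.
rewrite -[leRHS]mulrA [X in _ <= _ * X]mulrDl [leRHS]mulrDr; apply: lerD.
  by apply: le_trans E1 _; apply: ler_wpM2l.
rewrite normrM [X in _ <= C * X]mulrC; apply: ler_pM => //.
by rewrite ger0_norm ?divr_ge0 ?sqr_ge0.
Qed.

Variables (e : R) (x0 : 'rV[R]_n).
Hypothesis e0 : 0 < e.

(** The algebra generated by the constants, the coordinates and all bumps of radius [e] around [x0].
    It is stable under partial derivatives and consists of continuous functions, so all its members
    are smooth. *)
Inductive bump_poly : ('rV[R]_n -> R) -> Prop :=
| bump_poly_cst c : bump_poly (fun=> c)
| bump_poly_coord j : bump_poly (fun y => (y - x0) ord0 j)
| bump_poly_bump m : bump_poly (fun y => bump m e (y - x0))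
| bump_poly_add f g : bump_poly f -> bump_poly g -> bump_poly (fun y => f y + g y)
| bump_poly_mul f g : bump_poly f -> bump_poly g -> bump_poly (fun y => f y * g y).

Lemma dot_delta w i t : dot w (t *: delta_mx ord0 i) = t * w ord0 i.
Proof.
rewrite /dot (bigD1 i)//= !mxE !eqxx mulr1 big1 ?addr0 1?mulrC// => j ji.
by rewrite !mxE (negbTE ji) andbF !mulr0.
Qed.

Lemma enorm_delta i t : enorm (t *: delta_mx ord0 i : 'rV[R]_n) = `|t|.
Proof. by rewrite /enorm dot_delta !mxE !eqxx mulr1 -expr2 sqrtr_sqr. Qed.

Lemma is_derive_coord j i y : is_derive y (delta_mx ord0 i) (fun y => (y - x0) ord0 j) (j == i)%:R.
Proof.
apply: (@is_derive_quadratic _ _ _ _ _ _ 0 1) => // t _.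
rewrite mul0r normr_le0 !mxE eqxx /=; apply/eqP; ring.
Qed.

Lemma is_derive_bump m i y : is_derive y (delta_mx ord0 i) (fun y => bump m e (y - x0))
  (bump_slope m e (y - x0) * (y - x0) ord0 i).
Proof.
set w := y - x0; have r0 : 0 <= enorm w + 1 by rewrite addr_ge0 ?enorm_ge0.
have [M M0 HM] := bump_taylor m e0 r0.
apply: (@is_derive_quadratic _ _ _ _ _ _ M 1) => // t t1.
have := HM w (t *: delta_mx ord0 i); rewrite enorm_delta dot_delta => /(_ _ _).
have -> : t *: delta_mx ord0 i + y - x0 = w + t *: delta_mx ord0 i by rewrite -addrA addrC.
rewrite -/w mulrCA real_normK ?num_real//; apply; first by rewrite lerDl.
by apply: le_trans (ltW t1) _; rewrite lerDr enorm_ge0.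
Qed.

Lemma bump_poly_derive i f : bump_poly f ->
  exists2 f', bump_poly f' & forall y, is_derive y (delta_mx ord0 i) f (f' y).
Proof.
elim => [c|j|m|{}f g _ [f' Pf' df] _ [g' Pg' dg]|{}f g Pf [f' Pf' df] Pg [g' Pg' dg]].
- by exists (fun=> 0) => [|y]; [exact: bump_poly_cst|exact: is_derive_cst].
- exists (fun=> (j == i)%:R) => [|y]; [exact: bump_poly_cst|exact: is_derive_coord].
- exists (fun y => (- m%:R * bump m.+1 e (y - x0) + bump m.+2 e (y - x0)) * (- 2 / e ^+ 2) * (y - x0) ord0 i).
    do !apply: bump_poly_mul; try exact: bump_poly_cst; last exact: bump_poly_coord.
    apply: bump_poly_add; last exact: bump_poly_bump.
    by apply: bump_poly_mul; [exact: bump_poly_cst|exact: bump_poly_bump].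
  by move=> y; exact: is_derive_bump.
- by exists (fun y => f' y + g' y) => [|y]; [exact: bump_poly_add|exact: is_deriveD].
- exists (fun y => f y * g' y + g y * f' y) => [|y]; last exact: is_deriveM.
  by apply: bump_poly_add; exact: bump_poly_mul.
Qed.

Lemma bump_poly_continuous f : bump_poly f -> continuous f.
Proof.
have cc j : continuous (fun y : 'rV[R]_n => (y - x0) ord0 j).
  move=> y; rewrite (_ : (fun y : 'rV[R]_n => _) = (fun y : 'rV[R]_n => y ord0 j - x0 ord0 j)); last first.
    by apply/funext => z; rewrite !mxE.
  have h := @coord_continuous R 1 n ord0 j y.
  exact: (cvgB h (cvg_cst _)).
elim => [c|j|m|{}f g _ cf _ cg|{}f g _ cf _ cg] y; rewrite /continuous_at.
- exact: cst_continuous.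
- exact: cc.
- apply: (@continuous_comp _ _ _ (fun y : 'rV[R]_n => 1 - dot (y - x0) (y - x0) / e ^+ 2) (psi m)); last exact: psi_continuous.
  have cd : continuous (fun y : 'rV[R]_n => dot (y - x0) (y - x0)).
    rewrite /dot; apply: continuous_big => [|i _ z]; first exact: add_continuous.
    exact: (cvgM (cc i z) (cc i z)).
  have c1 : (fun=> 1 : R) @ y --> (1 : R) by exact: cst_continuous.
  exact: (cvgB c1 (cvgMr_tmp (cd y))).
- exact: (cvgD (cf y) (cg y)).
- exact: (cvgM (cf y) (cg y)).
Qed.

Lemma bump_poly_smooth f : bump_poly f -> smooth_on setT f.
Proof.
move=> Pf s y _; have Ps : bump_poly (foldr (@partial R n) f s).
  elim: s => //= i s IH; have [f' Pf' df] := bump_poly_derive i IH.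
  rewrite (_ : partial i _ = f')//; apply/funext => z; rewrite /partial.
  by have [_] := df z.
split; first exact: bump_poly_continuous.
by move=> i; have [f' _ df] := bump_poly_derive i Ps; have [] := df y.
Qed.

Lemma bump_eq0 m w : e <= enorm w -> bump m e w = 0.
Proof.
move=> ew; apply: psi_eq0; rewrite subr_le0 ler_pdivlMr ?exprn_gt0// mul1r -sqr_enorm.
by rewrite ler_sqr ?nnegrE ?enorm_ge0// ltW.
Qed.

(** The Euclidean ball of radius [e] lies in the cube of half-side [e], which serves as the compact
    support inside [D]. *)
Lemma test_function_bump (D : set 'rV[R]_n) : (forall y, (forall i, `|y ord0 i - x0 ord0 i| <= e) -> D y) ->
  test_function D (fun y => bump 0 e (y - x0)).
Proof.
move=> eD; split; first exact/bump_poly_smooth/bump_poly_bump.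
exists [set y : 'rV[R]_n | forall i, [set` `[x0 ord0 i - e, x0 ord0 i + e]] (y ord0 i)]; split.
- apply: (@rV_compact R n (fun i => [set` `[x0 ord0 i - e, x0 ord0 i + e]])) => i; exact: segment_compact.
- move=> y /= H; apply: eD => i; have := H i; rewrite in_itv/= ler_norml => /andP[h1 h2]; lra.
- move=> y /= H; apply: bump_eq0; rewrite leNgt; apply/negP => yx; apply: H => i.
  rewrite in_itv/=; have := le_lt_trans (ler_coord_enorm (y - x0) i) yx.
  by rewrite !mxE ltr_norml => /andP[h1 h2]; lra.
Qed.

Lemma partial_bump m i y : partial i (fun y => bump m e (y - x0)) y =
  bump_slope m e (y - x0) * (y - x0) ord0 i.
Proof. by rewrite /partial; have [_] := is_derive_bump m i y. Qed.

End bump.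

Lemma le_integral_EFin {d} {T : measurableType d} {R : realType} (mu : {measure set T -> \bar R}) (D : set T)
  (f g : T -> R) : measurable D -> measurable_fun D f -> measurable_fun D g -> (forall x, D x -> 0 <= f x) ->
  (forall x, D x -> f x <= g x) -> (\int[mu]_(x in D) (f x)%:E <= \int[mu]_(x in D) (g x)%:E)%E.
Proof.
move=> mD mf mg f0 fg; apply: ge0_le_integral => //; exact/measurable_EFinP.
Qed.

Lemma ip_sqrD2 {d} {T : measurableType d} {R : realType} (mu : {measure set T -> \bar R}) (D : set T)
  (u v : T -> R^o) : measurable D -> sqint mu D u -> sqint mu D v ->
  ip mu D (u + v) (u + v) <= 2 * ip mu D u u + 2 * ip mu D v v.
Proof.
move=> mD su sv.
have := @form_parallelogram R (T -> R^o) (sqint mu D) (ip mu D)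
  (@sqint_lin _ _ _ mu D mD) (fun u v _ _ => ipC mu D u v) (@ip_lin _ _ _ mu D mD) u v su sv.
have := ip_ge0 mu D (u - v); lra.
Qed.

Lemma measurable_continuousRn {R : realType} {n} (f : 'rV[R]_n -> R) (D : set (lebesgueRn R n)) :
  continuous f -> measurable_fun D (f : lebesgueRn R n -> R).
Proof.
move=> cf; apply: measurable_funTS.
move=> _; apply: (measurability _ (RGenOInfty.measurableE R)) => // /= _ [_ [r ->] <-].
rewrite setTI; apply: measurable_openRn; apply: open_comp => // x _; exact: cf.
Qed.

(** * Mollification *)

Section mollifier.
Context {R : realType} {n : nat}.
Local Notation mu := (@vol R n).
Local Notation Rn := (lebesgueRn R n).

Definition kern (e : R) (x y : 'rV[R]_n) : R := bump 0 e (y - x).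

Definition bump_mass (e : R) : R := \int[mu]_y bump 0 e y.

Lemma kern_ge0 e x y : 0 <= kern e x y. Proof. exact: psi_ge0. Qed.

Lemma kern_le1 e x y : kern e x y <= 1.
Proof. by have := @psi_le R 0 (1 - dot (y - x) (y - x) / e ^+ 2); rewrite fact0. Qed.

Lemma kernC e x y : kern e x y = kern e y x.
Proof.
rewrite /kern /bump; do 4 f_equal; rewrite /dot; apply: eq_bigr => i _; rewrite !mxE; ring.
Qed.

Lemma measurable_kern e x (D : set Rn) : measurable_fun D (kern e x : Rn -> R).
Proof.
by apply: measurable_continuousRn; apply: (@bump_poly_continuous _ _ e x); exact: bump_poly_bump.
Qed.

Lemma bounded_enorm_ball (x : 'rV[R]_n) r : bounded_set [set y | enorm (y - x) < r].
Proof.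
exists (r + `|x|); split; first exact: num_real.
move=> M rM y /= yr; rewrite -[y](subrK x); apply: le_trans (ler_normD _ _) _.
by apply: le_trans (ltW rM); rewrite lerD2r (le_trans (norm_le_enorm _))// ltW.
Qed.

Lemma open_enorm_ball (x : 'rV[R]_n) (r : R) : open [set y | enorm (y - x) < r].
Proof.
rewrite openE => y /= yr.
have n0 : 0 < n%:R + 1 :> R by rewrite ltr_wpDl.
apply/nbhs_ballP; exists ((r - enorm (y - x)) / (n%:R + 1)) => /=.
  by rewrite divr_gt0// subr_gt0.
move=> z; rewrite -ball_normE /= distrC ltr_pdivlMr// => yz /=.
have -> : z - x = (z - y) + (y - x) by rewrite addrA subrK.
apply: le_lt_trans (enormD _ _) _; rewrite -ltrBrDr; apply: le_lt_trans (enorm_le_norm _) _.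
by apply: le_lt_trans yz; rewrite mulrC; apply: ler_wpM2l; rewrite ?lerDl.
Qed.

Section fixed_radius.
Variables (e : R).
Hypothesis e0 : 0 < e.

Lemma kern_eq0 (x y : 'rV[R]_n) : e <= enorm (y - x) -> kern e x y = 0.
Proof. exact: bump_eq0. Qed.

Lemma kern_gt0 (x y : 'rV[R]_n) : enorm (y - x) < e -> 0 < kern e x y.
Proof.
move=> yx; apply: psi_gt0; rewrite subr_gt0 ltr_pdivrMr ?exprn_gt0// mul1r -sqr_enorm.
by rewrite ltr_sqr ?nnegrE ?enorm_ge0// ltW.
Qed.

Lemma integral_kern (x : 'rV[R]_n) : (\int[mu]_y (kern e x y)%:E = \int[mu]_y (kern e 0 y)%:E)%E.
Proof.
have := @ge0_integral_homothety R n 1 (- x) setT (fun y => (kern e 0 y)%:E) ltr01 measurableT.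
rewrite preimage_setT expr1n invr1 mul1e => <-.
- apply: eq_integral => y _; congr EFin; rewrite /kern /homothety scale1r subr0//.
- by apply/measurable_EFinP; exact: measurable_kern.
- by move=> y _; rewrite lee_fin kern_ge0.
Qed.

Lemma kern_integral_lt : (\int[mu]_y (kern e 0 y)%:E < +oo)%E.
Proof.
pose B : set Rn := [set y | enorm (y - 0) < e].
have mB : measurable B by apply: measurable_openRn; exact: open_enorm_ball.
apply: (@le_lt_trans _ _ (\int[mu]_y (\1_B y)%:E)%E).
  have mI : measurable_fun (setT : set Rn) (\1_B : Rn -> R) by exact: measurable_indic.
  apply: (@le_integral_EFin _ Rn _ mu setT (kern e 0) (\1_B) measurableT (@measurable_kern e 0 setT) mI).
  - by move=> y _; rewrite kern_ge0.
  - move=> y _; rewrite indicE; have [|] := boolP (y \in B); first by rewrite kern_le1.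
    by move/negP; rewrite inE /B /= => /negP; rewrite -leNgt => /kern_eq0 ->.
rewrite integral_indic// setIT; apply: vol_bounded; exact: bounded_enorm_ball.
Qed.

Lemma bump_massE (x : 'rV[R]_n) : (\int[mu]_y (kern e x y)%:E = (bump_mass e)%:E)%E.
Proof.
rewrite integral_kern /bump_mass /Rintegral fineK.
  by apply: eq_integral => y _; rewrite /kern subr0.
rewrite ge0_fin_numE; last by apply: integral_ge0 => y _; rewrite lee_fin psi_ge0.
have -> : (\int[mu]_y (bump 0 e y)%:E)%E = (\int[mu]_y (kern e 0 y)%:E)%E; last exact: kern_integral_lt.
by apply: eq_integral => y _; rewrite /kern subr0.
Qed.

Lemma bump_mass_gt0 : 0 < bump_mass e.
Proof.
rewrite -lte_fin -(bump_massE 0) lt_neqAle; apply/andP; split; last first.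
  by apply: integral_ge0 => y _; rewrite lee_fin kern_ge0.
apply/negP => /eqP/esym I0.
have mk : measurable_fun (setT : set Rn) (fun y : Rn => (kern e 0 y)%:E).
  by apply/measurable_EFinP; exact: measurable_kern.
have : ae_eq mu setT (fun y : Rn => (kern e 0 y)%:E) (cst 0%E).
  apply: (ae_eq_integral_abs mu measurableT mk).1; rewrite -[RHS]I0; apply: eq_integral => y _.
  by rewrite gee0_abs// lee_fin kern_ge0.
move=> [N [mN N0 HN]].
have ne : [set y : 'rV[R]_n | enorm (y - 0) < e] !=set0 by exists 0; rewrite /= subrr enorm0.
have := vol_open_gt0 (@open_enorm_ball 0 e) ne; apply/negP; rewrite -leNgt -N0.
apply: (le_outer_measure (@lebesgue_outer R n)); apply: subset_trans HN => y /= ye H.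
by have := kern_gt0 ye; have [->] := H Logic.I; rewrite ltxx.
Qed.

End fixed_radius.

Section mollification.
Variable D : set 'rV[R]_n.
Hypotheses (oD : open D) (bD : bounded_set D).

Let mD : measurable (D : set Rn). Proof. exact: measurable_openRn. Qed.
Let Dfin : (mu D < +oo)%E. Proof. exact: vol_bounded. Qed.

Local Notation sq := (sqint mu D).
Local Notation ip := (ip mu D).

Lemma sqint_bounded (f : 'rV[R]_n -> R) C : measurable_fun (D : set Rn) (f : Rn -> R) ->
  (forall x, D x -> `|f x| <= C) -> sq f.
Proof.
move=> mf fC; split => //.
apply: (@le_lt_trans _ _ (\int[mu]_(x in D) (C ^+ 2)%:E)%E).
  apply: (@le_integral_EFin _ Rn _ mu D (fun x => f x ^+ 2) (fun=> C ^+ 2) mD (measurable_funX 2 mf) (measurable_cst _)) => [x _|x Dx]; first exact: sqr_ge0.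
  rewrite -real_normK ?num_real// ler_sqr ?nnegrE ?fC//.
  exact: le_trans (normr_ge0 _) (fC _ Dx).
by rewrite integral_cst// ltey_eq fin_numM// ge0_fin_numE.
Qed.

Lemma sqint_ip1 (u : 'rV[R]_n -> R) : sq u -> mu.-integrable D (EFin \o u).
Proof.
move=> su; have s1 : sq (fun=> 1).
  by apply: (@sqint_bounded _ 1) => [|x _]; [exact: measurable_cst|rewrite normr1].
have := integrable_sqintM mD su s1; congr integrable; apply/funext => x /=; by rewrite mulr1.
Qed.

Lemma ip_bound (u f : 'rV[R]_n -> R) C : sq u -> measurable_fun (D : set Rn) (f : Rn -> R) ->
  (forall x, D x -> `|f x| <= C) -> `|ip u f| <= C * \int[mu]_(x in D) `|u x|.
Proof.
move=> su mf fC; have sf := sqint_bounded mf fC.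
have iuf := integrable_sqintM mD su sf; have iu := sqint_ip1 su.
apply: le_trans (le_normr_Rintegral mD iuf) _.
rewrite -RintegralZl//; last exact: integrable_norm.
apply: le_Rintegral => //.
- exact: (integrable_norm iuf).
- exact: (integrableZl mD C (integrable_norm iu)).
- by move=> x Dx; rewrite normrM mulrC ler_wpM2r// fC.
Qed.

Lemma sqint_kern e x : sq (kern e x).
Proof.
apply: (@sqint_bounded _ 1); first exact: measurable_kern.
by move=> y _; rewrite ger0_norm ?kern_ge0 ?kern_le1.
Qed.

(** Convolution with the normalized kernel of the function equal to [u] on [D] and to 0
    elsewhere. *)
Definition mollify (e : R) (u : 'rV[R]_n -> R) (x : 'rV[R]_n) : R := (bump_mass e)^-1 * ip u (kern e x).

Lemma mollify_lin e (a : R) (u v : 'rV[R]_n -> R^o) x : sq u -> sq v ->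
  mollify e (a *: u + v) x = a * mollify e u x + mollify e v x.
Proof.
move=> su sv; rewrite /mollify (ip_lin mD _ su sv (sqint_kern e x)) mulrDr; congr (_ + _).
by rewrite mulrCA.
Qed.

Section fixed_radius.
Variables (e : R).
Hypothesis e0 : 0 < e.
Let c := bump_mass e.
Let c0 : 0 < c. Proof. exact: bump_mass_gt0. Qed.

Lemma integrable_sqr_kern (u : 'rV[R]_n -> R) x : sq u -> mu.-integrable D (fun y => (u y ^+ 2 * kern e x y)%:E).
Proof.
move=> su; have iu := sqint_integrable su.
apply: (le_integrable mD _ _ iu).
  apply/measurable_EFinP; apply: measurable_funM; first by apply: measurable_funX; case: su.
  exact: measurable_kern.
move=> y Dy /=; by rewrite lee_fin normrM (ger0_norm (kern_ge0 _ _ _)) ger0_norm ?sqr_ge0// ler_piMr ?sqr_ge0 ?kern_le1.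
Qed.

Lemma int_kern_le x : \int[mu]_(y in D) kern e x y <= c.
Proof.
have E : (\int[mu]_(y in D) kern e x y)%:E = (\int[mu]_(y in D) (kern e x y)%:E)%E.
  by rewrite /Rintegral fineK//; exact: (integrable_fin_num mD (sqint_ip1 (sqint_kern e x))).
rewrite -lee_fin E /c -(bump_massE e0 x).
have mk : measurable_fun setT (fun y : Rn => (kern e x y)%:E).
  by apply/measurable_EFinP; exact: measurable_kern.
have k0 (y : Rn) : setT y -> (0 <= (kern e x y)%:E)%E by move=> _; rewrite lee_fin kern_ge0.
exact: (ge0_subset_integral mu mD measurableT mk k0 (@subsetT _ _)).
Qed.

(* Jensen's inequality for the probability density [kern e x / c]. *)
Lemma mollify_sqr (u : 'rV[R]_n -> R) x : sq u ->
  mollify e u x ^+ 2 <= c^-1 * \int[mu]_(y in D) (u y ^+ 2 * kern e x y).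
Proof.
move=> su; set t := mollify e u x; set A := Rintegral mu D _.
have B : ip u (kern e x) = c * t by rewrite /t /mollify mulrA divff ?mul1r// gt_eqF.
have i1 := integrable_sqr_kern x su.
have i2 := integrable_sqintM mD su (sqint_kern e x).
have i3 := sqint_ip1 (sqint_kern e x).
have iZ a f : mu.-integrable D (fun x => (f x)%:E) -> mu.-integrable D (fun x => (a * f x)%:E).
  by move=> fi; under eq_fun do rewrite EFinM; exact: integrableZl.
have iD f g : mu.-integrable D (fun x => (f x)%:E) -> mu.-integrable D (fun x => (g x)%:E) ->
   mu.-integrable D (fun x => (f x + g x)%:E).
  by move=> fi gi; under eq_fun do rewrite EFinD; exact: integrableD.
have : 0 <= \int[mu]_(y in D) (u y ^+ 2 * kern e x y + ((- 2 * t) * (u y * kern e x y) + t ^+ 2 * kern e x y)).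
  apply: Rintegral_ge0 => y _.
  have -> : u y ^+ 2 * kern e x y + ((- 2 * t) * (u y * kern e x y) + t ^+ 2 * kern e x y) =
    (u y - t) ^+ 2 * kern e x y by ring.
  by rewrite mulr_ge0 ?sqr_ge0 ?kern_ge0.
rewrite (RintegralD mD i1 (iD _ _ (iZ _ _ i2) (iZ _ _ i3))) (RintegralD mD (iZ _ _ i2) (iZ _ _ i3)).
rewrite (RintegralZl _ mD i2) (RintegralZl _ mD i3) -/A.
have -> : \int[mu]_(x0 in D) (u x0 * kern e x x0) = c * t by exact: B.
move=> H; rewrite ler_pdivlMl//.
have := ler_wpM2l (sqr_ge0 t) (int_kern_le x); move: H; lra.
Qed.

Definition dkern i (z y : 'rV[R]_n) : R := bump_slope 0 e (y - z) * (y - z) ord0 i.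

Lemma dkern_continuous i z : continuous (dkern i z).
Proof.
have [f' Pf' df] := bump_poly_derive e0 i (bump_poly_bump e z 0).
rewrite (_ : dkern i z = f'); first exact: bump_poly_continuous Pf'.
by apply/funext => y; have [_ <-] := df y; rewrite -[RHS]/(partial i _ y) partial_bump.
Qed.

(** The derivative falls on the kernel, so this makes sense for every square integrable [u]. [dkern]
    is the derivative in the integration variable, whence the sign. *)
Definition mollify_grad (u : 'rV[R]_n -> R) i z : R := - c^-1 * ip u (dkern i z).

Lemma dkern_bound : exists C, forall i z y, D z -> D y -> `|dkern i z y| <= C.
Proof.
have [r Hr] : exists r, forall y z, D y -> D z -> enorm (y - z) <= r.
  have [M [_ HM]] := bD; exists (n%:R * (2 * (M + 1))) => y z Dy Dz.
  apply: le_trans (enorm_le_norm _) _; rewrite ler_wpM2l//; apply: le_trans (ler_normB _ _) _.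
  have M1 : M < M + 1 by rewrite ltrDl.
  have := HM _ M1 _ Dy; have := HM _ M1 _ Dz; rewrite /=; lra.
have [C C0 HC] := @psi_taylor R 0.
exists (C * (2 / e ^+ 2) * r) => i z y Dz Dy; rewrite normrM; apply: ler_pM => //; last first.
  exact: le_trans (ler_coord_enorm _ _) (Hr _ _ Dy Dz).
rewrite /bump_slope normrM mulNr normrN; apply: ler_pM => //; first exact: (HC _ 0).2.
by rewrite ger0_norm// divr_ge0// sqr_ge0.
Qed.

Lemma sqint_dkern i z : D z -> sq (dkern i z).
Proof.
move=> Dz; have [C HC] := dkern_bound.
by apply: (@sqint_bounded _ C) => [|y Dy]; [exact/measurable_continuousRn/dkern_continuous|exact: HC].
Qed.

Lemma mollify_grad_bound u : sq u -> exists C, forall i z, D z -> `|mollify_grad u i z| <= C.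
Proof.
move=> su; have [C HC] := dkern_bound.
exists (c^-1 * (C * \int[mu]_(x in D) `|u x|)) => i z Dz.
rewrite /mollify_grad normrM normrN (gtr0_norm (x := c^-1)) ?invr_gt0//.
apply: ler_wpM2l; first by rewrite invr_ge0 ltW.
by apply: ip_bound => // [|y Dy]; [exact/measurable_continuousRn/dkern_continuous|exact: HC].
Qed.

(** The Taylor expansion of the kernel has a remainder that is uniform over the bounded set [D];
    integration against [u] transfers it. This is the form in which [poincare_smooth] asks for a
    gradient. *)
Lemma mollify_taylor u : sq u -> exists2 M, 0 <= M & forall x z, D x -> D z ->
  `|mollify e u x - mollify e u z - \sum_i mollify_grad u i z * (x ord0 i - z ord0 i)| <= M * enorm (x - z) ^+ 2.
Proof.
move=> su.
have [r r0 Hr] : exists2 r, 0 <= r & forall y z, D y -> D z -> enorm (y - z) <= r.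
  have [M [_ HM]] := bD; exists (n%:R * (2 * `|M + 1|)) => [|y z Dy Dz]; first by rewrite !mulr_ge0.
  apply: le_trans (enorm_le_norm _) _; rewrite ler_wpM2l//; apply: le_trans (ler_normB _ _) _.
  have M1 : M < M + 1 by rewrite ltrDl.
  have := HM _ M1 _ Dy; have := HM _ M1 _ Dz; have := ler_norm (M + 1); rewrite /=; lra.
have [M M0 HM] := @bump_taylor R n 0 e r e0 r0.
have I0 : 0 <= \int[mu]_(x in D) `|u x| by apply: Rintegral_ge0.
have ci : 0 <= c^-1 by rewrite invr_ge0 ltW.
exists (c^-1 * (M * \int[mu]_(x in D) `|u x|)); first by rewrite !mulr_ge0.
move=> x z Dx Dz.
pose s : 'rV[R]_n -> R^o := \sum_i (x ord0 i - z ord0 i) *: (dkern i z : 'rV[R]_n -> R^o).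
have sdk i : sq (dkern i z) by exact: sqint_dkern.
have ss : sq s.
  by apply: (big_ind (fun f => sq f)) => [|f g sf sg|i _]; [exact: sqint0|exact: sqintD|exact: sqintZ].
pose f : 'rV[R]_n -> R^o := (kern e x : 'rV[R]_n -> R^o) - kern e z + s.
have sE y : s y = bump_slope 0 e (y - z) * dot (y - z) (x - z).
  rewrite /s fct_sumE /dot mulr_sumr; apply: eq_bigr => i _.
  change ((x ord0 i - z ord0 i) * dkern i z y = bump_slope 0 e (y - z) * ((y - z) ord0 i * (x - z) ord0 i)).
  by rewrite /dkern !mxE; ring.
have -> : mollify e u x - mollify e u z - \sum_i mollify_grad u i z * (x ord0 i - z ord0 i) = c^-1 * ip u f.
  have sx := sqint_kern e x; have sz := sqint_kern e z.
  rewrite ipC /f -[X in X + s]scale1r (ip_lin mD _ (sqintB mD sx sz) ss su) mul1r.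
  have -> : (kern e x : 'rV[R]_n -> R^o) - kern e z = (-1) *: (kern e z : 'rV[R]_n -> R^o) + kern e x.
    by rewrite scaleN1r addrC.
  rewrite (ip_lin mD _ sz sx su) /s.
  rewrite (@form_sum R ('rV[R]_n -> R^o) sq ip (sqint0 mu D) (sqint_lin mD) (ip_lin mD))//.
  rewrite /mollify /mollify_grad ![ip u _]ipC mulrDr mulrDr mulr_sumr -sumrN.
  congr (_ + _); first by rewrite mulN1r mulrN addrC.
  by apply: eq_bigr => i _; rewrite [ip u _]ipC; ring.
rewrite normrM (ger0_norm ci) -mulrA ler_wpM2l// mulrAC mulrC.
rewrite [leRHS]mulrC; apply: ip_bound => //.
  by have [] : sq f by apply: sqintD => //; apply: sqintB => //; exact: sqint_kern.
move=> y Dy; change (`|kern e x y - kern e z y + s y| <= M * enorm (x - z) ^+ 2); rewrite sE.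
have := HM (y - z) (z - x) (Hr _ _ Dy Dz) (Hr _ _ Dz Dx).
have -> : dot (y - z) (z - x) = - dot (y - z) (x - z).
  by rewrite /dot -sumrN; apply: eq_bigr => i _; rewrite !mxE; ring.
by rewrite addrA subrK [enorm (z - x)]enorm_distC /kern mulrN opprK.
Qed.

End fixed_radius.
End mollification.
End mollifier.

(** Outer regularity: the boxes of a nearly optimal cover are enlarged to open ones. *)
Lemma lebesgue_outer_open {R : realType} {n} (A : set 'rV[R]_n) (e : R) : 0 < e ->
  (lebesgue_outer A < +oo)%E -> exists O, [/\ open O, A `<=` O & (lebesgue_outer O <= lebesgue_outer A + e%:E)%E].
Proof.
move=> e0 Afin.
have Afn : lebesgue_outer A \is a fin_num by rewrite ge0_fin_numE// outer_measure_ge0.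
have e20 : 0 < e / 2 by rewrite divr_gt0.
have [_ [B AB <-] HB] := lb_ereal_inf_adherent e20 Afn.
pose ek (k : nat) : R := e / 2 / (2 ^ k.+1)%:R.
have ek0 k : 0 < ek k by rewrite divr_gt0// ltr0n expn_gt0.
have /choice[d Hd] (k : nat) : exists d : R, 0 < d /\
    oapp (fun b => box_volume (enlarge d b)) 0 (B k) <= oapp (@box_volume R n) 0 (B k) + ek k.
  case: (B k) => [b|] /=; last by exists 1; rewrite add0r ltW.
  have /cvgrPdist_le /(_ _ (ek0 k)) H := cvg_at_right_filter (@box_volume_enlarge R n b).
  have pos : \forall d \near (0 : R)^'+, 0 < d by exact: nbhs_right_gt.
  have [d [d0 Hd]] := @filter_ex _ _ (at_right_proper_filter (0 : R)) _ (filterI pos H).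
  exists d; split => //; move: Hd; rewrite ler_norml => /andP[Hd _]; lra.
pose I k : set 'rV[R]_n := oapp (fun b : 'rV[R]_n * 'rV[R]_n =>
  [set x : 'rV[R]_n | forall i, (enlarge (d k) b).1 ord0 i < x ord0 i < (enlarge (d k) b).2 ord0 i]) set0 (B k).
exists (\bigcup_k I k); split.
- by apply: bigcup_open => k _; rewrite /I; case: (B k) => [b|] /=; [exact: box_open|exact: open0].
- move=> x /AB [k _ Bx]; exists k => //; move: Bx; rewrite /I; case: (B k) => [b|]//= bx i.
  have [d0 _] := Hd k; have /andP[h1 h2] := bx i; rewrite !mxE; apply/andP; split; lra.
- apply: le_trans (outer_measure_sigma_subadditive (@lebesgue_outer R n) I) _.
  have I_le k : (lebesgue_outer (I k) <= (oapp (@box_volume R n) 0 (B k))%:E + (ek k)%:E)%E.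
    apply: (@le_trans _ _ (oapp (fun b => box_volume (enlarge (d k) b)) 0 (B k))%:E); last first.
      by rewrite -EFinD lee_fin; have [] := Hd k.
    rewrite /I; case: (B k) => [b|] /=; last by rewrite outer_measure0.
    rewrite -lebesgue_outer_box; apply: (le_outer_measure (@lebesgue_outer R n)) => x /= H i.
    by have /andP[h1 h2] := H i; rewrite !ltW.
  apply: le_trans (lee_nneseries _ (fun k _ => I_le k)) _; first by move=> *; exact: (outer_measure_ge0 (@lebesgue_outer R n)).
  have ov0 k : (0 <= (oapp (@box_volume R n) 0 (B k))%:E)%E.
    by case: (B k) => [b|] //=; rewrite lee_fin box_volume_ge0.
  apply: le_trans (epsilon_trick xpredT ov0 (ltW e20)) _.
  have := leeD (ltW HB) (lexx (e / 2)%:E); rewrite -addeA -EFinD -splitr; exact.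
Qed.

(** * Convergence of mollifications in L^2 *)

Section mollify_approximation.
Context {R : realType} {n : nat}.
Local Notation mu := (@vol R n).
Local Notation Rn := (lebesgueRn R n).
Variable D : set 'rV[R]_n.
Hypotheses (oD : open D) (bD : bounded_set D).

Let mD : measurable (D : set Rn). Proof. exact: measurable_openRn. Qed.
Let Dfin : (mu D < +oo)%E. Proof. exact: vol_bounded. Qed.
Local Notation sq := (sqint mu D).
Local Notation ip := (ip mu D).
Local Notation mol := (mollify D).

Lemma measurable_lipschitz (w : 'rV[R]_n -> R) L : (forall x y, D x -> D y -> `|w x - w y| <= L * `|x - y|) ->
  measurable_fun (D : set Rn) (w : Rn -> R).
Proof.
move=> wL _; apply: (measurability _ (RGenOInfty.measurableE R)) => // /= _ [_ [s ->] <-].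
apply: measurable_openRn; rewrite openE => x [Kx]; rewrite /= in_itv/= andbT => sx.
have [e e0 He] := open_box_nbhs oD Kx.
apply/nbhs_ballP; exists (Num.min e ((w x - s) / (`|L| + 1))) => /=.
  by rewrite lt_min e0 divr_gt0 ?subr_gt0// ltr_wpDl.
move=> y; rewrite -ball_normE /= lt_min => /andP[ye yw].
have Ky : D y.
  apply: He => i; rewrite -[y ord0 i - x ord0 i]opprB normrN.
  by have := ler_coord_norm (x - y) i; rewrite !mxE => /le_trans; apply; exact: ltW.
split => //=; rewrite in_itv/= andbT; have := wL _ _ Kx Ky; rewrite ler_norml => /andP[_].
have : `|L| * `|x - y| + `|x - y| < w x - s.
  by rewrite -[X in _ + X]mul1r -mulrDl mulrC -ltr_pdivlMr ?ltr_wpDl.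
have : L * `|x - y| <= `|L| * `|x - y| by apply: ler_wpM2r (ler_norm _).
have := normr_ge0 (x - y).
have aux (a b c f g h : R) : 0 <= b -> h <= a -> a + b < c - f -> c - g <= h -> f < g by lra.
exact: aux.
Qed.

Section fixed_radius.
Variable e : R.
Hypothesis e0 : 0 < e.
Let c := bump_mass (n := n) e.
Let c0 : 0 < c. Proof. exact: bump_mass_gt0. Qed.

Lemma mollify_lipschitz u : sq u -> exists L, forall x y, D x -> D y -> `|mol e u x - mol e u y| <= L * `|x - y|.
Proof.
move=> su; have [C HC] := mollify_grad_bound oD bD e0 su; have [M M0 HM] := mollify_taylor oD bD e0 su.
have [r r0 Hr] : exists2 r, 0 <= r & forall y z, D y -> D z -> `|y - z| <= r.
  have [N [_ HN]] := bD; exists (2 * `|N + 1|) => [|y z Dy Dz]; first by rewrite mulr_ge0.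
  apply: le_trans (ler_normB _ _) _; have N1 : N < N + 1 by rewrite ltrDl.
  have := HN _ N1 _ Dy; have := HN _ N1 _ Dz; have := ler_norm (N + 1); rewrite /=; lra.
exists (n%:R * C + M * n%:R ^+ 2 * r) => x y Dx Dy.
set S := \sum_i mollify_grad D e u i y * (x ord0 i - y ord0 i).
have -> : mol e u x - mol e u y = S + (mol e u x - mol e u y - S) by rewrite [RHS]addrC subrK.
apply: le_trans (ler_normD _ _) _; rewrite mulrDl; apply: lerD.
  apply: le_trans (ler_norm_sum _ _ _) _.
  apply: (@le_trans _ _ (\sum_(i < n) C * `|x - y|)).
    apply: ler_sum => i _; rewrite normrM; apply: ler_pM => //; first exact: HC.
    by have := ler_coord_norm (x - y) i; rewrite !mxE.
  by rewrite sumr_const card_ord -[_ *+ n]mulr_natl mulrA.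
apply: le_trans (HM _ _ Dx Dy) _; rewrite -!mulrA; apply: ler_wpM2l => //.
apply: (@le_trans _ _ ((n%:R * `|x - y|) ^+ 2)).
  by rewrite ler_sqr ?nnegrE ?enorm_ge0 ?mulr_ge0// enorm_le_norm.
rewrite exprMn expr2 -mulrA; do 2 apply: ler_wpM2l => //.
rewrite [leLHS]expr2; apply: ler_wpM2r => //; exact: Hr.
Qed.

Lemma measurable_mollify u : sq u -> measurable_fun (D : set Rn) (mol e u : Rn -> R).
Proof. by move=> su; have [L HL] := mollify_lipschitz su; exact: measurable_lipschitz HL. Qed.

Lemma measurable_kern2 : measurable_fun setT (fun z : Rn * Rn => kern e z.1 z.2).
Proof.
rewrite /kern /bump; apply: (@measurableT_comp _ _ _ _ _ _ (psi 0) _ (fun z : Rn * Rn => 1 - dot (z.2 - z.1) (z.2 - z.1) / e ^+ 2)).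
  exact: continuous_measurable_fun (@psi_continuous R 0).
have mq : measurable_fun setT (fun z : Rn * Rn => dot (z.2 - z.1) (z.2 - z.1)).
  apply: measurable_sum => i.
  have mc : measurable_fun setT (fun z : Rn * Rn => (z.2 - z.1) ord0 i).
    rewrite (_ : (fun z : Rn * Rn => _) = (fun z : Rn * Rn => z.2 ord0 i - z.1 ord0 i)); last first.
      by apply/funext => z; rewrite !mxE.
    by apply: measurable_funB; apply: (measurableT_comp (measurable_coord i)).
  exact: (measurable_funM mc mc).
exact: (measurable_funB (measurable_cst _) (measurable_funM mq (measurable_cst _))).
Qed.

(** Jensen's inequality holds at every point, and Tonelli's theorem then integrates the kernel out
    in the other variable: it is symmetric and has mass [c] in either variable. *)
Lemma mollify_contraction u : sq u -> sq (mol e u) /\ ip (mol e u) (mol e u) <= ip u u.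
Proof.
move=> su; have mm := measurable_mollify su.
(* The square is extended by 0, so that Tonelli's theorem is used on the whole space. *)
pose U := (fun y => u y ^+ 2) \_ D : Rn -> R.
have mU : measurable_fun setT U.
  by apply/(measurable_restrictT _ mD); apply: measurable_funX; case: su.
have U0 y : 0 <= U y by rewrite /U patchE; case: ifP => // _; exact: sqr_ge0.
pose f (z : Rn * Rn) : \bar R := (c^-1 * (U z.2 * kern e z.1 z.2))%:E.
have f0 z : (0 <= f z)%E.
  by rewrite lee_fin mulr_ge0 ?invr_ge0 ?(ltW c0)// mulr_ge0 ?kern_ge0.
have mf : measurable_fun setT f.
  apply/measurable_EFinP; apply: (measurable_funM (measurable_cst _)).
  apply: measurable_funM; last exact: measurable_kern2.
  exact: (measurableT_comp mU measurable_snd).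
have main : (\int[mu]_(x in D) (mol e u x ^+ 2)%:E <= \int[mu]_(x in D) (u x ^+ 2)%:E)%E.
  have fx x : (\int[mu]_y f (x, y))%E = (c^-1 * \int[mu]_(y in D) (u y ^+ 2 * kern e x y))%:E.
    have iu := integrable_sqr_kern oD e x su.
    have E : (\int[mu]_(y in D) (u y ^+ 2 * kern e x y))%:E = (\int[mu]_(y in D) (u y ^+ 2 * kern e x y)%:E)%E.
      by rewrite /Rintegral fineK//; exact: (integrable_fin_num mD iu).
    rewrite EFinM E -(integralZl mD iu) [RHS]integral_mkcond.
    apply: eq_integral => y _; rewrite /f /U !patchE; case: ifP => // _.
    by rewrite mul0r mulr0.
  have mFf : measurable_fun (setT : set Rn) (fun x : Rn => \int[mu]_y f (x, y))%E.
    exact: (@measurable_fun_fubini_tonelli_F _ _ _ _ _ mu f mf f0).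
  apply: (@le_trans _ _ (\int[mu]_(x in D) \int[mu]_y f (x, y))%E).
    have m0 (x : Rn) : D x -> (0 <= (mol e u x ^+ 2)%:E)%E by rewrite lee_fin sqr_ge0.
    have mm2 := (measurable_EFinP (D : set Rn) _).2 (measurable_funX 2 mm).
    apply: ge0_le_integral; [exact: mD|exact: m0|exact: mm2|exact: measurable_funTS mFf|].
    by move=> x _; rewrite fx lee_fin; exact: mollify_sqr.
  apply: (@le_trans _ _ (\int[mu]_x \int[mu]_y f (x, y))%E).
    have F0 (x : Rn) : setT x -> (0 <= \int[mu]_y f (x, y))%E by move=> _; apply: integral_ge0 => y _; exact: f0.
    exact: (ge0_subset_integral mu mD measurableT mFf F0 (@subsetT _ _)).
  rewrite (@fubini_tonelli _ _ _ _ _ mu mu f mf f0) [leRHS]integral_mkcond.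
  rewrite le_eqVlt; apply/orP; left; apply/eqP; apply: eq_integral => y _.
  have -> : (\int[mu]_x f (x, y))%E = (\int[mu]_x ((c^-1 * U y)%:E * (kern e y x)%:E))%E.
    by apply: eq_integral => x _; rewrite /f /= -EFinM mulrA (kernC e x).
  have mk : measurable_fun (setT : set Rn) (fun x : Rn => (kern e y x)%:E).
    by apply/measurable_EFinP; exact: measurable_kern.
  have k0 (x : Rn) : setT x -> (0 <= (kern e y x)%:E)%E by move=> _; rewrite lee_fin kern_ge0.
  have cU : 0 <= c^-1 * U y by rewrite mulr_ge0 ?invr_ge0 ?(ltW c0).
  rewrite (ge0_integralZl_EFin mu measurableT k0 mk cU) (bump_massE e0) -EFinM.
  rewrite mulrAC mulVf ?gt_eqF// mul1r /U !patchE; by case: ifP.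
have sm : sq (mol e u) by split => //; apply: le_lt_trans main _; case: su.
by split => //; rewrite -lee_fin (ipE mD su) (ipE mD sm).
Qed.

Lemma mollify_indic_eq1 (O : set 'rV[R]_n) x : open O -> O `<=` D ->
  (forall y, enorm (y - x) < e -> O y) -> mol e (\1_O) x = 1.
Proof.
move=> oO OD xO.
have -> : mol e (\1_O) x = c^-1 * (\int[mu]_y kern e x y).
  rewrite /mollify /ip Rintegral_mkcond; congr (_ * _); apply: eq_Rintegral => y _.
  rewrite patchE indicE; have [ye|ey] := ltP (enorm (y - x)) e.
    by rewrite !mem_set ?mul1r//; [exact: xO|exact/OD/xO].
  by rewrite (kern_eq0 e0 ey) mulr0 if_same.
by rewrite /Rintegral (bump_massE e0) /= mulVf ?gt_eqF.
Qed.

End fixed_radius.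

Definition mollify_cvg (u : 'rV[R]_n -> R^o) := forall h, 0 < h -> exists2 r, 0 < r & forall e, 0 < e -> e < r ->
  ip ((mol e u : 'rV[R]_n -> R^o) - u) ((mol e u : 'rV[R]_n -> R^o) - u) <= h.

Lemma mollify_cvg_lin (a : R) (u v : 'rV[R]_n -> R^o) : sq u -> sq v -> mollify_cvg u -> mollify_cvg v ->
  mollify_cvg (a *: u + v).
Proof.
move=> su sv cu cv h h0.
have q0 : 0 < h / (4 * (a ^+ 2 + 1)) by rewrite divr_gt0// mulr_gt0// ltr_wpDl// sqr_ge0.
have h4 : 0 < h / 4 by rewrite divr_gt0.
have [r1 r10 H1] := cu _ q0; have [r2 r20 H2] := cv _ h4.
exists (Num.min r1 r2); first by rewrite lt_min r10.
move=> e e0; rewrite lt_min => /andP[er1 er2].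
have [su' _] := mollify_contraction e0 su; have [sv' _] := mollify_contraction e0 sv.
have -> : (mol e (a *: u + v) : 'rV[R]_n -> R^o) - (a *: u + v) =
   a *: ((mol e u : 'rV[R]_n -> R^o) - u) + ((mol e v : 'rV[R]_n -> R^o) - v).
  apply/funext => x; change (mol e (a *: u + v) x - (a * u x + v x) = a * (mol e u x - u x) + (mol e v x - v x)).
  rewrite (mollify_lin oD bD)//; ring.
have sdu := sqintB mD su' su; have sdv := sqintB mD sv' sv.
apply: le_trans (ip_sqrD2 mD (sqintZ mD a sdu) sdv) _.
rewrite (@formZ R ('rV[R]_n -> R^o) sq ip (sqint0 mu D) (sqint_lin mD) (fun u v _ _ => ipC mu D u v) (ip_lin mD))//.
have := H1 _ e0 er1; have := H2 _ e0 er2.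
move: (ip _ _) (ip _ _) => x y hy hx.
have : a ^+ 2 * x <= h / 4.
  apply: (@le_trans _ _ ((a ^+ 2 + 1) * (h / (4 * (a ^+ 2 + 1))))).
    apply: (@le_trans _ _ (a ^+ 2 * (h / (4 * (a ^+ 2 + 1))))); first by rewrite ler_wpM2l ?sqr_ge0.
    by rewrite ler_wpM2r ?lerDl// ltW.
  have p0 : a ^+ 2 + 1 != 0 by rewrite gt_eqF// ltr_wpDl ?sqr_ge0.
  by rewrite le_eqVlt; apply/orP; left; apply/eqP; field.
by move: hy; lra.
Qed.

(** The contraction bound makes convergence stable under limits in L^2. It then suffices to treat
    indicators, simple functions and finally nonnegative functions. *)
Lemma mollify_cvg_closed (u : 'rV[R]_n -> R^o) : sq u ->
  (forall h, 0 < h -> exists w : 'rV[R]_n -> R^o, [/\ sq w, mollify_cvg w & ip (u - w) (u - w) <= h]) ->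
  mollify_cvg u.
Proof.
move=> su H h h0.
(* Two applications of |f + g|^2 <= 2 |f|^2 + 2 |g|^2 to the three error terms give the weights 2, 4
   and 4, of sum 10. *)
have h10 : 0 < h / 10 by rewrite divr_gt0.
have [w [sw cw uw]] := H _ h10.
have [r r0 Hr] := cw _ h10.
exists r => // e e0 er; have [su' _] := mollify_contraction e0 su; have [sw' _] := mollify_contraction e0 sw.
have sd := sqintB mD su sw.
have [sd' cd] := mollify_contraction e0 sd.
have -> : (mol e u : 'rV[R]_n -> R^o) - u = (mol e (u - w) : 'rV[R]_n -> R^o) + (((mol e w : 'rV[R]_n -> R^o) - w) + (-1) *: (u - w)).
  apply/funext => x; change (mol e u x - u x = mol e (u - w) x + ((mol e w x - w x) + -1 * (u x - w x))).
  have -> : u - w = (-1) *: w + u by rewrite scaleN1r addrC.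
  rewrite (mollify_lin oD bD)//; ring.
have s1 := sqintB mD sw' sw; have s2 := sqintZ mD (-1) sd.
apply: le_trans (ip_sqrD2 mD sd' (sqintD mD s1 s2)) _.
have := ip_sqrD2 mD s1 s2.
rewrite (@formZ R ('rV[R]_n -> R^o) sq ip (sqint0 mu D) (sqint_lin mD) (fun u v _ _ => ipC mu D u v) (ip_lin mD))//.
have := Hr _ e0 er; move: cd uw.
have aux (A B C E : R) : A <= C -> C <= h / 10 -> E <= h / 10 -> B <= 2 * E + 2 * ((-1) ^+ 2 * C) -> 2 * A + 2 * B <= h.
  by rewrite sqrrN expr1n mul1r; lra.
exact: aux.
Qed.

Lemma ip_indic (A : set Rn) : measurable A -> A `<=` D -> ip (\1_A) (\1_A) = fine (mu A).
Proof.
move=> mA AD; have -> : ip (\1_A) (\1_A) = \int[mu]_(x in D) (\1_A : Rn -> R) x.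
  by apply: eq_Rintegral => x _; rewrite indicE; case: (_ \in _); rewrite ?mulr1 ?mulr0.
by rewrite /Rintegral integral_indic// setIidl.
Qed.

Lemma sqint_indic (A : set Rn) : measurable A -> sq (\1_A).
Proof.
move=> mA; apply: (sqint_bounded oD bD (C := 1)); first exact: measurable_indic.
by move=> x _; rewrite indicE; case: (_ \in _); rewrite ?normr1 ?normr0.
Qed.

(* The contraction bound gives [|m - 1_O|^2 <= 2 (|1_O|^2 - <m, 1_O>)] for the mollification [m] of [1_O]. *)
Lemma mollify_cvg_open (O : set 'rV[R]_n) : open O -> O `<=` D -> mollify_cvg (\1_O).
Proof.
move=> oO OD h h0.
(* The points of [O] at distance at least 1 / (k + 1) from its complement. The mollified indicator
   equals 1 there for smaller radii, and these sets increase to [O]. *)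
pose F k : set Rn := O `\` \bigcup_(y in ~` O) [set x | enorm (x - y) < k.+1%:R^-1].
have mO : measurable (O : set Rn) by exact: measurable_openRn.
have mF k : measurable (F k).
  apply: measurableD => //; apply: measurable_openRn; apply: bigcup_open => y _; exact: open_enorm_ball.
have FO : \bigcup_k F k = O.
  apply/seteqP; split => [x [k _ []]//|x Ox].
  have [r r0 Hr] := open_box_nbhs oO Ox.
  exists (Num.truncn r^-1) => //; split => // -[y nOy /= xy]; apply: nOy; apply: Hr => i.
  have := ler_coord_enorm (y - x) i; rewrite !mxE => /le_trans; apply.
  rewrite enorm_distC ltW// (lt_trans xy)// -[ltRHS]invrK ltf_pV2 ?posrE ?invr_gt0//; exact: truncnS_gt.
have Ofin : mu O \is a fin_num by rewrite ge0_fin_numE//; apply: le_lt_trans Dfin; exact: (le_outer_measure (@lebesgue_outer R n)).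
have cv : mu \o F @ \oo --> mu O.
  rewrite -[X in _ --> mu X]FO; apply: nondecreasing_cvg_mu => //; first by rewrite FO.
  move=> k l kl; apply/subsetPset => x [Ox nx]; split => // -[y nOy /= xy]; apply: nx; exists y => //=.
  by apply: lt_le_trans xy _; rewrite lef_pV2 ?posrE// ler_nat ltnS.
have h2 : 0 < h / 2 by rewrite divr_gt0.
have [k Hk] : exists k, fine (mu O) - h / 2 <= fine (mu (F k)).
  apply: contrapT => nk; have : (mu O <= (fine (mu O) - h / 2)%:E)%E.
    apply: (cvge_le _ cv); apply: nearW => k /=.
    rewrite -[X in (X <= _)%E]fineK; last first.
      by rewrite ge0_fin_numE//; apply: le_lt_trans Dfin; apply: (le_outer_measure (@lebesgue_outer R n)) => x [/OD].
    by rewrite lee_fin leNgt; apply/negP => /ltW kh; apply: nk; exists k.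
  by rewrite -{1}(fineK Ofin) lee_fin; lra.
exists k.+1%:R^-1; first by rewrite invr_gt0.
move=> e e0 ek.
have sO := sqint_indic mO; have [sm cm] := mollify_contraction e0 sO.
have sF := sqint_indic (mF k).
have FO' : F k `<=` O by move=> x [].
have low : fine (mu (F k)) <= ip (mol e (\1_O)) (\1_O).
  rewrite -ip_indic//; last exact: subset_trans OD.
  apply: le_Rintegral => //; [exact: (integrable_sqintM mD sF sF)|exact: (integrable_sqintM mD sm sO)|].
  move=> x Dx; rewrite [X in X * _]indicE.
  have [xF|_] := boolP (x \in F k); last first.
    rewrite mul0r mulr_ge0//.
    rewrite mulr_ge0 ?invr_ge0 ?(ltW (bump_mass_gt0 e0))//; apply: Rintegral_ge0 => y _.
    by rewrite mulr_ge0 ?kern_ge0// indicE.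
  have [Ox nx] := set_mem xF.
  rewrite mollify_indic_eq1//.
    by rewrite !indicE mem_set// mem_set.
  move=> y yx; apply: contrapT => nOy; apply: nx; exists y => //=.
  by rewrite enorm_distC (lt_trans yx).
have := cm; rewrite ip_indic//.
have E : ip ((mol e (\1_O) : 'rV[R]_n -> R^o) - \1_O) ((mol e (\1_O) : 'rV[R]_n -> R^o) - \1_O) =
    ip (mol e (\1_O)) (mol e (\1_O)) - 2 * ip (mol e (\1_O)) (\1_O) + ip (\1_O) (\1_O).
  have := @form_sqrD R ('rV[R]_n -> R^o) sq ip (sqint_lin mD) (fun u v _ _ => ipC mu D u v) (ip_lin mD) (-1) _ _ sm sO.
  rewrite scaleN1r addrC => ->; ring.
rewrite E ip_indic//; move: Hk low.
move: (ip _ _) (ip _ _) (fine _) (fine _) => x y z w; lra.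
Qed.

(** By outer regularity [A] is contained in an open subset of [D] of nearly the same measure, and
    the difference of the indicators is small in L^2. *)
Lemma mollify_cvg_indic (A : set Rn) : measurable A -> A `<=` D -> mollify_cvg (\1_A).
Proof.
move=> mA AD; apply: mollify_cvg_closed; first exact: sqint_indic.
move=> h h0.
have Afin : (mu A < +oo)%E by apply: le_lt_trans Dfin; exact: (le_outer_measure (@lebesgue_outer R n)).
have [U1 [oU AU Uh]] := lebesgue_outer_open h0 Afin.
pose O := U1 `&` D; have oO : open O by exact: openI.
have OD : O `<=` D by move=> x [].
have mO : measurable (O : set Rn) by exact: measurable_openRn.
exists (\1_O); split; [exact: sqint_indic|exact: mollify_cvg_open|].
have AO : A `<=` O by move=> x Ax; split; [exact: AU|exact: AD].
have mOA : measurable (O `\` A : set Rn) by exact: measurableD.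
have -> : ip ((\1_A : 'rV[R]_n -> R^o) - \1_O) ((\1_A : 'rV[R]_n -> R^o) - \1_O) = ip (\1_(O `\` A)) (\1_(O `\` A)).
  apply: eq_Rintegral => x _.
  change ((\1_A x - \1_O x) * (\1_A x - \1_O x) = \1_(O `\` A) x * \1_(O `\` A) x :> R).
  rewrite !indicE in_setD; have [xA|xA] := boolP (x \in A); have [xO|xO] := boolP (x \in O) => /=; try ring.
  by move: xO; rewrite notin_setE => /(_ (AO _ (set_mem xA))).
rewrite ip_indic//; last by move=> x [/OD].
have : (mu (O `\` A) <= h%:E)%E.
  rewrite measureD//; last by apply: le_lt_trans Dfin; exact: (le_outer_measure (@lebesgue_outer R n)).
  rewrite (setIidr AO) leeBlDr ?ge0_fin_numE// addeC; apply: le_trans Uh.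
  by apply: (le_outer_measure (@lebesgue_outer R n)) => x [].
have OAfin : mu (O `\` A) \is a fin_num.
  by rewrite ge0_fin_numE//; apply: le_lt_trans Dfin; apply: (le_outer_measure (@lebesgue_outer R n)) => x [/OD].
by rewrite -{1}(fineK OAfin) lee_fin.
Qed.

Lemma mollify_cvg_ge0 (f : 'rV[R]_n -> R^o) : sq f -> (forall x, D x -> 0 <= f x) -> mollify_cvg f.
Proof.
move=> sf f0; have mf : measurable_fun (D : set Rn) (f : Rn -> R) by case: sf.
pose A k (j : nat) : set Rn := D `&` [set x | j.+1%:R * k.+1%:R^-1 < f x].
have mA k j : measurable (A k j) by exact: measurable_level.
(* With (k + 1)^2 steps of height 1 / (k + 1) the staircase reaches the height k + 1, so at every
   point its error is eventually at most 1 / (k + 1). *)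
pose s k : 'rV[R]_n -> R^o := \sum_(j < (k.+1 ^ 2)%N) k.+1%:R^-1 *: (\1_(A k j) : 'rV[R]_n -> R^o).
have sE k x : D x -> s k x = stair (k.+1 ^ 2) k.+1%:R^-1 (f x).
  move=> Dx; rewrite /s fct_sumE /stair; apply: eq_bigr => j _.
  change (k.+1%:R^-1 * \1_(A k j) x = k.+1%:R^-1 * (j.+1%:R * k.+1%:R^-1 < f x)%R%:R :> R).
  by rewrite indicE /A in_setI mem_set//= mem_setE.
have ss k : sq (s k) /\ mollify_cvg (s k).
  rewrite /s; elim/big_ind : _ => [|g1 g2 [? ?] [? ?]|j _].
  - split; first exact: sqint0.
    have := mollify_cvg_indic measurable0 (@sub0set _ D); rewrite indic0; exact.
  - split; first exact: sqintD.
    by rewrite -[g1]scale1r; exact: mollify_cvg_lin.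
  - split; first by apply: sqintZ => //; exact: sqint_indic.
    rewrite -[X in mollify_cvg X]addr0; apply: mollify_cvg_lin => //.
    + exact: sqint_indic.
    + exact: sqint0.
    + by apply: mollify_cvg_indic => // x [].
    + have := mollify_cvg_indic measurable0 (@sub0set _ D); rewrite indic0; exact.
have st k x : D x -> 0 <= f x - s k x <= f x.
  move=> Dx; rewrite sE// subr_ge0 stair_le ?f0//= gerBl.
  by apply: sumr_ge0 => j _; rewrite mulr_ge0.
apply: mollify_cvg_closed => // h h0.
have md k : measurable_fun (D : set Rn) (fun x : Rn => ((f x - s k x) ^+ 2)%:E).
  apply/measurable_EFinP; apply: measurable_funX; apply: measurable_funB => //.
  by have [[]] := ss k.
have mz : measurable_fun (D : set Rn) (fun x : Rn => (0 : R)%:E) by exact: measurable_cst.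
have cvx : {ae mu, forall x, D x -> (fun k => ((f x - s k x) ^+ 2)%:E) @ \oo --> (0 : R)%:E}.
  apply: aeW => x Dx; apply: cvg_EFin; first exact: nearW.
  apply: (squeeze_cvgr _ (cvg_cst 0) (@cvg_harmonic R)).
  exists (Num.truncn (f x)).+1 => // k /= kf; rewrite /= sqr_ge0/=.
  have /andP[a0 a1] := st k x Dx.
  have le1 : f x - s k x <= k.+1%:R^-1.
    rewrite sE// lerBlDr; apply: stair_ge => //.
    apply: (@le_trans _ _ (k.+1%:R)).
      apply: le_trans (ltW (truncnS_gt _)) _; rewrite ler_nat; exact: leq_trans kf _.
    by rewrite ler_pdivlMr// -natrM ler_nat mulnn.
  rewrite expr2 /harmonic; apply: le_trans (ler_pM a0 a0 le1 le1) _.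
  by rewrite ler_piMr// invf_le1// ler1n.
have dom : {ae mu, forall x, forall k, D x -> (`|((f x - s k x) ^+ 2)%:E| <= (f x ^+ 2)%:E)%E}.
  apply: aeW => x k Dx; have /andP[a0 a1] := st k x Dx.
  by rewrite gee0_abs lee_fin ?sqr_ge0// ler_sqr ?nnegrE// f0.
have [_ _] := dominated_convergence mD md mz cvx (sqint_integrable sf) dom.
rewrite integral0 => cv.
have [k Hk] : exists k, (\int[mu]_(x in D) ((f x - s k x) ^+ 2)%:E < h%:E)%E.
  apply: contrapT => nk; have : (h%:E <= 0)%E.
    apply: (cvge_ge _ cv); apply: nearW => k /=.
    by rewrite leNgt; apply/negP => kh; apply: nk; exists k.
  by rewrite lee_fin leNgt h0.
exists (s k); have [sk ck] := ss k; split => //.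
by rewrite -lee_fin (ipE mD (sqintB mD sf sk)); exact: ltW.
Qed.

Lemma mollify_cvgP (f : 'rV[R]_n -> R^o) : sq f -> mollify_cvg f.
Proof.
move=> sf; have [mf _] := sf.
have pos (g : 'rV[R]_n -> R^o) : sq g -> sq (fun x => Num.max 0 (g x)).
  move=> sg; have mg : measurable_fun (D : set Rn) (fun x : Rn => Num.max 0 (g x)).
    by apply: measurable_maxr; [exact: measurable_cst|case: sg].
  apply: (sqint_le mD mg sg ler01) => x _; rewrite mul1r; have [g0|g0] := leP 0 (g x) => //.
  by rewrite expr0n sqr_ge0.
have sp := pos _ sf; have sn := pos _ (sqintZ mD (-1) sf).
have -> : f = (-1) *: (fun x => Num.max 0 (((-1) *: f) x)) + (fun x => Num.max 0 (f x)).
  apply/funext => x; change (f x = -1 * Num.max 0 (-1 * f x) + Num.max 0 (f x)).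
  rewrite !mulN1r; have [f0|f0] := leP 0 (f x).
    by have /max_idPl -> : - f x <= 0; rewrite ?oppr_le0// oppr0 add0r.
  by have /max_idPr -> : 0 <= - f x; rewrite ?oppr_ge0 ?(ltW f0)// opprK addr0.
by apply: mollify_cvg_lin => //; apply: mollify_cvg_ge0 => // x _; rewrite le_max lexx.
Qed.

End mollify_approximation.

(** * The Poincare inequality in H^1 *)

Lemma Rintegral_exhaust {d} {T : measurableType d} {R : realType} (mu : {measure set T -> \bar R}) (D : set T)
  (K : nat -> set T) (f : T -> R) : measurable D -> (forall j, measurable (K j)) -> (forall j, K j `<=` D) ->
  (forall x, D x -> exists N, forall j, (N <= j)%N -> K j x) -> mu.-integrable D (EFin \o f) ->
  (fun j => \int[mu]_(x in K j) f x) @ \oo --> \int[mu]_(x in D) f x.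
Proof.
move=> mD mK KD ev fi.
have mf := measurable_int mu fi.
have mj j : measurable_fun D ((EFin \o f) \_ (K j)).
  by apply/(measurable_restrict _ (mK j) mD); apply: measurable_funS mf => // x [].
have cvx : {ae mu, forall x, D x -> (fun j => ((EFin \o f) \_ (K j)) x) @ \oo --> (EFin \o f) x}.
  apply: aeW => x Dx; have [N HN] := ev x Dx.
  apply: cvg_near_cst; exists N => // j /= Nj; rewrite patchE mem_set//; exact: HN.
have dom : {ae mu, forall x, forall j, D x -> (`|((EFin \o f) \_ (K j)) x| <= `|(EFin \o f) x|)%E}.
  by apply: aeW => x j Dx; rewrite patchE; case: ifP => // _; rewrite abse0 abse_ge0.
have [_ _] := dominated_convergence mD mj mf cvx (integrable_abse fi) dom.
have E j : (\int[mu]_(x in D) ((EFin \o f) \_ (K j)) x)%E = (\int[mu]_(x in K j) (EFin \o f) x)%E.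
  by rewrite -integral_mkcondr setIidr.
move=> cv; have {cv} : (fun j => (\int[mu]_(x in K j) (EFin \o f) x)%E) @ \oo --> (\int[mu]_(x in D) (EFin \o f) x)%E.
  by rewrite (_ : (fun j => _) = (fun j => (\int[mu]_(x in D) ((EFin \o f) \_ (K j)) x)%E)) //; apply/funext => j.
rewrite -[X in _ --> X](fineK (integrable_fin_num mD fi)) => /fine_cvg; exact.
Qed.

Lemma Rintegral_sum {d} {T : measurableType d} {R : realType} (mu : {measure set T -> \bar R}) (D : set T)
  I (r : seq I) (f : I -> T -> R) : measurable D -> (forall i, mu.-integrable D (EFin \o f i)) ->
  mu.-integrable D (EFin \o (fun x => \sum_(i <- r) f i x)) /\
  \int[mu]_(x in D) (\sum_(i <- r) f i x) = \sum_(i <- r) \int[mu]_(x in D) f i x.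
Proof.
move=> mD fi; elim: r => [|i r [IH1 IH2]].
  rewrite big_nil; split.
    rewrite (_ : EFin \o _ = cst 0%E); first exact: integrable0.
    by apply/funext => x /=; rewrite big_nil.
  by under eq_Rintegral do rewrite big_nil; rewrite /Rintegral integral0.
have E : (fun x => \sum_(j <- i :: r) f j x) = (fun x => f i x + \sum_(j <- r) f j x).
  by apply/funext => x; rewrite big_cons.
rewrite big_cons -IH2 -(RintegralD mD (fi i) IH1) E; split => //.
exact: (integrableD mD (fi i) IH1).
Qed.

Section poincare.
Context {R : realType} {n : nat}.
Local Notation mu := (@vol R n).
Local Notation Rn := (lebesgueRn R n).
Variables (D : set 'rV[R]_n) (d : R).
Hypotheses (oD : open D) (cD : convexRn D) (bD : bounded_set D) (d0 : 0 < d).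
Hypothesis diamD : forall x y, D x -> D y -> enorm (x - y) <= d.

Let mD : measurable (D : set Rn). Proof. exact: measurable_openRn. Qed.
Let Dfin : (mu D < +oo)%E. Proof. exact: vol_bounded. Qed.
Local Notation sq := (sqint mu D).

(** When the closed cube of half-side [e] around [z] lies in [D], the kernel centred at [z] is a
    test function, and the definition of the weak gradient moves the derivative onto [u]. *)
Lemma mollify_grad_H1 e u g i (z : 'rV[R]_n) : 0 < e -> H1_gradient D u g ->
  (forall y : 'rV[R]_n, (forall i, `|y ord0 i - z ord0 i| <= e) -> D y) -> mollify_grad D e u i z = mollify D e (g i) z.
Proof.
move=> e0 [su Hg] zD; rewrite /mollify_grad /mollify mulNr -mulrN; congr (_ * _).
have [_ /(_ _ (test_function_bump e0 zD))] := Hg i.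
rewrite /ip => E; rewrite -[RHS]opprK -[in RHS]E; congr (- _); apply: eq_Rintegral => y _.
by rewrite partial_bump.
Qed.

Lemma mollify_bound e u x : 0 < e -> sq u ->
  `|mollify D e u x| <= (bump_mass (n := n) e)^-1 * \int[mu]_(x in D) `|u x|.
Proof.
move=> e0 su; have c0 := bump_mass_gt0 (n := n) e0.
rewrite normrM ger0_norm ?invr_ge0 ?(ltW c0)//; apply: ler_wpM2l; first by rewrite invr_ge0 ltW.
rewrite -[leRHS]mul1r; apply: ip_bound => //; first exact: measurable_kern.
by move=> y _; rewrite ger0_norm ?kern_ge0 ?kern_le1.
Qed.

Lemma sqint_sub (K : set 'rV[R]_n) u : measurable (K : set Rn) -> K `<=` D -> sq u -> sqint mu K u.
Proof.
move=> mK KD [mu_ fu]; split; first exact: measurable_funS mu_.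
apply: le_lt_trans fu; apply: (ge0_subset_integral mu mK mD _ _ KD).
  by apply/measurable_EFinP; apply: measurable_funX.
by move=> x _; rewrite lee_fin sqr_ge0.
Qed.

Lemma ip_sub (K : set 'rV[R]_n) u : measurable (K : set Rn) -> K `<=` D -> sq u -> ip mu K u u <= ip mu D u u.
Proof.
move=> mK KD su; rewrite -lee_fin (ipE mK (sqint_sub mK KD su)) (ipE mD su).
apply: (ge0_subset_integral mu mK mD _ _ KD).
  by apply/measurable_EFinP; apply: measurable_funX; case: su.
by move=> x _; rewrite lee_fin sqr_ge0.
Qed.

(** On [K], which keeps the distance [r] from the complement of [D], the mollification of [u] is
    smooth with gradient the mollification of [g]. The smooth inequality applies to it, contraction
    bounds its gradient, and [u] is close to it in L^2. *)
Lemma poincare_inner (K : set 'rV[R]_n) (r : R) u g h : open K -> convexRn K -> K `<=` D -> 0 < r ->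
  (forall x y : 'rV[R]_n, K x -> (forall i, `|y ord0 i - x ord0 i| <= r) -> D y) -> H1_gradient D u g -> 0 < h ->
  exists m, \int[mu]_(x in K) ((u x - m) ^+ 2) <= 80 * d ^+ 2 * (\sum_i ip mu D (g i) (g i)) + h.
Proof.
move=> oK cK KD r0 rK H1 h0; have [su Hg] := H1.
have sg i : sq (g i) by have [] := Hg i.
have bK : bounded_set K.
  by case: bD => M [Mr HM]; exists M; split => // y My x Kx; apply: HM => //; exact: KD.
have mK : measurable (K : set Rn) by exact: measurable_openRn.
set E := \sum_i _.
have E0 : 0 <= E by apply: sumr_ge0 => i _; exact: ip_ge0.
set A := 80 * d ^+ 2 * E.
have A0 : 0 <= A by rewrite mulr_ge0// mulr_ge0 ?sqr_ge0.
(* Young parameter for passing from the mollification back to [u]: the factor 1 + t costs at most h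
   / 2, and [q] is the L^2 error for which the factor 1 + 1 / t costs h / 2. *)
pose t := h / (2 * (A + 1)).
have t0 : 0 < t by rewrite divr_gt0// mulr_gt0// ltr_wpDl.
have tA : t * A <= h / 2.
  have -> : t = h / 2 / (A + 1) by rewrite /t invfM mulrA.
  by apply: ler_frac_succ => //; rewrite ltW// divr_gt0.
pose q := h / (2 * (1 + t^-1)).
have q0 : 0 < q by rewrite divr_gt0// mulr_gt0// addr_gt0// invr_gt0.
have [r1 r10 Hr1] := mollify_cvgP oD bD su q0.
pose e := Num.min r (r1 / 2).
have e0 : 0 < e by rewrite lt_min r0 divr_gt0.
have er : e <= r by rewrite ge_min lexx.
have er1 : e < r1 by rewrite gt_min; apply/orP; right; rewrite ltr_pdivrMr// ltr_pMr// ltr1n.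
have uv := Hr1 _ e0 er1.
pose v := mollify D e u.
have [sv _] := mollify_contraction oD bD e0 su.
have [C HC] := mollify_grad_bound oD bD e0 su.
have [M M0 HM] := mollify_taylor oD bD e0 su.
have [L HL] := mollify_lipschitz oD bD e0 su.
have GE i z : K z -> mollify_grad D e u i z = mollify D e (g i) z.
  by move=> Kz; apply: mollify_grad_H1 => // y zy; apply: (rK z) => // j; apply: le_trans (zy j) er.
have smg i := mollify_contraction oD bD e0 (sg i).
have mG i : measurable_fun (K : set Rn) (mollify_grad D e u i : Rn -> R).
  have [[mm _] _] := smg i.
  apply: (eq_measurable_fun (mollify D e (g i) : Rn -> R)); first by move=> z /set_mem Kz; rewrite GE.
  exact: measurable_funS mm.
set B0 := (bump_mass (n := n) e)^-1 * \int[mu]_(x in D) `|u x|.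
have [m Hm] : exists m, \int[mu]_(x in K) ((v x - m) ^+ 2) <=
    80 * d ^+ 2 * \int[mu]_(x in K) (\sum_i mollify_grad D e u i x ^+ 2).
  apply: (poincare_smooth oK cK bK d0 _ (B := Num.max B0 C) (L := L) M0).
  - by move=> x y /KD Dx /KD Dy; exact: diamD.
  - by move=> x Kx; rewrite le_max mollify_bound.
  - by move=> i x /KD Dx; rewrite le_max HC// orbT.
  - exact: mG.
  - by move=> x y /KD Dx /KD Dy; exact: HL.
  - by move=> x z /KD Dx /KD Dz _; exact: HM.
exists m.
have HmA : \int[mu]_(x in K) ((v x - m) ^+ 2) <= A.
  apply: le_trans Hm _; apply: ler_wpM2l; first by rewrite mulr_ge0 ?sqr_ge0.
  have -> : \int[mu]_(x in K) (\sum_i mollify_grad D e u i x ^+ 2) = \sum_i ip mu K (mollify D e (g i)) (mollify D e (g i)).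
    have sK i : sqint mu K (mollify D e (g i)) by exact: sqint_sub mK KD (smg i).1.
    rewrite -(Rintegral_sum _ mK (fun i => integrable_sqintM mK (sK i) (sK i))).2.
    apply: eq_Rintegral => x /set_mem Kx; apply: eq_bigr => i _.
    by rewrite GE// expr2.
  apply: ler_sum => i _; have [sm cm] := smg i.
  by apply: le_trans cm; exact: ip_sub.
have s1 : sqint mu K (fun=> m) by apply: (@sqint_bounded _ _ K oK bK _ `|m|) => //; exact: measurable_cst.
have suK := sqint_sub mK KD su; have svK := sqint_sub mK KD sv.
have i1 := sqint_integrable (sqintB mK suK s1 : sqint mu K (fun x => u x - m)).
have i2 := sqint_integrable (sqintB mK svK s1 : sqint mu K (fun x => v x - m)).
have s3 : sqint mu K (fun x => v x - u x) := sqintB mK svK suK.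
have i3 := sqint_integrable s3.
have iZ a f : mu.-integrable K (fun x => (f x)%:E) -> mu.-integrable K (fun x => (a * f x)%:E).
  by move=> fi; exact: (integrableZl mK a fi).
have : \int[mu]_(x in K) ((u x - m) ^+ 2) <=
    \int[mu]_(x in K) ((1 + t) * (v x - m) ^+ 2 + (1 + t^-1) * (v x - u x) ^+ 2).
  apply: le_Rintegral => //.
    exact: (integrableD mK (iZ (1 + t) _ i2) (iZ (1 + t^-1) _ i3)).
  move=> x Kx; move: (u x) (v x) => a b; rewrite -subr_ge0.
  have -> : (1 + t) * (b - m) ^+ 2 + (1 + t^-1) * (b - a) ^+ 2 - (a - m) ^+ 2 =
     t^-1 * (t * (b - m) + (b - a)) ^+ 2 by field; rewrite gt_eqF.
  by rewrite mulr_ge0 ?sqr_ge0// invr_ge0 ltW.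
rewrite (RintegralD mK (iZ (1 + t) _ i2) (iZ (1 + t^-1) _ i3)) (RintegralZl _ mK i2) (RintegralZl _ mK i3).
move=> /le_trans; apply.
have q3 : \int[mu]_(x in K) ((v x - u x) ^+ 2) <= q.
  apply: le_trans uv; have := ip_sub mK KD (sqintB mD sv su).
  rewrite /ip => /(le_trans _); apply; rewrite le_eqVlt; apply/orP; left; apply/eqP.
  by apply: eq_Rintegral => x _; rewrite expr2.
have t1 : 0 <= t^-1 by rewrite invr_ge0 ltW.
have := ler_wpM2l (addr_ge0 ler01 (ltW t0)) HmA.
have := ler_wpM2l (addr_ge0 ler01 t1) q3.
have -> : (1 + t^-1) * q = h / 2 by rewrite /q; field; rewrite !gt_eqF// addr_gt0.
by move: (_ * Rintegral _ _ _) (_ * Rintegral _ _ _) => x y; lra.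
Qed.

(** The mean value is the best constant. This eliminates [m], which varies with [K], and leaves
    integrals that pass to the limit when [K] exhausts [D]. *)
Lemma variance_le (K : set 'rV[R]_n) u m A : open K -> bounded_set K -> sqint mu K u ->
  \int[mu]_(x in K) ((u x - m) ^+ 2) <= A ->
  (\int[mu]_(x in K) 1) * (\int[mu]_(x in K) (u x ^+ 2)) - (\int[mu]_(x in K) u x) ^+ 2 <=
  (\int[mu]_(x in K) 1) * A.
Proof.
move=> oK bK su H; have mK : measurable (K : set Rn) by exact: measurable_openRn.
have i1 := sqint_integrable su; have i2 := sqint_ip1 oK bK su.
have s1 : sqint mu K (fun=> 1) by apply: (@sqint_bounded _ _ K oK bK _ `|1|) => //; exact: measurable_cst.
have i3 : mu.-integrable K (fun=> 1%:E) := sqint_ip1 oK bK s1.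
have iZ a f : mu.-integrable K (fun x => (f x)%:E) -> mu.-integrable K (fun x => (a * f x)%:E).
  by move=> fi; exact: (integrableZl mK a fi).
have E : \int[mu]_(x in K) ((u x - m) ^+ 2) = \int[mu]_(x in K) (u x ^+ 2) +
    (- 2 * m * \int[mu]_(x in K) u x + m ^+ 2 * \int[mu]_(x in K) 1).
  rewrite -(RintegralZl _ mK i2) -(RintegralZl _ mK i3) -(RintegralD mK (iZ _ _ i2) (iZ _ _ i3)).
  rewrite -(RintegralD mK i1 (integrableD mK (iZ _ _ i2) (iZ _ _ i3))).
  by apply: eq_Rintegral => x _; ring.
have k0 : 0 <= \int[mu]_(x in K) (1 : R) by exact: Rintegral_ge0.
move: H; rewrite E.
move: (Rintegral _ _ _) (Rintegral _ _ _) (Rintegral _ _ _) k0 => B U k k0 H.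
apply: le_trans (ler_wpM2l k0 H); rewrite -subr_ge0.
have -> : k * (U + (- 2 * m * B + m ^+ 2 * k)) - (k * U - B ^+ 2) = (k * m - B) ^+ 2 by ring.
exact: sqr_ge0.
Qed.

(** [D] is exhausted by its images under homotheties with centre [x0] and ratio below 1. These are
    convex and, by convexity of [D], keep a positive distance from its complement, so
    [poincare_inner] applies to each of them. *)
Theorem poincare_H1 u g : H1_gradient D u g ->
  ip mu D u u <= 80 * d ^+ 2 * (\sum_i ip mu D (g i) (g i)) + (fine (mu D))^-1 * (\int[mu]_(x in D) u x) ^+ 2.
Proof.
move=> H1; have [su _] := H1.
set A := 80 * d ^+ 2 * _.
have A0 : 0 <= A.
  apply: mulr_ge0; first exact: mulr_ge0 (sqr_ge0 _).
  by apply: sumr_ge0 => i _; exact: ip_ge0.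
have [DE|/eqP/set0P[x0 Dx0]] := pselect (D = set0).
  have -> : ip mu D u u = 0 by rewrite /ip DE Rintegral_set0.
  by rewrite addr_ge0// mulr_ge0 ?sqr_ge0// invr_ge0 fine_ge0.
have [r r0 Hr] := open_box_nbhs oD Dx0.
(* The index is shifted by 2 so that the ratio 1 - del j is at least 1/2. *)
pose del (j : nat) : R := j.+2%:R^-1.
have del0 j : 0 < del j by rewrite invr_gt0.
have del1 j : del j <= 2^-1 by rewrite lef_pV2 ?posrE// ler_nat.
have del1' j : 0 < 1 - del j by have := del1 j; lra.
pose f j (x : 'rV[R]_n) := (1 - del j)^-1 *: (x - del j *: x0).
pose K j := f j @^-1` D.
have fK j x : x = (1 - del j) *: f j x + del j *: x0.
  by rewrite /f scalerA divff ?gt_eqF// scale1r subrK.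
have oK j : open (K j).
  rewrite openE => x Kx; have [e e0 He] := open_box_nbhs oD Kx.
  apply/nbhs_ballP; exists ((1 - del j) * e) => /=; first by rewrite mulr_gt0.
  move=> y; rewrite -ball_normE /= distrC => yx; apply: He => i.
  have -> : f j y ord0 i - f j x ord0 i = (1 - del j)^-1 * (y - x) ord0 i by rewrite /f !mxE; ring.
  rewrite normrM gtr0_norm ?invr_gt0// ler_pdivrMl//.
  exact: le_trans (ler_coord_norm _ _) (ltW yx).
have KD j : K j `<=` D.
  move=> x Kx; rewrite (fK j x); apply: cD => //; rewrite del0 /=.
  by have := del1 j; lra.
have cK j : convexRn (K j).
  move=> x y t t01 Kx Ky; rewrite /K /=.
  have -> : f j ((1 - t) *: x + t *: y) = (1 - t) *: f j x + t *: f j y.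
    by apply/rowP => i; rewrite /f !mxE; ring.
  exact: cD.
have bK j : bounded_set (K j).
  by case: bD => M [Mr HM]; exists M; split => // y My x Kx; apply: HM => //; exact: (KD j).
have mK j : measurable (K j : set Rn) by exact: measurable_openRn.
(* A displacement y - x of the contracted point is charged to [x0], where it appears divided by
   [del j] and stays within the cube of half-side [r] contained in [D]. *)
have nK j (x y : 'rV[R]_n) : K j x -> (forall i, `|y ord0 i - x ord0 i| <= del j * r) -> D y.
  move=> Kx yx.
  have -> : y = (1 - del j) *: f j x + del j *: (x0 + (del j)^-1 *: (y - x)).
    rewrite scalerDr addrA -fK scalerA divff ?gt_eqF// scale1r addrC subrK//.
  apply: cD => //; first by rewrite del0 /=; have := del1 j; lra.
  apply: Hr => i.
  have -> : (x0 + (del j)^-1 *: (y - x)) ord0 i - x0 ord0 i = (del j)^-1 * (y ord0 i - x ord0 i) by rewrite !mxE; ring.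
  rewrite normrM gtr0_norm ?invr_gt0// ler_pdivrMl//; exact: yx.
have ev x : D x -> exists N, forall j, (N <= j)%N -> K j x.
  move=> Dx; have [e e0 He] := open_box_nbhs oD Dx.
  exists (Num.truncn (2 * (`|x - x0| + 1) / e)) => j Nj; apply: He => i.
  have -> : f j x ord0 i - x ord0 i = del j / (1 - del j) * (x - x0) ord0 i.
    by rewrite /f !mxE; field; rewrite gt_eqF.
  have dj : del j * (2 * (`|x - x0| + 1)) <= e.
    rewrite /del ler_pdivrMl// -ler_pdivrMr//; apply: le_trans (ltW (truncnS_gt _)) _.
    by rewrite ler_nat ltnS (leq_trans Nj).
  rewrite normrM ger0_norm ?divr_ge0 ?(ltW (del0 j)) ?(ltW (del1' j))//; apply: le_trans dj.
  rewrite -mulrA; apply: ler_wpM2l; first exact: ltW.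
  rewrite ler_pdivrMl//; have := ler_coord_norm (x - x0) i; have := del1 j; move=> h1 h2.
  apply: (le_trans h2); have := normr_ge0 (x - x0); move: h1; move: (del j) => dl h1 h3.
  apply: (@le_trans _ _ (2^-1 * (2 * (`|x - x0| + 1)))); last by apply: ler_wpM2r; [rewrite mulr_ge0// addr_ge0|lra].
  by rewrite mulrA mulVf// mul1r lerDl.
have s1 : sq (fun=> 1) by apply: (@sqint_bounded _ _ D oD bD _ `|1|) => //; exact: measurable_cst.
have i1 := sqint_integrable su; have i2 := sqint_ip1 oD bD su.
have i3 : mu.-integrable D (fun=> 1%:E) := sqint_ip1 oD bD s1.
have cv1 := Rintegral_exhaust mD mK KD ev i1.
have cv2 := Rintegral_exhaust mD mK KD ev i2.
have cv3 := Rintegral_exhaust mD mK KD ev i3.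
have kE : \int[mu]_(x in D) (1 : R) = fine (mu D) by rewrite Rintegral_cst// mul1r.
have k0 : 0 < \int[mu]_(x in D) (1 : R).
  by rewrite kE fine_gt0// Dfin andbT; apply: vol_open_gt0 => //; exists x0.
rewrite -kE -lerBlDr.
have -> : ip mu D u u = \int[mu]_(x in D) (u x ^+ 2) by apply: eq_Rintegral => x _; rewrite expr2.
apply/ler_addgt0Pr => h h0.
have cvl : (fun j => (\int[mu]_(x in K j) 1) * (\int[mu]_(x in K j) (u x ^+ 2)) -
    (\int[mu]_(x in K j) u x) * (\int[mu]_(x in K j) u x)) @ \oo -->
    (\int[mu]_(x in D) 1) * (\int[mu]_(x in D) (u x ^+ 2)) - (\int[mu]_(x in D) u x) * (\int[mu]_(x in D) u x).
  exact: (cvgB (cvgM cv3 cv1) (cvgM cv2 cv2)).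
have cvr : (fun j => (\int[mu]_(x in K j) 1) * (A + h)) @ \oo --> (\int[mu]_(x in D) 1) * (A + h).
  exact: (cvgMr_tmp cv3).
rewrite -(ler_pM2l k0) mulrBr mulVKf ?gt_eqF// expr2.
apply: (ler_cvg_to cvl cvr); apply: nearW => j /=.
have [m Hm] := poincare_inner (oK j) (cK j) (KD j) (mulr_gt0 (del0 j) r0) (nK j) H1 h0.
have := variance_le (oK j) (bK j) (sqint_sub (mK j) (KD j) su) Hm; rewrite expr2; exact.
Qed.

(** Cauchy-Schwarz against the constant 1, written as nonnegativity of the square norm of u minus
    its mean. It bounds the functionals of the compact embedding. *)
Lemma mean_sqr_le u : sq u -> (fine (mu D))^-1 * (\int[mu]_(x in D) u x) ^+ 2 <= ip mu D u u.
Proof.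
move=> su; set B := \int[mu]_(x in D) u x.
have [k0|k0] := eqVneq (fine (mu D)) 0; first by rewrite k0 invr0 mul0r ip_ge0.
have kp : 0 < fine (mu D) by rewrite lt0r k0 fine_ge0.
have kE : \int[mu]_(x in D) (1 : R) = fine (mu D) by rewrite Rintegral_cst// mul1r.
have s1 : sq (fun=> 1) by apply: (@sqint_bounded _ _ D oD bD _ `|1|) => //; exact: measurable_cst.
have E11 : ip mu D (fun=> 1) (fun=> 1) = fine (mu D).
  by rewrite -kE; apply: eq_Rintegral => x _; rewrite mulr1.
have Eu1 : ip mu D u (fun=> 1) = B by apply: eq_Rintegral => x _; rewrite mulr1.
have := ip_ge0 mu D ((- (B / fine (mu D))) *: ((fun=> 1) : 'rV[R]_n -> R^o) + (u : 'rV[R]_n -> R^o)).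
rewrite (@form_sqrD R ('rV[R]_n -> R^o) sq (ip mu D) (sqint_lin mD) (fun u v _ _ => ipC mu D u v) (ip_lin mD))//.
rewrite E11 Eu1 => H; rewrite -subr_ge0; apply: le_trans H _; rewrite le_eqVlt; apply/orP; left; apply/eqP.
by field.
Qed.

End poincare.

(** * Separated points and Voronoi cells *)

Lemma sum_measure_le {d} {T : measurableType d} {R : realType} (mu : {measure set T -> \bar R})
  N (F : 'I_N -> set T) (B : set T) : measurable B -> (forall i, measurable (F i)) -> (forall i, F i `<=` B) ->
  (forall i j x, F i x -> F j x -> i = j) -> (\sum_i mu (F i) <= mu B)%E.
Proof.
move=> mB mF FB dF.
have mU : measurable (\big[setU/set0]_(i < N) F i) by exact: bigsetU_measurable.
rewrite -measure_semi_additive_ord//; last first.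
  by apply/trivIsetP => i j _ _ ij; apply/seteqP; split => // x [Fi Fj]; case/eqP: ij; exact: dF Fi Fj.
apply: le_measure; rewrite ?inE//; apply: (big_ind (fun A => A `<=` B)) => //.
by move=> A A' AB A'B x [/AB|/A'B].
Qed.

Section separated.
Context {R : realType} {n : nat}.
Local Notation mu := (@vol R n).
Local Notation Rn := (lebesgueRn R n).
Implicit Types O : set 'rV[R]_n.

Definition separated O (r : R) N (x : 'I_N -> 'rV[R]_n) :=
  (forall i, O (x i)) /\ forall i j, i != j -> r <= enorm (x i - x j).

Definition packs O r N := exists x : 'I_N -> 'rV[R]_n, separated O r x.

Lemma packs_mono O r N M : (M <= N)%N -> packs O r N -> packs O r M.
Proof.
move=> MN [x [Ox xr]]; exists (fun i => x (widen_ord MN i)); split => // i j ij.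
by apply: xr; apply: contra ij => /eqP/(congr1 val)/= ij; apply/eqP/val_inj.
Qed.

(** The balls of radius r / 2 around the points are disjoint and contained in one large ball. *)
Lemma packs_finite O r : bounded_set O -> 0 < r -> exists N, ~ packs O r N.
Proof.
move=> [M [_ HM]] r0.
have M1 : M < M + 1 by rewrite ltrDl.
pose big : set Rn := [set y | enorm (y - 0) < n%:R * (M + 1) + r].
pose ball0 : set Rn := [set y | enorm (y - 0) < r / 2].
have mbig : measurable big by apply: measurable_openRn; exact: open_enorm_ball.
have bigfin : (mu big < +oo)%E by apply: vol_bounded; exact: bounded_enorm_ball.
have r2 : 0 < r / 2 by rewrite divr_gt0.
have ball_gt0 : (0 < mu ball0)%E.
  apply: vol_open_gt0; first exact: open_enorm_ball.
  by exists 0; rewrite /ball0 /= subrr enorm0.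
have ballfin : mu ball0 \is a fin_num by rewrite ge0_fin_numE//; apply: vol_bounded; exact: bounded_enorm_ball.
have v0 : 0 < fine (mu ball0) by rewrite fine_gt0// ball_gt0 -ge0_fin_numE.
exists (Num.truncn (fine (mu big) / fine (mu ball0))).+1 => -[x [Ox xr]].
set N := (Num.truncn _).+1 in x Ox xr.
have := @sum_measure_le _ _ _ mu N (fun i => [set y : 'rV[R]_n | enorm (y - x i) < r / 2] : set Rn) big mbig.
have -> : (\sum_(i < N) mu [set y : 'rV[R]_n | (enorm (y - x i) < r / 2)%R])%E = (N%:R * fine (mu ball0))%:E.
  transitivity (\sum_(i < N) (fine (mu ball0))%:E)%E.
    apply: eq_bigr => i _; rewrite fineK//.
    have -> : [set y : 'rV[R]_n | enorm (y - x i) < r / 2] = homothety 1 (- x i) @^-1` ball0.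
      by apply/seteqP; split => y; rewrite /ball0 /homothety /= scale1r subr0.
    by rewrite [LHS](lebesgue_outer_preimage _ _ ltr01) expr1n invr1 mul1e.
  by rewrite sumEFin sumr_const card_ord -[_ *+ N]mulr_natl.
move=> H.
have bigfn : mu big \is a fin_num by rewrite ge0_fin_numE.
have : N%:R * fine (mu ball0) <= fine (mu big).
  rewrite -lee_fin (fineK bigfn); apply: H.
  - by move=> i; apply: measurable_openRn; exact: open_enorm_ball.
  - move=> i y /= yi; rewrite /big /= subr0 -[y](subrK (x i)); apply: le_lt_trans (enormD _ _) _.
    rewrite addrC; apply: ler_ltD; last by apply: lt_trans yi _; rewrite ltr_pdivrMr// ltr_pMr// ltr1n.
    by apply: le_trans (enorm_le_norm _) _; rewrite ler_wpM2l//; exact: HM M1 _ (Ox i).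
  - move=> i j y /= yi yj; apply/eqP; apply: contraT => /xr; rewrite leNgt.
    have -> : x i - x j = ((y : 'rV[R]_n) - x j) - ((y : 'rV[R]_n) - x i).
      by apply/rowP => l; rewrite !mxE; ring.
    move=> /negP[]; apply: le_lt_trans (enormD _ _) _; rewrite enormN (splitr r); exact: ltrD.
rewrite -ler_pdivlMr// leNgt => /negP; apply; exact: truncnS_gt.
Qed.

(** A separated family of maximal cardinality is a net: a point at distance at least [r] from all of
    them could be added, at the index [ord_max]. *)
Lemma packs_maximal O r k : ~ packs O r k.+1 ->
  exists N (x : 'I_N -> 'rV[R]_n), [/\ (N <= k)%N, separated O r x & forall y, O y -> exists i, enorm (y - x i) < r].
Proof.
move=> nk; have p0 : exists N, `[< packs O r N >].
  by exists 0%N; apply/asboolP; exists (fun=> 0); split => [[]|[]].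
have pk N : `[< packs O r N >] -> (N <= k)%N.
  by move=> /asboolP pN; rewrite leqNgt; apply/negP => kN; apply: nk; exact: packs_mono pN.
case: (ex_maxnP p0 pk) => N /asboolP pN Nmax; have Nk : (N <= k)%N by apply: pk; apply/asboolP.
have [x [Ox xr]] := pN; exists N, x; split => // y Oy.
apply: contrapT => ny; suff /asboolP/Nmax : packs O r N.+1 by rewrite ltnn.
have ry i : r <= enorm (y - x i) by rewrite leNgt; apply/negP => h; apply: ny; exists i.
exists (fun i => oapp x y (unlift ord_max i)); split => [i|i j].
  by case: unliftP => [i' _|_] //=; exact: Ox.
case: unliftP => [i' ->|->]; case: unliftP => [j' ->|->] //=.
- by rewrite (inj_eq (lift_inj (h := _))); exact: xr.
- by move=> _; rewrite enorm_distC; exact: ry.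
- by rewrite eqxx.
Qed.

End separated.

(** * Voronoi cells *)

Section voronoi.
Context {R : realType} {n : nat}.
Local Notation mu := (@vol R n).
Local Notation Rn := (lebesgueRn R n).
Variables (O : set 'rV[R]_n) (N : nat) (x : 'I_N -> 'rV[R]_n) (r : R).
Hypotheses (oO : open O) (cO : convexRn O) (bO : bounded_set O) (r0 : 0 < r).
Hypothesis x_inj : forall i j, i != j -> x i != x j.
Hypothesis x_cover : forall y, O y -> exists i, enorm (y - x i) < r.

Definition voronoi i : set 'rV[R]_n := [set y | O y /\ forall j, j != i -> enorm (y - x i) < enorm (y - x j)].

(** The points closer to [a] than to [b] form an open half-space; openness and convexity of the
    cells follow from this. *)
Lemma enorm_lt_dot (y a b : 'rV[R]_n) :
  (enorm (y - a) < enorm (y - b)) = (2 * dot y (b - a) < dot b b - dot a a).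
Proof.
rewrite -ltr_sqr ?nnegrE ?enorm_ge0// !sqr_enorm -subr_gt0 -[RHS]subr_gt0; congr (_ < _).
have E (z : 'rV[R]_n) : dot (y - z) (y - z) = dot y y - 2 * dot y z + dot z z.
  have := dot_sqr 1 (-1) y z; rewrite scale1r scaleN1r => ->; ring.
have -> : dot y (b - a) = dot y b - dot y a.
  by rewrite /dot -sumrB; apply: eq_bigr => i _; rewrite !mxE; ring.
rewrite !E; ring.
Qed.

Lemma dot_continuous (a : 'rV[R]_n) : continuous (fun y : 'rV[R]_n => dot y a).
Proof.
rewrite /dot; apply: continuous_big => [|i _ z]; first exact: add_continuous.
exact: (cvgMr_tmp (@coord_continuous R 1 n ord0 i z)).
Qed.

Lemma open_voronoi i : open (voronoi i).
Proof.
rewrite openE => y [Oy yi]; apply: filterI; first exact: open_nbhs_nbhs.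
apply: filter_forall_fin => j; have [ji|ji] := eqVneq j i; first by apply: filterE => z /eqP.
suff : \forall z \near y, enorm (z - x i) < enorm (z - x j) by apply: filterS.
have := yi j ji; rewrite enorm_lt_dot mulrC -ltr_pdivlMr// => h.
have cd := @dot_continuous (x j - x i) y.
near=> z; rewrite enorm_lt_dot mulrC -ltr_pdivlMr//; near: z.
exact: (cvgr_lt _ cd).
Unshelve. all: by end_near. Qed.

Lemma convex_voronoi i : convexRn (voronoi i).
Proof.
move=> y z t /andP[t0 t1] [Oy yi] [Oz zi]; split; first by apply: cO => //; rewrite t0.
move=> j ji; have := yi j ji; have := zi j ji; rewrite !enorm_lt_dot dotC dotC.
rewrite [dot y _]dotC [dot z _]dotC [dot (_ + _) _]dotC.
have -> : dot ((1 - t) *: y + t *: z) (x j - x i) = (1 - t) * dot y (x j - x i) + t * dot z (x j - x i).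
  by rewrite dot_linl -[t *: z]addr0 dot_linl dot0l addr0.
rewrite ![dot (x j - x i) _]dotC.
have s0 : 0 < 1 - t by rewrite subr_gt0.
have aux (a b c : R) : 2 * b < c -> 2 * a < c -> 2 * ((1 - t) * a + t * b) < c.
  move=> bc ac; have h1 : (1 - t) * (2 * a) < (1 - t) * c by rewrite ltr_pM2l.
  have h2 : t * (2 * b) < t * c by rewrite ltr_pM2l.
  lra.
exact: aux.
Qed.

Lemma voronoi_sub i : voronoi i `<=` O. Proof. by move=> y []. Qed.

Lemma voronoi_disj i j y : voronoi i y -> voronoi j y -> i = j.
Proof.
move=> [_ yi] [_ yj]; apply/eqP; apply: contraT => ij.
by have := lt_trans (yi j _) (yj i ij); rewrite ltxx eq_sym ij => /(_ isT).
Qed.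

Lemma voronoi_diam i y z : voronoi i y -> voronoi i z -> enorm (y - z) <= 2 * r.
Proof.
have near_center w : voronoi i w -> enorm (w - x i) < r.
  move=> [Ow wi]; have [j wj] := x_cover Ow; have [<-//|ji] := eqVneq j i.
  exact: lt_trans (wi j ji) wj.
move=> /near_center yi /near_center zi.
have -> : y - z = (y - x i) - (z - x i) by rewrite opprB addrA subrK.
by apply: le_trans (enormD _ _) _; rewrite enormN; lra.
Qed.

(** A point outside all cells has two nearest centres, hence lies on one of finitely many bisecting
    hyperplanes. *)
Lemma voronoi_null : mu (O `\` \bigcup_i voronoi i) = 0%E.
Proof.
pose H i j : set 'rV[R]_n := [set y | \sum_l (x j - x i) ord0 l * y ord0 l = (dot (x j) (x j) - dot (x i) (x i)) / 2].
apply/eqP; rewrite eq_le measure_ge0 andbT.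
apply: (@le_trans _ _ (mu (\big[setU/set0]_(p : 'I_N * 'I_N | p.1 != p.2) H p.1 p.2))).
  apply: (le_outer_measure (@lebesgue_outer R n)) => y [Oy ny].
  have [i0 _] := x_cover Oy.
  pose i := [arg min_(i < i0) enorm (y - x i)]%O.
  have imin j : enorm (y - x i) <= enorm (y - x j).
    by rewrite /i; case: arg_minP => // k _; exact.
  have [j ji yj] : exists2 j, j != i & enorm (y - x j) <= enorm (y - x i).
    apply: contrapT => nj; apply: ny; exists i => //; split => // j ji.
    by rewrite ltNge; apply/negP => h; apply: nj; exists j.
  rewrite (bigD1 (i, j)) /=; last by rewrite eq_sym.
  left; rewrite /H /=.
  have := imin j; have := yj; rewrite !leNgt !enorm_lt_dot -!leNgt.
  have -> : dot y (x i - x j) = - dot y (x j - x i).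
    by rewrite /dot -sumrN; apply: eq_bigr => l _; rewrite !mxE; ring.
  rewrite -[\sum_l _]/(dot (x j - x i) y) dotC.
  have aux (a b c : R) : c - b <= 2 * a -> b - c <= 2 * - a -> a = (c - b) / 2 by lra.
  exact: aux.
elim/big_ind : _ => [|A B A0 B0|[i j] /= ij]; first by rewrite measure0.
  by apply: le_trans (outer_measureU2 (@lebesgue_outer R n) A B) _; rewrite -[leRHS]adde0; exact: leeD.
by rewrite /H [leLHS]hyperplane_null// subr_eq0 eq_sym x_inj.
Qed.

Let mO : measurable (O : set Rn). Proof. exact: measurable_openRn. Qed.
Let mV i : measurable (voronoi i : set Rn). Proof. exact/measurable_openRn/open_voronoi. Qed.

Lemma Rintegral_voronoi (f : 'rV[R]_n -> R) : mu.-integrable O (EFin \o f) ->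
  \int[mu]_(y in O) f y = \sum_i \int[mu]_(y in voronoi i) f y.
Proof.
move=> fi; have fV i : mu.-integrable O (EFin \o (f \_ (voronoi i))).
  have mf : measurable_fun (O : set Rn) (f : Rn -> R) by apply/measurable_EFinP; exact: measurable_int fi.
  have mfV : measurable_fun (O : set Rn) (EFin \o (f \_ (voronoi i))).
    apply/measurable_EFinP; apply/(measurable_restrict _ (mV i) mO).
    by apply: measurable_funS mf => // y [].
  apply: (le_integrable mO mfV _ fi) => y Oy; rewrite /= patchE; case: ifP => // _.
  by rewrite lee_fin normr0.
have [sI sE] := Rintegral_sum (index_enum 'I_N) mO fV.
transitivity (\int[mu]_(y in O) \sum_i (f \_ (voronoi i)) y); last first.
  rewrite sE; apply: eq_bigr => i _; rewrite -Rintegral_mkcondr setIidr//; exact: voronoi_sub.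
rewrite /Rintegral; congr fine.
apply: ae_eq_integral; [exact: mO|exact: measurable_int fi|exact: measurable_int sI|].
exists (O `\` \bigcup_i voronoi i); split.
- apply: measurableD; [exact: mO|apply: measurable_openRn; apply: bigcup_open => i _; exact: open_voronoi].
- exact: voronoi_null.
move=> y /= /not_implyP[Oy nE]; split => // -[i _ Vy]; apply: nE.
congr (_%:E); rewrite (bigD1 i)//= patchE mem_set// big1 ?addr0// => j ji.
rewrite patchE memNset// => Vj; by rewrite (voronoi_disj Vj Vy) eqxx in ji.
Qed.

(** A test function of [D] is one of [O]. It vanishes off a compact subset of [D], and so do its
    derivatives because the complement of that set is open, so the integrals over [D] and [O]
    agree. *)
Lemma H1_gradient_sub (D : set 'rV[R]_n) u g : open D -> D `<=` O -> H1_gradient O u g -> H1_gradient D u g.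
Proof.
move=> oD DO [su Hg].
have mD : measurable (D : set Rn) by exact: measurable_openRn.
split; first exact: (sqint_sub oO mD DO su).
move=> i; have [sg Hi] := Hg i; split; first exact: (sqint_sub oO mD DO sg).
move=> phi [sphi [K [cK KD K0]]].
have to : test_function O phi by split => //; exists K; split => //; exact: subset_trans KD DO.
have K0' y : ~ K y -> partial i phi y = 0.
  move=> nK; rewrite /partial.
  have oK : open (~` K) by apply: closed_openC; apply: compact_closed => //; exact: norm_hausdorff.
  rewrite (near_eq_derive (g := cst 0)) ?derive_cst//.
  have : nbhs y (~` K) by exact: open_nbhs_nbhs.
  by apply: filterS => z; exact: K0.
have ext (f : 'rV[R]_n -> R) : (forall y, ~ K y -> f y = 0) ->
    \int[mu]_(y in D) f y = \int[mu]_(y in O) f y.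
  move=> f0; rewrite Rintegral_mkcond [RHS]Rintegral_mkcond; apply: eq_Rintegral => y _.
  rewrite !patchE; have [yD|yD] := boolP (y \in D).
    by rewrite mem_set//; apply: DO; exact: set_mem yD.
  case: ifP => // _; rewrite f0// => /KD Dy; by rewrite mem_set in yD.
rewrite ext; last by move=> y /K0' ->; rewrite mulr0.
by rewrite (Hi _ to) [in RHS]ext// => y /K0 ->; rewrite mulr0.
Qed.

(** The Poincare inequality is summed over the cells, which are convex of diameter at most 2 r and
    cover [O] up to a null set. *)
Theorem poincare_cells u g : H1_gradient O u g ->
  ip mu O u u <= 80 * (2 * r) ^+ 2 * (\sum_l ip mu O (g l) (g l)) +
    \sum_i (fine (mu (voronoi i)))^-1 * (\int[mu]_(y in voronoi i) u y) ^+ 2.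
Proof.
move=> H1; have [su Hg] := H1.
have sg l : sqint mu O (g l) by have [] := Hg l.
rewrite /ip (Rintegral_voronoi (integrable_sqintM mO su su)).
under [X in _ <= _ * X + _]eq_bigr do rewrite (Rintegral_voronoi (integrable_sqintM mO (sg _) (sg _))).
rewrite exchange_big /= mulr_sumr -big_split /=; apply: ler_sum => i _.
have bV : bounded_set (voronoi i).
  by case: bO => M [Mr HM]; exists M; split => // y My z [Oz _]; exact: HM.
have r20 : 0 < 2 * r by rewrite mulr_gt0.
have H1V : H1_gradient (voronoi i) u g by apply: H1_gradient_sub H1; [exact: open_voronoi|exact: voronoi_sub].
exact: (poincare_H1 (@open_voronoi i) (@convex_voronoi i) bV r20 (@voronoi_diam i) H1V).
Qed.

End voronoi.

(** * Min-max for Neumann eigenvalues *)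

Section sobolev_forms.
Context {R : realType} {n : nat}.
Local Notation mu := (@vol R n).
Local Notation Rn := (lebesgueRn R n).
Variable O : set 'rV[R]_n.
Hypotheses (oO : open O) (bO : bounded_set O).

Let mO : measurable (O : set Rn). Proof. exact: measurable_openRn. Qed.
Local Notation sq := (sqint mu O).
Local Notation ip := (ip mu O).

(** The gradient is carried as data, which makes both forms bilinear on a vector space of plain
    functions. They are semidefinite only; equality almost everywhere is detected by [mass_form]. *)
Definition H1pair := (('rV[R]_n -> R^o) * ('I_n -> 'rV[R]_n -> R^o))%type.

Definition inH1 (w : H1pair) := H1_gradient O w.1 w.2.
Definition dirichlet_form (v w : H1pair) : R := \sum_l ip (v.2 l) (w.2 l).
Definition mass_form (v w : H1pair) : R := ip v.1 w.1.

Lemma sqint_of_support (f : 'rV[R]_n -> R) (K : set 'rV[R]_n) : continuous f -> compact K ->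
  (forall x, ~ K x -> f x = 0) -> sq f.
Proof.
move=> cf cK f0.
have [M [_ HM]] : bounded_set (f @` K).
  by apply: compact_bounded; apply: continuous_compact => //; exact: continuous_subspaceT.
apply: (sqint_bounded oO bO (C := Num.max 0 (M + 1))); first exact: measurable_continuousRn.
move=> x _; have [Kx|nKx] := pselect (K x); last by rewrite f0// normr0 le_max lexx.
by rewrite le_max; apply/orP; right; apply: (HM (M + 1)); [rewrite ltrDl|exists x].
Qed.

Lemma sqint_test phi : test_function O phi -> sq phi /\ forall i, sq (partial i phi).
Proof.
move=> [sphi [K [cK KO K0]]].
have K0' i y : ~ K y -> partial i phi y = 0.
  move=> nK; rewrite /partial.
  have oK : open (~` K) by apply: closed_openC; apply: compact_closed => //; exact: norm_hausdorff.
  rewrite (near_eq_derive (g := cst 0)) ?derive_cst//.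
  have : nbhs y (~` K) by exact: open_nbhs_nbhs.
  by apply: filterS => z; exact: K0.
split; first by apply: sqint_of_support cK K0 => x; have [] := sphi [::] x Logic.I.
by move=> i; apply: sqint_of_support cK (K0' i) => x; have [] := sphi [:: i] x Logic.I.
Qed.

Lemma inH1_sq w : inH1 w -> sq w.1 /\ forall l, sq (w.2 l).
Proof. by move=> [su Hg]; split => // l; have [] := Hg l. Qed.

Lemma inH1_0 : inH1 0.
Proof.
split; first exact: sqint0; move=> i; split; first exact: sqint0.
move=> phi _; have z (f : 'rV[R]_n -> R) : \int[mu]_(x in O) (0 * f x) = 0.
  by under eq_Rintegral do rewrite mul0r; rewrite /Rintegral integral0.
by rewrite z z oppr0.
Qed.

Lemma inH1_lin c v w : inH1 v -> inH1 w -> inH1 (c *: v + w).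
Proof.
move=> [sv Hv] [sw Hw]; split; first exact: (sqint_lin mO c sv sw).
move=> i; have [svi Ev] := Hv i; have [swi Ew] := Hw i; split; first exact: (sqint_lin mO c svi swi).
move=> phi tphi; have [sphi sdphi] := sqint_test tphi.
have := ip_lin mO c sv sw (sdphi i); have := ip_lin mO c svi swi sphi.
rewrite /ip => E1 E2; rewrite [LHS]E2 [X in _ = - X]E1 (Ev _ tphi) (Ew _ tphi); ring.
Qed.

Lemma dirichlet_formC v w : dirichlet_form v w = dirichlet_form w v.
Proof. by apply: eq_bigr => l _; rewrite ipC. Qed.

Lemma mass_formC v w : mass_form v w = mass_form w v.
Proof. exact: ipC. Qed.

Lemma dirichlet_form_lin c u v w : inH1 u -> inH1 v -> inH1 w ->
  dirichlet_form (c *: u + v) w = c * dirichlet_form u w + dirichlet_form v w.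
Proof.
move=> /inH1_sq[_ su] /inH1_sq[_ sv] /inH1_sq[_ sw].
rewrite /dirichlet_form mulr_sumr -big_split; apply: eq_bigr => l _ /=.
exact: (ip_lin mO c (su l) (sv l) (sw l)).
Qed.

Lemma mass_form_lin c u v w : inH1 u -> inH1 v -> inH1 w ->
  mass_form (c *: u + v) w = c * mass_form u w + mass_form v w.
Proof.
move=> /inH1_sq[su _] /inH1_sq[sv _] /inH1_sq[sw _]; exact: (ip_lin mO c su sv sw).
Qed.

Lemma dirichlet_form_ge0 u : 0 <= dirichlet_form u u.
Proof. by apply: sumr_ge0 => l _; exact: ip_ge0. Qed.

Lemma mass_form_ge0 u : 0 <= mass_form u u.
Proof. exact: ip_ge0. Qed.

Lemma ip_small (psi : 'rV[R]_n -> R^o) e : sq psi -> 0 < e -> exists2 d, 0 < d &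
  forall z : 'rV[R]_n -> R^o, sq z -> ip z z <= d -> `|ip z psi| <= e.
Proof.
move=> sp e0; have q0 := ip_ge0 mu O psi.
pose t := e / (ip psi psi + 1).
have t0 : 0 < t by rewrite divr_gt0// ltr_wpDl.
exists (e * t) => [|z sz zd]; first by rewrite mulr_gt0.
have := @form_AMGM R ('rV[R]_n -> R^o) sq ip (sqint_lin mO) (fun u v _ _ => ipC mu O u v) (ip_lin mO) (fun u _ => ip_ge0 mu O u) t psi z t0 sp sz.
have : t * ip psi psi <= e by apply: ler_frac_succ => //; exact: ltW.
have : t^-1 * ip z z <= e by rewrite ler_pdivrMl// mulrC.
rewrite (ipC mu O psi z) normrM (gtr0_norm (x := 2))//.
have aux (a b c : R) : a <= e -> b <= e -> 2 * c <= b + a -> c <= e by lra.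
exact: aux.
Qed.

(** The function and each component of the gradient converge in L^2 separately. The integration by
    parts identity survives because pairing with a fixed test function is continuous in L^2. *)
Lemma inH1_complete (w : nat -> H1pair) : (forall k, inH1 (w k)) ->
  (forall e, 0 < e -> exists N, forall i j, (N <= i)%N -> (N <= j)%N ->
     dirichlet_form (w i - w j) (w i - w j) + mass_form (w i - w j) (w i - w j) <= e) ->
  exists2 u, inH1 u & forall e, 0 < e -> exists N, forall i, (N <= i)%N ->
    dirichlet_form (w i - u) (w i - u) + mass_form (w i - u) (w i - u) <= e.
Proof.
move=> Pw cw.
have sw k := inH1_sq (Pw k).
have [u su Hu] : exists2 u : 'rV[R]_n -> R^o, sq u & forall e, 0 < e -> exists N, forall i, (N <= i)%N ->
    ip ((w i).1 - u) ((w i).1 - u) <= e.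
  apply: (sqint_complete mO) => [k|e e0]; first by have [] := sw k.
  have [N HN] := cw e e0; exists N => i j Ni Nj; apply: le_trans (HN i j Ni Nj).
  by rewrite lerDr dirichlet_form_ge0.
have /choice[g Hg] (l : 'I_n) : exists g : 'rV[R]_n -> R^o, sq g /\ forall e, 0 < e -> exists N, forall i, (N <= i)%N ->
    ip ((w i).2 l - g) ((w i).2 l - g) <= e.
  have [|g sg Hg] := @sqint_complete _ _ _ mu O mO (fun k => (w k).2 l) (fun k => (sw k).2 l); last by exists g.
  move=> e e0; have [N HN] := cw e e0; exists N => i j Ni Nj; apply: le_trans (HN i j Ni Nj).
  rewrite /dirichlet_form (bigD1 l)//= -addrA lerDl addr_ge0 ?mass_form_ge0// sumr_ge0// => m _; exact: ip_ge0.
exists (u, g).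
  split => // i; have [sg Hgi] := Hg i; split => // phi tphi; have [sphi sdphi] := sqint_test tphi.
  apply/eqP; rewrite -subr_eq0 opprK -normr_le0; apply/ler_addgt0Pr => e e0; rewrite add0r.
  have e2 : 0 < e / 2 by rewrite divr_gt0.
  have [d1 d10 H1] := ip_small (sdphi i) e2; have [d2 d20 H2] := ip_small sphi e2.
  have [N1 HN1] := Hu _ d10; have [N2 HN2] := Hgi _ d20.
  pose k := maxn N1 N2.
  have h1 := HN1 k (leq_maxl _ _); have h2 := HN2 k (leq_maxr _ _).
  have [suk sgk] := sw k.
  have {}H1 := H1 _ (sqintB mO suk su) h1; have {}H2 := H2 _ (sqintB mO (sgk i) sg) h2.
  have := (Pw k).2 i; move=> [_ /(_ _ tphi)].
  rewrite -![Rintegral mu O (fun x => _ * _)]/(ip _ _) => Ek.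
  have := ip_lin mO 1 (sqintB mO suk su) su (sdphi i).
  have := ip_lin mO 1 (sqintB mO (sgk i) sg) sg sphi.
  rewrite !scale1r !subrK !mul1r.
  have aux (a b c f p q : R) : p = - q -> `|c| <= e / 2 -> `|f| <= e / 2 -> q = f + b -> p = c + a -> `|a + b| <= e.
    move=> -> /[!ler_norml] /andP[? ?] /andP[? ?] qE pE; apply/andP; split; lra.
  exact: aux Ek H1 H2.
move=> e e0.
have e1 : 0 < e / (n.+1)%:R by rewrite divr_gt0.
have /choice[N HN] (l : 'I_n) : exists N, forall i, (N <= i)%N -> ip ((w i).2 l - g l) ((w i).2 l - g l) <= e / (n.+1)%:R.
  by have [_] := Hg l; exact.
have [N0 HN0] := Hu _ e1.
exists (maxn N0 (\max_l N l)) => i; rewrite geq_max => /andP[N0i Ni].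
have -> : e = \sum_(l < n) (e / n.+1%:R) + e / n.+1%:R.
  by rewrite sumr_const card_ord -[_ *+ n]mulr_natr -[X in _ + X]mulr1 -mulrDr natr1 divfK ?pnatr_eq0.
apply: lerD; last exact: HN0.
apply: ler_sum => l _; apply: HN; apply: leq_trans Ni; exact: leq_bigmax.
Qed.

Lemma form_sumE (q : H1pair -> H1pair -> R) (I : finType) (c d : I -> R) (f : I -> H1pair) :
  (forall c u v w, inH1 u -> inH1 v -> inH1 w -> q (c *: u + v) w = c * q u w + q v w) ->
  (forall v w, q v w = q w v) -> (forall i, inH1 (f i)) ->
  q (\sum_i c i *: f i) (\sum_i d i *: f i) = \sum_i \sum_j c i * d j * q (f i) (f j).
Proof.
move=> ql qC Pf.
have Ps : inH1 (\sum_i d i *: f i) by apply: (subspace_sum (P := inH1) inH1_0 inH1_lin).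
rewrite (form_sum (P := inH1) inH1_0 inH1_lin ql)//; apply: eq_bigr => i _.
rewrite qC (form_sum (P := inH1) inH1_0 inH1_lin ql)// mulr_sumr; apply: eq_bigr => j _.
by rewrite mulrA qC.
Qed.

Lemma mass_form_sum (I : finType) (c d : I -> R) (f : I -> H1pair) : (forall i, inH1 (f i)) ->
  mass_form (\sum_i c i *: f i) (\sum_i d i *: f i) = \sum_i \sum_j c i * d j * mass_form (f i) (f j).
Proof. exact: (form_sumE _ _ mass_form_lin mass_formC). Qed.

Lemma dirichlet_form_sum (I : finType) (c d : I -> R) (f : I -> H1pair) : (forall i, inH1 (f i)) ->
  dirichlet_form (\sum_i c i *: f i) (\sum_i d i *: f i) = \sum_i \sum_j c i * d j * dirichlet_form (f i) (f j).
Proof. exact: (form_sumE _ _ dirichlet_form_lin dirichlet_formC). Qed.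

Lemma neumann_eigenfunctionP m u : inH1 u -> (forall h, inH1 h -> dirichlet_form u h = m * mass_form u h) ->
  neumann_eigenfunction O m u.1.
Proof.
move=> Pu E; exists u.2 => // h gh Ph; have := E (h, gh) Ph.
have [_ su] := inH1_sq Pu; have [_ sh] := @inH1_sq (h, gh) Ph.
by rewrite /dirichlet_form /ip -(Rintegral_sum _ mO (fun l => integrable_sqintM mO (su l) (sh l))).2.
Qed.

Lemma eigenfunction_inH1 m u : neumann_eigenfunction O m u -> exists w : H1pair, [/\ inH1 w, w.1 = u &
  forall h, inH1 h -> dirichlet_form w h = m * mass_form w h].
Proof.
move=> [gu Pu E]; exists (u, gu); split => // -[h gh] Ph; have := E h gh Ph.
have [_ su] := @inH1_sq (u, gu) Pu; have [_ sh] := @inH1_sq (h, gh) Ph.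
by rewrite /dirichlet_form /ip -(Rintegral_sum _ mO (fun l => integrable_sqintM mO (su l) (sh l))).2.
Qed.

Lemma mass0_ae u : inH1 u -> mass_form u u = 0 -> {ae mu, forall x, O x -> u.1 x = 0}.
Proof. by move=> /inH1_sq[su _]; exact: sqint_ae0. Qed.

Lemma ae0_mass u v : inH1 u -> inH1 v -> {ae mu, forall x, O x -> u.1 x = 0} -> mass_form u v = 0.
Proof.
move=> /inH1_sq[su _] /inH1_sq[sv _] u0.
rewrite /mass_form (ip_ae mO su sv (sqint0 mu O) sv).
- by rewrite /ip; under eq_Rintegral do rewrite mul0r; rewrite /Rintegral integral0.
- exact: u0.
- by apply: aeW.
Qed.

Lemma sum_fst (I : finType) (c : I -> R) (f : I -> H1pair) x :
  (\sum_i c i *: f i).1 x = \sum_i c i * (f i).1 x.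
Proof.
rewrite (big_morph (fun w : H1pair => w.1 x : R) (id1 := 0) (op1 := +%R))//.
Qed.

End sobolev_forms.

(** * Counting indices by eigenvalue *)

Section counting.
Context {R : realType}.

(** The multiplicity condition yields one injection for each value. Indices belonging to different
    values are distinguished by [lam], so these injections glue together. *)
Lemma injection_by_value (k : nat) (nu : 'I_k.+1 -> R) (lam : nat -> R) :
  (forall m, exists2 f : 'I_(#|[set i | nu i == m]%SET|) -> nat, injective f & forall j, lam (f j) = m) ->
  exists2 F : 'I_k.+1 -> nat, injective F & forall j, lam (F j) = nu j.
Proof.
move=> H.
have /choice[phi Hphi] (m : R) : exists phi : 'I_k.+1 -> nat,
    (forall i j, nu i = m -> nu j = m -> phi i = phi j -> i = j) /\ forall i, nu i = m -> lam (phi i) = m.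
  have [f finj fE] := H m; set J := [set i | nu i == m]%SET in f finj fE.
  have [J0|[i0 Ji0]] := set_0Vmem J.
    have nJ i : nu i = m -> False.
      move=> /eqP im; have : i \in J by rewrite inE.
      by rewrite J0 finset.in_set0.
    by exists (fun=> 0%N); split => [i j /nJ|i /nJ].
  exists (fun i => f (enum_rank_in Ji0 i)); split => [i j /eqP im /eqP jm /finj|i _]; last exact: fE.
  by apply: enum_rank_in_inj; rewrite inE.
exists (fun i => phi (nu i) i) => [i j ij|j]; last by have [_] := Hphi (nu j); exact.
have [Hi li] := Hphi (nu i); have [_ lj] := Hphi (nu j).
have nij : nu j = nu i by rewrite -(li i erefl) ij (lj j erefl).
by apply: Hi => //; rewrite ij nij.
Qed.

(** k + 1 distinct indices cannot all be below k. This is where the numbering of eigenvalues from 0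
    matches k + 1 trial functions. *)
Lemma injection_ge (k : nat) (F : 'I_k.+1 -> nat) : injective F -> exists j, (k <= F j)%N.
Proof.
move=> Finj; apply: contrapT => nF.
have Fk j : (F j < k)%N by rewrite ltnNge; apply/negP => h; apply: nF; exists j.
have := leq_card (fun j => Ordinal (Fk j)) _; rewrite !card_ord ltnn => H.
by suff: false by []; apply: H => i j [] /Finj.
Qed.

End counting.


(** * Upper and lower bounds for Neumann eigenvalues *)

Section eigenvalue_bounds.
Context {R : realType} {n : nat}.
Local Notation mu := (@vol R n).
Local Notation Rn := (lebesgueRn R n).
Variable O : set 'rV[R]_n.
Hypotheses (oO : open O) (cO : convexRn O) (bO : bounded_set O).

Let mO : measurable (O : set Rn). Proof. exact: measurable_openRn. Qed.
Local Notation sq := (sqint mu O).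
Local Notation P := (inH1 O).
Local Notation a := (dirichlet_form O).
Local Notation b := (mass_form O).

(** The functionals are the integrals over the cells divided by the square root of the volume of the
    cell; their squares are then the mean terms of [poincare_cells]. There are at most [k] of them,
    which the lower bound needs, while compactness only needs finitely many. *)
Lemma sobolev_cells r k : 0 < r -> ~ packs O r k.+1 ->
  exists (N : nat) (l : 'I_N -> H1pair (R := R) (n := n) -> R),
  [/\ (N <= k)%N, forall j c u v, P u -> P v -> l j (c *: u + v) = c * l j u + l j v,
      forall j u, P u -> (l j u) ^+ 2 <= b u u &
      forall u, P u -> b u u <= 80 * (2 * r) ^+ 2 * a u u + \sum_j (l j u) ^+ 2].
Proof.
move=> r0 nk; have [N [x [Nk [Ox xr] xc]]] := packs_maximal nk.
have xi i j : i != j -> x i != x j.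
  move=> ij; apply: contraTneq (xr i j ij) => ->; by rewrite subrr enorm0 -ltNge.
pose V := voronoi O x.
have oV i : open (V i) by exact: open_voronoi.
have VO i : V i `<=` O by exact: voronoi_sub.
have bV i : bounded_set (V i).
  by case: bO => M [Mr HM]; exists M; split => // y My z /VO; exact: HM.
have mV i : measurable (V i : set Rn) by exact: measurable_openRn.
pose l i (u : H1pair (R := R) (n := n)) : R := (Num.sqrt (fine (mu (V i))))^-1 * \int[mu]_(y in V i) u.1 y.
have lE i u : (l i u) ^+ 2 = (fine (mu (V i)))^-1 * (\int[mu]_(y in V i) u.1 y) ^+ 2.
  by rewrite exprMn exprVn sqr_sqrtr// fine_ge0.
exists N, l; split => //.
- move=> j c u v /(inH1_sq) [su _] /inH1_sq [sv _]; rewrite /l.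
  have iu := sqint_ip1 (oV j) (bV j) (sqint_sub oO (mV j) (@VO j) su).
  have iv := sqint_ip1 (oV j) (bV j) (sqint_sub oO (mV j) (@VO j) sv).
  have -> : \int[mu]_(y in V j) (c *: u + v).1 y = c * (\int[mu]_(y in V j) u.1 y) + \int[mu]_(y in V j) v.1 y.
    by rewrite -(RintegralZl _ (mV j) iu) -(RintegralD (mV j) (integrableZl (mV j) c iu) iv).
  ring.
- move=> j u /inH1_sq [su _]; rewrite lE.
  apply: le_trans (ip_sub oO (mV j) (@VO j) su).
  exact: mean_sqr_le (oV j) (bV j) _ (sqint_sub oO (mV j) (@VO j) su).
- move=> u Pu; under eq_bigr do rewrite lE.
  exact: (poincare_cells oO cO bO r0 xi xc Pu).
Qed.

Lemma sobolev_compact e : 0 < e -> exists (N : nat) (l : 'I_N -> H1pair (R := R) (n := n) -> R),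
  [/\ forall j u v, P u -> P v -> l j (u - v) = l j u - l j v,
      forall j u, P u -> (l j u) ^+ 2 <= b u u &
      forall u, P u -> b u u <= e * a u u + \sum_j (l j u) ^+ 2].
Proof.
(* Solves 80 (2 r)^2 = 320 r^2 = e. *)
move=> e0; pose r := Num.sqrt (e / 320).
have h320 : 0 < 320 :> R by rewrite ltr0n.
have er0 := divr_gt0 e0 h320.
have r0 : 0 < r by rewrite sqrtr_gt0.
have [k nk] := packs_finite bO r0.
have [N [l [_ ll lb lP]]] := sobolev_cells r0 (fun p => nk (packs_mono (leqnSn k) p)).
exists N, l; split => // [j u v Pu Pv|u Pu].
  by rewrite -[u - v]addrC -scaleN1r ll// mulN1r addrC.
apply: le_trans (lP u Pu) _; rewrite exprMn (sqr_sqrtr (ltW er0)) lerD2r.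
have -> : 80 * (2 ^+ 2 * (e / 320)) = e by field.
exact: lexx.
Qed.

(** Minimization provides k + 1 orthonormal eigenvectors with eigenvalues at most [L]. Those sharing
    a value are free almost everywhere, so [lam] takes that value at least as many times. In all, k
    + 1 distinct indices carry values at most [L], one of these indices is at least [k], and [lam]
    is monotone. *)
Theorem lam_upper (lam : nat -> R) (k : nat) (f : 'I_k.+1 -> H1pair (R := R) (n := n)) (L : R) :
  neumann_eigenvalues O lam -> (forall i, P (f i)) ->
  (forall c : 'I_k.+1 -> R, a (\sum_i c i *: f i) (\sum_i c i *: f i) <=
     L * b (\sum_i c i *: f i) (\sum_i c i *: f i)) ->
  (forall c : 'I_k.+1 -> R, b (\sum_i c i *: f i) (\sum_i c i *: f i) = 0 -> forall i, c i = 0) ->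
  lam k <= L.
Proof.
move=> [lam_mono lamE] Pf fa fb.
have [e [nu [ev nuL orth]]] := minmax_eigenvectors (inH1_0 O) (inH1_lin oO bO)
  (fun u v _ _ => dirichlet_formC O u v) (fun u v _ _ => mass_formC O u v) (dirichlet_form_lin oO) (mass_form_lin oO)
  (fun u _ => dirichlet_form_ge0 O u) (fun u _ => mass_form_ge0 O u) sobolev_compact (inH1_complete oO bO) Pf fa fb.
have Pe (i : 'I_k.+1) : P (e i) by have [] := ev i (ltn_ord i).
have [F Finj FE] : exists2 F : 'I_k.+1 -> nat, injective F & forall j, lam (F j) = nu j.
  apply: injection_by_value => m; apply/lamE.
  set J := [set i : 'I_k.+1 | nu i == m]%SET.
  exists (fun j : 'I_#|J| => (e (enum_val j : 'I_k.+1)).1); split.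
    move=> j; have := enum_valP j; rewrite inE => /eqP num.
    have [_ E] := ev _ (ltn_ord (enum_val j : 'I_k.+1)).
    by apply: neumann_eigenfunctionP => // h Ph; rewrite -num; exact: E.
  move=> c c0 j.
  pose s := \sum_(i < #|J|) c i *: e (enum_val i : 'I_k.+1).
  have Ps : P s by apply: (subspace_sum (P := P) (inH1_0 O) (inH1_lin oO bO)) => i; exact: Pe.
  have s0 : {ae mu, forall x, O x -> s.1 x = 0}.
    by apply: (@filterS _ _ (ae_filter_ringOfSetsType mu) _ _ _ c0) => x H Ox; rewrite sum_fst H.
  have ev_le (i : 'I_#|J|) : ((enum_val i : 'I_k.+1) <= k)%N := ltn_ord (enum_val i : 'I_k.+1).
  have := ae0_mass oO Ps (Pe (enum_val j)) s0.
  rewrite (form_sum (P := P) (inH1_0 O) (inH1_lin oO bO) (mass_form_lin oO))//.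
  rewrite (bigD1 j)//= big1 => [|i ij].
    by rewrite (orth _ _ (ev_le j) (ev_le j)) eqxx mulr1 addr0.
  rewrite (orth _ _ (ev_le i) (ev_le j)) (_ : (_ == _) = false) ?mulr0//.
  by apply: contraNF ij => /eqP/val_inj/enum_val_inj ->.
have [j kj] := injection_ge Finj.
apply: le_trans (lam_mono _ _ kj) _; rewrite FE; exact: nuL _ (ltn_ord j).
Qed.

(** The indices 0 to [k] provide k + 1 independent eigenfunctions, and a nontrivial combination of
    them is killed by the at most [k] functionals. For it the Poincare term must carry the whole
    mass, while its Rayleigh quotient is at most [lam k]. *)
Theorem lam_lower (lam : nat -> R) (k : nat) (r : R) : neumann_eigenvalues O lam -> 0 < r ->
  ~ packs O r k.+1 -> 1 <= 320 * r ^+ 2 * lam k.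
Proof.
move=> [lam_mono lamE] r0 nk.
have [N [l [Nk ll _ lP]]] := sobolev_cells r0 nk.
pose J m := [set i : 'I_k.+1 | lam i == m]%SET.
have /choice[w Hw] (m : R) : exists w : 'I_k.+1 -> H1pair (R := R) (n := n),
    (forall i : 'I_k.+1, lam i = m -> P (w i) /\ forall h, P h -> a (w i) h = m * b (w i) h) /\
    forall c : 'I_k.+1 -> R, {ae mu, forall x, O x -> \sum_(i in J m) c i * (w i).1 x = 0} ->
      forall i : 'I_k.+1, lam i = m -> c i = 0.
  have [[i0 Ji0]|J0] : (exists i0, i0 \in J m) \/ (forall i, i \notin J m).
    have [->|[i0 Ji0]] := set_0Vmem (J m); last by left; exists i0.
    by right => i; rewrite finset.in_set0.
  (* No index up to [k] has the value [m]: any family serves, and both conditions are void. *)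
  2: by exists (fun=> 0); split => [i|c _ i] im; have := J0 i; rewrite inE im eqxx.
  have [|u [eu fu]] := (lamE m #|J m|).1.
    exists (fun j => (enum_val j : 'I_k.+1) : nat) => [i j /val_inj/enum_val_inj//|j].
    by have := enum_valP j; rewrite inE => /eqP.
  have /choice[v Hv] := fun j => eigenfunction_inH1 oO (eu j).
  have JE (i : 'I_k.+1) : lam i = m -> i \in J m by move=> im; rewrite inE im.
  exists (fun i => v (enum_rank_in Ji0 i)); split => [i im|c c0 i im]; first by have [] := Hv (enum_rank_in Ji0 i).
  rewrite -(enum_rankK_in Ji0 (JE _ im)).
  apply: (fu (fun j => c (enum_val j))).
  apply: (@filterS _ _ (ae_filter_ringOfSetsType mu) _ _ _ c0) => x H Ox; rewrite -[RHS](H Ox) [RHS]big_enum_val /=.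
  by apply: eq_bigr => j _; rewrite enum_valK_in; have [_ ->] := Hv j.
pose W (i : 'I_k.+1) := w (lam i) i.
have PW i : P (W i) by have [/(_ i erefl)[]] := Hw (lam i).
have aW i h : P h -> a (W i) h = lam i * b (W i) h by have [/(_ i erefl)[_ H] _] := Hw (lam i); exact: H.
have orth (i j : 'I_k.+1) : lam i != lam j -> b (W i) (W j) = 0.
  move=> ij; have := aW i _ (PW j); rewrite dirichlet_formC (aW j _ (PW i)) (mass_formC O (W j)) => /eqP.
  by rewrite -subr_eq0 -mulrBl mulf_eq0 subr_eq0 eq_sym (negbTE ij) => /eqP.
have PS c : P (\sum_i c i *: W i) by apply: (subspace_sum (P := P) (inH1_0 O) (inH1_lin oO bO)).
have free c : b (\sum_i c i *: W i) (\sum_i c i *: W i) = 0 -> forall i, c i = 0.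
  move=> c0 i0; set m := lam i0.
  (* The coefficients attached to the value [m]. Distinct values give orthogonal eigenfunctions, so
     this part of the combination has zero mass as well, and freeness within one eigenspace applies
     to it. *)
  pose d (i : 'I_k.+1) := if lam i == m then c i else 0.
  have dS : b (\sum_i d i *: W i) (\sum_i d i *: W i) = b (\sum_i c i *: W i) (\sum_i d i *: W i).
    apply: etrans (mass_form_sum oO bO d d PW) _; apply/esym.
    apply: etrans (mass_form_sum oO bO c d PW) _; apply/esym.
    apply: eq_bigr => i _; apply: eq_bigr => j _; rewrite {1}/d; case: eqP => // /eqP im.
    rewrite !mul0r; have [jm|jm] := eqVneq (lam j) m; last by rewrite /d (negbTE jm) mulr0 mul0r.
    by rewrite orth ?mulr0// jm.
  have d0 : b (\sum_i d i *: W i) (\sum_i d i *: W i) = 0.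
    rewrite dS; exact: (form_orth_of_min (inH1_lin oO bO) (fun u v _ _ => mass_formC O u v) (mass_form_lin oO) (fun u _ => mass_form_ge0 O u)).
  have [_ fr] := Hw m.
  apply: (fr c _ i0 erefl).
  apply: (@filterS _ _ (ae_filter_ringOfSetsType mu) _ _ _ (mass0_ae oO (PS d) d0)) => x H Ox.
  rewrite -[RHS](H Ox) sum_fst big_mkcond; apply: eq_bigr => i _.
  by rewrite inE /d /W; case: eqP => [->//|_]; rewrite mul0r.
have rayleigh c : a (\sum_i c i *: W i) (\sum_i c i *: W i) <= lam k * b (\sum_i c i *: W i) (\sum_i c i *: W i).
  (* Since the mass form couples equal eigenvalues only, lam k times the mass minus the energy is
     the mass of the combination with these coefficients, hence nonnegative. *)
  pose d (i : 'I_k.+1) := Num.sqrt (lam k - lam i) * c i.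
  have aux (x y z x' y' z' : R) : x = x' -> y = y' -> z = z' -> lam k * x' - y' = z' -> 0 <= z -> y <= lam k * x.
    by move=> -> -> -> <-; rewrite subr_ge0.
  apply: (aux _ _ _ _ _ _ (mass_form_sum oO bO c c PW) (dirichlet_form_sum oO bO c c PW) (mass_form_sum oO bO d d PW) _
    (mass_form_ge0 O _)).
  rewrite mulr_sumr -sumrB.
  apply: eq_bigr => i _; rewrite mulr_sumr -sumrB; apply: eq_bigr => j _.
  rewrite aW// /d; have [ij|ij] := eqVneq (lam i) (lam j); last by rewrite orth// !mulr0 subrr.
  have li : 0 <= lam k - lam j by rewrite subr_ge0; apply: lam_mono; rewrite -ltnS.
  have := sqr_sqrtr li; rewrite ij; move: (Num.sqrt _) => q qE.
  transitivity (q ^+ 2 * (c i * c j * b (W i) (W j))); first by rewrite qE; ring.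
  ring.
(* The linear system is indexed by natural numbers, so the functionals are extended by 0 beyond
   [N]. *)
have [c [i0 ci0] cl] := kernel_vector (fun i j => if insub j is Some j' then l j' (W i) else 0) Nk.
set s := \sum_i c i *: W i.
have ls j : l j s = 0.
  have l0 : l j 0 = 0.
    have := ll j 1 0 0 (inH1_0 O) (inH1_0 O); rewrite scaler0 addr0 mul1r => /eqP.
    by rewrite eq_sym -subr_eq0 addrK => /eqP.
  have lS (q : seq 'I_k.+1) : P (\sum_(i <- q) c i *: W i) /\ l j (\sum_(i <- q) c i *: W i) = \sum_(i <- q) c i * l j (W i).
    elim: q => [|i q [IH1 IH2]]; first by rewrite !big_nil; split => //; exact: inH1_0.
    by rewrite !big_cons ll// IH2; split => //; exact: (inH1_lin oO bO).
  have [_ ->] := lS (index_enum _).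
  by have := cl j (ltn_ord j); rewrite valK.
have := lP s (PS c); rewrite big1 ?addr0; last by move=> j _; rewrite ls expr0n.
move=> H; have bs : 0 < b s s.
  rewrite lt0r mass_form_ge0 andbT; apply: contra ci0 => /eqP/free ->//.
have c0 : 0 <= 80 * (2 * r) ^+ 2 by apply: mulr_ge0 (sqr_ge0 _).
have := le_trans H (ler_wpM2l c0 (rayleigh c)); rewrite mulrA -[X in X <= _]mul1r ler_pM2r// => {}H.
by apply: le_trans H _; rewrite le_eqVlt; apply/orP; left; apply/eqP; ring.
Qed.

End eigenvalue_bounds.

(** * Trial functions *)

Lemma integrable_le_indic {d} {T : measurableType d} {R : realType} (mu : {measure set T -> \bar R}) (B : set T)
  (f : T -> R) (A : R) : measurable B -> (mu B < +oo)%E -> measurable_fun setT f ->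
  (forall y, `|f y| <= A * \1_B y) -> mu.-integrable setT (EFin \o f).
Proof.
move=> mB Bfin mf fA; apply/integrableP; split; first exact/measurable_EFinP.
have iI : mu.-integrable setT (EFin \o \1_B).
  apply/integrableP; split; first exact/measurable_EFinP/measurable_indic.
  under eq_integral do rewrite gee0_abs ?lee_fin//.
  by rewrite integral_indic// setIT.
have mA : measurable_fun setT (fun y => A * \1_B y).
  exact: (measurable_funM (measurable_cst _) (measurable_indic mB)).
apply: (@le_lt_trans _ _ (\int[mu]_y (A * \1_B y)%:E)%E).
  apply: (@le_integral_EFin _ _ _ mu setT (fun y => `|f y|)) => //.
  exact: measurableT_comp mf.
have := integrable_fin_num measurableT (integrableZl measurableT A iI).
by rewrite fin_numE => /andP[_ /eqP]; rewrite ltey => ?; apply/eqP.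
Qed.

(** * Classical gradients are weak gradients *)

Section integration_by_parts.
Context {R : realType} {n : nat}.
Local Notation mu := (@vol R n).
Local Notation Rn := (lebesgueRn R n).

Lemma integral_translate (c : 'rV[R]_n) (f : Rn -> R) : measurable_fun setT f ->
  (\int[mu]_x (f (x + c)%R)%:E = \int[mu]_x (f x)%:E)%E.
Proof.
move=> mf; pose F : Rn -> \bar R := EFin \o f.
have mF : measurable_fun setT F by exact/measurable_EFinP.
have T (g : Rn -> \bar R) : measurable_fun setT g -> (forall x, 0 <= g x)%E ->
    (\int[mu]_x g (x + c)%R = \int[mu]_x g x)%E.
  move=> mg g0; have := ge0_integral_homothety c ltr01 measurableT mg (fun x _ => g0 x).
  rewrite preimage_setT expr1n invr1 mul1e => <-.
  by apply: eq_integral => x _; rewrite /homothety scale1r.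
rewrite integralE [RHS]integralE; congr (_ - _)%E.
- apply: etrans (T (F^\+)%E (measurable_funepos mF) (fun x => funepos_ge0 F x)).
  by apply: eq_integral => x _; rewrite !funepos.unlock.
- apply: etrans (T (F^\-)%E (measurable_funeneg mF) (fun x => funeneg_ge0 F x)).
  by apply: eq_integral => x _; rewrite !funeneg.unlock.
Qed.

Lemma is_derive_line (h : 'rV[R]_n -> R) (v y : 'rV[R]_n) (s : R) l :
  is_derive (s *: v + y) v h l -> is_derive s (1 : R) (fun s => h (s *: v + y)) l.
Proof.
move=> [dh dl]; have E : (fun t : R => t^-1 *: (((fun s => h (s *: v + y)) \o shift s) (t *: (1 : R)) - h (s *: v + y))) =
    (fun t : R => t^-1 *: ((h \o shift (s *: v + y)) (t *: v) - h (s *: v + y))).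
  apply/funext => t /=; congr (_ *: (h _ - _)).
  have -> : t *: (1 : R) = t by rewrite /GRing.scale/= mulr1.
  by rewrite scalerDl addrA.
apply: DeriveDef; first by rewrite /derivable E.
by rewrite /derive E.
Qed.

(** Difference quotients have integral 0 by translation invariance. They are bounded by the supremum
    of the derivative and supported in one ball for steps at most 1, so dominated convergence
    applies. *)
Lemma integral_derive0 (i : 'I_n) (h hi : 'rV[R]_n -> R) (K : set 'rV[R]_n) : continuous h -> continuous hi ->
  (forall y, is_derive y (delta_mx ord0 i) h (hi y)) -> compact K -> (forall y, ~ K y -> h y = 0) ->
  (forall y, ~ K y -> hi y = 0) -> \int[mu]_y hi y = 0.
Proof.
move=> ch chi dh cK h0 hi0.
have bnd (f : 'rV[R]_n -> R) : continuous f -> (forall y, ~ K y -> f y = 0) -> exists2 C, 0 <= C & forall y, `|f y| <= C.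
  move=> cf f0; have [M [_ HM]] : bounded_set (f @` K).
    by apply: compact_bounded; apply: continuous_compact => //; exact: continuous_subspaceT.
  exists (Num.max 0 (M + 1)) => [|y]; first by rewrite le_max lexx.
  have [Kx|nKx] := pselect (K y); last by rewrite f0// normr0 le_max lexx.
  by rewrite le_max; apply/orP; right; apply: (HM (M + 1)); [rewrite ltrDl|exists y].
have [C C0 HC] := bnd _ chi hi0; have [C' _ HC'] := bnd _ ch h0.
have [M [_ HM]] := compact_bounded cK.
have M1 : M < M + 1 by rewrite ltrDl.
pose B : set Rn := [set y | enorm (y - 0) < n%:R * (M + 1) + 2].
have mB : measurable B by apply: measurable_openRn; exact: open_enorm_ball.
have Bfin : (mu B < +oo)%E by apply: vol_bounded; exact: bounded_enorm_ball.
have KB y t : K y -> `|t| <= 1 -> B (y + t *: delta_mx ord0 i).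
  move=> Ky t1; rewrite /B /= subr0; apply: le_lt_trans (enormD _ _) _; rewrite enorm_delta.
  apply: ler_ltD; last by apply: le_lt_trans t1 _; rewrite ltr1n.
  by apply: le_trans (enorm_le_norm _) _; rewrite ler_wpM2l//; exact: HM M1 _ Ky.
have lip t y : `|h (t *: delta_mx ord0 i + y) - h y| <= C * `|t|.
  pose F s := h (s *: delta_mx ord0 i + y).
  have dF s : is_derive s (1 : R) F (hi (s *: delta_mx ord0 i + y)) by apply: is_derive_line.
  have cF : continuous F.
    move=> s; apply: differentiable_continuous; apply/derivable1_diffP; by have [] := dF s.
  have F0 : F 0 = h y by rewrite /F scale0r add0r.
  rewrite -F0 -/(F t); have [t0|t0] := leP 0 t.
    have [s _ ->] := MVT_segment t0 (fun x _ => dF x) (continuous_subspaceT cF).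
    by rewrite subr0 normrM ler_wpM2r.
  have [s _] := MVT_segment (ltW t0) (fun x _ => dF x) (continuous_subspaceT cF).
  by rewrite distrC => ->; rewrite sub0r normrM normrN ler_wpM2r.
pose ek (k : nat) : 'rV[R]_n := k.+1%:R^-1 *: delta_mx ord0 i.
pose D k (y : Rn) : R := k.+1%:R * (h (y + ek k) - h y).
have mh : measurable_fun (setT : set Rn) (h : Rn -> R) by exact: measurable_continuousRn.
have dom (f : Rn -> R) A : measurable_fun setT f -> (forall y, `|f y| <= A * \1_B y) -> mu.-integrable setT (EFin \o f).
  exact: integrable_le_indic.
have inB (f : 'rV[R]_n -> R) A y : (forall y, `|f y| <= A) -> (~ B y -> f y = 0) -> `|f y| <= A * \1_B y.
  move=> fA fB; rewrite indicE; have [yB|yB] := boolP (y \in B); first by rewrite mulr1.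
  by rewrite mulr0 fB ?normr0//; move: yB; rewrite notin_setE.
have ih : mu.-integrable setT (EFin \o h).
  apply: (dom _ C' mh) => y; apply: inB => // nB; apply: h0 => Ky; apply: nB.
  by have := KB y 0 Ky; rewrite scale0r addr0 normr0; apply.
have ekB k y : ~ B y -> ~ K (y + ek k).
  move=> nB Ky; apply: nB; have := KB _ (- k.+1%:R^-1) Ky.
  rewrite scaleNr addrK; apply; by rewrite normrN ger0_norm// invf_le1// ler1n.
have mhT k : measurable_fun setT (fun y : Rn => h (y + ek k)).
  rewrite (_ : (fun y : Rn => _) = h \o (homothety 1 (ek k) : Rn -> Rn)).
    exact: measurableT_comp mh (measurable_homothety (ek k) ltr01).
  by apply/funext => y; rewrite /homothety /= scale1r.
have ihT k : mu.-integrable setT (EFin \o (fun y => h (y + ek k))).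
  by apply: (dom _ C' (mhT k)) => y; apply: (inB (fun y => h (y + ek k))) => // /ekB nK; exact: h0.
have mD k : measurable_fun setT (D k).
  exact: (measurable_funM (measurable_cst _) (measurable_funB (mhT k) mh)).
have ID k : (\int[mu]_y (D k y)%:E = 0)%E.
  have -> : (\int[mu]_y (D k y)%:E = \int[mu]_y (k.+1%:R%:E * ((h (y + ek k))%:E - (h y)%:E)))%E.
    by apply: eq_integral => y _; rewrite /D EFinM EFinB.
  rewrite (integralZl measurableT (integrableB measurableT (ihT k) ih)).
  rewrite (integralB_EFin measurableT (ihT k) ih) (integral_translate _ mh) subee ?mule0//.
  exact: (integrable_fin_num measurableT ih).
have DC k y : `|D k y| <= C.
  rewrite normrM ger0_norm// -ler_pdivlMl// mulrC.
  have := lip k.+1%:R^-1 y; rewrite [_ + y]addrC; move=> /le_trans; apply.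
  by rewrite ger0_norm.
have cvD : {ae mu, forall y, setT y -> (fun k => (D k y)%:E) @ \oo --> (hi y)%:E}.
  apply: aeW => y _; apply: cvg_EFin; first exact: nearW.
  have [dhy <-] := dh y.
  have /cvg_dnbhs_at_right /cvg_at_rightP cvy := dhy.
  have /cvy : (forall m, (harmonic m : R) > 0) /\ ((harmonic m : R) @[m --> \oo] --> (0 : R)).
    by split => [m|]; [rewrite /harmonic invr_gt0|exact: cvg_harmonic].
  rewrite /derive; apply: cvg_trans; apply: near_eq_cvg; apply: nearW => m.
  rewrite /= /D /harmonic invrK; congr (_ * (h _ - _)); exact: addrC.
have domD : {ae mu, forall y, forall k, setT y -> (`|(D k y)%:E| <= (C * \1_B y)%:E)%E}.
  apply: aeW => y k _; rewrite lee_fin; apply: inB => // nB.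
  rewrite /D (h0 _ (ekB k y nB)) h0 ?subrr ?mulr0// => Ky; apply: nB.
  by have := KB y 0 Ky; rewrite scale0r addr0 normr0; apply.
have mhi : measurable_fun (setT : set Rn) (fun y : Rn => (hi y)%:E).
  by apply/measurable_EFinP; exact: measurable_continuousRn.
have iB : mu.-integrable setT (fun y : Rn => (C * \1_B y)%:E).
  apply: (dom (fun y => C * \1_B y) C) => [|y].
    exact: (measurable_funM (measurable_cst _) (measurable_indic mB)).
  by rewrite ger0_norm// mulr_ge0.
have mD' k : measurable_fun (setT : set Rn) (fun y : Rn => (D k y)%:E) by exact/measurable_EFinP.
have [_ _] := dominated_convergence measurableT mD' mhi cvD iB domD.
move=> cv; have cv0 : (fun _ : nat => 0%E : \bar R) @ \oo --> (\int[mu]_y (hi y)%:E)%E.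
  by rewrite (_ : (fun _ => 0%E) = (fun k => (\int[mu]_y (D k y)%:E)%E)) //; apply/funext => k.
rewrite /Rintegral.
by have -> := cvg_unique (@ereal_hausdorff R) cv0 (cvg_cst 0%E).
Qed.

(** [u] is differentiable on the whole space, so its product with a test function is differentiable
    with compact support, and the integral of the derivative of that product vanishes. *)
Lemma H1_gradient_classical (O : set 'rV[R]_n) (u : 'rV[R]_n -> R) (g : 'I_n -> 'rV[R]_n -> R) (C : R) :
  open O -> bounded_set O -> continuous u -> (forall i, continuous (g i)) ->
  (forall i y, is_derive y (delta_mx ord0 i) u (g i y)) ->
  (forall y, O y -> `|u y| <= C) -> (forall i y, O y -> `|g i y| <= C) -> H1_gradient O u g.
Proof.
move=> oO bO cu cg du uC gC.
have mO : measurable (O : set Rn) by exact: measurable_openRn.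
have su : sqint mu O u by apply: (sqint_bounded oO bO _ uC); exact: measurable_continuousRn.
have sg i : sqint mu O (g i) by apply: (sqint_bounded oO bO _ (gC i)); exact: measurable_continuousRn.
split; first exact: su; move=> i; split; first exact: sg; move=> phi tphi; have [sphi sdphi] := sqint_test oO bO tphi.
have [smphi [K [cK KO K0]]] := tphi.
have cphi : continuous phi by move=> x; have [] := smphi [::] x Logic.I.
have cdphi : continuous (partial i phi) by move=> x; have [] := smphi [:: i] x Logic.I.
have K0' y : ~ K y -> partial i phi y = 0.
  move=> nK; rewrite /partial.
  have oK : open (~` K) by apply: closed_openC; apply: compact_closed => //; exact: norm_hausdorff.
  rewrite (near_eq_derive (g := cst 0)) ?derive_cst//.
  have : nbhs y (~` K) by exact: open_nbhs_nbhs.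
  by apply: filterS => z; exact: K0.
have i1 := integrable_sqintM mO su (sdphi i); have i2 := integrable_sqintM mO (sg i) sphi.
apply/eqP; rewrite -addr_eq0 -(RintegralD mO i1 i2); apply/eqP.
pose hi y := u y * partial i phi y + g i y * phi y.
have hi0 y : ~ K y -> hi y = 0 by move=> nK; rewrite /hi K0// K0'// !mulr0 addr0.
have -> : \int[mu]_(y in O) (u y * partial i phi y + g i y * phi y) = \int[mu]_y hi y.
  rewrite Rintegral_mkcond; apply: eq_Rintegral => y _; rewrite patchE; case: ifPn => // yO.
  by rewrite hi0// => /KO /mem_set; apply/negP.
apply: (@integral_derive0 i (fun y => u y * phi y) hi K) => //.
- by move=> y; exact: (cvgM (cu y) (cphi y)).
- by move=> y; exact: (cvgD (cvgM (cu y) (cdphi y)) (cvgM (cg i y) (cphi y))).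
- move=> y; have dphi : is_derive y (delta_mx ord0 i) phi (partial i phi y).
    by apply: DeriveDef => //; have [_] := smphi [::] y Logic.I; exact.
  have -> : (fun y => u y * phi y) = (u : 'rV[R]_n -> R^o) * (phi : 'rV[R]_n -> R^o) by [].
  apply: (is_derive_eq (is_deriveM (du i y) dphi)).
  by rewrite /GRing.scale/= /hi [phi y * _]mulrC.
- by move=> y nK; rewrite K0// mulr0.
Qed.

End integration_by_parts.

Lemma bernoulli {R : realFieldType} (x : R) n : 0 <= x <= 1 -> 1 - n%:R * x <= (1 - x) ^+ n.
Proof.
move=> /andP[x0 x1]; elim: n => [|n IHn]; first by rewrite mul0r subr0 expr0.
rewrite exprS; apply: (@le_trans _ _ ((1 - x) * (1 - n%:R * x))); last by rewrite ler_wpM2l// subr_ge0.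
by have := mulr_ge0 (ler0n R n) (sqr_ge0 x); rewrite -natr1; lra.
Qed.

(** * Tents and their Rayleigh quotients *)

Section tent.
Context {R : realType} {n : nat}.
Local Notation mu := (@vol R n).
Local Notation Rn := (lebesgueRn R n).
Variables (z : 'rV[R]_n) (rho : R).
Hypothesis rho0 : 0 < rho.

Definition tent_base (y : 'rV[R]_n) : R := Num.max 0 (1 - dot (y - z) (y - z) / rho ^+ 2).
(** The square removes the kink of [tent_base] on the sphere of radius [rho], so the tent is
    continuously differentiable. *)
Definition tent y : R := tent_base y ^+ 2.
Definition tent_grad i (y : 'rV[R]_n) : R := - 4 / rho ^+ 2 * tent_base y * (y - z) ord0 i.

Lemma tent_base_ge0 y : 0 <= tent_base y.
Proof. by rewrite /tent_base le_max lexx. Qed.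

Lemma tent_base_le1 y : tent_base y <= 1.
Proof. by rewrite /tent_base ge_max ler01/= gerBl divr_ge0 ?dot_ge0// sqr_ge0. Qed.

Lemma tent_base_eq0 y : rho <= enorm (y - z) -> tent_base y = 0.
Proof.
move=> ry; apply/max_idPl; rewrite subr_le0 ler_pdivlMr ?exprn_gt0// mul1r -sqr_enorm.
by rewrite ler_sqr ?nnegrE ?enorm_ge0// ltW.
Qed.

Lemma tent_base_gt0 y : enorm (y - z) < rho -> 0 < tent_base y.
Proof.
move=> yr; rewrite lt_max; apply/orP; right.
rewrite subr_gt0 ltr_pdivrMr ?exprn_gt0// mul1r -sqr_enorm.
by rewrite ltr_sqr ?nnegrE ?enorm_ge0// ltW.
Qed.

Lemma sub_continuous j : continuous (fun y : 'rV[R]_n => (y - z) ord0 j).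
Proof. by apply: (@bump_poly_continuous _ _ 1 z); exact: bump_poly_coord. Qed.

Lemma tent_base_continuous : continuous tent_base.
Proof.
move=> y; rewrite /tent_base.
have cd : continuous (fun y : 'rV[R]_n => dot (y - z) (y - z)).
  rewrite /dot; apply: continuous_big => [|i _ w]; first exact: add_continuous.
  exact: (cvgM (@sub_continuous i w) (@sub_continuous i w)).
have c1 : (fun=> 1 : R) @ y --> (1 : R) by exact: cst_continuous.
have c0 : (fun=> 0 : R) @ y --> (0 : R) by exact: cst_continuous.
exact: (continuous_max c0 (cvgB c1 (cvgMr_tmp (cd y)))).
Qed.

Lemma tent_continuous : continuous tent.
Proof. by move=> y; rewrite /tent; exact: (cvgM (@tent_base_continuous y) (@tent_base_continuous y)). Qed.

Lemma tent_grad_continuous i : continuous (tent_grad i).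
Proof.
move=> y; exact: (cvgM (cvgMl_tmp (@tent_base_continuous y)) (@sub_continuous i y)).
Qed.

Lemma is_derive_tent i y : is_derive y (delta_mx ord0 i) tent (tent_grad i y).
Proof.
have r2 : 0 < rho ^+ 2 by rewrite exprn_gt0.
(* First-order expansion of the squared positive part with remainder (b - a)^2, valid across the
   kink. *)
have pp (a b : R) : `|Num.max 0 b ^+ 2 - Num.max 0 a ^+ 2 - 2 * Num.max 0 a * (b - a)| <= (b - a) ^+ 2.
  have [a0|a0] := leP 0 a; have [b0|b0] := leP 0 b.
  - have -> : b ^+ 2 - a ^+ 2 - 2 * a * (b - a) = (b - a) ^+ 2 by ring.
    by rewrite ger0_norm ?sqr_ge0.
  - rewrite ler_norml; apply/andP; split; nra.
  - rewrite ler_norml; apply/andP; split; nra.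
  - by rewrite expr0n !mulr0 mul0r !subr0 normr0 sqr_ge0.
set w := y - z; set l := tent_grad i y.
pose C := (2 * `|w ord0 i| + 1) ^+ 2 / rho ^+ 2 ^+ 2 + 2 / rho ^+ 2.
apply: (@is_derive_quadratic _ _ _ _ _ _ C 1) => // t t1.
rewrite /tent /tent_base.
have -> : t *: delta_mx ord0 i + y - z = 1 *: w + t *: delta_mx ord0 i by rewrite scale1r /w -addrA addrC.
rewrite dot_sqr -/w (_ : dot (delta_mx ord0 i) (delta_mx ord0 i) = 1); last first.
  by have := dot_delta (delta_mx ord0 i : 'rV[R]_n) i 1; rewrite scale1r mul1r mxE !eqxx.
rewrite (_ : dot w (delta_mx ord0 i) = w ord0 i); last first.
  by have := dot_delta w i 1; rewrite scale1r mul1r.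
set a := 1 - dot w w / rho ^+ 2; set b := 1 - _ / _.
have ba : b - a = - (2 * t * w ord0 i + t ^+ 2) / rho ^+ 2 by rewrite /a /b; field; rewrite gt_eqF.
have base1 : 0 <= Num.max 0 a <= 1 by have := tent_base_ge0 y; have := tent_base_le1 y; rewrite /tent_base -/w -/a => -> ->.
have -> : Num.max 0 b ^+ 2 - Num.max 0 a ^+ 2 - t * l =
   (Num.max 0 b ^+ 2 - Num.max 0 a ^+ 2 - 2 * Num.max 0 a * (b - a)) - 2 * Num.max 0 a * (t ^+ 2 / rho ^+ 2).
  rewrite ba /l /tent_grad /tent_base -/w -/a; field; by rewrite gt_eqF.
apply: le_trans (ler_normB _ _) _; rewrite [leRHS]mulrDl; apply: lerD.
  apply: le_trans (pp a b) _; rewrite ba.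
  have -> : (2 * `|w ord0 i| + 1) ^+ 2 / rho ^+ 2 ^+ 2 * t ^+ 2 = ((2 * `|w ord0 i| + 1) * `|t| / rho ^+ 2) ^+ 2.
    by rewrite !exprMn exprVn real_normK ?num_real//; ring.
  rewrite -[leLHS]real_normK ?num_real// ler_sqr ?nnegrE ?divr_ge0 ?mulr_ge0 ?addr_ge0 ?(ltW rho0)//.
  rewrite normrM normrN (gtr0_norm (x := (rho ^+ 2)^-1)) ?invr_gt0// ler_wpM2r ?invr_ge0 ?(ltW r2)//.
  apply: le_trans (ler_normD _ _) _; rewrite !normrM (gtr0_norm (x := 2))//.
  have : `|t| * `|t| <= `|t| by rewrite ler_piMl// ltW.
  by move: (`|t|) (`|w ord0 i|) => p q; lra.
have /andP[m0 m1] := base1.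
rewrite ger0_norm; last by rewrite mulr_ge0 ?divr_ge0 ?sqr_ge0// mulr_ge0.
have : 0 <= t ^+ 2 / rho ^+ 2 by rewrite divr_ge0 ?sqr_ge0.
have -> : 2 / rho ^+ 2 * t ^+ 2 = 2 * (t ^+ 2 / rho ^+ 2) by ring.
move: (t ^+ 2 / _) (Num.max _ _) m1 => p q q1 p0; by rewrite -mulrA; apply: ler_wpM2l => //; apply: ler_piMl.
Qed.

Variable O : set 'rV[R]_n.
Hypotheses (oO : open O) (cO : convexRn O) (bO : bounded_set O) (Oz : O z) (n1 : (1 <= n)%N).
Let mO : measurable (O : set Rn). Proof. exact: measurable_openRn. Qed.

Lemma tent_bound y : `|tent y| <= 1 + 4 / rho.
Proof.
rewrite ger0_norm ?sqr_ge0//; apply: (@le_trans _ _ 1); last by rewrite lerDl divr_ge0// ltW.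
by rewrite expr_le1 ?tent_base_ge0 ?tent_base_le1.
Qed.

Lemma tent_grad_bound i y : `|tent_grad i y| <= 1 + 4 / rho.
Proof.
apply: (@le_trans _ _ (4 / rho)); last by rewrite lerDr.
have r4 : 0 <= 4 / rho by rewrite divr_ge0// ltW.
have [yr|yr] := leP rho (enorm (y - z)); first by rewrite /tent_grad tent_base_eq0// mulr0 mul0r normr0.
have -> : 4 / rho = 4 / rho ^+ 2 * 1 * rho by field; rewrite gt_eqF.
rewrite /tent_grad !normrM normrN; apply: ler_pM => //; last exact: le_trans (ler_coord_enorm _ _) (ltW yr).
apply: ler_pM => //; last by rewrite ger0_norm ?tent_base_ge0 ?tent_base_le1.
by rewrite !ger0_norm// invr_ge0 sqr_ge0.
Qed.

Lemma tent_H1 : H1_gradient O tent tent_grad.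
Proof.
apply: (H1_gradient_classical (C := 1 + 4 / rho)) => //.
- exact: tent_continuous.
- exact: tent_grad_continuous.
- exact: is_derive_tent.
- by move=> y _; exact: tent_bound.
- by move=> i y _; exact: tent_grad_bound.
Qed.

Let mtent_base : measurable_fun (O : set Rn) (tent_base : Rn -> R).
Proof. by apply: measurable_continuousRn => //; exact: tent_base_continuous. Qed.

Let sq_base : sqint mu O tent_base.
Proof.
apply: (sqint_bounded oO bO mtent_base) => y _; rewrite ger0_norm; last exact: tent_base_ge0.
exact: tent_base_le1.
Qed.

(** The squared gradient is 16 / rho^4 times base^2 |y - z|^2, and |y - z| <= rho wherever the base
    is nonzero. What remains is to compare the masses of the base and of its square. *)
Lemma tent_dirichlet_le_base : \sum_i ip mu O (tent_grad i) (tent_grad i) <= 16 / rho ^+ 2 * ip mu O tent_base tent_base.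
Proof.
have sg i : sqint mu O (tent_grad i) by have [_ /(_ i)[]] := tent_H1.
have [iS E] := Rintegral_sum (index_enum 'I_n) mO (fun i => integrable_sqintM mO (sg i) (sg i)).
have ib := integrable_sqintM mO sq_base sq_base.
rewrite /ip -E -(RintegralZl _ mO ib); apply: (le_Rintegral mO iS (integrableZl mO (16 / rho ^+ 2) ib)) => y _.
have r2 : 0 < rho ^+ 2 by rewrite exprn_gt0.
rewrite (eq_bigr (fun i => (4 / rho ^+ 2 * tent_base y) ^+ 2 * ((y - z) ord0 i) ^+ 2)); last first.
  by move=> i _; rewrite /tent_grad; ring.
rewrite -mulr_sumr -/(dot (y - z) (y - z)).
have [yr|yr] := leP rho (enorm (y - z)); first by rewrite tent_base_eq0// !mulr0 expr0n mul0r.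
have : dot (y - z) (y - z) <= rho ^+ 2 by rewrite -sqr_enorm ler_sqr ?nnegrE ?enorm_ge0 ?ltW.
move: (dot _ _) => q qr.
have -> : 16 / rho ^+ 2 * (tent_base y * tent_base y) = (4 / rho ^+ 2 * tent_base y) ^+ 2 * rho ^+ 2.
  by field; rewrite gt_eqF.
by rewrite ler_wpM2l// sqr_ge0.
Qed.

Let sq_tent : sqint mu O tent. Proof. by have [] := tent_H1. Qed.

(* Shrinking the domain towards z by the factor s = 1 - 1/(2n) costs only a factor
   1/2 of volume and makes the tent at least 1 - s^2 on its support. *)
Lemma tent_base_le_mass : ip mu O tent_base tent_base <= 8 * n%:R ^+ 2 * ip mu O tent tent.
Proof.
have n0 : 0 < n%:R :> R by rewrite ltr0n.
pose x : R := (2 * n%:R)^-1; pose s := 1 - x.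
have x0 : 0 < x by rewrite invr_gt0 mulr_gt0.
have nx : n%:R * x = 2^-1 by rewrite /x; field; rewrite gt_eqF.
have x2 : x <= 2^-1 by rewrite /x lef_pV2 ?posrE ?mulr_gt0// ler_peMr// ler1n.
have s0 : 0 < s by rewrite /s; lra.
have sn : 2^-1 <= s ^+ n.
  by apply: le_trans (bernoulli n (x := x) _); [rewrite nx; lra|apply/andP; split; lra].
pose c : 'rV[R]_n := x *: z.
have Hz y : homothety s c y - z = s *: (y - z).
  by rewrite /homothety /c /s; apply/rowP => i; rewrite !mxE; ring.
(* With q = |y - z|^2 / rho^2 <= 1, the base at the shrunk point is 1 - s^2 q. It is at least 1 - q,
   and at least [x] because s^2 <= 1 - x, so its square is at least x (1 - q). *)
have Hb y : (x * tent_base y) ^+ 2 <= tent_base (homothety s c y) ^+ 2 ^+ 2.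
  have [yr|yr] := leP rho (enorm (y - z)); first by rewrite tent_base_eq0// mulr0 expr0n; rewrite sqr_ge0.
  have Eb w : tent_base w = Num.max 0 (1 - dot (w - z) (w - z) / rho ^+ 2) by [].
  have q1 : dot (y - z) (y - z) / rho ^+ 2 <= 1.
    by rewrite ler_pdivrMr ?exprn_gt0// mul1r -sqr_enorm ler_sqr ?nnegrE ?enorm_ge0 ?ltW.
  have q0 : 0 <= dot (y - z) (y - z) / rho ^+ 2 by rewrite divr_ge0 ?dot_ge0// sqr_ge0.
  rewrite !Eb Hz.
  have -> : dot (s *: (y - z)) (s *: (y - z)) / rho ^+ 2 = s ^+ 2 * (dot (y - z) (y - z) / rho ^+ 2).
    rewrite -!sqr_enorm enormZ exprMn (ger0_norm (ltW s0)); exact: esym (mulrA _ _ _).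
  move: (_ / rho ^+ 2) q1 q0 => q q1 q0.
  have s1 : s ^+ 2 <= 1 - x by rewrite /s; nra.
  have sq1 : s ^+ 2 * q <= 1 - x by apply: le_trans s1; rewrite ler_piMr// sqr_ge0.
  have sq2 : s ^+ 2 * q <= q by rewrite ler_piMl// (le_trans s1)//; lra.
  rewrite (max_idPr _) ?subr_ge0// (max_idPr _); last by lra.
  have a1 : 0 <= 1 - q by rewrite subr_ge0.
  have a2 : 1 - q <= 1 - s ^+ 2 * q by lra.
  have a3 : x <= 1 - s ^+ 2 * q by lra.
  move: (1 - q) (1 - s ^+ 2 * q) a1 a2 a3 => p p' a1 a2 a3.
  rewrite ler_sqr ?nnegrE ?sqr_ge0 ?mulr_ge0 ?(ltW x0)// expr2; apply: ler_pM => //; exact: ltW.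
pose T : Rn -> R := fun y => tent y ^+ 2.
have mT : measurable_fun (setT : set Rn) T.
  by apply: measurable_funX; apply: measurable_continuousRn => //; exact: tent_continuous.
have mTO : measurable_fun (O : set Rn) (fun y : Rn => (T y)%:E).
  by apply/measurable_EFinP; apply: measurable_funS mT.
have I1 := ge0_integral_homothety c s0 mO mTO (fun y _ => sqr_ge0 (tent y) : (0 <= (T y)%:E)%E).
have mH : measurable_fun setT (fun y : Rn => T (homothety s c y)).
  exact: measurableT_comp mT (measurable_homothety c s0).
have mHO : measurable (homothety s c @^-1` O : set Rn).
  by have := measurable_homothety c s0 measurableT mO; rewrite setTI.
have OH : O `<=` homothety s c @^-1` O.
  move=> y Oy; rewrite /= /homothety /c.
  have -> : s *: y + x *: z = (1 - x) *: y + x *: z by [].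
  by apply: cO => //; apply/andP; split; lra.
have : ((x ^+ 2)%:E * (ip mu O tent_base tent_base)%:E <= (s ^- n)%:E * (ip mu O tent tent)%:E)%E.
  rewrite (ipE mO sq_base) (ipE mO sq_tent) -I1.
  apply: (@le_trans _ _ (\int[mu]_(y in O) (T (homothety s c y))%:E)%E); last first.
    apply: (ge0_subset_integral mu mO mHO _ _ OH).
    - by apply/measurable_EFinP; apply: measurable_funS mH.
    - by move=> y _; rewrite lee_fin sqr_ge0.
  rewrite -(integralZl mO (sqint_integrable sq_base)).
  apply: (@le_integral_EFin _ _ _ mu O (fun y => x ^+ 2 * tent_base y ^+ 2) (fun y => T (homothety s c y))).
  - exact: mO.
  - exact: (measurable_funM (measurable_cst _) (measurable_funX 2 mtent_base)).
  - by apply: measurable_funS mH.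
  - by move=> y _; rewrite mulr_ge0// sqr_ge0.
  - by move=> y _; rewrite -exprMn; exact: Hb.
rewrite -!EFinM lee_fin => H.
have B0 := ip_ge0 mu O tent.
have {}H : x ^+ 2 * ip mu O tent_base tent_base <= 2 * ip mu O tent tent.
  apply: le_trans H _; rewrite ler_wpM2r//.
  by rewrite -[leRHS]invrK lef_pV2 ?posrE ?invr_gt0 ?exprn_gt0.
have -> : ip mu O tent_base tent_base = 4 * n%:R ^+ 2 * (x ^+ 2 * ip mu O tent_base tent_base).
  by rewrite /x; field; rewrite gt_eqF.
have -> : 8 * n%:R ^+ 2 * ip mu O tent tent = 4 * n%:R ^+ 2 * (2 * ip mu O tent tent) by ring.
by rewrite ler_wpM2l// mulr_ge0// sqr_ge0.
Qed.

Lemma tent_rayleigh : \sum_i ip mu O (tent_grad i) (tent_grad i) <= 128 * n%:R ^+ 2 / rho ^+ 2 * ip mu O tent tent.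
Proof.
apply: le_trans tent_dirichlet_le_base _.
have -> : 128 * n%:R ^+ 2 / rho ^+ 2 * ip mu O tent tent = 16 / rho ^+ 2 * (8 * n%:R ^+ 2 * ip mu O tent tent).
  by field; rewrite gt_eqF.
by apply: ler_wpM2l tent_base_le_mass; rewrite divr_ge0// sqr_ge0.
Qed.

Lemma tent_mass_gt0 : 0 < ip mu O tent tent.
Proof.
rewrite lt0r ip_ge0 andbT; apply/eqP => /(sqint_ae0 mO sq_tent) t0.
pose U : set 'rV[R]_n := O `&` [set y | enorm (y - z) < rho].
have oU : open U by apply: openI => //; exact: open_enorm_ball.
have mU : measurable (U : set Rn) by exact: measurable_openRn.
have : (0 < mu U)%E.
  by apply: (vol_open_gt0 oU); exists z; split => //=; rewrite subrr enorm0.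
suff -> : mu U = 0%E by rewrite ltxx.
apply: (measure_negligible mU); apply: negligibleS t0 => y [Oy yr] /(_ Oy) /eqP.
by rewrite /tent sqrf_eq0 gt_eqF// tent_base_gt0.
Qed.

End tent.

(** Tents of radius r / 2 around r-separated points have disjoint supports, so both forms are
    diagonal on their span and the Rayleigh bound for one tent passes to all combinations. The
    constant is 128 n^2 / (r / 2)^2. *)
Lemma lam_packs_upper {R : realType} {n : nat} (O : set 'rV[R]_n) (lam : nat -> R) (r : R) k : open O -> convexRn O ->
  bounded_set O -> (1 <= n)%N -> neumann_eigenvalues O lam -> 0 < r -> packs O r k.+1 ->
  lam k <= 512 * n%:R ^+ 2 / r ^+ 2.
Proof.
move=> oO cO bO n1 Hlam r0 [x [Ox xr]].
have rho0 : 0 < r / 2 by rewrite divr_gt0.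
pose f (i : 'I_k.+1) : @H1pair R n := (tent (x i) (r / 2), tent_grad (x i) (r / 2)).
have Pf i : inH1 O (f i) by exact: tent_H1.
have m0 i : 0 < mass_form O (f i) (f i) by exact: tent_mass_gt0.
have disj i j y : i != j -> tent_base (x i) (r / 2) y * tent_base (x j) (r / 2) y = 0.
  move=> ij; have [yi|yi] := leP (r / 2) (enorm (y - x i)); first by rewrite tent_base_eq0// mul0r.
  have [yj|yj] := leP (r / 2) (enorm (y - x j)); first by rewrite [X in _ * X]tent_base_eq0// mulr0.
  exfalso; have := xr i j ij; apply/negP; rewrite -ltNge.
  rewrite (_ : x i - x j = (y - x j) - (y - x i)); last by apply/rowP => l; rewrite !mxE; ring.
  apply: le_lt_trans (enormD _ _) _; rewrite enormN.
  by have := ltrD yj yi; rewrite -splitr.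
have mij i j : i != j -> mass_form O (f i) (f j) = 0.
  move=> ij; rewrite /mass_form /ip /=; under eq_Rintegral do rewrite /tent -exprMn disj// expr0n.
  by rewrite /Rintegral integral0.
have dij i j : i != j -> dirichlet_form O (f i) (f j) = 0.
  move=> ij; rewrite /dirichlet_form big1// => l _; rewrite /ip /=.
  rewrite (_ : (fun y => _) = cst 0); first by rewrite /Rintegral integral0.
  apply/funext => y; rewrite /tent_grad /=; have := disj i j y ij.
  move: (tent_base _ _ _) (tent_base _ _ _) => p q pq; set a := _ / _; set u := _ l; set v := _ l.
  have -> : a * q * u * (a * p * v) = q * p * (a ^+ 2 * u * v) by ring.
  by rewrite pq mul0r.
have diag (q : @H1pair R n -> @H1pair R n -> R) (c : 'I_k.+1 -> R) : (forall i j, i != j -> q (f i) (f j) = 0) ->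
    \sum_i \sum_j c i * c j * q (f i) (f j) = \sum_i c i ^+ 2 * q (f i) (f i).
  move=> qij; apply: eq_bigr => i _; rewrite (bigD1 i)//= big1 ?addr0 ?expr2// => j ji.
  by rewrite qij ?mulr0// eq_sym.
have mE c : mass_form O (\sum_i c i *: f i) (\sum_i c i *: f i) = \sum_i c i ^+ 2 * mass_form O (f i) (f i).
  by apply: etrans (mass_form_sum oO bO c c Pf) _; exact: diag.
have dE c : dirichlet_form O (\sum_i c i *: f i) (\sum_i c i *: f i) = \sum_i c i ^+ 2 * dirichlet_form O (f i) (f i).
  by apply: etrans (dirichlet_form_sum oO bO c c Pf) _; exact: diag.
apply: (lam_upper oO cO bO Hlam Pf) => [c|c].
  rewrite dE mE mulr_sumr; apply: ler_sum => i _; rewrite mulrCA ler_wpM2l ?sqr_ge0//.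
  have -> : 512 * n%:R ^+ 2 / r ^+ 2 = 128 * n%:R ^+ 2 / (r / 2) ^+ 2 by field; rewrite gt_eqF.
  exact: tent_rayleigh.
rewrite mE => /eqP; rewrite psumr_eq0; last by move=> i _; rewrite mulr_ge0 ?sqr_ge0// ltW.
move=> /allP H i; have := H i (mem_index_enum i).
by rewrite mulf_eq0 [X in _ || X]gt_eqF// orbF sqrf_eq0 => /eqP.
Qed.

(** * Nested convex domains *)

Lemma convex_setW {R : realType} {n : nat} (A : set 'rV[R]_n) : convex_set A -> convexRn A.
Proof.
move=> cA x y t /andP[t0 t1] Ax Ay.
have := cA y x (Itv01 (ltW t0) (ltW t1)) (mem_set Ay) (mem_set Ax); rewrite in_setE.
by rewrite /conv /= addrC.
Qed.

Section packing.
Context {R : realType} {n : nat}.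
Implicit Types (A B O : set 'rV[R]_n) (r s : R).

Lemma packs_homothety A B r s c N : 0 <= s -> homothety s c @` A `<=` B -> packs A r N -> packs B (s * r) N.
Proof.
move=> s0 AB [x [Ax xr]]; exists (fun i => homothety s c (x i)); split => [i|i j ij].
  by apply: AB; exists (x i).
rewrite /homothety opprD addrACA subrr addr0 -scalerBr enormZ ger0_norm//.
by rewrite ler_wpM2l// xr.
Qed.

(** Equally spaced points on a short segment parallel to the first coordinate axis. *)
Lemma packs_open O N : (1 <= n)%N -> open O -> O !=set0 -> exists2 r, 0 < r & packs O r N.
Proof.
move=> n1 oO [x Ox]; have [e e0 He] := open_box_nbhs oO Ox.
pose i0 := Ordinal n1; pose r := e / N.+1%:R.
have r0 : 0 < r by rewrite divr_gt0.
exists r => //; exists (fun j : 'I_N => x + (j%:R * r) *: delta_mx ord0 i0); split => [j|j l jl].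
  apply: He => i; rewrite !mxE [X in `|X|](_ : _ = (j%:R * r) * (i == i0)%:R); last by rewrite eqxx/=; ring.
  apply: (@le_trans _ _ (j%:R * r)).
    have jr : 0 <= j%:R * r by rewrite mulr_ge0// ltW.
    by case: (i == i0); rewrite ?mulr1 ?mulr0 ?normr0 ?ger0_norm.
  rewrite /r mulrA ler_pdivrMr// mulrC ler_wpM2l ?(ltW e0)// ler_nat.
  exact/ltnW/ltnW/ltn_ord.
apply: le_trans (ler_coord_enorm _ i0); rewrite !mxE !eqxx !mulr1.
have -> : x ord0 i0 + j%:R * r - (x ord0 i0 + l%:R * r) = (j%:R - l%:R) * r by ring.
rewrite normrM (gtr0_norm r0) ler_peMl ?(ltW r0)//.
wlog lj : j l jl / (l < j)%N => [H|].
  have [lj|jl'|/val_inj jl'] := ltngtP l j; first exact: H.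
  - by rewrite distrC; apply: H => //; rewrite eq_sym.
  - by rewrite jl' eqxx in jl.
by rewrite -natrB ?(ltnW lj)// normr_nat ler1n subn_gt0.
Qed.

Lemma packs_bounded O : bounded_set O -> exists r0, forall r, r0 <= r -> ~ packs O r 2.
Proof.
move=> [M [_ HM]]; have M1 : M < M + 1 by rewrite ltrDl.
exists (n%:R * ((M + 1) + (M + 1)) + 1) => r rr [x [Ox xr]].
have := xr ord0 (lift ord0 ord0) isT; apply/negP; rewrite -ltNge.
apply: lt_le_trans rr; apply: (@le_lt_trans _ _ (n%:R * ((M + 1) + (M + 1)))); last by rewrite ltrDl.
apply: le_trans (enorm_le_norm _) _; apply: ler_wpM2l => //.
by apply: le_trans (ler_normB _ _) _; apply: lerD; apply: HM.
Qed.

(** Otherwise every scale that packs k + 1 points could be doubled, and eventually two points would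
    be farther apart than the diameter allows. *)
Lemma packs_scale O k : (1 <= n)%N -> (1 <= k)%N -> open O -> O !=set0 -> bounded_set O ->
  exists r, [/\ 0 < r, packs O r k.+1 & ~ packs O (2 * r) k.+1].
Proof.
move=> n1 k1 oO O_neq0 bO; apply: contrapT => nr.
have [r r0 pr] := packs_open k.+1 n1 oO O_neq0; have [r1 Hr1] := packs_bounded bO.
have p2 m : packs O (2 ^+ m * r) k.+1.
  elim: m => [|m IHm]; first by rewrite expr0 mul1r.
  rewrite exprS -mulrA; apply: contrapT => np; apply: nr; exists (2 ^+ m * r); split => //.
  by rewrite mulr_gt0 ?exprn_gt0.
pose m := (Num.truncn (`|r1| / r)).+1.
have : r1 <= 2 ^+ m * r.
  rewrite -ler_pdivrMr//; apply: (@le_trans _ _ m%:R).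
    apply: le_trans (ltW (truncnS_gt _)); rewrite ler_pM2r ?invr_gt0//; exact: ler_norm.
  by rewrite -natrX ler_nat ltnW// ltn_expl.
by move=> /Hr1; apply; exact: packs_mono (p2 m).
Qed.

End packing.

(** * Large symmetric subsets of a convex domain *)

Section symmetric_part.
Context {R : realType} {n : nat}.
Local Notation mu := (@vol R n).
Local Notation Rn := (lebesgueRn R n).
Implicit Types A O : set 'rV[R]_n.

Definition symmetric_part O (z : 'rV[R]_n) : set 'rV[R]_n := [set y | O y /\ O (2 *: z - y)].

(** The sigma-algebra is the product of the two Lebesgue ones. The open set is therefore split into
    countably many boxes, for which the condition can be stated coordinate by coordinate. *)
Lemma measurable_reflection_pair O : open O -> measurable [set p : Rn * Rn | O (2 *: p.1 - p.2)].
Proof.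
move=> oO; have [c Oc] := open_bigcup_box oO.
have -> : [set p : Rn * Rn | O (2 *: p.1 - p.2)] =
    \bigcup_k [set p : Rn * Rn | oapp (@box R n) set0 (c k) (2 *: p.1 - p.2)].
  by apply/seteqP; split => p; rewrite /= {1}Oc => -[k ? ?]; exists k.
apply: bigcup_measurable => k _; case: (c k) => [[a b]|] /=.
  rewrite (_ : [set p | _] = \bigcap_(i in [set: 'I_n]) ((fun p : Rn * Rn => 2 * p.1 ord0 i - p.2 ord0 i) @^-1` `[a ord0 i, b ord0 i])).
    apply: fin_bigcap_measurable => [|i _]; first exact: finite_finset.
    have mf : measurable_fun setT (fun p : Rn * Rn => 2 * p.1 ord0 i - p.2 ord0 i).
      apply: measurable_funB; last exact: (measurableT_comp (measurable_coord i) measurable_snd).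
      apply: measurable_funM; first exact: measurable_cst.
      exact: (measurableT_comp (measurable_coord i) measurable_fst).
    by rewrite -[_ @^-1` _]setTI; exact: mf.
  apply/seteqP; split => p /= H i; first by move=> _; rewrite /= in_itv /=; have := H i; rewrite !mxE.
  by have := H i Logic.I; rewrite /= in_itv /= !mxE.
exact: measurable0.
Qed.

Lemma open_symmetric_part O z : open O -> open (symmetric_part O z).
Proof.
move=> oO; rewrite (_ : symmetric_part O z = O `&` ((fun y => 2 *: z - y) @^-1` O)) //.
apply: openI => //; apply: open_comp => // y _.
by apply: (@continuousB _ _ _ (cst (2 *: z)) id); [exact: cst_continuous|].
Qed.

(* Averaging over z: by Tonelli the integral of vol (symmetric_part O z) is 2^-n (vol O)^2,
   and by convexity only the z in O contribute. *)
Lemma symmetric_part_large O : open O -> convexRn O -> bounded_set O -> O !=set0 ->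
  exists z, O z /\ (2^-1 ^+ n.+1 * fine (mu O) <= fine (mu (symmetric_part O z))).
Proof.
move=> oO cO bO O_neq0; apply: contrapT => nz.
have mO : measurable (O : set Rn) by exact: measurable_openRn.
have Ofin : (mu O < +oo)%E by exact: vol_bounded.
have Ogt0 : (0 < mu O)%E by exact: vol_open_gt0.
pose V := fine (mu O); have VE : mu O = V%:E by rewrite fineK// ge0_fin_numE.
have V0 : 0 < V by rewrite -lte_fin -VE.
pose S : set (Rn * Rn) := [set p | O p.2 /\ O (2 *: p.1 - p.2)].
have mS : measurable S.
  have m2 : measurable (snd @^-1` O : set (Rn * Rn)).
    by rewrite -[_ @^-1` _]setTI; exact: measurable_snd.
  exact: (measurableI _ _ m2 (measurable_reflection_pair oO)).
pose f (p : Rn * Rn) : \bar R := (\1_S p)%:E.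
have f0 p : (0 <= f p)%E by rewrite lee_fin.
have mf : measurable_fun setT f by exact/measurable_EFinP/measurable_indic.
have I1 (z : Rn) : (\int[mu]_y f (z, y) = mu (symmetric_part O z))%E.
  have mz : measurable (symmetric_part O z : set Rn).
    by apply: measurable_openRn; exact: open_symmetric_part.
  by rewrite -[X in mu X]setIT -(integral_indic mu measurableT mz).
have I2 (y : Rn) : (\int[mu]_z f (z, y) = ((2 ^- n) * V * \1_O y)%:E)%E.
  have [Oy|nOy] := pselect (O y).
    have -> : (\int[mu]_z f (z, y) = \int[mu]_z (\1_(homothety 2 (- y) @^-1` O) z)%:E)%E.
      apply: eq_integral => z _; rewrite /f !indicE; congr ((_ : bool)%:R)%:E.
      apply/idP/idP; rewrite !inE; first by move=> [].
      by move=> H; split.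
    have mH : measurable (homothety 2 (- y) @^-1` O : set Rn).
      have H20 : 0 < 2 :> R by [].
      by have := measurable_homothety (- y) H20 measurableT mO; rewrite setTI.
    rewrite (integral_indic mu measurableT mH) setIT.
    apply: etrans (lebesgue_outer_preimage (- y) O (ltr0n R 2)) _.
    by have -> : lebesgue_outer O = V%:E := VE; rewrite indicE mem_set// mulr1.
  rewrite indicE memNset// mulr0 integral0_eq// => z _.
  by rewrite /f indicE memNset// => -[].
(* If every [z] in [O] failed, the double integral would be at most a V, which is half of its actual
   value 2^-n V^2. *)
pose a := 2^-1 ^+ n.+1 * V.
have intO : (\int[mu]_x (\1_O x)%:E = V%:E)%E.
  by rewrite -VE; apply: etrans (integral_indic mu measurableT mO) _; rewrite setIT.
have m1O : measurable_fun setT (\1_O : Rn -> R) by exact: measurable_indic.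
have iI : mu.-integrable setT (EFin \o (\1_O : Rn -> R)).
  by apply: (integrable_le_indic (A := 1) mO Ofin m1O) => y; rewrite mul1r ger0_norm.
have : (\int[mu]_z \int[mu]_y f (z, y) = (2 ^- n * V ^+ 2)%:E)%E.
  rewrite (@fubini_tonelli _ _ _ _ _ mu mu f mf f0); under eq_integral do rewrite I2 EFinM.
  by rewrite (integralZl measurableT iI) intO -EFinM expr2 mulrA.
apply/eqP; rewrite lt_eqF//; apply: (@le_lt_trans _ _ (\int[mu]_z (a * \1_O z)%:E)%E).
  apply: ge0_le_integral; first exact: measurableT.
  - by move=> z _; apply: integral_ge0.
  - exact: (@measurable_fun_fubini_tonelli_F _ _ _ _ _ mu f mf f0).
  - exact/measurable_EFinP/(measurable_funM (measurable_cst _) (measurable_indic mO)).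
  - move=> z _; rewrite I1 indicE; have [Oz|nOz] := pselect (O z).
      rewrite mem_set// mulr1; have : (mu (symmetric_part O z) <= mu O)%E.
        by apply: le_outer_measure => y [].
      move=> /le_lt_trans/(_ Ofin) fz; rewrite -[leLHS]fineK ?ge0_fin_numE ?outer_measure_ge0//.
      rewrite lee_fin leNgt; apply/negP => H; apply: nz; exists z; split => //; exact: ltW.
    rewrite memNset// mulr0; have -> : symmetric_part O z = set0; last by rewrite measure0.
    apply/seteqP; split => // y [Oy Oy']; apply: nOz.
    (* A nonempty symmetric part puts its centre in [O]: [z] is the midpoint of [y] and 2 z - y. *)
    have h01 : (0 : R) < 2^-1 < (1 : R) by apply/andP; split; lra.
    have := cO _ _ _ h01 Oy Oy'; congr (O _).
    by apply/rowP => i; rewrite !mxE; lra.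
under eq_integral do rewrite EFinM.
rewrite (integralZl measurableT iI) intO -EFinM lte_fin.
rewrite /a -mulrA -expr2 ltr_pM2r ?exprn_gt0// exprVn exprS invfM gtr_pMl ?invr_gt0 ?exprn_gt0//.
lra.
Qed.

End symmetric_part.

(** * Inclusion of a contracted copy of the larger domain *)

Section inclusion.
Context {R : realType} {n : nat}.
Local Notation mu := (@vol R n).
Local Notation Rn := (lebesgueRn R n).
Implicit Types A B : set 'rV[R]_n.

Lemma measurable_homothety_image (s : R) (c : 'rV[R]_n) (A : set Rn) : 0 < s -> measurable A ->
  measurable (homothety s c @` A : set Rn).
Proof.
move=> s0 mA; have -> : homothety s c @` A = homothety s^-1 (- s^-1 *: c) @^-1` A.
  rewrite homothety_preimage ?invr_neq0 ?gt_eqF// invrK scalerA mulrNN mulfV ?gt_eqF// scale1r.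
  by [].
have s0' : 0 < s^-1 by rewrite invr_gt0.
by have := measurable_homothety (- s^-1 *: c) s0' measurableT mA; rewrite setTI.
Qed.

(* With z as the origin, A is symmetric: if (1 - s) a + s x = (1 - t) b + t x with s < t, then
   (t - s) x = (1 - s) a + (1 - t) (- b) is in (2 - s - t) A. *)
Lemma symmetric_segment A (z x a b : 'rV[R]_n) (s t e : R) : convexRn A -> (forall y, A y -> A (2 *: z - y)) -> A z ->
  A a -> A b -> 0 <= s -> t < 1 -> 0 < e -> 2 * e <= t - s ->
  (1 - s) *: a + s *: x = (1 - t) *: b + t *: x -> A (homothety e ((1 - e) *: z) x).
Proof.
move=> cA symA Az Aa Ab s0 t1 e0 est E.
have D0 : 0 < t - s by lra.
pose S := (1 - s) + (1 - t); have S0 : 0 < S by rewrite /S; lra.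
pose m := (1 - (1 - t) / S) *: a + ((1 - t) / S) *: (2 *: z - b).
have Am : A m.
  apply: cA => //; last exact: symA.
  rewrite divr_gt0 ?subr_gt0//= ltr_pdivrMr// mul1r /S; lra.
(* The image of [x] divides the segment from [z] to [m] in this ratio. It is at most 1 because S <=
   2 and 2 e <= t - s. *)
pose th := e * S / (t - s).
have th0 : 0 < th by rewrite divr_gt0// mulr_gt0.
have th1 : th <= 1 by rewrite ler_pdivrMr// mul1r /S; nra.
have -> : homothety e ((1 - e) *: z) x = (1 - th) *: z + th *: m.
  apply/rowP => i; move/rowP/(_ i): E; rewrite /homothety /m !mxE.
  move: (a _ _) (b _ _) (x _ _) (z _ _) => a' b' x' z' E.
  have -> : x' = ((1 - s) * a' - (1 - t) * b') / (t - s).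
    apply: (mulIf (lt0r_neq0 D0)); rewrite divfK ?gt_eqF//; lra.
  by rewrite /th /S; field; rewrite (gt_eqF D0) (gt_eqF S0).
have [->|th_neq1] := eqVneq th 1; first by rewrite subrr scale0r add0r scale1r.
by apply: cA => //; rewrite th0 lt_neqAle th_neq1.
Qed.

(** Suppose that the image of [x] misses [A]. Then, by [symmetric_segment], the copies (1 - t) A + t
    x for parameters spaced by 2 e are pairwise disjoint; they lie in [B] by convexity, each keeps
    at least half of the volume of [A], and there are too many of them for the volume of [B]. *)
Lemma homothety_symmetric_sub A B (z : 'rV[R]_n) (w : R) : (1 <= n)%N -> open A -> convexRn A ->
  (forall y, A y -> A (2 *: z - y)) -> A z -> open B -> convexRn B -> bounded_set B -> A `<=` B ->
  0 < w -> w * fine (mu B) <= fine (mu A) ->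
  homothety (w / (8 * n%:R)) ((1 - w / (8 * n%:R)) *: z) @` B `<=` A.
Proof.
move=> n1 oA cA symA Az oB cB bB AB w0 wAB _ [x Bx <-]; apply: contrapT => nA.
have n0 : 0 < n%:R :> R by rewrite ltr0n.
set e := w / _ in nA; have e0 : 0 < e by rewrite divr_gt0// mulr_gt0.
have Bfin : (mu B < +oo)%E by exact: vol_bounded.
have Afin : (mu A < +oo)%E by apply: le_lt_trans Bfin; exact: le_outer_measure.
have Bgt0 : (0 < mu B)%E by apply: (vol_open_gt0 oB); exists x.
pose VA := fine (mu A); have VAE : mu A = VA%:E by rewrite fineK// ge0_fin_numE// outer_measure_ge0.
pose VB := fine (mu B); have VBE : mu B = VB%:E by rewrite fineK// ge0_fin_numE// outer_measure_ge0.
have VB0 : 0 < VB by rewrite -lte_fin -VBE.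
have VA0 : 0 <= VA by rewrite -lee_fin -VAE outer_measure_ge0.
(* There are m + 1 > 2 / w copies. The largest parameter is at most 2 e (2 / w) = 1 / (2 n), so
   Bernoulli's inequality gives (1 - t)^n >= 1/2; this fixes the 8 n in the ratio. *)
pose m := Num.truncn (2 / w); pose t (j : 'I_m.+1) : R := 2 * e * j%:R.
have mw : m%:R <= 2 / w by rewrite -truncn_ge_nat// divr_ge0// ltW.
have t0 j : 0 <= t j by rewrite !mulr_ge0// ltW.
have tn j : t j * (2 * n%:R) <= 1.
  have jw : j%:R <= 2 / w by apply: le_trans mw; rewrite ler_nat -ltnS.
  apply: (@le_trans _ _ (2 * e * (2 / w) * (2 * n%:R))).
    have e2 : 0 <= 2 * e by rewrite mulr_ge0// ltW.
    by apply: ler_wpM2r; [rewrite mulr_ge0|exact: ler_wpM2l].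
  by rewrite le_eqVlt; apply/orP; left; apply/eqP; rewrite /e; field; rewrite !gt_eqF.
have t2 j : t j <= 2^-1.
  have := tn j; have : 1 <= n%:R :> R by rewrite ler1n.
  by have := t0 j; move: (t j) (n%:R) => a b; nra.
have t1 j : 0 < 1 - t j by have := t2 j; lra.
pose F j : set 'rV[R]_n := homothety (1 - t j) (t j *: x) @` A.
have mF j : measurable (F j : set Rn).
  by apply: (measurable_homothety_image _ (t1 j)); exact: measurable_openRn.
have FB j : F j `<=` B.
  move=> _ [y Ay <-]; rewrite /homothety; have [->|tj] := eqVneq (t j) 0.
    by rewrite subr0 scale0r scale1r addr0; exact: AB.
  by apply: cB => //; [rewrite lt0r tj t0 -subr_gt0 t1|exact: AB].
have dF i j y : F i y -> F j y -> i = j.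
  wlog ij : i j / (i < j)%N => [H Fi Fj|].
    have [ij|ji|/val_inj//] := ltngtP i j; first exact: H Fi Fj.
    by apply/esym; exact: H Fj Fi.
  move=> [a Aa <-] [b Ab] /esym E; exfalso; apply: nA.
  apply: (symmetric_segment cA symA Az Aa Ab (t0 i) _ e0 _ E); first by rewrite -subr_gt0.
  have : i%:R + 1 <= j%:R :> R by rewrite natr1 ler_nat.
  by rewrite /t; have := e0; move: (i%:R) (j%:R) => p q; nra.
have vF j : ((2^-1 * VA)%:E <= mu (F j))%E.
  have -> : mu (F j) = (((1 - t j) ^+ n)%:E * mu A)%E := lebesgue_outer_homothety _ _ (t1 j).
  rewrite VAE -EFinM lee_fin; apply: ler_wpM2r => //.
  apply: le_trans (bernoulli n (x := t j) _); last by rewrite t0/=; have := t2 j; lra.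
  by have := tn j; lra.
have mB : measurable (B : set Rn) by exact: measurable_openRn.
have : (\sum_(j < m.+1) (2^-1 * VA)%:E <= mu B)%E.
  apply: le_trans (_ : \sum_(j < m.+1) mu (F j) <= _)%E.
    by apply: lee_sum => j _; exact: vF.
  exact: (@sum_measure_le _ _ _ mu m.+1 (F : 'I_m.+1 -> set Rn) B mB mF FB dF).
rewrite sumEFin VBE lee_fin sumr_const card_ord -[_ *+ m.+1]mulr_natl => H.
have : m.+1%:R <= 2 / w.
  rewrite ler_pdivlMr//; have : m.+1%:R * (2^-1 * (w * VB)) <= VB.
    by apply: le_trans H; rewrite ler_wpM2l// ler_wpM2l.
  have -> : m.+1%:R * (2^-1 * (w * VB)) = (m.+1%:R * w / 2) * VB by ring.
  by rewrite ger_pMl// ler_pdivrMr// mul1r.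
by apply/negP; rewrite -ltNge; exact: truncnS_gt.
Qed.

End inclusion.

(** One scale r serves both domains: [A] packs k + 1 points at r but not at 2 r, so 1 <= 320 (2 r)^2
    lam k, while [B] packs k + 1 points at e r. The constant is 512 times 1280. Both estimates of
    the theorem are instances, with the roles of the domains exchanged. *)
Lemma neumann_comparison {R : realType} : exists2 K : R, 0 < K &
  forall n (A B : set 'rV[R]_n) (lam lam' : nat -> R) (e : R) c k,
  (1 <= n)%N -> (1 <= k)%N -> open A -> convexRn A -> bounded_set A -> A !=set0 -> open B -> convexRn B -> bounded_set B ->
  neumann_eigenvalues A lam -> neumann_eigenvalues B lam' -> 0 < e -> homothety e c @` A `<=` B ->
  0 <= lam k /\ lam' k <= K * (n%:R / e) ^+ 2 * lam k.
Proof.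
exists (512 * 1280); first exact: mulr_gt0 (ltr0n R 512) (ltr0n R 1280).
move=> n A B lam lam' e c k n1 k1 oA cA bA A_neq0 oB cB bB HA HB e0 AB.
have [r [r0 pA npA]] := packs_scale n1 k1 oA A_neq0 bA.
have low := lam_lower oA cA bA HA (mulr_gt0 (ltr0n R 2) r0) npA.
have up := lam_packs_upper oB cB bB n1 HB (mulr_gt0 e0 r0) (packs_homothety (ltW e0) AB pA).
move: (lam k) (lam' k) low up => l l' low up; clear -e0 r0 low up.
have r2 : 0 < r ^+ 2 by rewrite exprn_gt0.
split; first by rewrite exprMn in low; nra.
apply: le_trans up _.
have -> : 512 * 1280 * (n%:R / e) ^+ 2 * l = 512 * n%:R ^+ 2 / (e * r) ^+ 2 * (320 * (2 * r) ^+ 2 * l).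
  by field; rewrite !gt_eqF.
apply: ler_peMr low; apply: divr_ge0 (sqr_ge0 _); exact: mulr_ge0 (ler0n _ _) (sqr_ge0 _).
Qed.

Lemma ln2_ge {R : realType} : 2^-1 <= ln 2 :> R.
Proof.
have := @le_ln1Dx R (- 2^-1) _; rewrite (_ : 1 - 2^-1 = 2^-1); last by lra.
rewrite lnV ?posrE// lerN2; apply; lra.
Qed.

(** - ln (1 - u) = ln (1 + u / (1 - u)) <= u / (1 - u) <= 2 u. *)
Lemma sqr_ln1B_le {R : realType} (u : R) : 0 <= u -> u <= 2^-1 -> ln (1 - u) ^+ 2 <= 4 * u ^+ 2.
Proof.
move=> u0 u1; have u2 : 0 < 1 - u by lra.
have le0 : ln (1 - u) <= 0 by rewrite ln_le0//; lra.
suff : - ln (1 - u) <= 2 * u by move=> H; rewrite -sqrrN (_ : 4 * u ^+ 2 = (2 * u) ^+ 2); [rewrite ler_sqr ?nnegrE; lra|ring].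
rewrite -lnV ?posrE// (_ : (1 - u)^-1 = 1 + u / (1 - u)); last by field; rewrite gt_eqF.
apply: le_trans (le_ln1Dx _) _; first by apply: lt_le_trans (divr_ge0 u0 (ltW u2)); lra.
by rewrite ler_pdivrMr//; nra.
Qed.

Theorem mainTheorem4 (R : realType) :
  exists c : R, 0 < c /\
  forall (n : nat) (Omega Omega' : set 'rV[R]_n) (lam lam' : nat -> R),
    (1 <= n)%N ->
    bounded_domain Omega -> convex_set Omega ->
    piecewise_smooth_boundary Omega ->
    bounded_domain Omega' -> convex_set Omega' ->
    piecewise_smooth_boundary Omega' ->
    Omega `<=` Omega' ->
    neumann_eigenvalues Omega lam -> neumann_eigenvalues Omega' lam' ->
    let v : R := fine (vol Omega) / fine (vol Omega') in
    forall k : nat, (2 <= k)%N ->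
      lam' k <= c^-1 * (n%:R * ln k%:R) ^+ 2 * lam k /\
      c * Num.min (ln (1 - 2 ^- n * v) ^+ 2 / (n%:R ^+ 8 * ln k%:R ^+ 6))
                  (1 / (n%:R ^+ 6 * ln k%:R ^+ 4)) * lam k <= lam' k.
Proof.
have [K K0 comparison] := @neumann_comparison R.
have q0 : 0 < 256 :> R by rewrite ltr0n.
(* One factor 256 is the square of the 16 in the ratio e = u / (16 n); the other one is 4 times 64,
   from the squared logarithm of 1 - u and from (ln k)^6 >= 1/64. *)
exists (K * 256 ^+ 2)^-1; split; first by rewrite invr_gt0; exact: mulr_gt0 K0 (exprn_gt0 2 q0).
move=> n O O' lam lam' n1 [oO _ O_neq0 bO] /convex_setW cO _ [oO' _ O'_neq0 bO'] /convex_setW cO' _ OO' HO HO' v k k2.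
have n_ge1 : 1 <= n%:R :> R by rewrite ler1n.
have n0 : 0 < n%:R :> R by rewrite ltr0n.
have L0 : 2^-1 <= ln k%:R :> R.
  by apply: le_trans ln2_ge _; rewrite ler_ln ?posrE ?ltr0n ?ler_nat// (leq_trans _ k2).
have k1 : (1 <= k)%N by exact: ltnW.
have H1 : homothety 1 0 @` O `<=` O'.
  by move=> _ [y Oy <-]; rewrite /homothety scale1r addr0; exact: OO'.
have [lam0 up] := comparison _ _ _ _ _ _ _ _ n1 k1 oO cO bO O_neq0 oO' cO' bO' HO HO' ltr01 H1.
split.
  apply: le_trans up _; rewrite invrK divr1; apply: (ler_wpM2r lam0).
  rewrite -mulrA; apply: ler_wpM2l; first exact: ltW.
  rewrite exprMn mulrCA; apply: ler_peMr; first exact: sqr_ge0.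
  by rewrite -exprMn exprn_ege1//; lra.
pose V := fine (vol O); pose V' := fine (vol O').
have fin (A : set 'rV[R]_n) : bounded_set A -> vol A = (fine (vol A))%:E.
  by move=> bA; rewrite fineK// ge0_fin_numE ?outer_measure_ge0//; exact: vol_bounded.
have V0 : 0 < V by rewrite -lte_fin -(fin _ bO); exact: vol_open_gt0.
have V'0 : 0 < V' by rewrite -lte_fin -(fin _ bO'); exact: vol_open_gt0.
have VV' : V <= V' by rewrite -lee_fin -(fin _ bO) -(fin _ bO'); exact: le_outer_measure.
set u := 2 ^- n * v.
have v0 : 0 < v by exact: divr_gt0.
have u0 : 0 < u by rewrite mulr_gt0// invr_gt0 exprn_gt0.
have u1 : u <= 2^-1.
  apply: (@le_trans _ _ (2 ^- n)).
    by rewrite /u ler_piMr ?invr_ge0 ?exprn_ge0// ler_pdivrMr// mul1r.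
  by rewrite lef_pV2 ?posrE ?exprn_gt0// -[leLHS]expr1 ler_eXn2l// ltr1n.
have [z [Oz zV]] := symmetric_part_large oO cO bO O_neq0.
have symS y : symmetric_part O z y -> symmetric_part O z (2 *: z - y).
  by move=> [Oy Oy']; split => //; rewrite subKr.
have cS : convexRn (symmetric_part O z).
  move=> x y t t01 [Ox Ox'] [Oy Oy']; split; first exact: cO.
  have := cO _ _ _ t01 Ox' Oy'; congr (O _).
  by apply/rowP => i; rewrite !mxE; ring.
have Sz : symmetric_part O z z by split => //; rewrite scalerDl scale1r addrK.
have SO' : symmetric_part O z `<=` O' by move=> y [/OO'].
(* u / 2 = 2^-(n+1) v is the share of the volume of [O'] that [symmetric_part_large] guarantees for
   the symmetric part. *)
have w0 : 0 < u / 2 by rewrite divr_gt0.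
have wS : u / 2 * V' <= fine (vol (symmetric_part O z)).
  apply: le_trans zV; rewrite -/V le_eqVlt; apply/orP; left; apply/eqP.
  by rewrite /u /v -/V -/V' exprVn exprS; field; rewrite !gt_eqF// exprn_gt0.
have := homothety_symmetric_sub n1 (@open_symmetric_part _ _ O z oO) cS symS Sz oO' cO' bO' SO' w0 wS.
set e := u / 2 / _ => H2.
have H3 := subset_trans H2 (fun y (Sy : symmetric_part O z y) => Sy.1).
have e0 : 0 < e by rewrite divr_gt0// mulr_gt0// ltr0n.
have [lam'0 low] := comparison _ _ _ _ _ _ _ _ n1 k1 oO' cO' bO' O'_neq0 oO cO bO HO' HO e0 H3.
clear H1 H2 H3 up.
have Kq : 0 < K * 256 ^+ 2 by exact: mulr_gt0 K0 (exprn_gt0 2 q0).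
rewrite -mulrA (ler_pdivrMl _ _ Kq).
set X := ln _ ^+ 2 / _; set m := Num.min _ _.
have mX : m <= X by rewrite ge_min lexx.
apply: le_trans (ler_wpM2r lam0 mX) _.
have X0 : 0 <= X by rewrite divr_ge0 ?sqr_ge0// mulr_ge0 ?exprn_ge0//; lra.
apply: le_trans (ler_wpM2l X0 low) _.
have -> : n%:R / e = 16 * n%:R ^+ 2 / u by rewrite /e; field; rewrite !gt_eqF.
rewrite mulrA; apply: (ler_wpM2r lam'0).
rewrite mulrCA; apply: ler_wpM2l; first exact: ltW.
(* Exactly what cancels (n / e)^2 = 256 n^4 / u^2 and leaves 256^2. *)
suff XL : X <= 256 * u ^+ 2 / n%:R ^+ 4.
  apply: le_trans (ler_wpM2r (sqr_ge0 _) XL) _; rewrite le_eqVlt; apply/orP; left; apply/eqP.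
  by field; rewrite !gt_eqF.
have L6 : 64^-1 <= ln k%:R ^+ 6 :> R.
  by rewrite (_ : 64^-1 = 2^-1 ^+ 6); [rewrite lerXn2r ?nnegrE; lra|field].
have n4 : 1 <= n%:R ^+ 4 :> R by rewrite exprn_ege1.
rewrite ler_pdivrMr; last by rewrite mulr_gt0 ?exprn_gt0//; lra.
have -> : 256 * u ^+ 2 / n%:R ^+ 4 * (n%:R ^+ 8 * ln k%:R ^+ 6) = 256 * u ^+ 2 * (n%:R ^+ 4 * ln k%:R ^+ 6).
  by field; rewrite gt_eqF.
apply: le_trans (sqr_ln1B_le (ltW u0) u1) _.
have : 64^-1 <= n%:R ^+ 4 * ln k%:R ^+ 6 :> R by apply: le_trans L6 _; apply: ler_peMl n4; apply: exprn_ge0; apply: le_trans L0; rewrite invr_ge0.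
have := sqr_ge0 u; move: (u ^+ 2) (_ * _) => a b; nra.
Qed.
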